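(* Let $N\ge 1$, $0<b<\tilde 2$, and let $\sigma$ satisfy $\frac{2-b}{N}\le\sigma<\sigma_b^*$. Let $\{v_n\}_{n=1}^\infty$ be a bounded family in $H^1(\mathbb{R}^N)$ such that $$\limsup_{n\to\infty}\|\nabla v_n\|_{L^2}\le M,\qquad \limsup_{n\to\infty}\left\||\cdot|^{\frac{-b}{2\sigma+2}}v_n\right\|_{L^{2\sigma+2}}\ge m,$$ for some $m,M>0$. Then there exist $\{x_n\}_{n=1}^\infty\subset\mathbb{R}^N$ and $V\in H^1(\mathbb{R}^N)$ such that, up to a subsequence, $$v_n(\cdot+x_n)\rightharpoonup V\quad\text{weakly in }H^1(\mathbb{R}^N).$$ Moreover, in the mass-critical case $\sigma=\frac{2-b}{N}$, one has (for these $x_n$ and $V$) $$\|V\|_{L^2}\ge C(M,m)\,\|Q\|_{L^2},\qquad\text{where}\quad C(M,m)=\left(\frac{m^{\frac{4-2b}{N}+2}\,N}{M^2(2-b+N)}\right)^{\frac{N}{2(2-b)}}$$ and $Q$ is the ground state.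
   Context: $\tilde 2=\frac N3$ if $N\le 3$ and $\tilde 2=2$ if $N\ge 4$. $\sigma_b^*=\infty$ if $N\le 2$ and $\sigma_b^*=\frac{2-b}{N-2}$ if $N\ge 3$. The condition $\frac{2-b}{N}\le\sigma<\sigma_b^*$ is equivalent to $0\le s_c<1$, where $s_c=\frac N2-\frac{2-b}{2\sigma}$. Ground state: $Q$ is the unique positive radial $H^1(\mathbb{R}^N)$ solution of $\Delta Q-Q+|x|^{-b}|Q|^{2\sigma}Q=0$ on $\mathbb{R}^N$ (here with $\sigma=\frac{2-b}{N}$). *)

(* Defs.v *)
From HB Require Import structures.
From mathcomp Require Import all_boot all_order all_algebra.
From mathcomp Require Import complex.
From mathcomp Require Import all_classical all_reals all_analysis.

Set Implicit Arguments.
Unset Strict Implicit.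
Unset Printing Implicit Defensive.

Import Order.TTheory GRing.Theory Num.Theory.
Import numFieldNormedType.Exports.

Local Open Scope classical_set_scope.
Local Open Scope ring_scope.

(* The sigma-algebra on 'rV[R]_n generated by the coordinate maps; it is the
   Borel sigma-algebra of R^n. *)
Definition rV_display : measure_display. Proof. exact: default_measure_display. Qed.

Section measurable_rV.
Variables (R : realType) (n : nat).

Let coord (i : 'I_n) (x : 'rV[R]_n) : measurableTypeR R := x ord0 i.

Let rV_set0 : g_sigma_preimage coord set0.
Proof. exact: sigma_algebra0. Qed.

Let rV_setC A : g_sigma_preimage coord A -> g_sigma_preimage coord (~` A).
Proof. exact: sigma_algebraC. Qed.

Let rV_bigcup (F : (set 'rV[R]_n)^nat) :
  (forall i, g_sigma_preimage coord (F i)) ->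
  g_sigma_preimage coord (\bigcup_i F i).
Proof. exact: sigma_algebra_bigcup. Qed.

HB.instance Definition _ := @isMeasurable.Build rV_display
  'rV[R]_n (g_sigma_preimage coord) rV_set0 rV_setC rV_bigcup.

Lemma measurable_coord (i : 'I_n) :
  measurable_fun [set: 'rV[R]_n] (fun x : 'rV[R]_n => x ord0 i : measurableTypeR R).
Proof.
move=> _ Y mY; rewrite setTI; apply: sub_sigma_algebra => /=.
rewrite -bigcup_seq/=; exists i => /=; first by rewrite mem_index_enum.
by exists Y => //; rewrite setTI.
Qed.

Lemma measurable_fun_coordP d (T : measurableType d) (f : T -> 'rV[R]_n) :
  (forall i, measurable_fun [set: T] (fun x => f x ord0 i : measurableTypeR R)) ->
  measurable_fun [set: T] f.
Proof.
move=> mf.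
suff : g_sigma_preimage (fun i => coord i \o f) `<=` measurable.
  by rewrite g_sigma_preimage_comp => h _ A mA; apply: h; exists A.
apply: smallest_sub; first exact: sigma_algebra_measurable.
rewrite -bigcup_seq; apply: bigcup_sub => i _.
by move=> A [B mB <-]; exact: mf.
Qed.

End measurable_rV.

Section lebesgue_rV.
Variable R : realType.

Definition cons_rV n (p : measurableTypeR R * 'rV[R]_n) : 'rV[R]_n.+1 :=
  \row_i oapp (fun j => p.2 ord0 j) (p.1 : R) (unlift ord0 i).

Lemma cons_rV0 n (p : measurableTypeR R * 'rV[R]_n) :
  cons_rV p ord0 ord0 = p.1.
Proof. by rewrite mxE unlift_none. Qed.

Lemma cons_rVS n (p : measurableTypeR R * 'rV[R]_n) j :
  cons_rV p ord0 (lift ord0 j) = p.2 ord0 j.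
Proof. by rewrite mxE liftK. Qed.

Lemma measurable_cons_rV n : measurable_fun setT (@cons_rV n).
Proof.
apply: measurable_fun_coordP => i.
case: (unliftP ord0 i) => [j|] ->.
  under eq_fun do rewrite cons_rVS.
  exact: (measurableT_comp (measurable_coord j) measurable_snd).
under eq_fun do rewrite cons_rV0.
exact: measurable_fst.
Qed.

Section step.
Variables (n : nat) (mu : {sigma_finite_measure set 'rV[R]_n -> \bar R}).
Local Open Scope ereal_scope.

Definition lebesgue_step : set 'rV[R]_n.+1 -> \bar R :=
  pushforward (lebesgue_measure \x mu) (@cons_rV n).

Let measurable_pre (A : set 'rV[R]_n.+1) :
  measurable A -> measurable (@cons_rV n @^-1` A).
Proof. by move=> mA; rewrite -[X in measurable X]setTI; exact: measurable_cons_rV. Qed.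

Let step0 : lebesgue_step set0 = 0.
Proof. by rewrite /lebesgue_step /pushforward preimage_set0 measure0. Qed.

Let step_ge0 A : 0 <= lebesgue_step A.
Proof. by apply: integral_ge0 => x _; exact: measure_ge0. Qed.

Let step_sigma_additive : semi_sigma_additive lebesgue_step.
Proof.
move=> F mF tF mUF; rewrite /lebesgue_step /pushforward preimage_bigcup.
apply: measure_semi_sigma_additive.
- by move=> k; exact: measurable_pre.
- apply/trivIsetP => /= i j _ _ ij; rewrite -preimage_setI.
  by move/trivIsetP : tF => /(_ _ _ _ _ ij) ->//; rewrite preimage_set0.
- by rewrite -preimage_bigcup; exact: measurable_pre.
Qed.

HB.instance Definition _ := isMeasure.Build _ _ _ lebesgue_step
  step0 step_ge0 step_sigma_additive.

Let tail (x : 'rV[R]_n.+1) : 'rV[R]_n := \row_j x ord0 (lift ord0 j).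

Let head (x : 'rV[R]_n.+1) : measurableTypeR R := x ord0 ord0.

Let measurable_tail : measurable_fun setT tail.
Proof.
apply: measurable_fun_coordP => i; under eq_fun do rewrite mxE.
exact: measurable_coord.
Qed.

Let uncons (x : 'rV[R]_n.+1) : measurableTypeR R * 'rV[R]_n := (head x, tail x).

Let cons_rVK : cancel (@cons_rV n) uncons.
Proof.
move=> [a y]; rewrite /uncons /head cons_rV0; congr (_, _).
by apply/rowP => j; rewrite mxE cons_rVS.
Qed.

Let measurable_uncons : measurable_fun setT uncons.
Proof.
by apply/measurable_fun_pair => //; exact: measurable_coord.
Qed.

Let step_sigma_finite : sigma_finite setT lebesgue_step.
Proof.
have [F FT Foo] : sigma_finite setT (lebesgue_measure \x mu).
  have /sigma_finiteP[F [TF ndF Foo]] := sigma_finiteT (@lebesgue_measure R).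
  have /sigma_finiteP[G [TG ndG Goo]] := sigma_finiteT mu.
  exists (fun k => F k `*` G k).
    rewrite -setXTT TF TG predeqE => -[x y]; split.
      move=> [/= [k _ Fkx] [l _ Gly]]; exists (maxn k l) => //; split.
      - by move: x Fkx; exact/subsetPset/ndF/leq_maxl.
      - by move: y Gly; exact/subsetPset/ndG/leq_maxr.
    by move=> [k _ []/= ? ?]; split; exists k.
  move=> k; have [? ?] := Foo k; have [? ?] := Goo k.
  split; first exact: measurableX.
  by rewrite product_measure1E// lte_mul_pinfty// ge0_fin_numE.
exists (fun k => uncons @^-1` F k); first by rewrite -preimage_bigcup -FT.
move=> k; have [mF Fk] := Foo k; split.
  by rewrite -[X in measurable X]setTI; exact: measurable_uncons.
rewrite /lebesgue_step /pushforward -comp_preimage.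
by rewrite (_ : uncons \o _ = id)//; apply/funext => p /=; rewrite cons_rVK.
Qed.

HB.instance Definition _ := Measure_isSigmaFinite.Build _ _ _ lebesgue_step
  step_sigma_finite.

End step.

Fixpoint lebesgue_rV n : {sigma_finite_measure set 'rV[R]_n -> \bar R} :=
  if n is k.+1 then lebesgue_step (lebesgue_rV k) else dirac (0 : 'rV[R]_0).

Local Open Scope ereal_scope.

Lemma lebesgue_rV_box n (a b : 'rV[R]_n) :
  (forall i, (a ord0 i <= b ord0 i)%R) ->
  lebesgue_rV n [set x | forall i, (a ord0 i <= x ord0 i <= b ord0 i)%R] =
  (\prod_(i < n) (b ord0 i - a ord0 i))%:E.
Proof.
elim: n a b => [|n IH] a b ab.
  rewrite big_ord0 /= diracE mem_set//; by case.
pose tl (x : 'rV[R]_n.+1) : 'rV[R]_n := (\row_j x ord0 (lift ord0 j))%R.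
have mI c d : measurable (`[c, d]%classic : set (measurableTypeR R)).
  exact: measurable_itv.
have mB : measurable
    [set x : 'rV[R]_n | forall i, (tl a ord0 i <= x ord0 i <= tl b ord0 i)%R].
  rewrite (_ : mkset _ = \bigcap_(i in [set: 'I_n])
      ((fun x : 'rV[R]_n => x ord0 i : measurableTypeR R) @^-1`
        `[tl a ord0 i, tl b ord0 i]%classic)); last first.
    apply/seteqP; split => x /= H i; first by move=> _ /=; rewrite in_itv/=.
    by have := H i I; rewrite /= in_itv.
  apply: fin_bigcap_measurable => // i _.
  by rewrite -[X in measurable X]setTI; apply: measurable_coord.
rewrite big_ord_recl EFinM /= /lebesgue_step /pushforward.
rewrite (_ : _ @^-1` _ = `[a ord0 ord0, b ord0 ord0]%classic `*`
    [set x : 'rV[R]_n | forall i, (tl a ord0 i <= x ord0 i <= tl b ord0 i)%R]).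
  rewrite product_measure1E// IH; last by move=> i; rewrite !mxE.
  congr (_ * _); last first.
    by congr EFin; apply: eq_bigr => i _; rewrite !mxE.
  rewrite [LHS]lebesgue_measure_itv/= lte_fin.
  have := ab ord0; rewrite le_eqVlt => /predU1P[->|->//].
  by rewrite ltxx subrr.
apply/seteqP; split => -[x y] /=.
  move=> H; split; first by have := H ord0; rewrite cons_rV0 in_itv.
  by move=> i; have := H (lift ord0 i); rewrite cons_rVS !mxE.
rewrite in_itv/= => -[H1 H2] i; case: (unliftP ord0 i) => [j|] ->.
  by rewrite cons_rVS; have := H2 j; rewrite !mxE.
by rewrite cons_rV0.
Qed.

End lebesgue_rV.

Section sobolev.
Variables (R : realType) (N : nat).
Local Notation X := 'rV[R]_N.
Local Notation leb := (lebesgue_rV R N).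

(* The norm `|x| of the library on 'rV is the sup norm. *)
Definition euclid_norm (x : X) : R := Num.sqrt (\sum_(i < N) x ord0 i ^+ 2).

Definition partial (i : 'I_N) (phi : X -> R) : X -> R :=
  'D_(delta_mx ord0 i) phi.

Definition iter_partial (s : seq 'I_N) (phi : X -> R) : X -> R :=
  foldr partial phi s.

Definition smooth (phi : X -> R) :=
  forall s, continuous (iter_partial s phi) /\
    forall i x, derivable (iter_partial s phi) x (delta_mx ord0 i).

(* Real-valued test functions are enough to test complex-valued
   distributions, by linearity. *)
Definition test_function (phi : X -> R) :=
  smooth phi /\ exists2 K : set X, compact K & forall x, ~ K x -> phi x = 0.

Definition laplacian (phi : X -> R) (x : X) : R :=
  \sum_(i < N) iter_partial [:: i; i] phi x.

Definition cintegral (f : X -> R[i]) : R[i] :=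
  Complex (Rintegral leb setT (fun x => complex.Re (f x)))
          (Rintegral leb setT (fun x => complex.Im (f x))).

Definition cmeasurable (u : X -> R[i]) :=
  measurable_fun [set: X] (fun x => complex.Re (u x) : measurableTypeR R) /\
  measurable_fun [set: X] (fun x => complex.Im (u x) : measurableTypeR R).

Definition cLnorm (p : R) (u : X -> R[i]) : \bar R :=
  Lnorm leb p%:E (fun x => (Normc.normc (u x))%:E).

Definition in_L2 (u : X -> R[i]) :=
  cmeasurable u /\ (cLnorm 2 u < +oo)%E.

Definition is_weak_partial (i : 'I_N) (u g : X -> R[i]) :=
  forall phi, test_function phi ->
    cintegral (fun x => u x * (partial i phi x)%:C%C) =
    - cintegral (fun x => g x * (phi x)%:C%C).

(* Elements of H^1 are represented by functions; all the notions below are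
   invariant under modification on a null set. *)
Definition in_H1 (u : X -> R[i]) :=
  in_L2 u /\ forall i, exists2 g, in_L2 g & is_weak_partial i u g.

Definition weak_partial (i : 'I_N) (u : X -> R[i]) : X -> R[i] :=
  xget (fun=> 0) [set g | in_L2 g /\ is_weak_partial i u g].

Definition grad_norm (u : X -> R[i]) : \bar R :=
  Lnorm leb 2%:E (fun x =>
    (Num.sqrt (\sum_(i < N) Normc.normc (weak_partial i u x) ^+ 2))%:E).

Definition H1_norm (u : X -> R[i]) : \bar R :=
  ((cLnorm 2 u `^ 2 + grad_norm u `^ 2) `^ (2^-1))%E.

(* Continuous linear functionals on H^1; the bound forces l to be constant on
   almost-everywhere classes. *)
Definition H1_functional (l : (X -> R[i]) -> R[i]) :=
  (forall (a : R[i]) u w, in_H1 u -> in_H1 w ->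
     l (fun x => a * u x + w x) = a * l u + l w) /\
  exists K : R, forall u, in_H1 u ->
    ((Normc.normc (l u))%:E <= K%:E * H1_norm u)%E.

Definition H1_weak_cvg (u : nat -> X -> R[i]) (V : X -> R[i]) :=
  forall l, H1_functional l ->
    (fun n => Normc.normc (l (u n) - l V)) @ \oo --> (0 : R).

Definition H1_bounded (u : nat -> X -> R[i]) :=
  exists K : R, forall n, in_H1 (u n) /\ (H1_norm (u n) <= K%:E)%E.

Definition weighted_norm (b sigma : R) (u : X -> R[i]) : \bar R :=
  cLnorm (2 * sigma + 2)
    (fun x => (euclid_norm x `^ (- b / (2 * sigma + 2)))%:C%C * u x).

(* 0 < Q x in R[i] means that Q x is real and positive; the equation is meant
   in the sense of distributions. *)
Definition positive_radial_solution (b sigma : R) (Q : X -> R[i]) :=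
  [/\ in_H1 Q,
      {ae leb, forall x, 0 < Q x},
      exists f : R -> R[i], {ae leb, forall x, Q x = f (euclid_norm x)} &
      forall phi, test_function phi ->
        cintegral (fun x =>
          (laplacian phi x)%:C%C * Q x - (phi x)%:C%C * Q x +
          (phi x)%:C%C * (euclid_norm x `^ (- b) *
            Normc.normc (Q x) `^ (2 * sigma))%:C%C * Q x) = 0].

Definition ground_state (b sigma : R) (Q : X -> R[i]) :=
  positive_radial_solution b sigma Q /\
  forall P, positive_radial_solution b sigma P ->
    {ae leb, forall x, P x = Q x}.

End sobolev.

Section exponents.
Variables (R : realType) (N : nat).

Definition two_tilde : R := if (N <= 3)%N then N%:R / 3 else 2.

Definition sigma_star (b : R) : \bar R :=
  if (N <= 2)%N then +oo%E else ((2 - b) / (N%:R - 2))%:E.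

Definition profile_const (b M m : R) : R :=
  ((m `^ ((4 - 2 * b) / N%:R + 2) * N%:R) / (M ^+ 2 * (2 - b + N%:R)))
    `^ (N%:R / (2 * (2 - b))).

End exponents.

(* Main.v *)
(* Bounded sequences of H^1 converge weakly up to a subsequence, so no translation is
   needed.  For the critical exponent the embedding of H^1 into the weighted space
   L^(2 sigma + 2)(|x|^-b dx) is moreover compact: |x|^-b prevents mass from escaping
   to infinity and is integrable near the origin.  Compactness passes the lower bound
   m to V, while the bound M on the gradient passes by weak lower semicontinuity.

   The bound on the mass of V is then the sharp Gagliardo-Nirenberg
   inequality with the best constant expressed by the mass of Q.  The same compact
   embedding gives a minimizer u >= 0 of the H^1 norm under the constraint
   int |x|^-b |u|^(2 sigma + 2) = 1.  Its Euler-Lagrange equation is that of the ground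
   state up to scaling, dilations give the Pohozaev identity, invariance under every
   polarization towards the origin makes u radially decreasing, and a barrier argument
   makes it positive.  A multiple of u is therefore a positive radial solution, which
   by uniqueness is Q, and the minimality of u, tested on dilations of |V|, is the
   desired inequality.

   Compactness is proved by telescoping averages over cubes of side 2^-k, without
   Sobolev embedding or symmetrization. *)
From HB Require Import structures.
Require Import Defs.
From mathcomp Require Import all_boot all_order all_algebra.
From mathcomp Require Import complex.
From mathcomp Require Import all_classical all_reals all_analysis.
From mathcomp Require Import measurable_realfun.
From mathcomp Require Import ring lra.

Set Implicit Arguments.
Unset Strict Implicit.
Unset Printing Implicit Defensive.

Import Order.TTheory GRing.Theory Num.Theory.
Import numFieldNormedType.Exports.

Local Open Scope classical_set_scope.
Local Open Scope ring_scope.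

(** The ground state is only known through uniqueness, so the minimizer must be shown to be a
    genuine competitor: a distributional solution, positive and radial almost everywhere. It is
    handled as a mere $H^1$ function, and this shapes the tools. Monotonicity is compared through
    averages over small balls, since each reflection has its own exceptional null set, and
    positivity comes from testing the weak equation with explicit smooth functions. Membership in
    $H^1$ of moduli is obtained from $L^2$ bounds on difference quotients rather than from a chain
    rule. $H^1$ is a closed subspace of a finite power of real $L^2$, a function being stored
    together with its weak derivatives; complex functions are pairs of such families. Criticality,
    [s N = 2 - b], leaves a factor [h ^ (2 s)] at scale [h], which makes the telescoping series
    geometric. The constant [C(M, m)] arises by dilating [|V|] until its mass and gradient are in
    the ratio dictated by the Pohozaev identity, with [M] in place of the gradient norm. *)

Lemma discriminant_le (R : realType) (c x e : R) :
  0 <= c -> 0 <= e -> (forall t, 0 <= c * t ^+ 2 + 2 * x * t + e) -> x ^+ 2 <= c * e.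
Proof.
move=> c0 e0 H; have [cz|cnz] := eqVneq c 0.
  rewrite cz mul0r; have [->|xnz] := eqVneq x 0; first by rewrite expr2 mul0r.
  (* With [c = 0] the quadratic is affine of nonzero slope; this is the point where it equals
     [-1]. *)
  have := H (- (e + 1) / (2 * x)).
  suff -> : c * (- (e + 1) / (2 * x)) ^+ 2 + 2 * x * (- (e + 1) / (2 * x)) + e = -1.
    by rewrite oppr_ge0 ler10.
  by rewrite cz; field.
have cp : 0 < c by rewrite lt_def cnz.
have := H (- x / c).
have -> : c * (- x / c) ^+ 2 + 2 * x * (- x / c) + e = (c * e - x ^+ 2) / c by field.
by rewrite pmulr_lge0 ?invr_gt0// subr_ge0.
Qed.

(** * Hilbert spaces *)

Section hilbert.
Variables (R : realType) (W : Type).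
Variables (add : W -> W -> W) (scale : R -> W -> W) (ip : W -> W -> R).

(** The squared distance, expanded so that it makes sense before any subtraction on [W] is
    available. *)
Definition dist2 u v : R := ip u u - 2 * ip u v + ip v v.

Definition seq_to (u : nat -> W) (v : W) :=
  forall e, 0 < e -> exists K, forall n, (K <= n)%N -> dist2 (u n) v < e.

(** Vectors are plain functions, not classes modulo null sets. Hence [ip u u = 0] does not force [u]
    to be zero, limits are unique only up to distance zero, and no vector space law is asked of
    [add] and [scale]: only their effect inside [ip] is recorded. The predicate [P] carves subspaces
    out of one ambient type. *)
Record hilbert (P : W -> Prop) : Prop := Hilbert {
  hilbert_ex : exists u, P u;
  hilbertD : forall u v, P u -> P v -> P (add u v);
  hilbertZ : forall a u, P u -> P (scale a u);
  ipC : forall u v, P u -> P v -> ip u v = ip v u;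
  ipDl : forall u v w, P u -> P v -> P w -> ip (add u v) w = ip u w + ip v w;
  ipZl : forall a u w, P u -> P w -> ip (scale a u) w = a * ip u w;
  ip_ge0 : forall u, P u -> 0 <= ip u u;
  hilbert_complete : forall u : nat -> W, (forall n, P (u n)) ->
    (forall e, 0 < e -> exists K, forall m n, (K <= m)%N -> (K <= n)%N ->
       dist2 (u m) (u n) < e) ->
    exists2 v, P v & seq_to u v }.

(** The bound is on squares, which keeps square roots out of the estimates. *)
Definition functional (P : W -> Prop) (l : W -> R) :=
  [/\ forall u v, P u -> P v -> l (add u v) = l u + l v,
      forall a u, P u -> l (scale a u) = a * l u &
      exists2 K, 0 <= K & forall u, P u -> l u ^+ 2 <= K * ip u u].

Section theory.
Variables (P : W -> Prop) (hP : hilbert P).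

Lemma ipDr u v w : P u -> P v -> P w -> ip w (add u v) = ip w u + ip w v.
Proof.
by move=> Pu Pv Pw; rewrite (ipC hP)// ?(ipDl hP)// 1?(ipC hP Pu)// 1?(ipC hP Pv)//; exact: hilbertD.
Qed.

Lemma ipZr a u w : P u -> P w -> ip w (scale a u) = a * ip w u.
Proof. by move=> Pu Pw; rewrite (ipC hP)// ?(ipZl hP)// 1?(ipC hP Pu)//; exact: hilbertZ. Qed.

Definition hsub u v := add u (scale (-1) v).

Lemma hsubP u v : P u -> P v -> P (hsub u v).
Proof. by move=> Pu Pv; apply: hilbertD => //; apply: hilbertZ. Qed.

Lemma ip_subl u v w : P u -> P v -> P w -> ip (hsub u v) w = ip u w - ip v w.
Proof.
by move=> Pu Pv Pw; rewrite (ipDl hP)// ?(ipZl hP)// ?mulN1r//; exact: hilbertZ.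
Qed.

Lemma ip_subr u v w : P u -> P v -> P w -> ip w (hsub u v) = ip w u - ip w v.
Proof. by move=> Pu Pv Pw; rewrite ipDr// ?ipZr// ?mulN1r//; exact: hilbertZ. Qed.

Lemma dist2E u v : P u -> P v -> dist2 u v = ip (hsub u v) (hsub u v).
Proof.
move=> Pu Pv; have Puv := hsubP Pu Pv.
by rewrite ip_subl// !ip_subr// (ipC hP Pv Pu) /dist2; ring.
Qed.

Lemma dist2_ge0 u v : P u -> P v -> 0 <= dist2 u v.
Proof. by move=> Pu Pv; rewrite dist2E//; apply: (ip_ge0 hP); exact: hsubP. Qed.

Lemma dist2C u v : P u -> P v -> dist2 u v = dist2 v u.
Proof. by move=> Pu Pv; rewrite /dist2 (ipC hP Pu Pv); ring. Qed.

Lemma ip_addt u v t : P u -> P v ->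
  ip (add u (scale t v)) (add u (scale t v)) =
  ip v v * t ^+ 2 + 2 * ip u v * t + ip u u.
Proof.
move=> Pu Pv; have Ptv := hilbertZ hP t Pv.
rewrite (ipDl hP)// ?ipDr// ?(ipZl hP)// ?ipZr//; last exact: hilbertD.
by rewrite (ipC hP Pv Pu); ring.
Qed.

Lemma cauchy_schwarz u v : P u -> P v -> ip u v ^+ 2 <= ip u u * ip v v.
Proof.
move=> Pu Pv; rewrite mulrC; apply: discriminant_le; try exact: (ip_ge0 hP).
move=> t; rewrite -ip_addt//; apply: (ip_ge0 hP); apply: hilbertD => //.
exact: hilbertZ.
Qed.

(** Expands [|(u - w) - (w - v)|^2 >= 0]; the factor [2] replaces the triangle inequality for
    squared distances. *)
Lemma dist2_le u v w : P u -> P v -> P w ->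
  dist2 u v <= 2 * dist2 u w + 2 * dist2 w v.
Proof.
move=> Pu Pv Pw.
have Pa := hsubP Pu Pw; have Pb := hsubP Pw Pv.
have := ip_ge0 hP (hsubP Pa Pb).
rewrite ip_subl// ?ip_subr// ?ip_subl// ?ip_subr//; try exact: hsubP.
rewrite /dist2 (ipC hP Pw Pu) (ipC hP Pv Pu) (ipC hP Pv Pw); lra.
Qed.

Lemma functional_ip u : P u -> functional P (ip u).
Proof.
move=> Pu; split=> [v w Pv Pw|a v Pv|]; [exact: ipDr|exact: ipZr|].
by exists (ip u u); [exact: (ip_ge0 hP)|move=> v Pv; exact: cauchy_schwarz].
Qed.

(* The functional [ip w w - 2 l w] has Cauchy minimising sequences by the
   parallelogram law; the Euler equation is only used approximately along such
   a sequence, so that its value at the limit is not needed. *)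
Lemma riesz l : functional P l -> exists2 v, P v & forall w, P w -> l w = ip v w.
Proof.
move=> [lD lZ [K K0 lK]].
pose J w := ip w w - 2 * l w.
have Jlb w : P w -> - K <= J w.
  move=> Pw; have iw := ip_ge0 hP Pw; have lw := lK _ Pw.
  rewrite /J; have : 2 * l w <= K + ip w w.
    have [ln|lp] := leP (l w) 0; first by lra.
    rewrite -ler_sqr ?nnegrE; [|lra|lra].
    have := sqr_ge0 (K - ip w w); nra.
  lra.
have [u0 Pu0] := hilbert_ex hP.
have hinf : has_inf [set J w | w in P].
  split; first by exists (J u0), u0.
  by exists (- K) => _ [w Pw <-]; exact: Jlb.
pose j := inf [set J w | w in P].
have jle w : P w -> j <= J w.
  by move=> Pw; apply: ge_inf; [exact: hinf.2|exists w].
have ex n : exists w, P w /\ J w < j + n.+1%:R^-1.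
  have n0 : (0 : R) < n.+1%:R^-1 by rewrite invr_gt0.
  by have [_ [w Pw <-] h] := inf_adherent n0 hinf; exists w.
have [u uP] := choice ex.
have Pu n : P (u n) by case: (uP n).
have uJ n : J (u n) < j + n.+1%:R^-1 by case: (uP n).
have par v w : P v -> P w -> dist2 v w <= 2 * (J v - j) + 2 * (J w - j).
  move=> Pv Pw; have Pvw := hilbertD hP Pv Pw.
  have := jle _ (hilbertZ hP (2^-1) Pvw).
  rewrite /J (ipZl hP)//; last exact: hilbertZ.
  rewrite ipZr// (ipDl hP)// !ipDr// lZ// lD// /dist2 (ipC hP Pw Pv); lra.
have small e : 0 < e -> exists K, forall n, (K <= n)%N -> n.+1%:R^-1 < e :> R.
  move=> e0; have /cvgrPdist_lt/(_ _ e0)[k _ H] := @cvg_harmonic R.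
  exists k => n kn; have /= := H n kn.
  by rewrite sub0r normrN ger0_norm// invr_ge0.
have [|v Pv uv] := hilbert_complete hP Pu.
  move=> e e0; have e4 : 0 < e / 4 by lra.
  have [k Hk] := small _ e4.
  exists k => m n km kn; apply: le_lt_trans (par _ _ (Pu m) (Pu n)) _.
  have Hm := lt_trans (uJ m) (ler_ltD (lexx j) (Hk _ km)).
  have Hn := lt_trans (uJ n) (ler_ltD (lexx j) (Hk _ kn)).
  lra.
exists v => // w Pw; apply/eqP; rewrite -subr_eq0 -sqrf_eq0 eq_le sqr_ge0 andbT.
rewrite -(mul0r (2 + 2 * ip w w)); apply/ler_addgt0Pl => e e0.
have iw := ip_ge0 hP Pw.
pose e' := e / (2 + 4 * ip w w).
have e'0 : 0 < e' by rewrite divr_gt0//; lra.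
have [k1 H1] := small _ e'0; have [k2 H2] := uv _ e'0.
pose n := maxn k1 k2.
have h1 := H1 n (leq_maxl _ _); have h2 := H2 n (leq_maxr _ _).
(* Minimality along the line [u n + t w] gives a quadratic in [t] that stays nonnegative up to
   [1 / (n + 1)]; its discriminant is the approximate Euler equation. *)
have a1 : (ip (u n) w - l w) ^+ 2 <= ip w w * n.+1%:R^-1.
  apply: discriminant_le => [//||t]; first by rewrite invr_ge0.
  have Pt := hilbertD hP (Pu n) (hilbertZ hP t Pw).
  have := jle _ Pt; rewrite /J ip_addt// lD ?lZ//; last exact: hilbertZ.
  move: (uJ n); rewrite /J; move: (n.+1%:R^-1) => a; lra.
have a2 : (ip (u n) w - ip v w) ^+ 2 <= ip w w * dist2 (u n) v.
  rewrite -ip_subl// dist2E// mulrC; apply: cauchy_schwarz => //; exact: hsubP.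
have d0 := dist2_ge0 (Pu n) Pv.
have b1 : ip w w * n.+1%:R^-1 <= ip w w * e' by apply: ler_wpM2l => //; exact: ltW.
have b2 : ip w w * dist2 (u n) v <= ip w w * e' by apply: ler_wpM2l => //; exact: ltW.
have den0 : 0 < 2 + 4 * ip w w by lra.
have eE : e' * (2 + 4 * ip w w) = e by rewrite /e' divfK// gt_eqF.
have {}a1 := le_trans a1 b1; have {}a2 := le_trans a2 b2.
have := sqr_ge0 (ip (u n) w - l w + (ip (u n) w - ip v w)).
rewrite mul0r addr0; clear -a1 a2 eE e'0; lra.
Qed.

End theory.

Lemma hilbert_sub (P Q : W -> Prop) : hilbert P -> (forall u, Q u -> P u) ->
  (exists u, Q u) ->
  (forall u v, Q u -> Q v -> Q (add u v)) -> (forall a u, Q u -> Q (scale a u)) ->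
  (forall (u : nat -> W) v, (forall n, Q (u n)) -> P v -> seq_to u v -> Q v) ->
  hilbert Q.
Proof.
move=> hP QP Q0 QD QZ Qc; split => //.
- by move=> u v Qu Qv; apply: (ipC hP); exact: QP.
- by move=> u v w Qu Qv Qw; apply: (ipDl hP); exact: QP.
- by move=> a u w Qu Qw; apply: (ipZl hP); exact: QP.
- by move=> u Qu; apply: (ip_ge0 hP); exact: QP.
- move=> u Qu /(hilbert_complete hP (fun n => QP _ (Qu n)))[v Pv uv].
  by exists v => //; exact: Qc uv.
Qed.

(** The projection of [w] is the Riesz representative in [Q] of the functional [ip w]. *)
Lemma projection (P Q : W -> Prop) : hilbert P -> hilbert Q ->
  (forall u, Q u -> P u) ->
  forall w, P w -> exists2 v, Q v & forall z, Q z -> ip w z = ip v z.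
Proof.
move=> hP hQ QP w Pw; apply: (riesz hQ).
have [fD fZ [K K0 fK]] := functional_ip hP Pw.
split=> [u v Qu Qv|a u Qu|]; [by apply: fD; exact: QP|by apply: fZ; exact: QP|].
by exists K => // u /QP; exact: fK.
Qed.

(** Project [w] on the closure [C] of [Q]: the difference is orthogonal to [Q], hence has norm zero
    by hypothesis, so [w] is at distance zero from the closure. *)
Lemma dense_of_orthogonal (P Q : W -> Prop) : hilbert P -> (forall u, Q u -> P u) ->
  (exists u, Q u) ->
  (forall u v, Q u -> Q v -> Q (add u v)) -> (forall a u, Q u -> Q (scale a u)) ->
  (forall w, P w -> (forall q, Q q -> ip w q = 0) -> ip w w = 0) ->
  forall w, P w -> forall e, 0 < e -> exists2 q, Q q & dist2 w q < e.
Proof.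
move=> hP QP Q0 QD QZ Qort.
pose C w := P w /\ forall e, 0 < e -> exists2 q, Q q & dist2 w q < e.
have QC q : Q q -> C q.
  move=> Qq; split; first exact: QP.
  by move=> e e0; exists q => //; rewrite /dist2; lra.
have CP u : C u -> P u by case.
have hC : hilbert C.
  apply: (hilbert_sub hP) => //.
  - by have [q Qq] := Q0; exists q; exact: QC.
  - move=> u v [Pu Hu] [Pv Hv]; split; first exact: hilbertD.
    move=> e e0; have e4 : 0 < e / 4 by lra.
    have [q1 Qq1 h1] := Hu _ e4; have [q2 Qq2 h2] := Hv _ e4.
    exists (add q1 q2); first exact: QD.
    have [Pq1 Pq2] := (QP _ Qq1, QP _ Qq2).
    have := ip_ge0 hP (hsubP hP (hsubP hP Pu Pq1) (hsubP hP Pv Pq2)).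
    have S1 := hsubP hP Pu Pq1; have S2 := hsubP hP Pv Pq2.
    rewrite !(ip_subl hP, ip_subr hP)//; try exact: hsubP.
    move: h1 h2; rewrite /dist2 !(ipDl hP, ipDr hP)//; try exact: (hilbertD hP).
    rewrite (ipC hP Pq1 Pu) (ipC hP Pq2 Pv) (ipC hP Pv Pu) (ipC hP Pq2 Pu)
      (ipC hP Pq2 Pq1) (ipC hP Pv Pq1); lra.
  - move=> a u [Pu Hu]; split; first exact: hilbertZ.
    move=> e e0; have ap : 0 < a ^+ 2 + 1 by have := sqr_ge0 a; lra.
    have [q Qq h] := Hu _ (divr_gt0 e0 ap).
    exists (scale a q); first exact: QZ.
    have Pq := QP _ Qq; have d0 := dist2_ge0 hP Pu Pq.
    rewrite /dist2 !(ipZl hP, ipZr hP)//; try exact: hilbertZ.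
    apply: (@le_lt_trans _ _ (a ^+ 2 * dist2 u q)).
      by rewrite /dist2; lra.
    move: h; rewrite ltr_pdivlMr//; nra.
  - move=> u v Cu Pv uv; split=> // e e0; have e4 : 0 < e / 4 by lra.
    have [k Hk] := uv _ e4; have [Pk /(_ _ e4)[q Qq h]] := Cu k.
    exists q => //; have Pq := QP _ Qq.
    have := dist2_le hP Pv Pq Pk; rewrite (dist2C hP Pv Pk).
    have := Hk k (leqnn _); lra.
move=> w Pw e e0.
have [v Cv vE] := projection hP hC CP Pw.
have Pv := CP _ Cv.
have : ip (hsub w v) (hsub w v) = 0.
  apply: Qort => [|q Qq]; first exact: hsubP.
  by rewrite (ip_subl hP)//; [rewrite vE ?subrr//; exact: QC|exact: QP].
rewrite -(dist2E hP)// => wv0.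
have e4 : 0 < e / 4 by lra.
have [q Qq h] := Cv.2 _ e4.
exists q => //; have := dist2_le hP Pw (QP _ Qq) Pv; lra.
Qed.

End hilbert.

(** * Subsequences and weak sequential compactness *)

Lemma cvgnP (R : realType) (u : nat -> R) (l : R) :
  u @ \oo --> l <->
  forall e, 0 < e -> exists K, forall n, (K <= n)%N -> `|u n - l| < e.
Proof.
split=> [/cvgrPdist_lt H e e0|H].
  by have [K _ HK] := H e e0; exists K => n Kn; rewrite distrC; exact: HK.
apply/cvgrPdist_lt => e e0; have [K HK] := H e e0.
by exists K => // n Kn /=; rewrite distrC; exact: HK.
Qed.

Lemma cauchy_cvgn (R : realType) (u : nat -> R) :
  (forall e, 0 < e -> exists K, forall m n, (K <= m)%N -> (K <= n)%N ->
     `|u m - u n| < e) -> cvgn u.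
Proof.
move=> H; apply/cauchy_cvgP/cauchy_exP => e e0; have [K HK] := H e e0.
exists (u K); exists K => // n Kn /=.
by rewrite -ball_normE /ball_ /=; exact: HK.
Qed.

(** Cantor's diagonal argument over Bolzano-Weierstrass: [K j] is the extraction after treating rows
    [0] to [j - 1], each refining the previous one. *)
Lemma diagonal_cvg (R : realType) (a : nat -> nat -> R) (B : nat -> R) :
  (forall m n, `|a m n| <= B m) ->
  exists2 k : nat -> nat, {homo k : i j / (i < j)%N} &
    forall m, cvgn (fun n => a m (k n)).
Proof.
move=> aB.
have step (jg : nat * (nat -> nat)) : exists f : nat -> nat,
    increasing_seq f /\ cvgn (fun n => a jg.1 (jg.2 (f n))).
  case: jg => j g /=.
  have [|f fi fc] := @bolzano_weierstrass R (fun n => a j (g n)).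
    exists (B j); split; first by rewrite num_real.
    by move=> x Bx y _ /=; apply: le_trans (ltW Bx).
  by exists f; split.
have [F FP] := choice step.
have Fi jg i j : (i < j)%N -> (F jg i < F jg j)%N.
  by move=> ij; have [h _] := FP jg; have := h j i; rewrite !leEnat ltnNge => ->; rewrite -ltnNge.
have ge_id (h : nat -> nat) : {homo h : i j / (i < j)%N} -> forall n, (n <= h n)%N.
  by move=> hh; elim=> // n IH; apply: leq_ltn_trans IH _; exact: hh.
pose K := fix K j := if j is j'.+1 then K j' \o F (j', K j') else id.
have KS j : K j.+1 = K j \o F (j, K j) by [].
have Ki j : {homo K j : i i' / (i < i')%N}.
  elim: j => // j IH i i' ii'; rewrite KS; apply: IH; exact: Fi.
have sub j n : (j <= n)%N -> exists2 h : nat -> nat,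
    {homo h : i i' / (i < i')%N} & K n = K j \o h.
  elim: n => [|n IH]; first by rewrite leqn0 => /eqP ->; exists id.
  rewrite leq_eqVlt => /predU1P[->|]; first by exists id.
  rewrite ltnS => /IH[h hi Kn]; exists (h \o F (n, K n)).
    by move=> i i' ii'; apply: hi; exact: Fi.
  by rewrite KS Kn.
exists (fun n => K n n).
  apply: homo_ltn => [n m p|n]; first exact: ltn_trans.
  rewrite KS /=; apply: (Ki n); apply: leq_trans (ge_id _ (@Fi (n, K n)) n.+1).
  by [].
move=> m; have [_ /cvg_ex[l /cvgnP Hl]] := FP (m, K m).
apply/cvg_ex; exists l; apply/cvgnP => e e0; have [N HN] := Hl e e0.
(* Row [m] converges along [K m.+1], and the diagonal is a subsequence of it only for indices at
   least [m + 1]. *)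
exists (maxn N m.+1) => n; rewrite geq_max => /andP[Nn mn].
have [h hi ->] := sub _ _ mn; rewrite KS /=; apply: HN.
exact: leq_trans Nn (ge_id _ hi n).
Qed.

Section weak_compactness.
Variables (R : realType) (W : Type).
Variables (add : W -> W -> W) (scale : R -> W -> W) (ip : W -> W -> R).
Variables (P : W -> Prop) (hP : hilbert add scale ip P).

Let CSn C u v : P u -> P v -> ip u u <= C -> `|ip u v| ^+ 2 <= C * ip v v.
Proof.
move=> Pu Pv uC; rewrite real_normK ?num_real//.
apply: le_trans (cauchy_schwarz hP Pu Pv) _.
by apply: ler_wpM2r => //; exact: (ip_ge0 hP).
Qed.

(* The set of [w] against which the diagonal subsequence converges is a closed
   subspace containing the sequence, hence, by projection, everything. *)
Lemma hilbert_weak_compact (u : nat -> W) (C : R) :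
  (forall n, P (u n)) -> (forall n, ip (u n) (u n) <= C) ->
  exists2 k : nat -> nat, {homo k : i j / (i < j)%N} &
  exists2 v, P v & forall l, functional add scale ip P l ->
    (fun n => l (u (k n))) @ \oo --> l v.
Proof.
move=> Pu uC.
have C0 : 0 <= C by apply: le_trans (uC 0%N); exact: (ip_ge0 hP).
have [|k ki kc] := @diagonal_cvg R (fun m n => ip (u n) (u m))
    (fun m => C + ip (u m) (u m)).
  move=> m n; have h := CSn (Pu n) (Pu m) (uC n).
  have i0 := ip_ge0 hP (Pu m).
  rewrite -ler_sqr ?nnegrE ?addr_ge0//; apply: le_trans h _; nra.
exists k => //.
pose x n := u (k n); have Px n : P (x n) by exact: Pu.
have xC n : ip (x n) (x n) <= C by exact: uC.
pose Q w := P w /\ cvgn (fun n => ip (x n) w).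
have QP w : Q w -> P w by case.
have Qu m : Q (u m) by split => //; exact: kc.
have QD v w : Q v -> Q w -> Q (add v w).
  move=> [Pv cv] [Pw cw]; split; first exact: (hilbertD hP).
  under eq_fun do rewrite (ipDr hP Pv Pw)//.
  exact: is_cvgD.
have QZ a v : Q v -> Q (scale a v).
  move=> [Pv cv]; split; first exact: (hilbertZ hP).
  under eq_fun do rewrite (ipZr hP a Pv)//.
  exact: is_cvgMr.
have hQ : hilbert add scale ip Q.
  apply: (hilbert_sub hP) => //; first by exists (u 0%N).
  move=> w v Qw Pv wv; split => //; apply: cauchy_cvgn => e e0.
  have e1 : 0 < (e / 3) ^+ 2 / (C + 1) by rewrite divr_gt0 ?exprn_gt0//; lra.
  have [K /(_ K (leqnn _)) HK] := wv _ e1.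
  have [PK /cvg_ex[l /cvgnP cK]] := Qw K.
  have e6 : 0 < e / 6 by lra.
  have [N HN] := cK _ e6.
  have key n : `|ip (x n) v - ip (x n) (w K)| < e / 3.
    rewrite -(ip_subr hP)// -ltr_sqr ?nnegrE//; last lra.
    have Ps := hsubP hP Pv PK.
    apply: le_lt_trans (CSn (Px n) Ps (xC n)) _.
    have d0 := dist2_ge0 hP PK Pv.
    rewrite -(dist2E hP)// (dist2C hP)//.
    move: HK; rewrite ltr_pdivlMr//; [nra|lra].
  exists N => m n Nm Nn.
  have := HN _ Nm; have := HN _ Nn; have := key m; have := key n.
  rewrite !ltr_norml; lra.
have PQ w : P w -> Q w.
  move=> Pw; have [w0 Qw0 w0E] := projection hP hQ QP Pw.
  have [Pw0 cw0] := Qw0; split => //.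
  under eq_fun do rewrite (ipC hP)// (w0E _ (Qu _)) (ipC hP)//.
  exact: cw0.
(* The limits define a bounded functional; its Riesz representative is the weak limit. *)
pose lam w := limn (fun n => ip (x n) w).
have flam : functional add scale ip P lam.
  split=> [v w Pv Pw|a v Pv|].
  - rewrite /lam; under eq_fun do rewrite (ipDr hP Pv Pw)//.
    by apply: limD; [case: (PQ _ Pv)|case: (PQ _ Pw)].
  - rewrite /lam; under eq_fun do rewrite (ipZr hP a Pv)//.
    by apply: cvg_lim => //; apply: cvgMr; case: (PQ _ Pv).
  - exists C => // w Pw; rewrite -real_normK ?num_real//.
    have [_ cw] := PQ _ Pw.
    have -> : `|lam w| ^+ 2 = limn (fun n => `|ip (x n) w| ^+ 2).
      apply/esym/cvg_lim => //; rewrite expr2.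
      under eq_fun do rewrite expr2.
      by apply: cvgM; apply: cvg_norm.
    apply: limr_le; last by apply: nearW => n; exact: CSn.
    apply/cvg_ex; exists (`|lam w| ^+ 2); rewrite expr2.
    under eq_fun do rewrite expr2.
    by apply: cvgM; apply: cvg_norm.
have [v Pv vE] := riesz hP flam.
exists v => // l /(riesz hP)[z Pz zE].
rewrite zE// (ipC hP)// -vE//; under eq_fun do rewrite zE// (ipC hP)//.
by have [_] := PQ _ Pz.
Qed.

End weak_compactness.
(** * Real integrals and square-integrable functions *)

Section Rintegral_facts.
Context {d} {T : measurableType d} {R : realType}.
Variable mu : {measure set T -> \bar R}.
Implicit Types f g h : T -> R.

Definition intg f := mu.-integrable setT (EFin \o f).

Lemma intg_meas f : intg f -> measurable_fun setT f.
Proof. by move=> /(measurable_int mu)/measurable_EFinP. Qed.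

Lemma intg_le f g : measurable_fun setT f -> (forall x, `|f x| <= g x) ->
  intg g -> intg f.
Proof.
move=> mf fg; apply: le_integrable => //; first exact/measurable_EFinP.
move=> x _; rewrite lee_fin; apply: le_trans (fg x) _; exact: ler_norm.
Qed.

Lemma intgD f g : intg f -> intg g -> intg (fun x => f x + g x).
Proof. by move=> hf hg; have := integrableD measurableT hf hg. Qed.

Lemma intgZ a f : intg f -> intg (fun x => a * f x).
Proof. by move=> hf; have := integrableZl measurableT a hf. Qed.

Lemma intgN f : intg f -> intg (fun x => - f x).
Proof. by move=> hf; have := integrableN hf. Qed.

Lemma intgB f g : intg f -> intg g -> intg (fun x => f x - g x).
Proof. by move=> hf /intgN hg; apply: intgD. Qed.

Lemma intg0 : intg (fun=> 0).
Proof. exact: integrable0. Qed.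

Lemma intg_sum (I : Type) (s : seq I) (F : I -> T -> R) :
  (forall i, intg (F i)) -> intg (fun x => \sum_(i <- s) F i x).
Proof.
move=> HF; elim: s => [|i s IH].
  by under eq_fun do rewrite big_nil; exact: intg0.
by under eq_fun do rewrite big_cons; exact: intgD.
Qed.

Lemma intg_norm f : intg f -> intg (fun x => `|f x|).
Proof. by move=> hf; have := integrable_norm hf. Qed.

Lemma RintD f g : intg f -> intg g ->
  \int[mu]_x (f x + g x) = \int[mu]_x f x + \int[mu]_x g x.
Proof. by move=> hf hg; exact: RintegralD. Qed.

Lemma RintB f g : intg f -> intg g ->
  \int[mu]_x (f x - g x) = \int[mu]_x f x - \int[mu]_x g x.
Proof. by move=> hf hg; exact: RintegralB. Qed.

Lemma RintZ a f : intg f -> \int[mu]_x (a * f x) = a * \int[mu]_x f x.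
Proof. by move=> hf; exact: RintegralZl. Qed.

Lemma Rint0 : \int[mu]_x (0 : R) = 0.
Proof. by rewrite /Rintegral; under eq_integral do [] ; rewrite integral0. Qed.

Lemma RintN f : intg f -> \int[mu]_x (- f x) = - \int[mu]_x f x.
Proof.
by move=> hf; under eq_Rintegral do rewrite -mulN1r; rewrite RintZ ?mulN1r.
Qed.

Lemma Rint_sum (I : Type) (s : seq I) (F : I -> T -> R) :
  (forall i, intg (F i)) ->
  \int[mu]_x (\sum_(i <- s) F i x) = \sum_(i <- s) \int[mu]_x F i x.
Proof.
move=> HF; elim: s => [|i s IH].
  by rewrite big_nil; under eq_Rintegral do rewrite big_nil; exact: Rint0.
rewrite big_cons -IH -RintD//; last exact: intg_sum.
by under eq_Rintegral do rewrite big_cons.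
Qed.

Lemma Rint_le f g : intg f -> intg g -> (forall x, f x <= g x) ->
  \int[mu]_x f x <= \int[mu]_x g x.
Proof. by move=> hf hg fg; apply: le_Rintegral. Qed.

Lemma Rint_ge0 f : (forall x, 0 <= f x) -> 0 <= \int[mu]_x f x.
Proof. by move=> f0; apply: Rintegral_ge0. Qed.

Lemma EFin_Rint f : intg f -> (\int[mu]_x f x)%:E = (\int[mu]_x (f x)%:E)%E.
Proof. by move=> hf; rewrite fineK//; exact: integrable_fin_num. Qed.

Lemma intg_lty f : measurable_fun setT f -> (forall x, 0 <= f x) ->
  (\int[mu]_x (f x)%:E < +oo)%E -> intg f.
Proof.
move=> mf f0 hf; apply/integrableP; split; first exact/measurable_EFinP.
by under eq_integral do rewrite /= ger0_norm//.
Qed.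

Lemma Rint_ae f g : measurable_fun setT f -> measurable_fun setT g ->
  {ae mu, forall x, f x = g x} -> \int[mu]_x f x = \int[mu]_x g x.
Proof.
move=> mf mg fg; rewrite /Rintegral; congr fine.
apply: ae_eq_integral => //; [exact/measurable_EFinP|exact/measurable_EFinP|].
by apply: filterS fg => x -> _.
Qed.

Lemma Rint_eq0_ae f : intg f -> (forall x, 0 <= f x) -> \int[mu]_x f x = 0 ->
  {ae mu, forall x, f x = 0}.
Proof.
move=> hf f0 If; have mf := intg_meas hf.
have : (\int[mu]_x `|(f x)%:E| = 0)%E.
  under eq_integral do rewrite /= ger0_norm//.
  by rewrite -EFin_Rint// If.
move/(ae_eq_integral_abs mu measurableT).
move=> /(_ (measurable_int mu hf)); apply: filterS => x /(_ Logic.I)/=.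
by case.
Qed.

Lemma Rint_norm f : intg f -> `|\int[mu]_x f x| <= \int[mu]_x `|f x|.
Proof. by move=> hf; apply: le_normr_Rintegral. Qed.

Lemma Rint_dct (F : nat -> T -> R) f g :
  (forall n, measurable_fun setT (F n)) -> measurable_fun setT f ->
  {ae mu, forall x, F ^~ x @ \oo --> f x} -> intg g ->
  {ae mu, forall x n, `|F n x| <= g x} ->
  intg f /\ (fun n => \int[mu]_x F n x) @ \oo --> \int[mu]_x f x.
Proof.
move=> mF mf Ff hg Fg.
have [|||||hf _ cF] := @dominated_convergence _ _ _ mu setT measurableT
   (fun n => EFin \o F n) (EFin \o f) (EFin \o g).
- by move=> n; exact/measurable_EFinP.
- exact/measurable_EFinP.
- by apply: filterS Ff => x Fx _; apply: cvg_EFin; [exact: nearW|exact: Fx].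
- exact: hg.
- apply: filterS Fg => x Fx n _; rewrite /= lee_fin; exact: Fx.
split => //; apply: fine_cvg; rewrite EFin_Rint//.
Qed.

End Rintegral_facts.

Section L2.
Context {d} {T : measurableType d} {R : realType}.
Variable mu : {measure set T -> \bar R}.
Implicit Types f g h : T -> R.
Local Notation intg := (intg mu).

Definition L2 f := measurable_fun setT f /\ intg (fun x => f x ^+ 2).

Definition L2dot f g := \int[mu]_x (f x * g x).
Local Notation dot := L2dot.

Lemma L2_meas f : L2 f -> measurable_fun setT f. Proof. by case. Qed.

Lemma L2_intgM f g : L2 f -> L2 g -> intg (fun x => f x * g x).
Proof.
move=> [mf hf] [mg hg]; apply: intg_le (intgD hf hg); first exact: measurable_funM.
move=> x; rewrite normrM -(real_normK (num_real (f x))) -(real_normK (num_real (g x))).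
have := sqr_ge0 (`|f x| - `|g x|); nra.
Qed.

Lemma L2_dom f g : measurable_fun setT f -> (forall x, `|f x| <= `|g x|) ->
  L2 g -> L2 f.
Proof.
move=> mf fg [mg hg]; split => //; apply: intg_le hg => [|x].
  exact: measurable_funX.
by rewrite ger0_norm ?sqr_ge0// -real_normK ?num_real// -[leRHS]real_normK ?num_real// ler_sqr ?nnegrE.
Qed.

Lemma L2D f g : L2 f -> L2 g -> L2 (fun x => f x + g x).
Proof.
move=> Lf Lg; have [mf hf] := Lf; have [mg hg] := Lg.
have mfg : measurable_fun setT (fun x => f x + g x) by exact: measurable_funD.
split => //; apply: intg_le (intgD (intgZ 2 hf) (intgZ 2 hg)).
  exact: measurable_funX.
by move=> x; rewrite ger0_norm ?sqr_ge0//; have := sqr_ge0 (f x - g x); nra.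
Qed.

Lemma L2Z a f : L2 f -> L2 (fun x => a * f x).
Proof.
move=> [mf hf]; split; first exact: measurable_funM.
by under eq_fun do rewrite exprMn; exact: intgZ.
Qed.

Lemma L2N f : L2 f -> L2 (fun x => - f x).
Proof. by move=> /(L2Z (-1)); under eq_fun do rewrite mulN1r. Qed.

Lemma L2B f g : L2 f -> L2 g -> L2 (fun x => f x - g x).
Proof. by move=> Lf /L2N; exact: L2D. Qed.

Lemma L2_0 : L2 (fun=> 0).
Proof. by split => //; under eq_fun do rewrite expr0n; exact: intg0. Qed.

Lemma L2_sum (I : Type) (s : seq I) (F : I -> T -> R) :
  (forall i, L2 (F i)) -> L2 (fun x => \sum_(i <- s) F i x).
Proof.
move=> HF; elim: s => [|i s IH].
  by under eq_fun do rewrite big_nil; exact: L2_0.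
by under eq_fun do rewrite big_cons; exact: L2D.
Qed.

Lemma L2_norm f : L2 f -> L2 (fun x => `|f x|).
Proof.
by move=> Lf; apply: (L2_dom _ _ Lf) => [|x]; [apply: measurableT_comp => //; case: Lf|rewrite normr_id].
Qed.

Lemma dotC f g : dot f g = dot g f.
Proof. by apply: eq_Rintegral => x _; rewrite mulrC. Qed.

Lemma dot0r f : dot f (fun=> 0) = 0.
Proof. by rewrite /L2dot; under eq_Rintegral do rewrite mulr0; exact: Rint0. Qed.

Lemma dotDl f g h : L2 f -> L2 g -> L2 h ->
  dot (fun x => f x + g x) h = dot f h + dot g h.
Proof.
move=> Lf Lg Lh; rewrite /L2dot -RintD; [|exact: L2_intgM..].
by apply: eq_Rintegral => x _; rewrite mulrDl.
Qed.

Lemma dotZl a f h : L2 f -> L2 h -> dot (fun x => a * f x) h = a * dot f h.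
Proof.
move=> Lf Lh; rewrite /L2dot -RintZ; [|exact: L2_intgM].
by apply: eq_Rintegral => x _; rewrite mulrA.
Qed.

Lemma dotNl f h : L2 f -> L2 h -> dot (fun x => - f x) h = - dot f h.
Proof.
by move=> Lf Lh; under [LHS]eq_Rintegral do rewrite mulNr; rewrite RintN//; exact: L2_intgM.
Qed.

Lemma dotBl f g h : L2 f -> L2 g -> L2 h ->
  dot (fun x => f x - g x) h = dot f h - dot g h.
Proof. by move=> Lf Lg Lh; rewrite dotDl ?dotNl//; exact: L2N. Qed.

Lemma dotDr f g h : L2 f -> L2 g -> L2 h ->
  dot h (fun x => f x + g x) = dot h f + dot h g.
Proof. by move=> *; rewrite dotC dotDl// !(dotC h). Qed.

Lemma dotZr a f h : L2 f -> L2 h -> dot h (fun x => a * f x) = a * dot h f.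
Proof. by move=> *; rewrite dotC dotZl// (dotC h). Qed.

Lemma dotNr f h : L2 f -> L2 h -> dot h (fun x => - f x) = - dot h f.
Proof. by move=> *; rewrite dotC dotNl// (dotC h). Qed.

Lemma dotBr f g h : L2 f -> L2 g -> L2 h ->
  dot h (fun x => f x - g x) = dot h f - dot h g.
Proof. by move=> *; rewrite dotC dotBl// !(dotC h). Qed.

Lemma dotE f : dot f f = \int[mu]_x (f x ^+ 2).
Proof. by apply: eq_Rintegral => x _; rewrite expr2. Qed.

Lemma dot_ge0 f : 0 <= dot f f.
Proof. by rewrite dotE; apply: Rint_ge0 => x; exact: sqr_ge0. Qed.

Lemma EFin_dot f : L2 f -> (dot f f)%:E = (\int[mu]_x (f x ^+ 2)%:E)%E.
Proof. by move=> [mf hf]; rewrite dotE EFin_Rint. Qed.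

Lemma dot_eq0 f : L2 f -> dot f f = 0 -> {ae mu, forall x, f x = 0}.
Proof.
move=> [mf hf]; rewrite dotE => h; have := Rint_eq0_ae hf (fun x => sqr_ge0 _) h.
by apply: filterS => x /eqP; rewrite sqrf_eq0 => /eqP.
Qed.

Lemma dot_ae f g f' g' : L2 f -> L2 g -> L2 f' -> L2 g' ->
  {ae mu, forall x, f x = f' x} -> {ae mu, forall x, g x = g' x} ->
  dot f g = dot f' g'.
Proof.
move=> [mf _] [mg _] [mf' _] [mg' _] ff gg; apply: Rint_ae; [exact: measurable_funM..|].
by apply: filterS2 ff gg => x -> ->.
Qed.

Lemma dot_sub f g : L2 f -> L2 g ->
  dot (fun x => f x - g x) (fun x => f x - g x) = dot f f - 2 * dot f g + dot g g.
Proof.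
move=> Lf Lg; have Lfg := L2B Lf Lg.
by rewrite dotBl// !dotBr// (dotC g f); ring.
Qed.

End L2.

(** * Completeness of L^2 and of its finite powers *)

Section fatou_L2.
Context {d} {T : measurableType d} {R : realType}.
Variable mu : {measure set T -> \bar R}.

(** The bound is asked only from index [N] on and the limit only almost everywhere; the lower limit
    in Fatou's lemma absorbs both. *)
Lemma fatou_bound (F : nat -> T -> R) (f : T -> R) (C : \bar R) (N : nat) :
  (forall n, measurable_fun setT (F n)) -> measurable_fun setT f ->
  (forall n x, 0 <= F n x) -> (forall x, 0 <= f x) ->
  {ae mu, forall x, F ^~ x @ \oo --> f x} ->
  (forall n, (N <= n)%N -> (\int[mu]_x (F n x)%:E <= C)%E) ->
  (\int[mu]_x (f x)%:E <= C)%E.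
Proof.
move=> mF mf F0 f0 Ff FC.
have mEF n : measurable_fun setT (EFin \o F n) by exact/measurable_EFinP.
have -> : (\int[mu]_x (f x)%:E = \int[mu]_x limn_einf (fun n => (F n x)%:E))%E.
  apply: ae_eq_integral => //; first exact/measurable_EFinP.
    rewrite (_ : (fun x => _) = (fun x => - limn_esup (fun n => - (F n x)%:E))%E).
      apply: measurableT_comp => //; apply: measurable_fun_limn_esup => n.
      by apply: measurableT_comp => //; exact: mEF.
    by apply/funext => x; rewrite -limn_einfN; congr limn_einf; apply/funext => n /=; rewrite opprK.
  apply: filterS Ff => x Fx _.
  have : (fun n => (F n x)%:E) @ \oo --> (f x)%:E.
    by apply: cvg_EFin; [exact: nearW|exact: Fx].
  by move/cvg_limn_einf_sup => -[-> _].
apply: le_trans (fatou mu measurableT mEF _) _ => //.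
  by move=> n x _; rewrite lee_fin.
rewrite limn_einf_lim; apply: lime_le; first exact: is_cvg_einfs.
apply: nearW => n; apply: le_trans (FC (maxn n N) (leq_maxr _ _)).
by apply: ereal_inf_lbound; exists (maxn n N) => //=; exact: leq_maxl.
Qed.

(** Riesz-Fischer. Along a subsequence with squared distances below [8 ^ -j], the series of
    [4 ^ j dl_j ^ 2] is integrable, hence finite almost everywhere, which makes the increments
    pointwise [O(2 ^ -j)]. Fatou then turns the pointwise limit into an $L^2$ limit of the whole
    sequence. *)
Lemma L2_complete (u : nat -> T -> R) : (forall n, L2 mu (u n)) ->
  (forall e, 0 < e -> exists K, forall m n, (K <= m)%N -> (K <= n)%N ->
     L2dot mu (fun x => u m x - u n x) (fun x => u m x - u n x) < e) ->
  exists2 v, L2 mu v & forall e, 0 < e -> exists K, forall n, (K <= n)%N ->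
     L2dot mu (fun x => u n x - v x) (fun x => u n x - v x) < e.
Proof.
move=> Lu Cu.
have mu_ n := L2_meas (Lu n).
have ex j : exists K, forall m n, (K <= m)%N -> (K <= n)%N ->
     L2dot mu (fun x => u m x - u n x) (fun x => u m x - u n x) < (8^-1) ^+ j.
  by apply: Cu; rewrite exprn_gt0// invr_gt0.
have [K HK] := choice ex.
(* Dominates [j] and every [K i] with [i <= j], so [k j] and [k j.+1] are both past rank [K j]. *)
pose k j := (j + \sum_(i < j.+1) K i)%N.
have kK j : (K j <= k j)%N.
  by rewrite /k big_ord_recr/= addnA; exact: leq_addl.
have kK1 j : (K j <= k j.+1)%N.
  rewrite /k big_ord_recr/= addnC -addnA; apply: leq_trans (leq_addr _ _).
  by rewrite big_ord_recr/=; exact: leq_addl.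
have kj j : (j <= k j)%N by exact: leq_addr.
pose dl j x := u (k j.+1) x - u (k j) x.
have Ld j : L2 mu (dl j) by exact: L2B.
have dd j : L2dot mu (dl j) (dl j) <= (8^-1) ^+ j by apply/ltW/HK.
pose h j x : \bar R := (4 ^+ j * dl j x ^+ 2)%:E.
have h0 j x : (0 <= h j x)%E by rewrite lee_fin; apply: mulr_ge0; [apply: exprn_ge0|apply: sqr_ge0].
have mh j : measurable_fun setT (h j).
  apply/measurable_EFinP; apply: measurable_funM => //.
  by apply: measurable_funX; apply: measurable_funB.
pose H x := (\sum_(j <oo) h j x)%E.
have H0 x : (0 <= H x)%E by apply: nneseries_ge0.
have mH : measurable_fun setT H by exact: ge0_emeasurable_sum.
have iH : mu.-integrable setT H.
  apply/integrableP; split => //.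
  under eq_integral do rewrite gee0_abs//.
  rewrite /H integral_nneseries//.
  apply: (@le_lt_trans _ _ 2%:E); last exact: ltry.
  apply: lime_le; first by apply: is_cvg_nneseries => *; exact: integral_ge0.
  apply: nearW => n.
  apply: (@le_trans _ _ (\sum_(0 <= j < n) ((2^-1) ^+ j)%:E)%E).
    apply: lee_sum => j _; rewrite /h.
    under eq_integral do rewrite EFinM.
    rewrite ge0_integralZl//=; last 2 first.
      - by apply/measurable_EFinP; apply: measurable_funX; apply: measurable_funB.
      - by move=> x _; rewrite lee_fin sqr_ge0.
    rewrite -EFin_dot// -EFinM lee_fin.
    apply: (@le_trans _ _ (4 ^+ j * 8^-1 ^+ j)).
      by apply: ler_wpM2l => //; rewrite exprn_ge0.
    by rewrite -exprMn (_ : 4 * 8^-1 = 2^-1)//; field.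
  rewrite sumEFin lee_fin big_mkord.
  have -> : \sum_(i < n) (2^-1 : R) ^+ i = 2 - 2 * 2^-1 ^+ n.
    elim: n => [|n IH]; first by rewrite big_ord0 expr0; ring.
    by rewrite big_ord_recr/= IH exprS; field.
  by rewrite gerBl mulr_ge0// exprn_ge0.
have Hfin := integrable_ae measurableT iH.
pose w j x := u (k j) x.
have cw x : H x \is a fin_num -> cvgn (w ^~ x).
  (* Adding [1] gives [H x <= C ^ 2], so the bound on squares becomes [|dl j x| <= C 2 ^ -j]. *)
  move=> Hx; pose C := fine (H x) + 1.
  have C1 : 1 <= C by rewrite /C lerDr fine_ge0.
  have dC j : `|dl j x| <= C * 2^-1 ^+ j.
    have hj : (h j x <= H x)%E.
      have := @nneseries_lim_ge R (h^~ x) predT 0 j.+1 (fun n _ _ => h0 n x).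
      apply: le_trans; rewrite big_mkord big_ord_recr /=.
      by rewrite leeDr// sume_ge0.
    have hj' : 4 ^+ j * dl j x ^+ 2 <= C ^+ 2.
      have : 4 ^+ j * dl j x ^+ 2 <= fine (H x) by rewrite -lee_fin fineK.
      move/le_trans; apply; rewrite /C; have : 0 <= fine (H x) by rewrite fine_ge0.
      nra.
    rewrite -ler_sqr ?nnegrE ?mulr_ge0// ?exprn_ge0//; last by lra.
    rewrite real_normK ?num_real// exprMn -exprM mulnC exprM.
    rewrite -ler_pdivrMr ?exprn_gt0//.
    rewrite -exprVn (_ : (2^-1 ^+ 2)^-1 = 4); last by field.
    by rewrite mulrC.
  have tail m n : `|w (m + n)%N x - w m x| <= 2 * C * 2^-1 ^+ m.
    suff : `|w (m + n)%N x - w m x| <= 2 * C * 2^-1 ^+ m - 2 * C * 2^-1 ^+ (m + n)%N.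
      move/le_trans; apply; rewrite gerBl !mulr_ge0// ?exprn_ge0//; lra.
    elim: n => [|n IH]; first by rewrite addn0 !subrr normr0.
    rewrite addnS; have := dC (m + n)%N; rewrite /dl -/(w _ x) -/(w _ x) => h1.
    have := ler_normD (w (m + n).+1 x - w (m + n)%N x) (w (m + n)%N x - w m x).
    rewrite addrA subrK exprS => /le_trans; apply.
    apply: le_trans (lerD h1 IH) _; move: (2^-1 ^+ _) => a; lra.
  apply: cauchy_cvgn => e e0.
  have : (fun m => 4 * C * 2^-1 ^+ m) @ \oo --> 4 * C * 0.
    apply: cvgMr; apply: cvg_expr; rewrite ger0_norm ?invr_ge0//; lra.
  rewrite mulr0 => /cvgnP /(_ _ e0)[N /(_ _ (leqnn _)) HN].
  exists N => m n /subnKC <- /subnKC <-.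
  rewrite subr0 ger0_norm in HN; last by rewrite !mulr_ge0 ?exprn_ge0//; lra.
  apply: le_lt_trans (le_trans (ler_distD (w N x) _ _) _) HN.
  rewrite [X in _ + X]distrC; apply: le_trans (lerD (tail _ _) (tail _ _)) _.
  move: (2^-1 ^+ _) => a; lra.
(* The upper limit is measurable on the whole space and equals the limit where one exists; [fine]
   sends infinite values to zero. *)
pose v x := fine (limn_esup (fun j => (w j x)%:E)).
have mw j : measurable_fun setT (w j) by exact: mu_.
have mv : measurable_fun setT v.
  apply: measurableT_comp => //; apply: measurable_fun_limn_esup => j.
  exact/measurable_EFinP.
have wv : {ae mu, forall x, w ^~ x @ \oo --> v x}.
  apply: filterS Hfin => x /(_ Logic.I)/cw /cvg_ex[l wl].
  suff -> : v x = l by [].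
  rewrite /v; have : (fun n => (w n x)%:E) @ \oo --> l%:E.
    by apply: cvg_EFin; [exact: nearW|exact: wl].
  by move/cvg_limn_einf_sup => -[_ ->].
have key e : 0 < e -> exists K, forall n, (K <= n)%N ->
    (\int[mu]_x ((u n x - v x) ^+ 2)%:E <= e%:E)%E.
  move=> e0; have [N HN] := Cu _ e0; exists N => n Nn.
  apply: (@fatou_bound (fun j x => (u n x - w j x) ^+ 2) _ _ N).
  - by move=> j; apply: measurable_funX; exact: measurable_funB.
  - by apply: measurable_funX; exact: measurable_funB.
  - by move=> j x; exact: sqr_ge0.
  - by move=> x; exact: sqr_ge0.
  - apply: filterS wv => x wx; rewrite expr2; under eq_fun do rewrite expr2.
    by apply: cvgM; apply: cvgB => //; exact: cvg_cst.
  - move=> j Nj; rewrite -EFin_dot; last exact: L2B (Lu n) (Lu (k j)).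
    by rewrite lee_fin; apply/ltW/HN => //; exact: leq_trans Nj (kj j).
have Lv : L2 mu v.
  have [N /(_ _ (leqnn _)) HN] := key 1 ltr01.
  have LN : L2 mu (fun x => u N x - v x).
    split; first exact: measurable_funB.
    apply: intg_lty; [|by move=> x; exact: sqr_ge0|exact: le_lt_trans HN (ltry _)].
    by apply: measurable_funX; exact: measurable_funB.
  have := L2B (Lu N) LN.
  by under eq_fun do rewrite opprB addrCA subrr addr0.
exists v => // e e0; have e2 : 0 < e / 2 by lra.
have [N HN] := key _ e2; exists N => n /HN.
by rewrite -EFin_dot ?lee_fin; [move=> hh; lra|exact: L2B (Lu n) Lv].
Qed.

End fatou_L2.

Section L2_family.
Context {d} {T : measurableType d} {R : realType}.
Variable mu : {measure set T -> \bar R}.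
Variable I : finType.
Implicit Types u v : I -> T -> R.

Definition fadd u v : I -> T -> R := fun i x => u i x + v i x.
Definition fscale (a : R) u : I -> T -> R := fun i x => a * u i x.
Definition fdot u v : R := \sum_i L2dot mu (u i) (v i).
Definition fL2 u := forall i, L2 mu (u i).

(** A point is a finite family of functions: [unit] gives $L^2$ itself, ['I_N] gradients,
    [option 'I_N] a function with its gradient. *)
Lemma fL2_hilbert : hilbert fadd fscale fdot fL2.
Proof.
have fdist u v : fL2 u -> fL2 v -> dist2 fdot u v =
    \sum_i L2dot mu (fun x => u i x - v i x) (fun x => u i x - v i x).
  move=> Lu Lv; rewrite /dist2 /fdot mulr_sumr -sumrB -big_split/=.
  by apply: eq_bigr => i _; rewrite dot_sub.
split.
- by exists (fun _ _ => 0) => i; exact: L2_0.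
- by move=> u v Lu Lv i; exact: L2D.
- by move=> a u Lu i; exact: L2Z.
- by move=> u v _ _; apply: eq_bigr => i _; rewrite dotC.
- by move=> u v w Lu Lv Lw; rewrite -big_split; apply: eq_bigr => i _; exact: dotDl.
- by move=> a u w Lu Lw; rewrite mulr_sumr; apply: eq_bigr => i _; exact: dotZl.
- by move=> u Lu; apply: sumr_ge0 => i _; exact: dot_ge0.
- move=> u Lu Cu.
  have ex i : exists v : T -> R, L2 mu v /\ forall e, 0 < e -> exists K, forall n, (K <= n)%N ->
      L2dot mu (fun x => u n i x - v x) (fun x => u n i x - v x) < e.
    have [||z Lz zu] := @L2_complete _ _ _ mu (fun n => u n i).
    - by move=> n; exact: Lu.
    - move=> e /Cu[K HK]; exists K => m n Km Kn.
      apply: le_lt_trans (HK _ _ Km Kn); rewrite fdist// (bigD1 i)//=.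
      by rewrite lerDl; apply: sumr_ge0 => j _; exact: dot_ge0.
    by exists z.
  have [v vP] := choice ex.
  have Lv : fL2 v by move=> i; case: (vP i).
  exists v => // e e0.
  (* The successor keeps the sum strictly below [e] and covers an empty index type. *)
  have c0 : 0 < e / (#|I|.+1)%:R by rewrite divr_gt0.
  have exK i := (vP i).2 _ c0.
  have [K HK] := choice exK.
  exists (\max_i K i) => n Kn; rewrite fdist//.
  apply: (@le_lt_trans _ _ (\sum_(i : I) e / (#|I|.+1)%:R)).
    by apply: ler_sum => i _; apply/ltW/HK; exact: leq_trans (leq_bigmax i) Kn.
  rewrite sumr_const -[X in X < _]mulr_natr -mulrA gtr_pMr// mulrC ltr_pdivrMr//.
  by rewrite mul1r ltr_nat.
Qed.

End L2_family.
(** * Lebesgue measure on R^N and its changes of variables *)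

Section boxes.
Context {R : realType} {N : nat}.
Local Notation X := 'rV[R]_N.
Local Notation leb := (lebesgue_rV R N).
Implicit Types (a b x y z : X) (A B : set X).

Definition box a b : set X := [set x | forall i, a ord0 i <= x ord0 i <= b ord0 i].

Lemma measurable_box a b : measurable (box a b).
Proof.
rewrite (_ : box a b = \bigcap_(i in [set: 'I_N])
   ((fun x : X => x ord0 i : measurableTypeR R) @^-1` `[a ord0 i, b ord0 i]%classic)).
  apply: fin_bigcap_measurable => // i _; rewrite -[X in measurable X]setTI.
  by apply: measurable_coord => //; exact: measurable_itv.
apply/seteqP; split=> [x H i _ /=|x H i]; first by rewrite in_itv/=; exact: H.
by have := H i Logic.I; rewrite /= in_itv.
Qed.

Lemma leb_box a b : (forall i, a ord0 i <= b ord0 i) ->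
  leb (box a b) = (\prod_(i < N) (b ord0 i - a ord0 i))%:E.
Proof. exact: lebesgue_rV_box. Qed.

(** The maximum makes the formula cover empty boxes, so that preimages of boxes are compared factor
    by factor. *)
Lemma leb_boxE a b : leb (box a b) =
  (\prod_(i < N) Num.max 0 (b ord0 i - a ord0 i))%:E.
Proof.
have [ab|] := pselect (forall i, a ord0 i <= b ord0 i).
  rewrite leb_box//; congr EFin; apply: eq_bigr => i _.
  by rewrite max_r// subr_ge0.
move=> /existsNP[i /negP]; rewrite -ltNge => ba.
rewrite (_ : box a b = set0); last first.
  apply/seteqP; split=> // x /(_ i)/andP[h1 h2].
  by have := le_lt_trans (le_trans h1 h2) ba; rewrite ltxx.
rewrite measure0; congr EFin; rewrite (bigD1 i)//= max_l ?mul0r//.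
by rewrite subr_le0 ltW.
Qed.

Lemma leb_box_lty a b : (leb (box a b) < +oo)%E.
Proof. by rewrite leb_boxE ltry. Qed.

Definition cube (r : R) : set X := box (const_mx (- r)) (const_mx r).

Lemma cubeP r x : cube r x <-> forall i, `|x ord0 i| <= r.
Proof. by split => H i; have := H i; rewrite !mxE ler_norml. Qed.

Lemma leb_cube r : 0 <= r -> leb (cube r) = ((2 * r) ^+ N)%:E.
Proof.
move=> r0; rewrite leb_boxE; congr EFin.
rewrite (eq_bigr (fun=> 2 * r)) => [|i _].
  by rewrite prodr_const cardT size_enum_ord.
by rewrite !mxE opprK max_r; [ring|lra].
Qed.

Lemma bigcup_cube : \bigcup_n cube n%:R = [set: X].
Proof.
apply/seteqP; split => // x _.
exists (\max_i (Num.bound `|x ord0 i|)) => //; apply/cubeP => i.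
apply: ltW; apply: lt_le_trans (archi_boundP (normr_ge0 _)) _.
by rewrite ler_nat; exact: leq_bigmax.
Qed.

Definition boxes : set (set X) := [set B | exists a b, B = box a b].

Lemma boxesI : setI_closed boxes.
Proof.
move=> _ _ [a [b ->]] [c [e ->]].
exists (\row_i Num.max (a ord0 i) (c ord0 i)), (\row_i Num.min (b ord0 i) (e ord0 i)).
apply/seteqP; split=> [x [H1 H2] i|x H].
  by rewrite !mxE ge_max le_min; have /andP[-> ->] := H1 i; have /andP[-> ->] := H2 i.
split=> i; have := H i; rewrite !mxE ge_max le_min => /andP[/andP[h1 h2] /andP[h3 h4]].
  by rewrite h1.
by rewrite h2.
Qed.

Lemma measurable_rVE : @measurable _ X = <<s boxes >>.
Proof.
apply/seteqP; split; last first.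
  apply: smallest_sub; first exact: sigma_algebra_measurable.
  by move=> _ [a [b ->]]; exact: measurable_box.
apply: smallest_sub; first exact: smallest_sigma_algebra.
rewrite -bigcup_seq; apply: bigcup_sub => i _ _ [B mB <-].
rewrite setTI.
have : measurable_fun [set: g_sigma_algebraType boxes]
    (fun x : g_sigma_algebraType boxes => (x : X) ord0 i).
  apply: (measurability _ (RGenCInfty.measurableE R)) => // _ [_ [t ->] <-].
  rewrite setTI.
  (* A closed half-space is a countable union of boxes, bounded below by [t] in coordinate [i] and
     by [- n] in the others. *)
  rewrite (_ : _ @^-1` _ = \bigcup_n box (\row_j if j == i then t else - n%:R)
     (const_mx n%:R)).
    by apply: bigcupT_measurable => n; apply: sub_sigma_algebra; eexists; eexists.
  apply/seteqP; split => [x /=|x [n _ /(_ i)]]; last first.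
    by rewrite !mxE eqxx /= in_itv/= andbT => /andP[].
  rewrite in_itv/= andbT => tx.
  have : [set: X] x by [].
  rewrite -bigcup_cube => -[n _ xn]; exists n => // j; have := xn j; rewrite !mxE.
  by case: eqVneq => // -> /andP[_ ->]; rewrite tx.
by move=> /(_ measurableT B mB); rewrite setTI.
Qed.

Lemma box_unique (m1 m2 : {measure set X -> \bar R}) :
  (forall a b, m1 (box a b) = m2 (box a b)) ->
  (forall a b, (m1 (box a b) < +oo)%E) ->
  forall A, measurable A -> m1 A = m2 A.
Proof.
move=> m12 m1oo A mA; apply: (measure_unique boxes (fun n => cube n%:R)) => //.
- exact: measurable_rVE.
- exact: boxesI.
- by move=> n; eexists; eexists.
- exact: bigcup_cube.
- by move=> _ [a [b ->]].
- by move=> n; exact: m1oo.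
Qed.

End boxes.

Section change_of_variables.
Context {R : realType} {N : nat}.
Local Notation X := 'rV[R]_N.
Local Notation leb := (lebesgue_rV R N).

(** [c] is the inverse of the Jacobian: [1] for isometries, [l ^ -N] for the dilation by [l]. Stated
    on preimages, it yields the substitution rule through a pushforward. *)
Definition leb_scaling (c : R) (S : X -> X) := measurable_fun setT S /\
  forall A, measurable A -> leb (S @^-1` A) = (c%:E * leb A)%E.

Lemma ge0_integral_scaling (c : {nonneg R}) S (f : X -> \bar R) :
  leb_scaling c%:num S -> measurable_fun setT f -> (forall x, 0 <= f x)%E ->
  (\int[leb]_x f (S x) = c%:num%:E * \int[leb]_x f x)%E.
Proof.
move=> [mS hS] mf f0.
have := @ge0_integral_pushforward _ _ _ _ R S mS leb setT f measurableT mf.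
rewrite preimage_setT => <-; last by move=> y _; exact: f0.
rewrite -ge0_integral_mscale//; apply: eq_measure_integral => A mA _.
exact: hS.
Qed.

Lemma leb_scaling_box (c : R) (S : X -> X) : 0 <= c -> measurable_fun setT S ->
  (forall a b, leb (S @^-1` box a b) = (c%:E * leb (box a b))%E) -> leb_scaling c S.
Proof.
move=> c0 mS hS; split => // A mA.
have mS' : S \in (mfun : {pred X -> X}) by rewrite inE.
pose S' : {mfun X >-> X} := mfun_Sub mS'.
apply: (@box_unique _ _ (pushforward leb S') (mscale (NngNum c0) leb)) => // a b.
by have /= h := hS a b; rewrite /= /pushforward h leb_boxE -EFinM ltry.
Qed.

Lemma measurable_affine (A : 'M[R]_N) (c : X) :
  measurable_fun setT (fun x : X => x *m A + c).
Proof.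
apply: measurable_fun_coordP => i.
under eq_fun do rewrite !mxE.
apply: measurable_funD => //; apply: measurable_sum => j.
by apply: measurable_funM => //; exact: measurable_coord.
Qed.

Lemma measurable_shift (z : X) : measurable_fun setT (fun x : X => x + z).
Proof. by have := measurable_affine 1%:M z; under eq_fun do rewrite mulmx1. Qed.

Lemma measurable_scale (c : R) : measurable_fun setT (fun x : X => c *: x).
Proof.
have := measurable_affine (c%:M) 0.
by under eq_fun do rewrite mul_mx_scalar addr0.
Qed.

Lemma leb_shift z : leb_scaling 1 (fun x : X => x + z).
Proof.
apply: leb_scaling_box => // [|a b]; first exact: measurable_shift.
rewrite mul1e (_ : _ @^-1` _ = box (a - z) (b - z)).
  by rewrite !leb_boxE; congr EFin; apply: eq_bigr => i _; rewrite !mxE; congr Num.max; ring.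
by apply/seteqP; split => x H i; have := H i; rewrite !mxE lerBlDr lerBrDr.
Qed.

Lemma leb_opp : leb_scaling 1 (fun x : X => - x).
Proof.
apply: leb_scaling_box => // [|a b].
  by have := measurable_scale (-1); under eq_fun do rewrite scaleN1r.
rewrite mul1e (_ : _ @^-1` _ = box (- b) (- a)).
  by rewrite !leb_boxE; congr EFin; apply: eq_bigr => i _; rewrite !mxE; congr Num.max; ring.
apply/seteqP; split => x H i; have := H i; rewrite !mxE lerNl lerNr andbC//.
Qed.

Lemma leb_dilation (c : R) : 0 < c -> leb_scaling ((c ^+ N)^-1) (fun x : X => c *: x).
Proof.
move=> c0; apply: leb_scaling_box => [||a b].
- by rewrite invr_ge0 exprn_ge0// ltW.
- exact: measurable_scale.
rewrite (_ : _ @^-1` _ = box (c^-1 *: a) (c^-1 *: b)).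
  rewrite !leb_boxE -EFinM; congr EFin.
  rewrite -exprVn -[X in _ ^+ X]card_ord -prodr_const -big_split/=.
  apply: eq_bigr => i _; rewrite !mxE -mulrBr [RHS]maxr_pMr ?mulr0//.
  by rewrite invr_ge0 ltW.
apply/seteqP; split => x H i; have := H i; rewrite !mxE.
  by rewrite ler_pdivrMl// ler_pdivlMl.
by rewrite ler_pdivrMl// ler_pdivlMl.
Qed.

Lemma leb_preim_lin (T : X -> X) A : leb_scaling 1 T -> measurable A ->
  leb (T @^-1` A) = leb A.
Proof. by move=> [_ hT] mA; rewrite hT// mul1e. Qed.

Lemma measurable_preim (S : X -> X) A : measurable_fun setT S -> measurable A ->
  measurable (S @^-1` A).
Proof. by move=> mS mA; rewrite -[X in measurable X]setTI; exact: mS. Qed.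

Lemma leb_indic A : measurable A -> leb A = (\int[leb]_x (\1_A x)%:E)%E.
Proof. by move=> mA; rewrite integral_indic// setIT. Qed.

(* Both sides are [\int\int 1_A x 1_B (x + T y)], integrated in the two orders. *)
Lemma leb_mul_comm (T : 'M[R]_N) A B : T \in unitmx -> measurable A -> measurable B ->
  (leb A * leb ((fun x => x *m T) @^-1` B) = leb B * leb ((fun x => x *m T) @^-1` A))%E.
Proof.
move=> uT mA mB.
have mT : measurable_fun setT (fun x : X => x *m T).
  by have := measurable_affine T 0; under eq_fun do rewrite addr0.
have mTA := measurable_preim mT mA; have mTB := measurable_preim mT mB.
have m1A : measurable_fun setT (\1_A : X -> R) by exact: measurable_indic.
have m1B : measurable_fun setT (\1_B : X -> R) by exact: measurable_indic.
pose F (p : X * X) : \bar R := ((\1_A p.1 : R) * \1_B (p.1 + p.2 *m T))%:E.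
have mS : measurable_fun setT (fun p : X * X => p.1 + p.2 *m T).
  apply: measurable_fun_coordP => i; under eq_fun do rewrite mxE.
  apply: measurable_funD.
    by apply: (measurableT_comp (measurable_coord i)); exact: measurable_fst.
  apply: (measurableT_comp (measurable_coord i)).
  by apply: (measurableT_comp mT); exact: measurable_snd.
have mF : measurable_fun setT F.
  apply/measurable_EFinP; apply: measurable_funM.
    by apply: (measurableT_comp m1A measurable_fst).
  by apply: (measurableT_comp m1B mS).
have F0 p : (0 <= F p)%E by rewrite lee_fin mulr_ge0.
have := fubini_tonelli (m1 := leb) (m2 := leb) F mF F0.
have -> : (\int[leb]_x \int[leb]_y F (x, y) =
          leb A * leb ((fun x => x *m T) @^-1` B))%E.
  transitivity (\int[leb]_x ((\1_A x)%:E * leb ((fun x => x *m T) @^-1` B)))%E.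
    apply: eq_integral => x _; rewrite /F /=.
    under eq_integral do rewrite EFinM.
    rewrite ge0_integralZl//; last first.
      apply/measurable_EFinP; apply: (measurableT_comp m1B).
      under eq_fun do rewrite addrC.
      by apply: measurable_affine.
    congr (_ * _)%E.
    rewrite -(leb_preim_lin (leb_shift (x *m invmx T)) mTB).
    rewrite leb_indic; last exact: measurable_preim (measurable_shift _) mTB.
    apply: eq_integral => y _; congr EFin; rewrite !indicE; congr ((nat_of_bool _)%:R).
    by apply/idP/idP; rewrite !inE /= mulmxDl mulmxKV// addrC.
  under eq_integral do rewrite muleC.
  by rewrite ge0_integralZl// -?leb_indic 1?muleC//; exact/measurable_EFinP.
have -> : (\int[leb]_y \int[leb]_x F (x, y) =
          leb B * leb ((fun x => x *m T) @^-1` A))%E; last by move->.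
transitivity (\int[leb]_y \int[leb]_x ((\1_A (x - y *m T) : R) * \1_B x)%:E)%E.
  apply: eq_integral => y _.
  pose f (x : X) : \bar R := ((\1_A (x - y *m T) : R) * \1_B x)%:E.
  have mf : measurable_fun setT f.
    apply/measurable_EFinP; apply: measurable_funM => //.
    by apply: (measurableT_comp m1A (measurable_shift _)).
  have f0 x : (0 <= f x)%E by rewrite lee_fin mulr_ge0.
  have := ge0_integral_scaling (c := NngNum ler01) (leb_shift (y *m T)) mf f0.
  rewrite /= mul1e => <-.
  by apply: eq_integral => x _; rewrite /F /f /= addrK.
pose G (p : X * X) : \bar R := ((\1_A (p.1 - p.2 *m T) : R) * \1_B p.1)%:E.
have mG : measurable_fun setT G.
  apply/measurable_EFinP; apply: measurable_funM; last first.
    exact: (measurableT_comp m1B measurable_fst).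
  apply: (measurableT_comp m1A).
  apply: measurable_fun_coordP => i; under eq_fun do rewrite !mxE.
  apply: measurable_funB.
    by apply: (measurableT_comp (measurable_coord i)); exact: measurable_fst.
  apply: measurable_sum => j; apply: measurable_funM => //.
  by apply: (measurableT_comp (measurable_coord j)); exact: measurable_snd.
have G0 p : (0 <= G p)%E by rewrite lee_fin mulr_ge0.
rewrite -(fubini_tonelli (m1 := leb) (m2 := leb) G mG G0).
transitivity (\int[leb]_x ((\1_B x)%:E * leb ((fun x => x *m T) @^-1` A)))%E.
  apply: eq_integral => x _; rewrite /G /=.
  under eq_integral do rewrite mulrC EFinM.
  have mA' : measurable ((fun y : X => x - y *m T) @^-1` A).
    apply: measurable_preim => //.
    have := measurable_affine (- T) x.
    by under eq_fun do rewrite mulmxN addrC.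
  rewrite ge0_integralZl//; last first.
    apply/measurable_EFinP; apply: (measurableT_comp m1A).
    have := measurable_affine (- T) x.
    by under eq_fun do rewrite mulmxN addrC.
  congr (_ * _)%E.
  rewrite -(leb_preim_lin leb_opp mTA).
  rewrite -(leb_preim_lin (leb_shift (- (x *m invmx T)))); last first.
    by apply: measurable_preim => //; have [] := leb_opp.
  rewrite leb_indic; last first.
    by apply: measurable_preim; [exact: measurable_shift|apply: measurable_preim => //; have [] := leb_opp].
  apply: eq_integral => y _; congr EFin; rewrite !indicE; congr ((nat_of_bool _)%:R).
  apply/idP/idP; rewrite !inE /=.
    by rewrite opprD opprK mulmxDl mulNmx mulmxKV// addrC.
  by rewrite opprD opprK mulmxDl mulNmx mulmxKV// addrC.
under eq_integral do rewrite muleC.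
by rewrite ge0_integralZl// -?leb_indic 1?muleC//; exact/measurable_EFinP.
Qed.

End change_of_variables.

(** * Integrals under maps that scale Lebesgue measure; rotations; open sets *)

Section scaling.
Context {R : realType} {N : nat}.
Local Notation X := 'rV[R]_N.
Local Notation leb := (lebesgue_rV R N).
Implicit Types (S : X -> X) (f g : X -> R) (A B : set X) (x y z : X).
Local Notation intg := (intg leb).
Local Notation L2 := (L2 leb).
Local Notation dot := (L2dot leb).

Lemma leb_scaling_comp (c e : R) S S' : leb_scaling c S -> leb_scaling e S' ->
  leb_scaling (c * e) (S' \o S).
Proof.
move=> [mS hS] [mS' hS']; split; first exact: measurableT_comp.
move=> A mA; rewrite comp_preimage hS; last exact: measurable_preim.
by rewrite hS'// muleA EFinM.
Qed.

Lemma scaling_ae (c : R) S (P : X -> Prop) : leb_scaling c S ->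
  {ae leb, forall x, P x} -> {ae leb, forall x, P (S x)}.
Proof.
move=> [mS hS] [Z [mZ Z0 PZ]]; exists (S @^-1` Z); split.
- exact: measurable_preim.
- by rewrite hS// Z0 mule0.
- by move=> x /= nP; exact: PZ.
Qed.

Lemma scaling_meas (c : R) S f : leb_scaling c S -> measurable_fun setT f ->
  measurable_fun setT (fun x => f (S x)).
Proof. by move=> [mS _] mf; exact: (measurableT_comp mf mS). Qed.

Lemma ge0_scaling (c : R) S (f : X -> \bar R) : 0 <= c ->
  leb_scaling c S -> measurable_fun setT f -> (forall x, 0 <= f x)%E ->
  (\int[leb]_x f (S x) = c%:E * \int[leb]_x f x)%E.
Proof. by move=> c0; exact: (ge0_integral_scaling (c := NngNum c0)). Qed.

Lemma scaling_intg (c : R) S f : 0 <= c -> leb_scaling c S -> intg f ->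
  intg (fun x => f (S x)).
Proof.
move=> c0 hS hf; have mf := intg_meas hf.
move: hf => /integrableP[_ hf]; apply/integrableP; split.
  by apply/measurable_EFinP; exact: scaling_meas hS mf.
rewrite (ge0_scaling (f := fun x => `|(f x)%:E|%E) c0 hS)//; last first.
  by apply: measurableT_comp => //; exact/measurable_EFinP.
by apply: lte_mul_pinfty.
Qed.

Lemma scaling_Rint (c : R) S f : 0 <= c -> leb_scaling c S -> intg f ->
  \int[leb]_x f (S x) = c * \int[leb]_x f x.
Proof.
move=> c0 hS hf; have mf := intg_meas hf.
have hfp : intg (f^\+) by have := integrable_funrpos measurableT hf.
have hfn : intg (f^\-) by have := integrable_funrneg measurableT hf.
have ge0E g : (forall x, 0 <= g x) -> intg g ->
    \int[leb]_x g (S x) = c * \int[leb]_x g x.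
  move=> g0 hg; apply: EFin_inj; rewrite EFinM !EFin_Rint//; last exact: scaling_intg hS hg.
  rewrite (ge0_scaling (f := fun x => (g x)%:E) c0 hS)//.
  by apply/measurable_EFinP; exact: intg_meas hg.
have fE x : f x = f^\+ x - f^\- x.
  by have := congr1 (fun h => h x) (esym (funrposBneg f)).
under eq_Rintegral do rewrite fE.
rewrite RintB; [|exact: scaling_intg hS _..].
under [in RHS]eq_Rintegral do rewrite fE.
rewrite RintB// mulrBr !ge0E//.
Qed.

Lemma scaling_L2 (c : R) S f : 0 <= c -> leb_scaling c S -> L2 f -> L2 (fun x => f (S x)).
Proof.
move=> c0 hS [mf hf]; split; first exact: scaling_meas hS mf.
exact: (scaling_intg (f := fun x => f x ^+ 2) c0 hS).
Qed.

Lemma scaling_dot (c : R) S f g : 0 <= c -> leb_scaling c S -> L2 f -> L2 g ->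
  dot (fun x => f (S x)) (fun x => g (S x)) = c * dot f g.
Proof.
move=> c0 hS Lf Lg.
exact: (scaling_Rint (f := fun x => f x * g x) c0 hS (L2_intgM Lf Lg)).
Qed.

Definition sqn (x : X) : R := \sum_i x ord0 i ^+ 2.

Lemma sqn_ge0 x : 0 <= sqn x.
Proof. by apply: sumr_ge0 => i _; exact: sqr_ge0. Qed.

Lemma sqnE x : sqn x = (x *m x^T) ord0 ord0.
Proof. by rewrite mxE; apply: eq_bigr => i _; rewrite mxE expr2. Qed.

Lemma euclid_normE x : euclid_norm x = Num.sqrt (sqn x). Proof. by []. Qed.

Lemma euclid_norm_ge0 x : 0 <= euclid_norm x.
Proof. exact: sqrtr_ge0. Qed.

Lemma sqr_euclid x : euclid_norm x ^+ 2 = sqn x.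
Proof. by rewrite sqr_sqrtr// sqn_ge0. Qed.

Lemma sqn_orth (T : 'M[R]_N) x : T *m T^T = 1%:M -> sqn (x *m T) = sqn x.
Proof. by move=> hT; rewrite !sqnE trmx_mul mulmxA -(mulmxA x) hT mulmx1. Qed.

Lemma coord_le_euclid x i : `|x ord0 i| <= euclid_norm x.
Proof.
rewrite -ler_sqr ?nnegrE ?euclid_norm_ge0// sqr_euclid real_normK ?num_real//.
by rewrite /sqn (bigD1 i)//= lerDl; apply: sumr_ge0 => j _; exact: sqr_ge0.
Qed.

Lemma measurable_sqn : measurable_fun setT sqn.
Proof.
apply: measurable_sum => i; apply: measurable_funX; exact: measurable_coord.
Qed.

Lemma measurable_euclid : measurable_fun setT (@euclid_norm R N).
Proof.
apply: (measurableT_comp _ measurable_sqn).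
by apply: continuous_measurable_fun; exact: sqrt_continuous.
Qed.

Definition eball (r : R) : set X := [set x | sqn x <= r ^+ 2].

Lemma measurable_eball r : measurable (eball r).
Proof.
rewrite (_ : eball r = sqn @^-1` `]-oo, r ^+ 2]%classic).
  rewrite -[X in measurable X]setTI; apply: measurable_sqn => //.
by apply/seteqP; split => x; rewrite /eball /= in_itv.
Qed.

Lemma cube_sub_eball r : 0 <= r -> cube (r / N%:R) `<=` eball r.
Proof.
move=> r0 x /cubeP H; rewrite /eball /=.
have [N0|N0] := posnP N.
  rewrite /sqn big1 ?sqr_ge0// => i _; suff : False by [].
  by case: i => i; rewrite N0.
apply: (@le_trans _ _ (\sum_(i < N) (r / N%:R) ^+ 2)).
  apply: ler_sum => i _; rewrite -[leLHS]real_normK ?num_real//.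
  by rewrite ler_sqr ?nnegrE ?divr_ge0.
rewrite sumr_const card_ord -[leLHS]mulr_natr expr_div_n -mulrA ler_piMr ?sqr_ge0//.
rewrite expr2 invfM -mulrA mulVf ?pnatr_eq0 -?lt0n// mulr1.
by rewrite invf_le1 ?ltr0n// ler1n.
Qed.

Lemma eball_sub_cube r : 0 <= r -> eball r `<=` cube r.
Proof.
move=> r0 x xr; apply/cubeP => i; apply: le_trans (coord_le_euclid x i) _.
by rewrite -ler_sqr ?nnegrE ?euclid_norm_ge0// sqr_euclid.
Qed.

Lemma leb_eball_gt0 r : 0 < r -> (0 < leb (eball r))%E.
Proof.
move=> r0; have [N0|N0] := posnP N.
  apply: (@lt_le_trans _ _ (leb (cube (r / N%:R)))); last first.
    apply: le_measure; rewrite ?inE; [exact: measurable_box|exact: measurable_eball|].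
    exact: cube_sub_eball (ltW r0).
  by rewrite leb_cube ?divr_ge0// ?ltW// lte_fin N0 expr0.
apply: (@lt_le_trans _ _ (leb (cube (r / N%:R)))); last first.
  apply: le_measure; rewrite ?inE; [exact: measurable_box|exact: measurable_eball|].
  exact: cube_sub_eball (ltW r0).
rewrite leb_cube; last by rewrite divr_ge0// ltW.
by rewrite lte_fin exprn_gt0// mulr_gt0// divr_gt0// ltr0n.
Qed.

Lemma leb_eball_lty r : 0 <= r -> (leb (eball r) < +oo)%E.
Proof.
move=> r0; apply: le_lt_trans (leb_box_lty (const_mx (- r)) (const_mx r)).
by apply: le_measure; rewrite ?inE; [exact: measurable_eball|exact: measurable_box|exact: eball_sub_cube].
Qed.

(** Apply [leb_mul_comm] to the unit ball, which [T] preserves and whose measure is positive and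
    finite; the two ball factors cancel. *)
Lemma leb_orth (T : 'M[R]_N) : T *m T^T = 1%:M -> leb_scaling 1 (fun x : X => x *m T).
Proof.
move=> hT; have uT : T \in unitmx by have [] := mulmx1_unit hT.
have mT : measurable_fun setT (fun x : X => x *m T).
  by have := measurable_affine T 0; under eq_fun do rewrite addr0.
split => // A mA; rewrite mul1e.
have b0 := leb_eball_gt0 ltr01; have boo := leb_eball_lty ler01.
have bE : (fun x : X => x *m T) @^-1` eball 1 = eball 1.
  by apply/seteqP; split => x; rewrite /eball /= sqn_orth.
have := leb_mul_comm uT mA (measurable_eball 1).
rewrite bE muleC => /esym.
have fb : leb (eball 1) \is a fin_num by rewrite ge0_fin_numE// ltW.
rewrite -(fineK fb) in b0 boo *; rewrite lte_fin in b0.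
move=> /(congr1 (fun t : \bar R => ((fine (leb (eball 1)))^-1)%:E * t)%E).
by rewrite !muleA -EFinM mulVf ?gt_eqF// !mul1e.
Qed.

Lemma leb_isometry (T : 'M[R]_N) (c : X) : T *m T^T = 1%:M ->
  leb_scaling 1 (fun x : X => x *m T + c).
Proof.
by move=> hT; have := leb_scaling_comp (leb_orth hT) (leb_shift c); rewrite mulr1.
Qed.

(** The sigma-algebra is generated by coordinates, so an open set is written as a countable union of
    cubes with rational centre and radius [1 / (n + 1)], enumerated by [unpickle]. *)
Lemma open_measurable_rV (U : set X) : open U -> measurable U.
Proof.
move=> oU.
pose Q (q : 'rV[rat]_N * nat) : set X :=
  box (\row_i (ratr (q.1 ord0 i) - q.2.+1%:R^-1)) (\row_i (ratr (q.1 ord0 i) + q.2.+1%:R^-1)).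
pose F k := if @unpickle ('rV[rat]_N * nat)%type k is Some q then
   if `[< Q q `<=` U >] then Q q else set0 else set0.
rewrite (_ : U = \bigcup_k F k).
  apply: bigcupT_measurable => k; rewrite /F; case: unpickle => // q.
  by case: asboolP => // _; exact: measurable_box.
apply/seteqP; split => [x Ux|x [k _]]; last first.
  rewrite /F; case: unpickle => // q; case: asboolP => // QU; exact: QU.
have : nbhs x U by exact: open_nbhs_nbhs.
move=> /nbhs_ballP[e /= e0 xU].
have e2 : 0 < e / 2 by rewrite divr_gt0.
have [n ne] : exists n, n.+1%:R^-1 < e / 2 :> R.
  have /cvgrPdist_lt/(_ _ e2)[k _ H] := @cvg_harmonic R.
  by exists k; have := H k (leqnn _); rewrite /= sub0r normrN ger0_norm// invr_ge0.
have n0 : (0 : R) < n.+1%:R^-1 by rewrite invr_gt0.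
have exq (i : 'I_N) : exists q : rat, `|ratr q - x ord0 i| < n.+1%:R^-1.
  have [|q] := @rat_in_itvoo R (x ord0 i - n.+1%:R^-1) (x ord0 i + n.+1%:R^-1).
    by move: n0; move: (n.+1%:R^-1) => a; lra.
  rewrite in_itv/= => hq; exists q; rewrite ltr_norml; move: hq.
  by move: (n.+1%:R^-1) => a; lra.
have [q hq] := choice exq.
exists (pickle ((\row_i q i), n)) => //; rewrite /F pickleK.
have xQ : Q (\row_i q i, n) x.
  by move=> i; rewrite !mxE /=; have := hq i; rewrite ltr_norml; move: (n.+1%:R^-1) => a; lra.
case: asboolP => //; case => y yQ; apply: xU.
rewrite /ball /= /mx_ball; split => // i j; rewrite !ord1 {i}.
have := xQ j; have := yQ j; rewrite !mxE /= /ball /= => h1 h2.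
rewrite ltr_norml; move: ne h1 h2; move: (n.+1%:R^-1) => a; lra.
Qed.

Lemma continuous_measurable_rV f : continuous f -> measurable_fun setT f.
Proof.
move=> cf; apply: (measurability _ (RGenOInfty.measurableE R)) => // _ [_ [t ->] <-].
rewrite setTI; apply: open_measurable_rV; exact: open_comp.
Qed.

End scaling.
(** * Smooth functions and test functions *)

Section directional.
Context {R : realType} {U : normedModType R}.
Implicit Types (f g : U -> R) (x v : U).

Lemma is_derive_addf f g x v df dg : is_derive x v f df -> is_derive x v g dg ->
  is_derive x v (fun y => f y + g y) (df + dg).
Proof. by move=> hf hg; exact: is_deriveD. Qed.

Lemma is_derive_mulf f g x v df dg : is_derive x v f df -> is_derive x v g dg ->
  is_derive x v (fun y => f y * g y) (df * g x + f x * dg).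
Proof.
move=> hf hg; have h := @is_deriveM _ _ f g x v df dg hf hg.
by apply: (is_derive_eq h); rewrite /GRing.scale/= addrC (mulrC (g x)).
Qed.

Lemma is_derive_cstf (c : R) x v : is_derive x v (fun=> c) 0.
Proof. exact: is_derive_cst. Qed.

Lemma is_derive_cmulf (c : R) f x v df : is_derive x v f df ->
  is_derive x v (fun y => c * f y) (c * df).
Proof.
move=> hf; have h := is_derive_mulf (is_derive_cstf c x v) hf.
by apply: (is_derive_eq h); rewrite mul0r add0r.
Qed.

Lemma is_derive_cvg f x v (df : R) :
  (fun h => h^-1 * (f (h *: v + x) - f x)) @ 0^' --> df -> is_derive x v f df.
Proof.
move=> H; split; first by apply/cvg_ex; exists df.
exact: cvg_lim H.
Qed.

Lemma cvg_is_derive f x v (df : R) : is_derive x v f df ->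
  (fun h => h^-1 * (f (h *: v + x) - f x)) @ 0^' --> df.
Proof. by move=> [h1 <-]; exact: h1. Qed.

Lemma is_derive_unique f x v (a b : R) : is_derive x v f a -> is_derive x v f b -> a = b.
Proof. by move=> [_ <-] [_ <-]. Qed.

End directional.

Section lines.
Context {R : realType}.

(** Existence and value of a derivative depend only on the increments; this transports derivatives
    between a function, its restriction to a line and its affine reparametrizations. *)
Lemma is_derive_quot (U1 U2 : normedModType R) (f : U1 -> R) (g : U2 -> R) x v y w df :
  (forall h : R, f (h *: v + x) - f x = g (h *: w + y) - g y) ->
  is_derive x v f df -> is_derive y w g df.
Proof.
move=> E [h1 h2].
have E' : (fun h : R => h^-1 *: (f (h *: v + x) - f x)) =
    (fun h => h^-1 *: (g (h *: w + y) - g y)) by apply/funext => h; rewrite E.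
split.
  by move: h1; rewrite /derivable /= E'.
by move: h2; rewrite /derive /= E'.
Qed.

Variable U : normedModType R.
Implicit Types (f g : U -> R) (x v : U).

Lemma is_derive_line_at f x v (t df : R) : is_derive (t *: v + x) v f df ->
  is_derive t (1 : R) (fun t : R => f (t *: v + x)) df.
Proof.
apply: is_derive_quot => h.
by rewrite addrA -scalerDl [h *: (1 : R)]mulr1.
Qed.

Lemma is_derive_of_line f x v (df : R) :
  is_derive (0 : R) (1 : R) (fun t : R => f (t *: v + x)) df -> is_derive x v f df.
Proof.
apply: is_derive_quot => h.
by rewrite addr0 [h *: (1 : R)]mulr1 scale0r add0r.
Qed.

Lemma is_derive_to_line f x v (df : R) : is_derive x v f df ->
  is_derive (0 : R) (1 : R) (fun t : R => f (t *: v + x)) df.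
Proof. by move=> hf; apply: is_derive_line_at; rewrite scale0r add0r. Qed.

Lemma is_derive_compf (h : R -> R) f x v (df dh : R) : is_derive x v f df ->
  is_derive (f x) (1 : R) h dh -> is_derive x v (fun y => h (f y)) (dh * df).
Proof.
move=> hf hh; apply: is_derive_of_line.
have hf' := is_derive_to_line hf.
have hh' : is_derive (f ((0 : R) *: v + x)) (1 : R) h dh by rewrite scale0r add0r.
exact: (@is_derive1_comp _ h (fun t : R => f (t *: v + x)) 0 dh df hh' hf').
Qed.

Lemma is_derive_invf f x v (df : R) : f x != 0 -> is_derive x v f df ->
  is_derive x v (fun y => (f y)^-1) (- df * ((f x)^-1 * (f x)^-1)).
Proof.
move=> fx0 [h1 h2]; split; first exact: derivableV.
by rewrite deriveV// h2 /GRing.scale/= expr2 invfM; ring.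
Qed.

Lemma is_derive_continuous1 (h : R -> R) (t dh : R) : is_derive t (1 : R) h dh ->
  {for t, continuous h}.
Proof.
by move=> [h1 _]; apply: differentiable_continuous; apply/derivable1_diffP.
Qed.

Lemma mean_value_ineq (h dh : R -> R) (s C : R) :
  (forall t, is_derive t (1 : R) h (dh t)) -> (forall t, `|t| <= `|s| -> `|dh t| <= C) ->
  `|h s - h 0| <= C * `|s|.
Proof.
move=> hd dC.
have hc (a b : R) : {within `[a, b], continuous h}.
  by apply: continuous_subspaceT => t; exact: is_derive_continuous1 (hd t).
have [s0|s0] := leP 0 s.
  have [c cs ->] := MVT_segment s0 (fun t _ => hd t) (hc _ _).
  rewrite subr0 normrM ler_wpM2r//; apply: dC.
  by move: cs; rewrite in_itv/= => /andP[h1 h2]; rewrite !ger0_norm.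
have [c cs /eqP] := MVT_segment (ltW s0) (fun t _ => hd t) (hc _ _).
rewrite sub0r -eqr_opp opprB => /eqP ->.
rewrite -mulrN opprK normrM ler_wpM2r//; apply: dC.
by move: cs; rewrite in_itv/= => /andP[h1 h2]; rewrite !ler0_norm ?lerN2// ltW.
Qed.

End lines.

(* [Ck e n f]: all iterated derivatives of [f] of order at most [n] along the
   directions [e i] exist and are continuous. *)
Section Ck.
Context {R : realType} {U : normedModType R} {I : finType}.
Variable e : I -> U.
Implicit Types (f g : U -> R) (x v : U).

Fixpoint Ck (n : nat) f : Prop := continuous f /\
  if n is m.+1 then
    forall i, exists g, (forall x, is_derive x (e i) f (g x)) /\ Ck m g
  else True.

Lemma Ck_cont n f : Ck n f -> continuous f.
Proof. by case: n => [|n] []. Qed.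

Lemma CkS n f : Ck n.+1 f -> Ck n f.
Proof.
elim: n f => [|n IH] f; first by case.
move=> [cf hf]; split => // i; have [g [fg Cg]] := hf i.
by exists g; split => //; exact: IH.
Qed.

Lemma Ck_cst n (c : R) : Ck n (fun=> c).
Proof.
elim: n c => [|n IH] c; split => //; try exact: cst_continuous.
by move=> i; exists (fun=> 0); split => // x; exact: is_derive_cstf.
Qed.

Lemma CkD n f g : Ck n f -> Ck n g -> Ck n (fun x => f x + g x).
Proof.
elim: n f g => [|n IH] f g [cf hf] [cg hg].
  by split => // x; apply: cvgD; [exact: cf|exact: cg].
split; first by move=> x; apply: cvgD; [exact: cf|exact: cg].
move=> i; have [f' [df Cf]] := hf i; have [g' [dg Cg]] := hg i.
exists (fun x => f' x + g' x); split; last exact: IH.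
by move=> x; exact: is_derive_addf.
Qed.

Lemma CkM n f g : Ck n f -> Ck n g -> Ck n (fun x => f x * g x).
Proof.
elim: n f g => [|n IH] f g Hf Hg.
  have [[cf _] [cg _]] := (Hf, Hg).
  by split => // x; apply: cvgM; [exact: cf|exact: cg].
have [[cf hf] [cg hg]] := (Hf, Hg).
split; first by move=> x; apply: cvgM; [exact: cf|exact: cg].
move=> i; have [f' [df Cf]] := hf i; have [g' [dg Cg]] := hg i.
exists (fun x => f' x * g x + f x * g' x); split.
  by move=> x; exact: is_derive_mulf.
by apply: CkD; apply: IH => //; exact: CkS.
Qed.

Lemma Ck_sum n (J : Type) (s : seq J) (F : J -> U -> R) :
  (forall j, Ck n (F j)) -> Ck n (fun x => \sum_(j <- s) F j x).
Proof.
move=> HF; elim: s => [|j s IH].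
  by under eq_fun do rewrite big_nil; exact: Ck_cst.
by under eq_fun do rewrite big_cons; exact: CkD.
Qed.

Lemma Ck_prod n (J : Type) (s : seq J) (F : J -> U -> R) :
  (forall j, Ck n (F j)) -> Ck n (fun x => \prod_(j <- s) F j x).
Proof.
move=> HF; elim: s => [|j s IH].
  by under eq_fun do rewrite big_nil; exact: Ck_cst.
by under eq_fun do rewrite big_cons; exact: CkM.
Qed.

Lemma CkZ n c f : Ck n f -> Ck n (fun x => c * f x).
Proof. by move=> Cf; apply: CkM => //; exact: Ck_cst. Qed.

Lemma Ck_inv n f : (forall x, f x != 0) -> Ck n f -> Ck n (fun x => (f x)^-1).
Proof.
move=> f0; have cV g : continuous g -> (forall x, g x != 0) -> continuous (fun x => (g x)^-1).
  by move=> cg g0 x; apply: cvgV => //; exact: cg.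
elim: n f f0 => [|n IH] f f0 Hf.
  by split => //; apply: cV => //; case: Hf.
have [cf hf] := Hf; split; first exact: cV.
move=> i; have [f' [df Cf]] := hf i.
exists (fun x => - f' x * ((f x)^-1 * (f x)^-1)); split.
  by move=> x; exact: is_derive_invf.
apply: CkM; first by under eq_fun do rewrite -mulN1r; exact: CkZ.
by apply: CkM; apply: IH => //; exact: CkS.
Qed.

End Ck.

Definition Dk {R : realType} := @Ck R R unit (fun=> 1).

Lemma Ck_comp {R : realType} {U : normedModType R} {I : finType} (e : I -> U) n
  (h : R -> R) (f : U -> R) : Dk n h -> Ck e n f -> Ck e n (fun x => h (f x)).
Proof.
elim: n h f => [|n IH] h f Hh Hf.
  have [[ch _] [cf _]] := (Hh, Hf).
  by split => // x; apply: continuous_comp; [exact: cf|exact: ch].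
have [[ch hh] [cf hf]] := (Hh, Hf).
split; first by move=> x; apply: continuous_comp; [exact: cf|exact: ch].
move=> i; have [f' [df Cf]] := hf i; have [h' [dh Ch]] := hh tt.
exists (fun x => h' (f x) * f' x); split.
  by move=> x; exact: is_derive_compf.
by apply: CkM => //; apply: IH => //; exact: CkS.
Qed.
Section smooth_rV.
Context {R : realType} {N : nat}.
Local Notation X := 'rV[R]_N.
Implicit Types (f g phi : X -> R) (x y z v : X).
Local Notation e i := (delta_mx ord0 i : X).

Definition CkX := @Ck R X 'I_N (fun i => e i).

Lemma smooth_partial i phi : smooth phi -> smooth (partial i phi).
Proof.
move=> sphi s; have := sphi (rcons s i).
by rewrite /iter_partial foldr_rcons.
Qed.

Lemma smooth_is_derive i phi x : smooth phi -> is_derive x (e i) phi (partial i phi x).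
Proof. by move=> sphi; apply/derivableP; have [_] := sphi [::]; exact. Qed.

Lemma partial_is_derive i f g : (forall x, is_derive x (e i) f (g x)) -> partial i f = g.
Proof. by move=> h; apply/funext => x; case: (h x). Qed.

(** [Ck] is closed under sums, products and compositions by induction on the order, whereas [smooth]
    speaks of concrete iterated partials. *)
Lemma smoothP phi : smooth phi <-> forall n, CkX n phi.
Proof.
split.
  move=> sphi n; elim: n phi sphi => [|n IH] phi sphi; have [cphi _] := sphi [::]; split => //.
  move=> i; exists (partial i phi); split; first by move=> x; exact: smooth_is_derive.
  by apply: IH; exact: smooth_partial.
move=> H s; have : CkX (size s).+1 phi by [].
(* [iter_partial] folds from the right, so the last index of [s] is the derivative taken first. *)
elim/last_ind: s phi {H} => [|s i IH] phi.
  move=> [cphi H]; split => // i x; have [g [h _]] := H i.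
  by have [] := h x.
rewrite size_rcons => -[_ /(_ i)[g [h Cg]]].
rewrite /iter_partial foldr_rcons (partial_is_derive h).
exact: IH.
Qed.

(** The step [h (v + c e_i)] is split into one along [h v], then one along [h c e_i]; the second is
    handled by the mean value inequality, the partial derivative being continuous at [x]. Adding
    coordinates one by one gives all directional derivatives. *)
Lemma is_derive_add_dir f g x v (df c : R) i : is_derive x v f df ->
  (forall y, is_derive y (e i) f (g y)) -> {for x, continuous g} ->
  is_derive x (v + c *: e i) f (df + c * g x).
Proof.
move=> /cvg_is_derive Hv Hi cg; apply: is_derive_cvg.
have E h : h^-1 * (f (h *: (v + c *: e i) + x) - f x) =
   h^-1 * (f (h *: v + x) - f x) + h^-1 * (f ((h * c) *: e i + (h *: v + x)) - f (h *: v + x)).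
  by rewrite scalerDr scalerA (addrC (h *: v)) -addrA; ring.
under eq_fun do rewrite E.
apply: cvgD => //; apply/cvgrPdist_le => eps eps0.
pose eta := eps / (`|c| + 1).
have c1 : 0 < `|c| + 1 by rewrite ltr_wpDl.
have eta0 : 0 < eta by rewrite divr_gt0.
move: cg => /cvgrPdist_lt/(_ _ eta0)/nbhs_ballP[del /= del0 Hdel].
(* For [|h| M < del] the whole segment from [x + h v] along [h c e_i] stays in the ball where the
   partial derivative is within [eta] of its value at [x]. *)
pose M := `|c| * `|e i| + `|v| + 1.
have M0 : 0 < M by rewrite ltr_wpDl// addr_ge0// mulr_ge0.
have d0 : 0 < del / M by rewrite divr_gt0.
apply/nbhs_ballP; exists (del / M) => //= h.
rewrite /ball /= sub0r normrN ltr_pdivlMr// => hM h0.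
have mv := @mean_value_ineq R (fun t => f (t *: e i + (h *: v + x)) - t * g x)
  (fun t => g (t *: e i + (h *: v + x)) - g x) (h * c) eta.
have {}mv : `|f ((h * c) *: e i + (h *: v + x)) - (h * c) * g x - f (h *: v + x)| <= eta * `|h * c|.
  apply: le_trans (mv _ _); first by rewrite scale0r add0r mul0r subr0.
    move=> t; apply: is_derive_addf; first exact: is_derive_line_at.
    under eq_fun do rewrite mulrC -mulNr.
    by apply: (is_derive_eq (is_derive_cmulf (- g x) (is_derive_id t (1 : R)))); rewrite mulr1.
  move=> t th; rewrite distrC; apply/ltW/Hdel.
  rewrite -ball_normE /ball_/= -normrN opprB addrA addrK.
  apply: le_lt_trans (ler_normD _ _) _; apply: le_lt_trans hM.
  rewrite !normrZ; have := ler_wpM2r (normr_ge0 (e i)) th; rewrite normrM.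
  have := normr_ge0 h; have := normr_ge0 v; rewrite /M; nra.
rewrite (_ : c * g x - _ = - (h^-1 * (f ((h * c) *: e i + (h *: v + x)) - (h * c) * g x - f (h *: v + x)))); last by field.
rewrite normrN normrM normfV mulrC ler_pdivrMr ?normr_gt0//.
apply: le_trans mv _; rewrite normrM mulrCA [leRHS]mulrC ler_wpM2l//.
rewrite /eta mulrAC ler_pdivrMr// ler_wpM2l ?ltW//; lra.
Qed.

Lemma is_derive_dir f (G : 'I_N -> X -> R) x v :
  (forall i y, is_derive y (e i) f (G i y)) -> (forall i, continuous (G i)) ->
  is_derive x v f (\sum_i v ord0 i * G i x).
Proof.
move=> HG cG.
rewrite [X in is_derive _ X](_ : v = \sum_i v ord0 i *: e i); last first.
  by rewrite [v in LHS]row_sum_delta.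
elim: (index_enum _) => [|i s IH]; first by rewrite !big_nil; exact: is_derive0.
rewrite !big_cons addrC [X in is_derive _ _ _ X]addrC.
by apply: is_derive_add_dir => //; exact: cG.
Qed.

Lemma continuous_rV (T : topologicalType) (S : T -> X) :
  (forall i, continuous (fun t => S t ord0 i)) -> continuous S.
Proof.
move=> cS t; apply/cvgrPdist_lt => eps eps0.
have : \forall t' \near t, forall i : 'I_N, `|S t ord0 i - S t' ord0 i| < eps.
  apply: filter_forall => i.
  by have /cvgrPdist_lt/(_ _ eps0) := cS i t.
apply: filterS => t' H.
rewrite [`|_|]mx_normrE; apply/bigmax_ltP; split => // -[i j] _ /=.
by rewrite !mxE ord1; exact: H.
Qed.

Lemma Ck_coord n i : CkX n (fun x => x ord0 i).
Proof.
case: n => [|n]; split => //; try exact: coord_continuous.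
move=> j; exists (fun=> (j == i)%:R); split; last exact: Ck_cst.
move=> x; apply: is_derive_cvg.
apply: cvg_near_cst; near=> h.
have h0 : h != 0 by near: h; exact: nbhs_dnbhs_neq.
by rewrite !mxE addrK mulKf// eqxx eq_sym.
Unshelve. all: by end_near. Qed.

Lemma continuous_affine (A : 'M[R]_N) (c : X) : continuous (fun x : X => x *m A + c).
Proof.
apply: continuous_rV => i; under eq_fun do rewrite !mxE.
apply: (@Ck_cont _ _ _ (fun i => e i) 0%N); apply: CkD; last exact: Ck_cst.
apply: Ck_sum => j.
by apply: (CkM (f := fun x : X => x ord0 j) (g := fun=> A j i)); [exact: (Ck_coord 0)|exact: Ck_cst].
Qed.

Lemma Ck_affine n (A : 'M[R]_N) (c : X) f : CkX n f -> CkX n (fun x => f (x *m A + c)).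
Proof.
elim: n f => [|n IH] f Hf; have [cf hf] := Hf.
  split => // x; apply: continuous_comp; [exact: continuous_affine|exact: cf].
split; first by move=> x; apply: continuous_comp; [exact: continuous_affine|exact: cf].
have [G HG] := choice hf.
move=> i; exists (fun x => \sum_j A i j * G j (x *m A + c)); split.
  move=> x.
  have := @is_derive_dir f G (x *m A + c) (row i A) (fun j => (HG j).1) (fun j => Ck_cont (HG j).2).
  under eq_bigr do rewrite mxE.
  apply: is_derive_quot => h; congr (f _ - _).
  by rewrite mulmxDl -scalemxAl -rowE addrA.
by apply: Ck_sum => j; apply: CkZ; apply: IH; exact: (HG j).2.
Qed.

Lemma smoothD f g : smooth f -> smooth g -> smooth (fun x => f x + g x).
Proof. by move=> /smoothP Hf /smoothP Hg; apply/smoothP => n; exact: (CkD (Hf n) (Hg n)). Qed.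

Lemma smoothM f g : smooth f -> smooth g -> smooth (fun x => f x * g x).
Proof. by move=> /smoothP Hf /smoothP Hg; apply/smoothP => n; exact: (CkM (Hf n) (Hg n)). Qed.

Lemma smooth_affine (A : 'M[R]_N) (c : X) f : smooth f -> smooth (fun x => f (x *m A + c)).
Proof. by move=> /smoothP Hf; apply/smoothP => n; exact: (Ck_affine A c (Hf n)). Qed.

Lemma smooth_cst (c : R) : smooth (fun _ : X => c).
Proof. by apply/smoothP => n; exact: Ck_cst. Qed.

Lemma partial_affine (A : 'M[R]_N) (c : X) f i x : smooth f ->
  partial i (fun x => f (x *m A + c)) x = \sum_j A i j * partial j f (x *m A + c).
Proof.
move=> sf; have := @is_derive_dir f (fun j => partial j f) (x *m A + c) (row i A)
  (fun j y => smooth_is_derive j y sf) (fun j => (smooth_partial j sf [::]).1).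
under eq_bigr do rewrite mxE.
move=> h; have [_ <-] : is_derive x (e i) (fun x => f (x *m A + c))
   (\sum_j A i j * partial j f (x *m A + c)); last by [].
apply: is_derive_quot h => h; congr (f _ - _).
by rewrite mulmxDl -scalemxAl -rowE addrA.
Qed.

Lemma partialM i f g x : smooth f -> smooth g ->
  partial i (fun x => f x * g x) x = partial i f x * g x + f x * partial i g x.
Proof.
move=> sf sg; have [_ <-] := is_derive_mulf (smooth_is_derive i x sf) (smooth_is_derive i x sg).
by [].
Qed.

Lemma smooth_comp (h : R -> R) f : (forall n, Dk n h) -> smooth f -> smooth (fun x => h (f x)).
Proof. by move=> Hh /smoothP Hf; apply/smoothP => n; exact: (Ck_comp (Hh n) (Hf n)). Qed.

Lemma partial_comp i (h dh : R -> R) f x : (forall t, is_derive t (1 : R) h (dh t)) ->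
  smooth f -> partial i (fun x => h (f x)) x = dh (f x) * partial i f x.
Proof.
move=> hd sf; have [_ <-] := is_derive_compf (smooth_is_derive i x sf) (hd (f x)).
by [].
Qed.

Lemma smooth_coord i : smooth (fun x : X => x ord0 i).
Proof. by apply/smoothP => n; exact: Ck_coord. Qed.

Lemma smooth_sqn : smooth (@sqn R N).
Proof.
apply/smoothP => n; apply: (@Ck_sum _ _ _ _ n _ _ (fun i (x : X) => x ord0 i ^+ 2)) => i.
rewrite (_ : (fun x : X => _) = (fun x : X => x ord0 i * x ord0 i)); last first.
  by apply/funext => x; rewrite expr2.
exact: (CkM (Ck_coord n i) (Ck_coord n i)).
Qed.

Lemma partial_coord i j x : partial i (fun x : X => x ord0 j) x = (i == j)%:R.
Proof.
suff [_ h] : is_derive x (e i) (fun x : X => x ord0 j) ((i == j)%:R : R) by exact: h.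
apply: is_derive_cvg; apply: cvg_near_cst; near=> h.
have h0 : h != 0 by near: h; exact: nbhs_dnbhs_neq.
by rewrite !mxE addrK mulKf// eqxx eq_sym.
Unshelve. all: by end_near. Qed.

End smooth_rV.

(** * The bump function exp(-1/s) *)

Section bump.
Context {R : realType}.
Implicit Types (P Q : {poly R}) (s t u : R).

(** Coefficientwise, from [u ^ i <= i! exp u]. *)
Lemma poly_le_expR Q : exists2 C, 0 <= C & forall u, 0 <= u -> `|Q.[u]| <= C * expR u.
Proof.
exists (\sum_(i < size Q) `|Q`_i| * (i`!)%:R).
  by apply: sumr_ge0 => i _; rewrite mulr_ge0.
move=> u u0; rewrite horner_coef mulr_suml.
apply: le_trans (ler_norm_sum _ _ _) _; apply: ler_sum => i _.
rewrite normrM -mulrA ler_wpM2l// ger0_norm ?exprn_ge0//.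
case: (nat_of_ord i) => [|n]; first by rewrite expr0 mul1r -expR0 ler_expR.
have := expR_ge1Dxn n u0; rewrite -ler_pdivrMl ?ltr0n ?fact_gt0// => h.
by apply: le_trans h; rewrite mulrC lerDr.
Qed.

(** The functions [P(1/s) exp(-1/s)], extended by zero, are closed under differentiation: [P]
    becomes [X^2 (P - P')]. Hence they are smooth across [0]. *)
Definition bumpP P s : R := if 0 < s then P.[s^-1] * expR (- s^-1) else 0.

Lemma is_derive_bumpP P s :
  is_derive s (1 : R) (bumpP P) (bumpP ('X^2 * (P - P^`())) s).
Proof.
have [s0|s0|s0] := ltgtP s 0.
- rewrite {2}/bumpP ltNge ltW//=.
  refine (near_eq_is_derive _ (is_derive_cstf 0 s 1)).
  near=> t; rewrite /bumpP ltNge ltW//; near: t; exact: lt_nbhsl.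
- have sn0 : s != 0 by rewrite gt_eqF.
  have hi := is_derive_invf sn0 (is_derive_id s (1 : R)).
  have hN : is_derive s (1 : R) (fun t => - t^-1) (-1 * (- 1 * (s^-1 * s^-1))).
    by under eq_fun do rewrite -mulN1r; exact: is_derive_cmulf.
  have h1 := is_derive_compf hi (is_derive_poly P s^-1).
  have h2 := is_derive_compf hN (is_derive_expR (- s^-1)).
  suff h3 : is_derive s (1 : R) (fun t => P.[t^-1] * expR (- t^-1)) (bumpP ('X^2 * (P - P^`())) s).
    refine (near_eq_is_derive _ h3).
    by near=> t; rewrite /bumpP; suff -> : 0 < t by []; near: t; exact: lt_nbhsr.
  apply: (is_derive_eq (is_derive_mulf h1 h2)).
  by rewrite /bumpP s0 !hornerE /=; ring.
- rewrite {2}/bumpP s0 ltxx.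
  (* At [0] the quotient [h^-1 P(1/h) exp(-1/h)] is [h] times [h^-2 P(1/h) exp(-1/h)]; the factor
     [X^2] supplies the [h^-2], so the quotient is [O(h)]. *)
  have [C C0 HC] := poly_le_expR ('X^2 * P).
  apply: is_derive_cvg; apply/cvgrPdist_le => eps eps0.
  have C1 : 0 < C + 1 by rewrite ltr_wpDl.
  apply/nbhs_ballP; exists (eps / (C + 1)); first by rewrite /= divr_gt0.
  move=> h; rewrite /ball /= sub0r normrN => hlt h0.
  rewrite sub0r normrN /bumpP ltxx subr0 addr0 [h *: _]mulr1.
  case: ifPn => [hp|_]; last by rewrite mulr0 normr0 ltW.
  have hi : 0 <= h^-1 by rewrite invr_ge0 ltW.
  have := HC _ hi; rewrite !hornerE => H.
  rewrite !normrM (ger0_norm hi) (ger0_norm (expR_ge0 _)).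
  rewrite normrM (ger0_norm (sqr_ge0 _)) in H.
  have E : h^-1 * (`|P.[h^-1]| * expR (- h^-1)) =
     h * ((h^-1 ^+ 2 * `|P.[h^-1]|) * expR (- h^-1)) by field.
  rewrite -mulrA E; apply: (@le_trans _ _ (h * C)).
    apply: ler_wpM2l; first exact: ltW.
    by rewrite expRN ler_pdivrMr ?expR_gt0.
  move: hlt; rewrite gtr0_norm// ltr_pdivlMr//; nra.
Unshelve. all: by end_near. Qed.

Lemma Dk_bumpP n P : Dk n (bumpP P).
Proof.
elim: n P => [|n IH] P; split => //;
  try by move=> s; exact: is_derive_continuous1 (is_derive_bumpP P s).
by move=> _; exists (bumpP ('X^2 * (P - P^`()))); split => // s; exact: is_derive_bumpP.
Qed.

Definition bump s : R := if 0 < s then expR (- s^-1) else 0.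

Lemma bumpE : bump = bumpP 1.
Proof. by apply/funext => s; rewrite /bump /bumpP hornerE mul1r. Qed.

Lemma Dk_bump n : Dk n bump. Proof. by rewrite bumpE; exact: Dk_bumpP. Qed.

Lemma bump_ge0 s : 0 <= bump s.
Proof. by rewrite /bump; case: ifP => // _; exact: expR_ge0. Qed.

Lemma bump_le1 s : bump s <= 1.
Proof.
rewrite /bump; case: ifPn => // s0.
by rewrite -expR0 ler_expR oppr_le0 invr_ge0 ltW.
Qed.

Lemma bump_gt0 s : 0 < s -> 0 < bump s.
Proof. by rewrite /bump => ->; exact: expR_gt0. Qed.

Lemma bump_eq0 s : s <= 0 -> bump s = 0.
Proof. by rewrite /bump ltNge => ->. Qed.

Lemma bump_near1 s (e : R) : 0 < e -> e^-1 <= s -> 1 - e <= bump s.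
Proof.
move=> e0 es; have s0 : 0 < s by apply: lt_le_trans es; rewrite invr_gt0.
rewrite /bump s0; apply: le_trans (expR_ge1Dx _); rewrite lerD2l lerN2.
by rewrite -[leRHS]invrK lef_pV2 ?posrE// invr_gt0.
Qed.

End bump.

Section test_functions.
Context {R : realType} {N : nat}.
Local Notation X := 'rV[R]_N.
Local Notation leb := (lebesgue_rV R N).
Local Notation L2 := (L2 leb).
Implicit Types (f g phi : X -> R) (x y z v : X).

Lemma compact_cube (r : R) : compact (cube r : set X).
Proof.
have := @rV_compact R N (fun=> `[-r, r]%classic) (fun=> @segment_compact _ _ _).
rewrite (_ : mkset _ = cube r)//.
by apply/seteqP; split => x H i; have := H i; rewrite /= in_itv/= !mxE.
Qed.

Lemma testP phi : test_function phi <->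
  smooth phi /\ exists r, forall x, ~ cube r x -> phi x = 0.
Proof.
split=> -[sphi]; last first.
  by move=> [r Hr]; split => //; exists (cube r) => //; exact: compact_cube.
move=> [K cK HK]; split => //.
have [M [_ HM]] := compact_bounded cK.
exists (M + 1) => x nx; apply: HK => Kx; apply: nx; apply/cubeP => i.
have := HM (M + 1); rewrite ltrDl ltr01 => /(_ isT x Kx).
apply: le_trans; rewrite [`|x|]mx_normrE.
by apply: (le_bigmax _ (fun i : 'I_1 * 'I_N => `|x i.1 i.2|) (ord0, i)).
Qed.

Lemma test_smooth phi : test_function phi -> smooth phi. Proof. by case. Qed.

Lemma test_partial i phi : test_function phi -> test_function (partial i phi).
Proof.
move=> /testP[sphi [r Hr]]; apply/testP; split; first exact: smooth_partial.
exists r => x nx.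
suff [_ h] : is_derive x (delta_mx ord0 i : X) phi (0 : R) by exact: h.
refine (near_eq_is_derive _ (is_derive_cstf 0 x (delta_mx ord0 i : X))).
have : open (~` (cube r : set X)).
  by apply: closed_openC; apply: compact_closed; [exact: norm_hausdorff|exact: compact_cube].
move=> oC; have := open_nbhs_nbhs (conj oC nx : open_nbhs x (~` (cube r : set X))).
by apply: filterS => y /Hr ->.
Qed.

Lemma testM phi f : test_function phi -> smooth f -> test_function (fun x => f x * phi x).
Proof.
move=> /testP[sphi [r Hr]] sf; apply/testP; split; first exact: smoothM.
by exists r => x /Hr ->; rewrite mulr0.
Qed.

Lemma testD phi f : test_function phi -> test_function f -> test_function (fun x => f x + phi x).
Proof.
move=> /testP[sphi [r Hr]] /testP[sf [s Hs]]; apply/testP; split; first exact: smoothD.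
exists (Num.max r s) => x nx; rewrite Hr ?Hs ?addr0// => H; apply: nx.
  by apply/cubeP => i; rewrite le_max; move/cubeP : H => ->; rewrite orbT.
by apply/cubeP => i; rewrite le_max; move/cubeP : H => ->.
Qed.

Lemma testZ (c : R) phi : test_function phi -> test_function (fun x => c * phi x).
Proof. by move=> tphi; apply: testM => //; exact: smooth_cst. Qed.

Lemma test0 : test_function (fun _ : X => 0 : R).
Proof. by apply/testP; split; [exact: smooth_cst|exists 0]. Qed.

Lemma test_sum (I : Type) (s : seq I) (F : I -> X -> R) :
  (forall i, test_function (F i)) -> test_function (fun x => \sum_(i <- s) F i x).
Proof.
move=> HF; elim: s => [|i s IH].
  by under eq_fun do rewrite big_nil; exact: test0.
by under eq_fun do rewrite big_cons; apply: testD.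
Qed.

Lemma test_affine (A B : 'M[R]_N) (c : X) phi : A *m B = 1%:M -> test_function phi ->
  test_function (fun x => phi (x *m A + c)).
Proof.
move=> AB /testP[sphi [r Hr]]; apply/testP; split; first exact: smooth_affine.
have : compact ((fun y => y *m B + (- c *m B)) @` (cube r : set X)).
  apply: continuous_compact; last exact: compact_cube.
  by apply: continuous_subspaceT; exact: continuous_affine.
move=> /compact_bounded[M [_ HM]].
exists (M + 1) => x nx; apply: Hr => Kx; apply: nx; apply/cubeP => i.
have := HM (M + 1); rewrite ltrDl ltr01 => /(_ isT x); rewrite /mkset.
have H : ((fun y => y *m B + (- c *m B)) @` (cube r : set X)) x.
  exists (x *m A + c) => //.
  by rewrite mulmxDl -mulmxA AB mulmx1 mulNmx addrK.
move=> /(_ H); apply: le_trans; rewrite [`|x|]mx_normrE.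
by apply: (le_bigmax _ (fun i : 'I_1 * 'I_N => `|x i.1 i.2|) (ord0, i)).
Qed.

Lemma test_shift (z : X) phi : test_function phi -> test_function (fun x => phi (x + z)).
Proof.
move=> /(test_affine z (mulmx1 1%:M)).
by under eq_fun do rewrite mulmx1.
Qed.

Lemma test_cont phi : test_function phi -> continuous phi.
Proof. by move=> [sphi _]; have [] := sphi [::]. Qed.

Lemma test_meas phi : test_function phi -> measurable_fun setT phi.
Proof. by move=> tphi; apply: continuous_measurable_rV; exact: test_cont. Qed.

Lemma test_bounded phi : test_function phi -> exists2 C, 0 <= C & forall x, `|phi x| <= C.
Proof.
move=> tphi; have /testP[sphi [r Hr]] := tphi.
have : compact (phi @` (cube r : set X)).
  apply: continuous_compact; last exact: compact_cube.
  by apply: continuous_subspaceT; exact: test_cont.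
move=> /compact_bounded[M [_ HM]].
exists (`|M| + 1) => [|x]; first by rewrite addr_ge0.
have [cx|/Hr ->] := pselect (cube r x); last by rewrite normr0 addr_ge0.
apply: (HM (`|M| + 1)); last by exists x.
by have := ler_norm M; lra.
Qed.

Lemma intg_indic (A : set X) : measurable A -> (leb A < +oo)%E -> intg leb (\1_A).
Proof.
move=> mA Aoo; apply: intg_lty; [exact: measurable_indic|by []|].
by rewrite -leb_indic.
Qed.

Lemma L2_indic (A : set X) : measurable A -> (leb A < +oo)%E -> L2 (\1_A).
Proof.
move=> mA Aoo; split; first exact: measurable_indic.
rewrite (_ : (fun x => _) = \1_A); first exact: intg_indic.
by apply/funext => x; rewrite indicE; case: (_ \in _); rewrite ?expr1n ?expr0n.
Qed.

Lemma test_L2 phi : test_function phi -> L2 phi.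
Proof.
move=> tphi; have [C C0 HC] := test_bounded tphi.
have /testP[sphi [r Hr]] := tphi.
apply: (L2_dom (g := fun x => C * \1_(cube r) x)); first exact: test_meas.
  move=> x; rewrite normrM (ger0_norm C0) indicE.
  have [cx|nx] := pselect (cube r x); first by rewrite mem_set// normr1 mulr1.
  by rewrite Hr// normr0 mulr_ge0.
by apply: L2Z; apply: L2_indic; [exact: measurable_box|exact: leb_box_lty].
Qed.

Definition dpartial v phi : X -> R := fun x => \sum_i v ord0 i * partial i phi x.

Lemma test_dpartial v phi : test_function phi -> test_function (dpartial v phi).
Proof. by move=> tphi; apply: test_sum => i; apply: testZ; exact: test_partial. Qed.

Lemma is_derive_dpartial v phi x : smooth phi -> is_derive x v phi (dpartial v phi x).
Proof.
move=> sphi.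
exact: (@is_derive_dir R N phi (fun i => partial i phi) x v
  (fun i y => smooth_is_derive i y sphi) (fun i => (smooth_partial i sphi [::]).1)).
Qed.

Lemma test_lipschitz phi : test_function phi ->
  exists2 L, 0 <= L & forall x v, `|phi (x + v) - phi x| <= L * `|v|.
Proof.
move=> tphi; have [C HC] := choice (fun i => (let: ex_intro2 C C0 H := test_bounded (test_partial i tphi) in ex_intro (fun C => 0 <= C /\ forall x, `|partial i phi x| <= C) C (conj C0 H))).
exists (\sum_i C i); first by apply: sumr_ge0 => i _; case: (HC i).
move=> x v.
have hd (t : R) : is_derive t (1 : R) (fun t : R => phi (t *: v + x)) (dpartial v phi (t *: v + x)).
  by apply: is_derive_line_at; apply: is_derive_dpartial; case: tphi.
have := @mean_value_ineq R _ _ 1 (\sum_i C i * `|v|) hd.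
rewrite scale1r scale0r add0r normr1 mulr1 -mulr_suml (addrC x); apply => t _.
apply: le_trans (ler_norm_sum _ _ _) _; rewrite mulr_suml; apply: ler_sum => i _.
rewrite normrM mulrC; apply: ler_pM => //; first exact: (HC i).2.
rewrite [leRHS]mx_normrE.
by apply: (le_bigmax _ (fun i : 'I_1 * 'I_N => `|v i.1 i.2|) (ord0, i)).
Qed.

(** The mean value inequality for [phi] minus its linear part along [v], whose derivative is small
    because [dpartial v phi] is Lipschitz. *)
Lemma test_taylor v phi : test_function phi ->
  exists2 L, 0 <= L & forall x (t : R), `|phi (x + t *: v) - phi x - t * dpartial v phi x| <= L * t ^+ 2.
Proof.
move=> tphi; have [L L0 HL] := test_lipschitz (test_dpartial v tphi).
exists (L * `|v|) => [|x t]; first by rewrite mulr_ge0.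
have hd (s : R) : is_derive s (1 : R) (fun s : R => phi (s *: v + x) + (- dpartial v phi x) * s)
    (dpartial v phi (s *: v + x) - dpartial v phi x).
  apply: is_derive_addf.
    by apply: is_derive_line_at; apply: is_derive_dpartial; case: tphi.
  by apply: (is_derive_eq (is_derive_cmulf (- dpartial v phi x) (is_derive_id s (1 : R)))); rewrite mulr1.
have := @mean_value_ineq R _ _ t (L * `|v| * `|t|) hd.
rewrite scale0r add0r mulr0 addr0 -[_ * _ * `|t| * `|t|]mulrA -expr2 real_normK ?num_real//.
move=> H; apply: le_trans (H _); last first.
  move=> s st; rewrite (addrC (s *: v)); apply: le_trans (HL _ _) _.
  by rewrite normrZ -mulrA ler_wpM2l// mulrC ler_wpM2l.
by rewrite (addrC x) mulNr (mulrC (dpartial v phi x)) addrAC.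
Qed.

End test_functions.
(** * The fundamental lemma of the calculus of variations *)

Section fundamental_lemma.
Context {R : realType} {N : nat}.
Local Notation X := 'rV[R]_N.
Local Notation leb := (lebesgue_rV R N).
Local Notation L2 := (L2 leb).
Local Notation intg := (intg leb).
Local Notation dot := (L2dot leb).
Implicit Types (f g phi : X -> R) (x y z v a b : X).

Lemma indic_cvg (F : nat -> set X) x : nondecreasing_seq F ->
  (fun n => \1_(F n) x : R) @ \oo --> (\1_(\bigcup_n F n) x : R).
Proof.
move=> ndF; have [[n _ Fnx]|nF] := pselect ((\bigcup_n F n) x).
  apply: cvg_near_cst; exists n => // m /= nm.
  have /subsetPset/(_ x Fnx) Fmx := ndF _ _ nm.
  by rewrite !indicE !mem_set//; exists n.
apply: cvg_near_cst; apply: nearW => m.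
rewrite !indicE !memNset// => Fm; apply: nF; by exists m.
Qed.

Lemma cube_nd : nondecreasing_seq (fun n => cube n%:R : set X).
Proof.
move=> m n mn; apply/subsetPset => x /cubeP H; apply/cubeP => i.
by apply: le_trans (H i) _; rewrite ler_nat.
Qed.

Lemma intg_mul_indic f A : measurable A -> intg f -> intg (fun x => f x * \1_A x).
Proof.
move=> mA hf; apply: (intg_le (g := fun x => `|f x|)); last exact: intg_norm.
  by apply: measurable_funM; [exact: intg_meas hf|exact: measurable_indic].
move=> x; rewrite normrM ler_piMr// indicE.
by case: (_ \in _); rewrite ?normr0 ?normr1.
Qed.

Lemma L2_mul_indic f A : measurable A -> L2 f -> L2 (fun x => f x * \1_A x).
Proof.
move=> mA Lf; apply: (L2_dom _ _ Lf).
  by apply: measurable_funM; [case: Lf|exact: measurable_indic].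
move=> x; rewrite normrM ler_piMr// indicE.
by case: (_ \in _); rewrite ?normr0 ?normr1.
Qed.

(** The sets over which [f] integrates to zero form a lambda-system containing the boxes, which are
    stable under intersection, so all measurable sets are reached. With [A = {f >= 0}], the function
    [2 f 1_A - f] is [|f|] and has zero integral. *)
Lemma intg_box_null f : intg f -> (forall a b, \int[leb]_x (f x * \1_(box a b) x) = 0) ->
  {ae leb, forall x, f x = 0}.
Proof.
move=> hf f0; have mf := intg_meas hf.
pose H (A : set X) := measurable A /\ \int[leb]_x (f x * \1_A x) = 0.
have Hnd : ndseq_closed H.
  move=> F ndF HF; have mU : measurable (\bigcup_n F n).
    by apply: bigcupT_measurable => n; case: (HF n).
  split => //.
  have [|||||_ cF] := @Rint_dct _ _ _ leb (fun n x => f x * \1_(F n) x)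
    (fun x => f x * \1_(\bigcup_n F n) x) (fun x => `|f x|).
  - by move=> n; apply: measurable_funM => //; apply: measurable_indic; case: (HF n).
  - by apply: measurable_funM => //; exact: measurable_indic.
  - by apply: aeW => x; apply: cvgM; [exact: cvg_cst|exact: indic_cvg].
  - exact: intg_norm.
  - apply: aeW => x n; rewrite normrM ler_piMr// indicE.
    by case: (_ \in _); rewrite ?normr0 ?normr1.
  apply: (cvg_unique _ cF) => //.
  rewrite (_ : (fun n => _) = fun=> 0); first exact: cvg_cst.
  by apply/funext => n; exact: (HF n).2.
have HG : boxes `<=` H by move=> _ [a [b ->]]; split; [exact: measurable_box|exact: f0].
have HD : setSD_closed H.
  move=> A B BA [mA A0] [mB B0]; split; first exact: measurableD.
  rewrite (_ : (fun x => _) = (fun x => f x * \1_A x - f x * \1_B x)).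
    by rewrite RintB ?A0 ?B0 ?subrr//; exact: intg_mul_indic.
  apply/funext => x; rewrite -mulrBr; congr (_ * _); rewrite !indicE in_setD.
  have [xB|xB] := boolP (x \in B); last by rewrite andbT subr0.
  by rewrite andbF mem_set ?subrr//; apply: BA; exact: set_mem.
have HT : H setT.
  rewrite -bigcup_cube; apply: Hnd; first exact: cube_nd.
  by move=> n; apply: HG; eexists; eexists.
have HM A : measurable A -> H A.
  rewrite measurable_rVE; apply: lambda_system_subset => //; exact: boxesI.
pose A := [set x | 0 <= f x].
have mA : measurable A.
  rewrite (_ : A = f @^-1` `[0, +oo[%classic).
    by rewrite -[X in measurable X]setTI; exact: mf.
  by apply/seteqP; split => x; rewrite /A /= in_itv/= andbT.
have [_ IA] := HM _ mA; have [_ IT] := HM _ measurableT.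
have hfA := intg_mul_indic mA hf; have hfT := intg_mul_indic measurableT hf.
have : {ae leb, forall x, 2 * (f x * \1_A x) - f x * \1_setT x = 0}.
  apply: Rint_eq0_ae; first by apply: intgB => //; exact: intgZ.
    move=> x; rewrite !indicE in_setT mulr1 /A.
    have [f0x|f0x] := leP 0 (f x).
      by rewrite mem_set// mulr1; lra.
    rewrite memNset ?mulr0n ?mulr0; [lra|by move=> /= h; move: f0x; rewrite ltNge h].
  rewrite RintB//; last exact: intgZ.
  by rewrite RintZ// IA IT mulr0 subr0.
apply: filterS => x; rewrite !indicE in_setT mulr1 /A.
have [f0x|f0x] := leP 0 (f x).
  by rewrite mem_set// mulr1; lra.
rewrite memNset ?mulr0n ?mulr0; [lra|by move=> /= h; move: f0x; rewrite ltNge h].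
Qed.

(** The squared factor drives the argument to minus infinity outside the closed box, while the added
    [n + 1] drives it to plus infinity on the box, faces included; so the limit is the indicator at
    every point. Beyond distance [1] from the box the argument is already nonpositive for every
    [n]. *)
Definition box_approx (n : nat) a b x : R :=
  \prod_i (bump (n.+1%:R ^+ 2 * (x ord0 i - a ord0 i) + n.+1%:R) *
           bump (n.+1%:R ^+ 2 * (b ord0 i - x ord0 i) + n.+1%:R)).

Lemma box_approx_ge0 n a b x : 0 <= box_approx n a b x.
Proof. by apply: prodr_ge0 => i _; rewrite mulr_ge0// bump_ge0. Qed.

Lemma box_approx_le1 n a b x : box_approx n a b x <= 1.
Proof.
rewrite /box_approx; elim: (index_enum _) => [|i s IH]; rewrite ?big_nil// big_cons.
have h : 0 <= \prod_(j <- s) (bump (n.+1%:R ^+ 2 * (x ord0 j - a ord0 j) + n.+1%:R) *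
           bump (n.+1%:R ^+ 2 * (b ord0 j - x ord0 j) + n.+1%:R)).
  by apply: prodr_ge0 => j _; rewrite mulr_ge0// bump_ge0.
apply: mulr_ile1 => //; first by rewrite mulr_ge0// bump_ge0.
by apply: mulr_ile1; rewrite ?bump_ge0 ?bump_le1.
Qed.

Lemma box_approx_supp n a b x : ~ box (a - const_mx 1) (b + const_mx 1) x ->
  box_approx n a b x = 0.
Proof.
move=> /existsNP[i /negP]; rewrite !mxE => H; rewrite /box_approx (bigD1 i)//=.
have n1 : (1 : R) <= n.+1%:R by rewrite ler1n.
move: H; rewrite negb_and -!ltNge => /orP[H|H].
- by rewrite bump_eq0 ?mul0r//; nra.
- by rewrite (bump_eq0 (s := _ * (b ord0 i - _) + _)) ?mulr0 ?mul0r//; nra.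
Qed.

Lemma smooth_bump_coord (c e0 : R) i : smooth (fun x : X => bump (c * x ord0 i + e0)).
Proof.
apply: smooth_comp; first exact: Dk_bump.
apply: (smoothD (f := fun x : X => c * x ord0 i) (g := fun=> e0)); last exact: smooth_cst.
by apply: (smoothM (f := fun=> c)); [exact: smooth_cst|exact: smooth_coord].
Qed.

Lemma smooth_prod (I : Type) (s : seq I) (F : I -> X -> R) :
  (forall i, smooth (F i)) -> smooth (fun x => \prod_(i <- s) F i x).
Proof.
by move=> HF; apply/smoothP => n; apply: Ck_prod => i; have /smoothP := HF i; exact.
Qed.

Lemma box_approx_test n a b : test_function (box_approx n a b).
Proof.
apply/testP; split.
  apply: smooth_prod => i; apply: smoothM.
    rewrite (_ : (fun x => _) = (fun x : X => bump (n.+1%:R ^+ 2 * x ord0 i +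
       (n.+1%:R - n.+1%:R ^+ 2 * a ord0 i)))); first exact: smooth_bump_coord.
    by apply/funext => x; congr bump; ring.
  rewrite (_ : (fun x => _) = (fun x : X => bump (- n.+1%:R ^+ 2 * x ord0 i +
       (n.+1%:R + n.+1%:R ^+ 2 * b ord0 i)))); first exact: smooth_bump_coord.
  by apply/funext => x; congr bump; ring.
exists (\sum_i (`|a ord0 i| + `|b ord0 i| + 1)) => x nx.
apply: box_approx_supp => H; apply: nx; apply/cubeP => i.
have S0 : 0 <= \sum_(j < N | j != i) (`|a ord0 j| + `|b ord0 j| + 1).
  by apply: sumr_ge0 => j _; rewrite !addr_ge0.
rewrite (bigD1 i)//=; have := H i; rewrite !mxE ler_norml.
have := ler_norm (a ord0 i); have := ler_norm (b ord0 i).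
have := ler_norm (- a ord0 i); have := ler_norm (- b ord0 i); rewrite !normrN; lra.
Qed.

Lemma bump_large (t : R) : 0 <= t ->
  (fun n : nat => bump (n.+1%:R ^+ 2 * t + n.+1%:R)) @ \oo --> (1 : R).
Proof.
move=> t0; apply/cvgnP => e e0.
have e2 : 0 < e / 2 by rewrite divr_gt0.
have /cvgrPdist_lt/(_ _ e2)[k _ H] := @cvg_harmonic R.
exists k => n kn; have /= := H n kn.
rewrite sub0r normrN ger0_norm ?invr_ge0// => hn.
have h := @bump_near1 R (n.+1%:R ^+ 2 * t + n.+1%:R) (e / 2) e2.
have n1 : (1 : R) <= n.+1%:R by rewrite ler1n.
rewrite distrC ger0_norm ?subr_ge0 ?bump_le1//.
suff : 1 - e / 2 <= bump (n.+1%:R ^+ 2 * t + n.+1%:R) by move=> hh; lra.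
apply: h; apply: (@le_trans _ _ n.+1%:R); last by rewrite lerDr mulr_ge0// sqr_ge0.
by rewrite -[leRHS]invrK lef_pV2 ?posrE ?invr_gt0// ltW.
Qed.

Lemma bump_small (t : R) : t < 0 ->
  (fun n : nat => bump (n.+1%:R ^+ 2 * t + n.+1%:R)) @ \oo --> (0 : R).
Proof.
move=> t0; apply/cvgnP => e e0.
have e2 : 0 < - t by lra.
have /cvgrPdist_lt/(_ _ e2)[k _ H] := @cvg_harmonic R.
exists k => n kn; have /= := H n kn.
rewrite sub0r normrN ger0_norm ?invr_ge0// => hn.
rewrite bump_eq0 ?subrr ?normr0// expr2 -mulrA -{3}[n.+1%:R]mulr1 -mulrDr.
rewrite pmulr_rle0//.
have : (1 : R) < - t * n.+1%:R by rewrite -ltr_pdivrMr// div1r.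
by lra.
Qed.

Lemma box_approx_cvg a b x :
  (fun n => box_approx n a b x) @ \oo --> (\1_(box a b) x : R).
Proof.
have [xB|nB] := pselect (box a b x).
  rewrite indicE mem_set//= /box_approx.
  rewrite (_ : 1%:R = \prod_(i < N) ((1 : R) * 1)); last first.
    by rewrite big1// => i _; rewrite mulr1.
  elim: (index_enum _) => [|i s IH].
    by under eq_fun do rewrite big_nil; rewrite big_nil; exact: cvg_cst.
  under eq_fun do rewrite big_cons; rewrite big_cons.
  apply: cvgM => //; have /andP[h1 h2] := xB i.
  by apply: cvgM; apply: bump_large; rewrite subr_ge0.
rewrite indicE memNset//=; move: nB => /existsNP[i /negP].
rewrite negb_and -!ltNge => H.
have cp : (fun n : nat => bump (n.+1%:R ^+ 2 * (x ord0 i - a ord0 i) + n.+1%:R) *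
           bump (n.+1%:R ^+ 2 * (b ord0 i - x ord0 i) + n.+1%:R)) @ \oo --> (0 : R).
  have sq (F G : nat -> R) : (forall n, 0 <= F n <= 1) -> (forall n, 0 <= G n) ->
     G @ \oo --> (0 : R) -> (fun n => F n * G n) @ \oo --> (0 : R).
    move=> F01 G0 cG; apply: (squeeze_cvgr _ (cvg_cst 0) cG).
    apply: nearW => n; have /andP[f0 f1] := F01 n.
    by rewrite mulr_ge0//= ler_piMl.
  case/orP : H => H.
    under eq_fun do rewrite mulrC.
    apply: sq; [by move=> n; rewrite bump_ge0 bump_le1|by move=> n; exact: bump_ge0|].
    by apply: bump_small; rewrite subr_lt0.
  apply: sq; [by move=> n; rewrite bump_ge0 bump_le1|by move=> n; exact: bump_ge0|].
  by apply: bump_small; rewrite subr_lt0.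
apply: (squeeze_cvgr _ (cvg_cst 0) cp); apply: nearW => n.
rewrite box_approx_ge0/= /box_approx (bigD1 i)//=.
rewrite ler_piMr// ?mulr_ge0 ?bump_ge0//.
elim: (index_enum _) => [|j s IH]; rewrite ?big_nil// big_cons; case: ifP => // _.
have h : 0 <= \prod_(j <- s | j != i) (bump (n.+1%:R ^+ 2 * (x ord0 j - a ord0 j) + n.+1%:R) *
           bump (n.+1%:R ^+ 2 * (b ord0 j - x ord0 j) + n.+1%:R)).
  by apply: prodr_ge0 => k _; rewrite mulr_ge0// bump_ge0.
apply: mulr_ile1 => //; first by rewrite mulr_ge0// bump_ge0.
by apply: mulr_ile1; rewrite ?bump_ge0 ?bump_le1.
Qed.

Lemma dot_box g a b : L2 g -> (forall phi, test_function phi -> dot g phi = 0) ->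
  \int[leb]_x (g x * \1_(box a b) x) = 0.
Proof.
move=> Lg g0; have mg := L2_meas Lg.
pose B := box (a - const_mx 1) (b + const_mx 1).
have LB : L2 (\1_B) by apply: L2_indic; [exact: measurable_box|exact: leb_box_lty].
have [|||||_ cF] := @Rint_dct _ _ _ leb (fun n x => g x * box_approx n a b x)
    (fun x => g x * \1_(box a b) x) (fun x => `|g x| * \1_B x).
- move=> n; apply: measurable_funM => //; apply: test_meas; exact: box_approx_test.
- by apply: measurable_funM => //; apply: measurable_indic; exact: measurable_box.
- by apply: aeW => x; apply: cvgM; [exact: cvg_cst|exact: box_approx_cvg].
- by apply: (L2_intgM (f := fun x => `|g x|)) => //; exact: L2_norm.
- apply: aeW => x n; rewrite normrM ler_wpM2l// ger0_norm ?box_approx_ge0//.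
  rewrite indicE; have [xB|nB] := pselect (B x).
    by rewrite mem_set// box_approx_le1.
  by rewrite box_approx_supp.
apply: (cvg_unique _ cF) => //.
have E n : \int[leb]_x (g x * box_approx n a b x) = 0.
  by rewrite -[LHS]/(dot g (box_approx n a b)) g0//; exact: box_approx_test.
rewrite (_ : (fun n => _) = fun=> 0); first exact: cvg_cst.
by apply/funext => n; exact: E.
Qed.

Lemma box_setI a b c e : exists a' b', box a b `&` box c e = box a' b' :> set X.
Proof.
have Bab : @boxes R N (box a b) by exists a, b.
have Bce : @boxes R N (box c e) by exists c, e.
by have [a' [b' ->]] := boxesI Bab Bce; exists a', b'.
Qed.

(** A square-integrable [g] is made integrable by restriction to cubes; a cube meets a box in a box,
    so [dot_box] still applies. *)
Lemma fundamental_lemma g : L2 g -> (forall phi, test_function phi -> dot g phi = 0) ->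
  {ae leb, forall x, g x = 0}.
Proof.
move=> Lg g0.
have H n : {ae leb, forall x, g x * \1_(cube n%:R) x = 0}.
  apply: intg_box_null.
    apply: L2_intgM => //; apply: L2_indic; [exact: measurable_box|exact: leb_box_lty].
  move=> a b; have [a' [b' E]] := box_setI (const_mx (- n%:R)) (const_mx n%:R) a b.
  rewrite -(dot_box a' b' Lg g0); apply: eq_Rintegral => x _.
  rewrite -mulrA; congr (_ * _); rewrite -E !indicE in_setI.
  by rewrite -natrM mulnb.
have := ae_foralln H; apply: filterS => x Hx.
have : [set: X] x by []; rewrite -bigcup_cube => -[n _ xn].
by have := Hx n; rewrite indicE mem_set// mulr1.
Qed.

(** Orthogonality to all test functions forces a function to vanish, so by projection their closure
    is everything. *)
Lemma test_dense g : L2 g -> forall e, 0 < e ->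
  exists2 phi, test_function phi & dot (fun x => g x - phi x) (fun x => g x - phi x) < e.
Proof.
move=> Lg e e0.
pose Q (u : unit -> X -> R) := test_function (u tt).
have := @dense_of_orthogonal R (unit -> X -> R) _ _ _ _ Q (fL2_hilbert leb unit).
have fdE (u v : unit -> X -> R) : fdot leb u v = dot (u tt) (v tt).
  rewrite /fdot (bigD1 tt)//= big1 ?addr0// => i; by case: i.
case/(_ _ _ _ _ _ (fun=> g) _ e e0) => //.
- by move=> u Qu []; exact: test_L2.
- by exists (fun=> (fun=> 0)); exact: test0.
- by move=> u v Qu Qv; exact: testD.
- by move=> c u Qu; exact: testZ.
- move=> w Pw H; rewrite fdE.
  have w0 : {ae leb, forall x, w tt x = 0}.
    apply: fundamental_lemma; first exact: Pw.
    by move=> phi tphi; have := H (fun=> phi) tphi; rewrite fdE.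
  rewrite (dot_ae (Pw tt) (Pw tt) (L2_0 _) (L2_0 _) w0 w0).
  exact: dot0r.
move=> u Qu; rewrite /dist2 !fdE => h; exists (u tt) => //.
by rewrite dot_sub//; exact: test_L2.
Qed.

End fundamental_lemma.
(** * The space H^1 *)

Section sobolev_space.
Context {R : realType} {N : nat}.
Local Notation X := 'rV[R]_N.
Local Notation leb := (lebesgue_rV R N).
Local Notation L2 := (L2 leb).
Local Notation intg := (intg leb).
Local Notation dot := (L2dot leb).
Implicit Types (f g phi : X -> R) (x y z v : X).
Local Notation e i := (delta_mx ord0 i : X).

Lemma dot_cauchy_schwarz f g : L2 f -> L2 g -> dot f g ^+ 2 <= dot f f * dot g g.
Proof.
move=> Lf Lg; rewrite mulrC; apply: discriminant_le; try exact: dot_ge0.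
move=> t; have := dot_ge0 leb (fun x => t * g x + f x).
have Ltg := L2Z t Lg; rewrite dotDl ?dotDr ?dotZl ?dotZr//; try exact: L2D.
by rewrite (dotC leb g f); lra.
Qed.

(** The norm is a supremum over test functions: were [dot g g > C], a test function close to [g]
    would violate the hypothesis. *)
Lemma dual_bound g (C : R) : 0 <= C -> L2 g ->
  (forall phi, test_function phi -> dot g phi ^+ 2 <= C * dot phi phi) -> dot g g <= C.
Proof.
move=> C0 Lg H; rewrite leNgt; apply/negP => aC.
set a := dot g g in aC *.
have a0 : 0 < a by lra.
(* The first term keeps [|dot g h| <= a / 4], so that [a - 2 dot g h >= a / 2]; the second makes
   [C dot h h] smaller than [(a - C) a / 4]. *)
pose eps := Num.min (a / 16) ((a - C) * a / (4 * C + 4)).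
have e0 : 0 < eps by rewrite lt_min !divr_gt0// ?mulr_gt0//; lra.
have [phi tphi he] := test_dense Lg e0.
have Lphi := test_L2 tphi; have Ld := L2B Lg Lphi.
set h := fun x => g x - phi x in he Ld *.
have Eh : dot g phi = a - dot g h by rewrite /h dotBr// -/a; lra.
have Ep : dot phi phi = a - 2 * dot g h + dot h h.
  have -> : dot h h = a - 2 * dot g phi + dot phi phi by rewrite /h dot_sub.
  by rewrite Eh; lra.
have := H _ tphi; rewrite Eh Ep.
have := dot_cauchy_schwarz Lg Ld; rewrite -/a.
have d0 : 0 <= dot h h := dot_ge0 leb h.
move: he; rewrite /eps lt_min => /andP[h1 h2].
set r := dot g h; set d := dot h h in d0 h1 h2 *.
move=> rd.
have r4 : `|r| <= a / 4.
  have a4 : 0 <= a / 4 by lra.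
  by rewrite -ler_sqr ?nnegrE// real_normK ?num_real//; nra.
move: r4; rewrite ler_norml => /andP[r4 r5].
have h2' : d * (4 * C + 4) < (a - C) * a by rewrite -ltr_pdivlMr//; lra.
nra.
Qed.

(** [K] depends on [f] and the cube only, so pairing [f] with a remainder supported there is
    controlled by the supremum of the remainder. *)
Lemma L2_local f (r : R) : L2 f -> exists2 K, 0 <= K &
  forall (g : X -> R) (c : R), measurable_fun setT g -> (forall x, `|g x| <= c) ->
    (forall x, ~ cube r x -> g x = 0) -> `|\int[leb]_x (f x * g x)| <= K * c.
Proof.
move=> Lf.
have Li : L2 (\1_(cube r)) by apply: L2_indic; [exact: measurable_box|exact: leb_box_lty].
have hi : intg (fun x => `|f x| * \1_(cube r) x) by apply: L2_intgM => //; exact: L2_norm.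
exists (\int[leb]_x (`|f x| * \1_(cube r) x)); first by apply: Rint_ge0 => x; rewrite mulr_ge0.
move=> g c mg gc g0; have c0 : 0 <= c by apply: le_trans (gc 0).
have dom x : `|f x * g x| <= c * (`|f x| * \1_(cube r) x).
  rewrite normrM indicE; have [cx|nx] := pselect (cube r x).
    by rewrite mem_set// mulr1 mulrC ler_wpM2r.
  by rewrite g0// normr0 mulr0 !mulr_ge0.
have hfg : intg (fun x => f x * g x).
  apply: intg_le (intgZ c hi) => //; by apply: measurable_funM => //; case: Lf.
apply: le_trans (Rint_norm hfg) _; rewrite mulrC -RintZ//.
by apply: Rint_le => //; [exact: intg_norm|exact: intgZ].
Qed.

Lemma partial_shift (c : X) phi i x : smooth phi ->
  partial i (fun x => phi (x + c)) x = partial i phi (x + c).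
Proof.
move=> sphi; have h := smooth_is_derive i (x + c) sphi.
suff [_ h'] : is_derive x (e i) (fun x => phi (x + c)) (partial i phi (x + c)) by exact: h'.
by apply: is_derive_quot h => h; rewrite addrA.
Qed.

(** [f] is merely square integrable, so the derivative falls on the test function, through a Taylor
    remainder uniform in [x] and supported in one fixed cube. *)
Lemma is_derive_dot_shift f phi z (t : R) : L2 f -> test_function phi ->
  is_derive t (1 : R) (fun t : R => dot f (fun x => phi (x + t *: z)))
    (dot f (fun x => dpartial z phi (x + t *: z))).
Proof.
move=> Lf tphi.
have td := test_dpartial z tphi.
have [L L0 HL] := test_taylor z tphi.
have /testP[_ [r1 Hr1]] := tphi; have /testP[_ [r2 Hr2]] := td.
(* The cube contains the supports of all translates [phi (x + s z)] with [|s| <= |t| + 1], hence of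
   every difference quotient with [|h| < 1]. *)
pose r := Num.max r1 r2 + (`|t| + 1) * `|z|.
have [K K0 HK] := L2_local r Lf.
apply: is_derive_cvg; apply/cvgrPdist_le => eps eps0.
have KL : 0 < K * L + 1 by rewrite ltr_wpDl ?mulr_ge0.
apply/nbhs_ballP; exists (Num.min 1 (eps / (K * L + 1))).
  by rewrite /= lt_min ltr01 divr_gt0.
move=> h; rewrite /ball /= sub0r normrN lt_min => /andP[h1 hlt] h0.
have Ls (s : R) : L2 (fun x => phi (x + s *: z)) by apply: test_L2; exact: test_shift.
have Ld : L2 (fun x => dpartial z phi (x + t *: z)) by apply: test_L2; exact: test_shift.
have -> : h *: (1 : R) + t = h + t by rewrite [h *: _]mulr1.
rewrite distrC -dotBr// -dotZr; last 2 first.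
- exact: L2B.
- by [].
rewrite -dotBr//; last by apply: L2Z; exact: L2B.
apply: (@le_trans _ _ (K * (L * `|h|))); last first.
  by move: hlt; rewrite ltr_pdivlMr//; have := normr_ge0 h; nra.
apply: HK => [|x|x nx].
- apply: (@L2_meas _ _ _ leb); apply: L2B => //; apply: L2Z; exact: L2B.
- have E : x + t *: z + h *: z = x + (h + t) *: z by rewrite -addrA -scalerDl (addrC t).
  have := HL (x + t *: z) h; rewrite E => H.
  rewrite -[X in `|_ - X|](mulKf h0) -mulrBr normrM normfV.
  by rewrite ler_pdivrMl ?normr_gt0// mulrCA -expr2 real_normK ?num_real.
- have nin (s : R) : `|s| <= `|t| + 1 -> forall r', r' <= Num.max r1 r2 -> ~ cube r' (x + s *: z).
    move=> hs r' hr' /cubeP H; apply: nx; apply/cubeP => i.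
    have := H i; rewrite !mxE => H1.
    have zi : `|z ord0 i| <= `|z|.
      rewrite [`|z|]mx_normrE.
      by apply: (le_bigmax _ (fun i : 'I_1 * 'I_N => `|z i.1 i.2|) (ord0, i)).
    have -> : x ord0 i = (x ord0 i + s * z ord0 i) - s * z ord0 i by ring.
    apply: le_trans (ler_normB _ _) _; apply: lerD; first exact: le_trans H1 hr'.
    by rewrite normrM; apply: ler_pM.
  rewrite Hr1; last first.
    apply: nin; last by rewrite le_max lexx.
    by apply: le_trans (ler_normD _ _) _; rewrite addrC lerD2l ltW.
  rewrite Hr1; last by apply: nin; [rewrite lerDl|rewrite le_max lexx].
  rewrite Hr2; last by apply: nin; [rewrite lerDl|rewrite le_max lexx orbT].
  by rewrite subrr mulr0 subrr.
Qed.

Definition wpd i f g := forall phi, test_function phi ->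
  dot f (partial i phi) = - dot g phi.

Lemma wpd_unique i f g g' : L2 g -> L2 g' -> wpd i f g -> wpd i f g' ->
  {ae leb, forall x, g x = g' x}.
Proof.
move=> Lg Lg' H H'.
have : {ae leb, forall x, g x - g' x = 0}.
  apply: fundamental_lemma; first exact: L2B.
  move=> phi tphi; have Lphi := test_L2 tphi.
  by rewrite dotBl// -[dot g phi]opprK -H// H'// opprK subrr.
by apply: filterS => x /eqP; rewrite subr_eq0 => /eqP.
Qed.

(* [U None] stands for the function and [U (Some i)] for its [i]-th weak derivative. *)
Definition jet := option 'I_N -> X -> R.
Implicit Types U V : jet.

Definition H1j U := fL2 leb U /\ forall i, wpd i (U None) (U (Some i)).

Definition gdot U V := \sum_i dot (U (Some i)) (V (Some i)).

Lemma fdotE U V : fdot leb U V = dot (U None) (V None) + gdot U V.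
Proof.
rewrite /fdot (bigD1 None)//= (reindex_omap Some id)/=; last by case.
by congr (_ + _); apply: eq_bigl => i; rewrite eqxx.
Qed.

Lemma gdot_ge0 U : 0 <= gdot U U.
Proof. by apply: sumr_ge0 => i _; exact: dot_ge0. Qed.

(** For a fixed test function both sides of the weak derivative identity are continuous in $L^2$, so
    these jets form a closed subspace of a power of $L^2$. *)
Lemma H1j_hilbert : hilbert (@fadd _ X R (option 'I_N)) (@fscale _ X R (option 'I_N)) (fdot leb (I := option 'I_N)) H1j.
Proof.
apply: (hilbert_sub (fL2_hilbert leb _)).
- by move=> U [].
- exists (fun=> fun=> 0); split => [i|i phi tphi]; first exact: L2_0.
  by rewrite !(dotC _ (fun=> 0)) !dot0r oppr0.
- move=> U V [LU WU] [LV WV]; split; first by move=> i; exact: L2D.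
  move=> i phi tphi; have Lp := test_L2 tphi; have Lpp := test_L2 (test_partial i tphi).
  by rewrite /fadd !dotDl// WU// WV// opprD.
- move=> a U [LU WU]; split; first by move=> i; exact: L2Z.
  move=> i phi tphi; have Lp := test_L2 tphi; have Lpp := test_L2 (test_partial i tphi).
  by rewrite /fscale !dotZl// WU// mulrN.
- move=> u V Hu LV uV; split => // i phi tphi.
  have Lp := test_L2 tphi; have Lpp := test_L2 (test_partial i tphi).
  have key o q : L2 q -> (fun n => dot (u n o) q) @ \oo --> dot (V o) q.
    move=> Lq; apply/cvgnP => eps eps0.
    have q1 : 0 < dot q q + 1 by rewrite ltr_wpDl ?dot_ge0.
    have e1 : 0 < eps ^+ 2 / (dot q q + 1) by rewrite divr_gt0 ?exprn_gt0.
    have [K HK] := uV _ e1; exists K => n /HK.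
    have Lu : L2 (u n o) by have [L _] := Hu n; exact: L.
    have LVo := LV o.
    rewrite ltr_pdivlMr// => hd.
    rewrite -dotBl// -ltr_sqr ?nnegrE//; last exact: ltW.
    rewrite real_normK ?num_real//.
    apply: le_lt_trans (dot_cauchy_schwarz (L2B Lu LVo) Lq) _.
    apply: le_lt_trans hd.
    apply: ler_pM; rewrite ?dot_ge0//; last by rewrite lerDl.
    rewrite /dist2 /fdot mulr_sumr -sumrB -big_split/= (bigD1 o)//= dot_sub//.
    rewrite lerDl; apply: sumr_ge0 => j _; rewrite -dot_sub ?dot_ge0//.
    by have [L _] := Hu n; exact: L.
  have c1 := key None _ Lpp; have c2 := key (Some i) _ Lp.
  apply: (cvg_unique _ c1) => //.
  rewrite (_ : (fun n => _) = (fun n => - dot (u n (Some i)) phi)); first exact: cvgN.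
  by apply/funext => n; have [_ W] := Hu n; exact: W.
Qed.

Definition shift_diff f z : X -> R := fun x => f (x + z) - f x.

Definition jet_dir U z : X -> R := fun x => \sum_i z ord0 i * U (Some i) x.

(** By duality: paired with [phi], the difference is [Th 1 - Th 0], where [Th t] pairs [U None] with
    a translate of [phi]. The derivative of [Th] pairs the directional weak derivative with that
    translate and is bounded by Cauchy-Schwarz. *)
Lemma shift_bound U z : H1j U ->
  dot (shift_diff (U None) z) (shift_diff (U None) z) <= dot (jet_dir U z) (jet_dir U z).
Proof.
move=> [LU WU]; set D := shift_diff _ _; set G := jet_dir _ _.
have LG : L2 G by apply: L2_sum => i; exact: L2Z.
have LUz : L2 (fun x => U None (x + z)) := scaling_L2 ler01 (leb_shift z) (LU None).
have LD : L2 D by exact: L2B.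
apply: dual_bound => //; first exact: dot_ge0.
move=> phi tphi; have Lphi := test_L2 tphi.
pose Th (t : R) := dot (U None) (fun x => phi (x + t *: (- z))).
have dTh t := is_derive_dot_shift (- z) t (LU None) tphi.
have Lps (t : R) : L2 (fun x => phi (x + t *: - z)) by apply: test_L2; exact: test_shift.
have E (t : R) : dot (U None) (fun x => dpartial (- z) phi (x + t *: - z)) =
    dot G (fun x => phi (x + t *: - z)).
  transitivity (\sum_i z ord0 i * dot (U (Some i)) (fun x => phi (x + t *: - z))).
    rewrite /L2dot /dpartial.
    transitivity (\int[leb]_x (\sum_i (U None x * (- z ord0 i * partial i phi (x + t *: - z))))).
      by apply: eq_Rintegral => x _; rewrite mulr_sumr; apply: eq_bigr => i _; rewrite !mxE.
    have tp i : test_function (fun x => partial i phi (x + t *: - z)).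
      by apply: test_shift; exact: test_partial.
    rewrite Rint_sum => [|i]; last by apply: L2_intgM => //; apply: L2Z; exact: test_L2.
    apply: eq_bigr => i _.
    rewrite -[LHS]/(dot _ (fun x => - z ord0 i * partial i phi (x + t *: - z))).
    rewrite dotZr//; last exact: test_L2.
    have -> : (fun x => partial i phi (x + t *: - z)) = partial i (fun x => phi (x + t *: - z)).
      by apply/funext => x; rewrite partial_shift; case: tphi.
    by rewrite WU ?mulNr ?mulrN ?opprK//; exact: test_shift.
  rewrite /G /jet_dir /L2dot.
  transitivity (\int[leb]_x (\sum_i (z ord0 i * (U (Some i) x * phi (x + t *: - z))))).
    rewrite Rint_sum => [|i]; last by apply: intgZ; exact: L2_intgM.
    by apply: eq_bigr => i _; rewrite RintZ//; exact: L2_intgM.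
  by apply: eq_Rintegral => x _; rewrite mulr_suml; apply: eq_bigr => i _; rewrite mulrA.
have shiftE (t : R) : dot (fun x => phi (x + t *: - z)) (fun x => phi (x + t *: - z)) = dot phi phi.
  by rewrite (scaling_dot ler01 (leb_shift (t *: - z)) Lphi Lphi) mul1r.
have DE : dot D phi = Th 1 - Th 0.
  rewrite /D /shift_diff dotBl// /Th; congr (_ - _); last first.
    by congr (L2dot leb); apply/funext => x; rewrite scale0r addr0.
  rewrite -[RHS]mul1r -(scaling_dot ler01 (leb_shift z) (LU None) (Lps 1)).
  by congr (L2dot leb); apply/funext => x; rewrite scale1r addrK.
have := @mean_value_ineq R Th _ 1 (Num.sqrt (dot G G * dot phi phi)) dTh.
rewrite normr1 mulr1 -DE => H.
rewrite -[leLHS]real_normK ?num_real// -[leRHS]sqr_sqrtr ?mulr_ge0 ?dot_ge0//.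
rewrite ler_sqr ?nnegrE ?sqrtr_ge0//; apply: H => t _.
rewrite E -ler_sqr ?nnegrE ?sqrtr_ge0// sqr_sqrtr ?mulr_ge0 ?dot_ge0//.
rewrite real_normK ?num_real//; apply: le_trans (dot_cauchy_schwarz LG (Lps t)) _.
by rewrite shiftE.
Qed.

Lemma shift_bound_coord U i (h : R) : H1j U ->
  dot (shift_diff (U None) (h *: e i)) (shift_diff (U None) (h *: e i)) <= h ^+ 2 * dot (U (Some i)) (U (Some i)).
Proof.
move=> HU; have [LU _] := HU; apply: le_trans (shift_bound (h *: e i) HU) _.
rewrite (_ : jet_dir U (h *: e i) = (fun x => h * U (Some i) x)); last first.
  apply/funext => x; rewrite /jet_dir (bigD1 i)//= big1 ?addr0 => [|j ji].
    by rewrite !mxE !eqxx mulr1.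
  by rewrite !mxE (negPf ji) andbF mulr0 mul0r.
have Lh := L2Z h (LU (Some i)).
by rewrite dotZl// dotZr// mulrA -expr2.
Qed.

Lemma shift_bound_cube U z (r : R) : H1j U -> (forall i, `|z ord0 i| <= r) ->
  dot (shift_diff (U None) z) (shift_diff (U None) z) <= N%:R * r ^+ 2 * gdot U U.
Proof.
move=> HU zr; have [LU _] := HU; apply: le_trans (shift_bound z HU) _.
have LG : L2 (jet_dir U z) by apply: L2_sum => i; exact: L2Z.
apply: (@le_trans _ _ (\int[leb]_x (\sum_i (N%:R * r ^+ 2 * U (Some i) x ^+ 2)))).
  rewrite dotE; apply: Rint_le; first by case: LG.
    by apply: intg_sum => i; apply: intgZ; case: (LU (Some i)).
  move=> x; pose b i := z ord0 i * U (Some i) x.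
  (* Cauchy-Schwarz with the constant vector, as the discriminant of the sum of the squares
     [(t + b i) ^ 2]. *)
  have cs : (\sum_i b i) ^+ 2 <= N%:R * \sum_i b i ^+ 2.
    apply: discriminant_le => [//||t]; first by apply: sumr_ge0 => i _; exact: sqr_ge0.
    have -> : N%:R * t ^+ 2 + 2 * (\sum_i b i) * t + \sum_i b i ^+ 2 = \sum_i (t + b i) ^+ 2.
      rewrite [RHS](eq_bigr (fun i => t ^+ 2 + 2 * t * b i + b i ^+ 2)) => [|i _]; last by ring.
      rewrite !big_split/= sumr_const card_ord -mulr_sumr mulr_natl.
      by congr (_ + _ + _); rewrite mulrAC.
    by apply: sumr_ge0 => i _; exact: sqr_ge0.
  apply: le_trans cs _.
  rewrite [leRHS](eq_bigr (fun i => N%:R * (r ^+ 2 * U (Some i) x ^+ 2))) => [|i _]; last by rewrite mulrA.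
  rewrite -mulr_sumr.
  rewrite ler_wpM2l//; apply: ler_sum => i _; rewrite /b exprMn.
  apply: ler_wpM2r; first exact: sqr_ge0.
  have r0 : 0 <= r by apply: le_trans (zr i).
  by rewrite -[leLHS]real_normK ?num_real// ler_sqr ?nnegrE.
rewrite Rint_sum => [|i]; last by apply: intgZ; case: (LU (Some i)).
rewrite /gdot mulr_sumr; apply: ler_sum => i _.
by rewrite RintZ ?dotE//; case: (LU (Some i)).
Qed.

(** The difference quotients are bounded in $L^2$; a weak limit of them is the derivative, because
    the translation can be moved to the test function. *)
Lemma wpd_of_shift f i (K : R) : L2 f -> 0 <= K ->
  (forall h : R, dot (shift_diff f (h *: e i)) (shift_diff f (h *: e i)) <= h ^+ 2 * K) ->
  exists g, [/\ L2 g, wpd i f g & dot g g <= K].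
Proof.
move=> Lf K0 HD.
pose h n : R := n.+1%:R^-1.
have h0 n : 0 < h n by rewrite invr_gt0.
have Lfs (s : R) : L2 (fun x => f (x + s *: e i)) := scaling_L2 ler01 (leb_shift _) Lf.
pose q n : unit -> X -> R := fun _ x => (h n)^-1 * (f (x + h n *: e i) - f x).
have Lq n : L2 (q n tt) by apply: L2Z; exact: L2B.
have qK n : dot (q n tt) (q n tt) <= K.
  have LD := L2B (Lfs (h n)) Lf.
  rewrite (dotZl _ LD (Lq n)) (dotZr _ LD LD) mulrA -expr2.
  rewrite exprVn ler_pdivrMl ?exprn_gt0//; exact: HD.
have fdE (u v : unit -> X -> R) : fdot leb u v = dot (u tt) (v tt).
  rewrite /fdot (bigD1 tt)//= big1 ?addr0// => j; by case: j.
have [||k ki [g Lg wg]] := @hilbert_weak_compact _ _ _ _ _ _ (fL2_hilbert leb unit) q K.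
- by move=> n []; exact: Lq.
- by move=> n; rewrite fdE.
have {}Lg := Lg tt.
have wk p : L2 p -> (fun n => dot (q (k n) tt) p) @ \oo --> dot (g tt) p.
  move=> Lp; have := wg _ (functional_ip (fL2_hilbert leb unit) (u := fun=> p) _).
  have -> : fdot leb (fun=> p) g = dot (g tt) p by rewrite fdE dotC.
  rewrite (_ : (fun n => fdot leb (fun=> p) (q (k n))) = (fun n => dot (q (k n) tt) p)).
    by apply => -[].
  by apply/funext => n; rewrite fdE dotC.
exists (g tt); split => //.
- move=> phi tphi; have Lphi := test_L2 tphi.
  have dTh := is_derive_dot_shift (- e i) 0 Lf tphi.
  have E : dot f (fun x => dpartial (- e i) phi (x + 0 *: - e i)) = - dot f (partial i phi).
    rewrite -dotNr//; last by apply: test_L2; exact: test_partial.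
    congr (L2dot leb); apply/funext => x; rewrite scale0r addr0 /dpartial (bigD1 i)//= big1 ?addr0.
      by rewrite !mxE !eqxx mulN1r.
    by move=> j ji; rewrite !mxE (negPf ji) andbF oppr0 mul0r.
  rewrite E in dTh.
  have cd := cvg_is_derive dTh.
  have hc : (fun n => h (k n)) @ \oo --> 0^'.
    move=> A /nbhs_ballP[eps /= eps0 HA].
    have /cvgrPdist_lt/(_ _ eps0)[n0 _ Hn] := @cvg_harmonic R.
    have kge n : (n <= k n)%N.
      by elim: n => // n IH; apply: leq_ltn_trans IH _; exact: ki.
    exists n0 => // n nn0 /=; apply: HA => /=; last by rewrite gt_eqF.
    by have := Hn (k n) (leq_trans nn0 (kge n)).
  have := cvg_comp _ _ hc cd; rewrite /comp => c1.
  have c2 := wk _ Lphi.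
  suff c3 : (fun n => dot (q (k n) tt) phi) @ \oo --> - dot f (partial i phi).
    by rewrite (cvg_unique _ c2 c3)// opprK.
  rewrite (_ : (fun n => dot (q (k n) tt) phi) = (fun n => (h (k n))^-1 *
    (dot f (fun x => phi (x + (h (k n) *: (1 : R) + 0) *: - e i)) -
     dot f (fun x => phi (x + 0 *: - e i))))); first exact: c1.
  apply/funext => n; rewrite [h _ *: (1 : R)]mulr1 addr0 scale0r.
  have LD := L2B (Lfs (h (k n))) Lf.
  rewrite /q dotZl// dotBl//; congr (_ * (_ - _)).
    have Lp1 : L2 (fun x => phi (x + h (k n) *: - e i)) by apply: test_L2; exact: test_shift.
    rewrite -[RHS]mul1r -(scaling_dot ler01 (leb_shift (h (k n) *: e i)) Lf Lp1).
    by congr (L2dot leb); apply/funext => x; rewrite scalerN addrK.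
  by congr (L2dot leb); apply/funext => x; rewrite addr0.
- have c := wk _ Lg.
  have g0 := dot_ge0 leb (g tt).
  (* Weak lower semicontinuity, by testing the quotients against their own limit. *)
  have : dot (g tt) (g tt) ^+ 2 <= K * dot (g tt) (g tt).
    have cc : (fun n => dot (q (k n) tt) (g tt) ^+ 2) @ \oo --> dot (g tt) (g tt) ^+ 2.
      by rewrite expr2; under eq_fun do rewrite expr2; exact: cvgM.
    rewrite -(cvg_lim _ cc)//; apply: limr_le; first by apply/cvg_ex; exists (dot (g tt) (g tt) ^+ 2).
    apply: nearW => n; apply: le_trans (dot_cauchy_schwarz (Lq _) Lg) _.
    exact: ler_wpM2r.
  have [->//|gn0] := eqVneq (dot (g tt) (g tt)) 0.
  by rewrite expr2 ler_pM2r// lt_def gn0.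
Qed.

(** The difference quotients of [f] are bounded by those of [U] and [V], so [wpd_of_shift] applies.
    Two inputs serve the modulus of a complex function; [V = 0] gives the absolute value. *)
Lemma H1j_of_lipschitz U V f : H1j U -> H1j V -> measurable_fun setT f ->
  (forall x, f x ^+ 2 <= U None x ^+ 2 + V None x ^+ 2) ->
  (forall x y, (f x - f y) ^+ 2 <= (U None x - U None y) ^+ 2 + (V None x - V None y) ^+ 2) ->
  exists W, [/\ H1j W, W None = f & forall i,
    dot (W (Some i)) (W (Some i)) <=
    dot (U (Some i)) (U (Some i)) + dot (V (Some i)) (V (Some i))].
Proof.
move=> HU HV mf fb fl; have [LU _] := HU; have [LV _] := HV.
have Lf : L2 f.
  split => //; apply: (intg_le (g := fun x => U None x ^+ 2 + V None x ^+ 2)).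
  - exact: measurable_funX.
  - by move=> x; rewrite ger0_norm// sqr_ge0.
  - by apply: intgD; [case: (LU None)|case: (LV None)].
have ex i : exists g, [/\ L2 g, wpd i f g & dot g g <=
    dot (U (Some i)) (U (Some i)) + dot (V (Some i)) (V (Some i))].
  apply: wpd_of_shift => //; first by rewrite addr_ge0// dot_ge0.
  move=> h; rewrite mulrDr.
  have sh g : L2 g -> L2 (fun x => g (x + h *: e i)) := scaling_L2 ler01 (leb_shift _).
  apply: le_trans (lerD (shift_bound_coord i h HU) (shift_bound_coord i h HV)).
  have LDU := L2B (sh _ (LU None)) (LU None); have LDV := L2B (sh _ (LV None)) (LV None).
  have LD := L2B (sh _ Lf) Lf.
  rewrite !dotE -RintD; [|by case: LDU|by case: LDV].
  apply: Rint_le => [||x]; [by case: LD|by apply: intgD; [case: LDU|case: LDV]|exact: fl].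
have [g gP] := choice ex.
exists (fun o => if o is Some i then g i else f); split => //.
  split; first by case => [i|] //; case: (gP i).
  by move=> i; case: (gP i).
by move=> i; case: (gP i).
Qed.

End sobolev_space.

(** * Weak derivatives under affine changes of variables *)

Section dot_sums.
Context {d} {T : measurableType d} {R : realType}.
Variable mu : {measure set T -> \bar R}.
Local Notation L2 := (L2 mu).
Local Notation dot := (L2dot mu).

Lemma dot_suml (I : Type) (s : seq I) (F : I -> T -> R) g :
  (forall i, L2 (F i)) -> L2 g ->
  dot (fun x => \sum_(i <- s) F i x) g = \sum_(i <- s) dot (F i) g.
Proof.
move=> LF Lg; elim: s => [|i s IH].
  by rewrite big_nil; under eq_fun do rewrite big_nil; rewrite dotC dot0r.
rewrite big_cons -IH; under eq_fun do rewrite big_cons.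
by rewrite dotDl//; exact: L2_sum.
Qed.

Lemma dot_sumr (I : Type) (s : seq I) (F : I -> T -> R) g :
  (forall i, L2 (F i)) -> L2 g ->
  dot g (fun x => \sum_(i <- s) F i x) = \sum_(i <- s) dot g (F i).
Proof.
by move=> LF Lg; rewrite dotC dot_suml//; apply: eq_bigr => i _; rewrite dotC.
Qed.

End dot_sums.

Section affine_jets.
Context {R : realType} {N : nat}.
Local Notation X := 'rV[R]_N.
Local Notation leb := (lebesgue_rV R N).
Local Notation L2 := (L2 leb).
Local Notation dot := (L2dot leb).
Local Notation jet := (@jet R N).
Implicit Types (f g phi : X -> R) (x y z v : X) (U V : jet).

Definition jcomp (T : 'M[R]_N) (c : X) U : jet := fun o =>
  if o is Some i then fun x => \sum_j T i j * U (Some j) (x *m T + c)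
  else fun x => U None (x *m T + c).

Lemma fL2_jcomp (T : 'M[R]_N) (c : X) (k : R) U : 0 <= k ->
  leb_scaling k (fun x => x *m T + c) -> fL2 leb U -> fL2 leb (jcomp T c U).
Proof.
move=> k0 hS LU [i|] /=; last exact: (scaling_L2 k0 hS (LU None)).
by apply: L2_sum => j; apply: L2Z; exact: (scaling_L2 k0 hS (LU (Some j))).
Qed.

(** The test function is pulled through the change of variables, [phi x = psi (x T + c)], and both
    integrals pick up the same factor [k]. *)
Lemma H1j_jcomp (T B : 'M[R]_N) (c : X) (k : R) U : 0 <= k -> T *m B = 1%:M ->
  leb_scaling k (fun x => x *m T + c) -> H1j U -> H1j (jcomp T c U).
Proof.
move=> k0 TB hS [LU WU]; split; first exact: fL2_jcomp hS LU.
move=> i phi tphi.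
have BT : B *m T = 1%:M by exact: mulmx1C.
pose psi y := phi (y *m B + (- (c *m B))).
have tpsi : test_function psi by exact: (test_affine _ BT).
have phiE x : phi x = psi (x *m T + c).
  by rewrite /psi mulmxDl addrK -mulmxA TB mulmx1.
have Lpsi := test_L2 tpsi.
have LS f : L2 f -> L2 (fun x => f (x *m T + c)) := scaling_L2 k0 hS.
have Lp j := LS _ (test_L2 (test_partial j tpsi)).
have -> : partial i phi = (fun x => \sum_j T i j * partial j psi (x *m T + c)).
  apply/funext => x; rewrite -(partial_affine T c i x (test_smooth tpsi)).
  by congr partial; apply/funext.
rewrite /jcomp dot_sumr; [|by move=> j; exact: L2Z|exact: LS].
rewrite dot_suml; [|by move=> j; apply: L2Z; exact: LS|exact: test_L2].
rewrite -sumrN; apply: eq_bigr => j _.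
rewrite dotZr//; last exact: LS.
rewrite dotZl//; [|exact: LS|exact: test_L2].
rewrite (scaling_dot k0 hS (LU None) (test_L2 (test_partial j tpsi))) WU//.
rewrite [in RHS](_ : phi = (fun x => psi (x *m T + c))); last by apply/funext.
by rewrite (scaling_dot k0 hS (LU (Some j)) Lpsi) !mulrN.
Qed.

Lemma dot_jcomp0 (T : 'M[R]_N) (c : X) (k : R) U V : 0 <= k ->
  leb_scaling k (fun x => x *m T + c) -> fL2 leb U -> fL2 leb V ->
  dot (jcomp T c U None) (jcomp T c V None) = k * dot (U None) (V None).
Proof. by move=> k0 hS LU LV; rewrite (scaling_dot k0 hS (LU None) (LV None)). Qed.

(** [T] is a similarity: [s = 1] for reflections and [s = l ^ 2] for dilations by [l]. *)
Lemma gdot_jcomp (T : 'M[R]_N) (c : X) (k s : R) U V : 0 <= k -> T^T *m T = s%:M ->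
  leb_scaling k (fun x => x *m T + c) -> fL2 leb U -> fL2 leb V ->
  gdot (jcomp T c U) (jcomp T c V) = s * k * gdot U V.
Proof.
move=> k0 TT hS LU LV.
have LS f : L2 f -> L2 (fun x => f (x *m T + c)) := scaling_L2 k0 hS.
rewrite /gdot /jcomp.
transitivity (\sum_i \sum_j \sum_l T i j * T i l * (k * dot (U (Some j)) (V (Some l)))).
  apply: eq_bigr => i _; rewrite dot_suml; last 2 first.
  - by move=> j; apply: L2Z; exact: LS.
  - by apply: L2_sum => j; apply: L2Z; exact: LS.
  apply: eq_bigr => j _; rewrite dotZl; [|exact: LS|by apply: L2_sum => l; apply: L2Z; exact: LS].
  rewrite dot_sumr; [|by move=> l; apply: L2Z; exact: LS|exact: LS].
  rewrite mulr_sumr; apply: eq_bigr => l _.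
  rewrite dotZr; [|exact: LS|exact: LS].
  by rewrite (scaling_dot k0 hS (LU (Some j)) (LV (Some l))) mulrA.
rewrite exchange_big/= mulr_sumr; apply: eq_bigr => j _.
rewrite exchange_big/= (bigD1 j)//= [X in _ + X]big1 ?addr0.
  rewrite -mulr_suml -mulrA; congr (_ * _).
  have := congr1 (fun M : 'M[R]_N => M j j) TT; rewrite !mxE eqxx mulr1n => <-.
  by apply: eq_bigr => i _; rewrite mxE.
move=> l lj; rewrite -mulr_suml.
have := congr1 (fun M : 'M[R]_N => M j l) TT; rewrite !mxE eq_sym (negPf lj) mulr0n.
by under eq_bigr do rewrite mxE; move=> ->; rewrite mul0r.
Qed.

End affine_jets.

(** * Reflections and polarization *)

Section reflection.
Context {R : realType} {N : nat}.
Local Notation X := 'rV[R]_N.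
Local Notation leb := (lebesgue_rV R N).
Local Notation L2 := (L2 leb).
Local Notation intg := (intg leb).
Local Notation dot := (L2dot leb).
Local Notation jet := (@jet R N).
Implicit Types (f g phi : X -> R) (x y z v : X) (U V : jet).

Definition inner x y : R := \sum_i x ord0 i * y ord0 i.

Lemma innerE x y : inner x y = (x *m y^T) ord0 ord0.
Proof. by rewrite mxE; apply: eq_bigr => i _; rewrite mxE. Qed.

Lemma inner_sqn x : inner x x = sqn x.
Proof. by apply: eq_bigr => i _; rewrite expr2. Qed.

Lemma innerDl x y z : inner (x + y) z = inner x z + inner y z.
Proof. by rewrite /inner -big_split; apply: eq_bigr => i _; rewrite mxE mulrDl. Qed.

Lemma innerZl (a : R) x z : inner (a *: x) z = a * inner x z.
Proof. by rewrite /inner mulr_sumr; apply: eq_bigr => i _; rewrite mxE mulrA. Qed.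

Lemma innerC x y : inner x y = inner y x.
Proof. by apply: eq_bigr => i _; rewrite mulrC. Qed.

Lemma sqnD x y : sqn (x + y) = sqn x + 2 * inner x y + sqn y.
Proof.
by rewrite -!inner_sqn innerDl !(innerC _ (x + y)) !innerDl (innerC y x); ring.
Qed.

Lemma sqnZ (a : R) x : sqn (a *: x) = a ^+ 2 * sqn x.
Proof. by rewrite -!inner_sqn innerZl innerC innerZl mulrA expr2. Qed.

Variables (nu : X) (c : R).
Hypothesis nu1 : sqn nu = 1.

(** Signed distance to a hyperplane with unit normal [nu]. For [c > 0] the origin lies on the
    negative side, [hneg]. *)
Definition hside x : R := inner x nu - c.

Definition hrefl_mx : 'M[R]_N := 1%:M - (2 : R) *: (nu^T *m nu).

Definition hrefl x : X := x *m hrefl_mx + (2 * c) *: nu.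

Lemma mul_hrefl_mx x : x *m hrefl_mx = x - (2 * inner x nu) *: nu.
Proof.
rewrite /hrefl_mx mulmxBr mulmx1 -scalemxAr mulmxA.
by rewrite [x *m nu^T]mx11_scalar -innerE mul_scalar_mx scalerA.
Qed.

Lemma hreflE x : hrefl x = x - (2 * hside x) *: nu.
Proof.
by rewrite /hrefl mul_hrefl_mx; apply/rowP => j; rewrite /hside !mxE; ring.
Qed.

Lemma hside_refl x : hside (hrefl x) = - hside x.
Proof.
rewrite {1}/hside hreflE innerDl -scaleNr innerZl inner_sqn nu1 /hside; ring.
Qed.

Lemma hreflK : involutive hrefl.
Proof.
move=> x; rewrite hreflE hside_refl hreflE -addrA -opprD -scalerDl.
by rewrite mulrN subrr scale0r subr0.
Qed.

Lemma hrefl_tr : hrefl_mx^T = hrefl_mx.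
Proof. by rewrite /hrefl_mx linearB/= trmx1 linearZ/= trmx_mul trmxK. Qed.

Lemma hrefl_sqr : hrefl_mx *m hrefl_mx = 1%:M.
Proof.
have H x : x *m hrefl_mx *m hrefl_mx = x.
  rewrite !mul_hrefl_mx innerDl -scaleNr innerZl inner_sqn nu1.
  by apply/rowP => j; rewrite !mxE; ring.
by apply/row_matrixP => i; rewrite row_mul rowE H rowE mulmx1.
Qed.

Lemma leb_hrefl : leb_scaling 1 hrefl.
Proof. by apply: leb_isometry; rewrite hrefl_tr hrefl_sqr. Qed.

Lemma smooth_hside : smooth hside.
Proof.
apply: (smoothD (f := fun x => inner x nu) (g := fun=> - c)); last exact: smooth_cst.
apply/smoothP => n; apply: (@Ck_sum _ _ _ _ n _ _ (fun i (x : X) => x ord0 i * nu ord0 i)) => i.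
exact: (CkM (Ck_coord n i) (Ck_cst _ n (nu ord0 i))).
Qed.

Lemma measurable_hside : measurable_fun setT hside.
Proof. by apply: continuous_measurable_rV; have [] := smooth_hside [::]. Qed.

Definition hneg : set X := [set x | hside x < 0].

Lemma measurable_hneg : measurable hneg.
Proof.
rewrite (_ : hneg = hside @^-1` `]-oo, 0[%classic).
  by rewrite -[X in measurable X]setTI; exact: measurable_hside.
by apply/seteqP; split => x; rewrite /hneg /= in_itv.
Qed.

End reflection.

(** * Steep symmetric steps built from the arctangent *)

Section atan_cutoff.
Context {R : realType}.

Lemma Dk_atan n : Dk n (@atan R).
Proof.
have cont : continuous (@atan R).
  by move=> x; exact: is_derive_continuous1 (is_derive1_atan x).
case: n => [|n]; split => // _; exists (fun x => (1 + x ^+ 2)^-1); split.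
  by move=> x; exact: is_derive1_atan.
apply: Ck_inv => [x|]; first by rewrite gt_eqF// ltr_wpDr ?sqr_ge0.
have id n' : Ck (fun _ : unit => 1 : R) n' (fun x : R => x).
  case: n' => [|n']; split => //; try by move=> x; exact: cvg_id.
  by move=> _; exists (fun=> 1); split; [move=> x; exact: is_derive_id|exact: Ck_cst].
rewrite (_ : (fun x : R => _) = (fun x => 1 + x * x)); last first.
  by apply/funext => x; rewrite expr2.
exact: (CkD (Ck_cst _ n (1 : R)) (CkM (id n) (id n))).
Qed.

Lemma atan_bound (t : R) : `|atan t| <= pi / 2.
Proof. by rewrite ler_norml !ltW// ?atan_gtNpi2 ?atan_ltpi2. Qed.

(* Symmetric in the sense that [step_down n (- t) = 1 - step_down n t]. *)
Definition step_down (n : nat) (t : R) : R := 2^-1 - atan (n.+1%:R * t) / pi.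

Definition step_down' (n : nat) (t : R) : R :=
  - (n.+1%:R / pi * (1 + (n.+1%:R * t) ^+ 2)^-1).

Lemma is_derive_step_down n (t : R) : is_derive t (1 : R) (step_down n) (step_down' n t).
Proof.
have h1 := is_derive_cmulf (n.+1%:R) (is_derive_id t (1 : R)).
have h2 := is_derive_compf h1 (is_derive1_atan (n.+1%:R * t)).
have h3 := is_derive_cmulf (- pi^-1) h2.
have h4 := is_derive_addf (is_derive_cstf (2^-1) t (1 : R)) h3.
have -> : step_down n = (fun y => 2^-1 + - pi^-1 * atan (n.+1%:R * y)).
  by apply/funext => y; rewrite /step_down mulrC mulNr.
by apply: (is_derive_eq h4); rewrite /step_down'; ring.
Qed.

Lemma Dk_step_down n m : Dk m (step_down n).
Proof.
have -> : step_down n = (fun y => 2^-1 + - pi^-1 * atan (n.+1%:R * y)).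
  by apply/funext => y; rewrite /step_down mulrC mulNr.
apply: CkD; first exact: Ck_cst.
apply: CkZ; apply: (Ck_comp (h := @atan R)); first exact: Dk_atan.
apply: CkZ; case: m => [|m]; split => //; try by move=> x; exact: cvg_id.
by move=> _; exists (fun=> 1); split; [move=> x; exact: is_derive_id|exact: Ck_cst].
Qed.

Lemma step_down_bound n (t : R) : `|step_down n t| <= 1.
Proof.
have p0 : (0 : R) < pi by exact: pi_gt0.
have := atan_bound (n.+1%:R * t); rewrite !ler_norml /step_down => /andP[h1 h2].
have k : atan (n.+1%:R * t) = atan (n.+1%:R * t) / pi * pi by rewrite divfK// gt_eqF.
move: h1 h2; rewrite {1 2}k; move: (_ / pi) => w h1 h2; nra.
Qed.

(** Uniform in [n]: the derivative of the steep step is at most of size [1 / |t|]. In the cut-off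
    argument it multiplies an odd test function of size [O(|t|)], which yields a majorant free of
    [n]. *)
Lemma step_down'_bound n (t : R) : `|step_down' n t| * `|t| <= pi^-1.
Proof.
have p0 : (0 : R) < pi by exact: pi_gt0.
have d0 : 0 < 1 + (n.+1%:R * t) ^+ 2 by rewrite ltr_wpDr ?sqr_ge0.
rewrite /step_down' normrN normrM normrM !normfV (gtr0_norm p0) (gtr0_norm d0).
rewrite ger0_norm// [leLHS](_ : _ = pi^-1 * (n.+1%:R * `|t|) / (1 + (n.+1%:R * t) ^+ 2)); last by ring.
rewrite ler_pdivrMr// ler_pM2l ?invr_gt0// -[(n.+1%:R * t) ^+ 2]real_normK ?num_real// normrM (ger0_norm (ler0n _ _)).
by move: (n.+1%:R * `|t|) => w; have := sqr_ge0 (2 * w - 1); lra.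
Qed.

Lemma step_down'_cvg (t : R) : (fun n => step_down' n t * t) @ \oo --> (0 : R).
Proof.
have [->|t0] := eqVneq t 0; first by under eq_fun do rewrite mulr0; exact: cvg_cst.
have p0 : (0 : R) < pi by exact: pi_gt0.
apply/cvgnP => e e0.
have e1 : 0 < e * pi * `|t| by rewrite !mulr_gt0// normr_gt0.
have /cvgrPdist_lt/(_ _ e1)[k _ H] := @cvg_harmonic R.
exists k => n kn; have /= := H n kn; rewrite sub0r normrN ger0_norm ?invr_ge0//.
rewrite subr0 => hn; rewrite normrM.
have n0 : (0 : R) < n.+1%:R by rewrite ltr0n.
have d0 : 0 < 1 + (n.+1%:R * t) ^+ 2 by rewrite ltr_wpDr ?sqr_ge0.
have t1 : 0 < `|t| by rewrite normr_gt0.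
rewrite /step_down' normrN normrM normrM !normfV (gtr0_norm p0) (gtr0_norm d0) (gtr0_norm n0).
apply: (@le_lt_trans _ _ ((n.+1%:R^-1) / (pi * `|t|))); last first.
  by rewrite ltr_pdivrMr ?mulr_gt0// mulrA.
rewrite mulrAC ler_pdivrMr//.
have -> : n.+1%:R^-1 / (pi * `|t|) * (1 + (n.+1%:R * t) ^+ 2) =
   n.+1%:R^-1 / (pi * `|t|) + n.+1%:R / pi * `|t|.
  rewrite mulrDr mulr1; congr (_ + _).
  have -> : (n.+1%:R * t) ^+ 2 = (n.+1%:R * `|t|) ^+ 2 by rewrite !exprMn real_normK ?num_real.
  clear -n0 t1 p0; move: (n.+1%:R) n0 (`|t|) t1 (pi : R) p0 => m m0 a a0 q q0; field.
  by rewrite !gt_eqF.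
by rewrite lerDr divr_ge0 ?invr_ge0 ?mulr_ge0// ltW.
Qed.

Lemma atan_cvgy (t : R) : 0 < t -> (fun n : nat => atan (n.+1%:R * t)) @ \oo --> pi / 2.
Proof.
move=> t0; have h : (fun n : nat => n.+1%:R * t) @ \oo --> +oo; last first.
  exact: (cvg_comp _ _ h (@cvgy_atan R)).
apply/cvgryPge => A; exists (Num.bound (`|A| / t)) => // n /= nb.
rewrite -ler_pdivrMr//; apply: (@le_trans _ _ (`|A| / t)).
  by rewrite ler_pM2r ?invr_gt0// ler_norm.
apply: ltW; apply: lt_le_trans (archi_boundP _) _; first by rewrite divr_ge0// ltW.
by rewrite ler_nat; exact: leq_trans nb _.
Qed.

Lemma step_down_cvg (t : R) : t != 0 ->
  (fun n => step_down n t) @ \oo --> ((t < 0)%R%:R : R).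
Proof.
have p0 : (pi : R) != 0 by rewrite gt_eqF// pi_gt0.
have E (u : R) : 0 < u -> (fun n : nat => atan (n.+1%:R * u) / pi) @ \oo --> (2^-1 : R).
  move=> u0; have -> : (2^-1 : R) = pi / 2 * pi^-1 by rewrite mulrAC divff// mul1r.
  by apply: cvgM (atan_cvgy u0) _; exact: cvg_cst.
move=> t0; have [tn|tp] := ltP t 0.
  have h := cvgD (cvg_cst (2^-1 : R)) (E _ (_ : 0 < - t)).
  rewrite (_ : (fun n => step_down n t) = (fun n : nat => 2^-1 + atan (n.+1%:R * - t) / pi)).
    have -> : (1%:R : R) = 2^-1 + 2^-1 by field.
    by apply: h; rewrite oppr_gt0.
  by apply/funext => n; rewrite mulrN atanN /step_down mulNr.
have tp' : 0 < t by rewrite lt_def t0.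
have h := cvgB (cvg_cst (2^-1 : R)) (E _ tp').
have -> : (false%:R : R) = 2^-1 - 2^-1 by rewrite subrr.
exact: h.
Qed.

End atan_cutoff.
Section polarization.
Context {R : realType} {N : nat}.
Local Notation X := 'rV[R]_N.
Local Notation leb := (lebesgue_rV R N).
Local Notation L2 := (L2 leb).
Local Notation intg := (intg leb).
Local Notation dot := (L2dot leb).
Local Notation jet := (@jet R N).
Implicit Types (f g phi : X -> R) (x y z v : X) (U V : jet).
Variables (nu : X) (c : R).
Hypothesis nu1 : sqn nu = 1.
Local Notation hs := (hside nu c).
Local Notation S := (hrefl nu c).
Local Notation H := (hneg nu c).

Lemma hside_shift x (t : R) : hs (x + t *: nu) = hs x + t.
Proof. by rewrite /hside innerDl innerZl inner_sqn nu1; ring. Qed.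

Lemma partial_hside i x : partial i hs x = nu ord0 i.
Proof.
suff [_ h] : is_derive x (delta_mx ord0 i : X) hs (nu ord0 i) by exact: h.
apply: is_derive_cvg; apply: cvg_near_cst; near=> h.
have h0 : h != 0 by near: h; exact: nbhs_dnbhs_neq.
rewrite /hside innerDl innerZl.
have -> : inner (delta_mx ord0 i) nu = nu ord0 i.
  rewrite /inner (bigD1 i)//= big1 ?addr0 => [|j ji]; first by rewrite !mxE !eqxx mul1r.
  by rewrite !mxE (negPf ji) andbF mul0r.
rewrite [X in _ * X](_ : _ = h * nu ord0 i); last by ring.
by rewrite mulKf.
Unshelve. all: by end_near. Qed.

(** The [n] translates of a bounded piece of the hyperplane by [(k / n) nu] are disjoint and stay in
    one cube, so [n] times its measure is bounded independently of [n]. *)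
Lemma hyperplane_null : {ae leb, forall x, hs x != 0}.
Proof.
pose Z r : set X := [set x | hs x = 0] `&` cube r.
have mhs : measurable_fun setT hs by exact: measurable_hside.
have mZ0 : measurable [set x : X | hs x = 0].
  rewrite (_ : [set x | _] = hs @^-1` [set 0]).
    by rewrite -[X in measurable X]setTI; apply: mhs => //; exact: measurable_set1.
  by apply/seteqP; split.
have mZ r : measurable (Z r) by apply: measurableI => //; exact: measurable_box.
have nui i : `|nu ord0 i| <= 1.
  rewrite -ler_sqr ?nnegrE// real_normK ?num_real// expr1n -nu1 /sqn (bigD1 i)//= lerDl.
  by apply: sumr_ge0 => j _; exact: sqr_ge0.
have Z0 (r : nat) : leb (Z r%:R) = 0%E.
  have bd (n : nat) : (n%:R%:E * leb (Z r%:R) <= leb (cube (r%:R + 1)))%E.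
    pose sh (k : 'I_n) : X := (k%:R / n%:R) *: nu.
    have E (k : 'I_n) : leb (Z r%:R) = (\int[leb]_x (\1_(Z r%:R) (x + sh k))%:E)%E.
      rewrite (ge0_scaling (f := fun x => (\1_(Z r%:R) x)%:E) ler01 (leb_shift (sh k)))//.
        by rewrite mul1e -leb_indic.
      by apply/measurable_EFinP; exact: measurable_indic.
    have mi (k : 'I_n) : measurable_fun setT (fun x : X => (\1_(Z r%:R) (x + sh k) : R)%:E).
      have m1 : measurable_fun setT (\1_(Z r%:R) : X -> R) by exact: measurable_indic.
      have h := scaling_meas (leb_shift (sh k)) m1.
      exact/measurable_EFinP.
    have -> : (n%:R%:E * leb (Z r%:R) = \int[leb]_x (\sum_(k < n) (\1_(Z r%:R) (x + sh k))%:E))%E.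
      rewrite ge0_integral_sum//.
      under eq_bigr do rewrite -E.
      have leoo : leb (Z r%:R) \is a fin_num.
        rewrite ge0_fin_numE//; apply: le_lt_trans (leb_box_lty (const_mx (- r%:R)) (const_mx r%:R)).
        by apply: le_measure; rewrite ?inE; [exact: mZ|exact: measurable_box|exact: subIsetr].
      by rewrite -(fineK leoo) sumEFin sumr_const card_ord -EFinM mulr_natl.
    rewrite leb_indic; last exact: measurable_box.
    apply: ge0_le_integral => //.
    - by move=> x _; apply: sume_ge0 => k _; rewrite lee_fin.
    - by apply: emeasurable_sum => k.
    - by apply/measurable_EFinP; apply: measurable_indic; exact: measurable_box.
    move=> x _; rewrite sumEFin lee_fin.
    have [[k hk]|nk] := pselect (exists k : 'I_n, Z r%:R (x + sh k)); last first.
      rewrite big1// => k _; rewrite indicE memNset// => hk; apply: nk; by exists k.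
    have n0 : (0 : R) < n%:R by rewrite ltr0n (leq_ltn_trans _ (ltn_ord k)).
    rewrite (bigD1 k)//= big1 ?addr0 => [|l lk].
      rewrite !indicE mem_set// mem_set//; apply/cubeP => i.
      have [_ /cubeP/(_ i)] := hk; rewrite !mxE => hi.
      have -> : x ord0 i = (x ord0 i + k%:R / n%:R * nu ord0 i) - k%:R / n%:R * nu ord0 i by ring.
      apply: le_trans (ler_normB _ _) _; apply: lerD => //.
      rewrite normrM ger0_norm ?divr_ge0//.
      apply: mulr_ile1 => //.
      by rewrite ler_pdivrMr// mul1r ler_nat ltnW.
    rewrite indicE memNset// => -[hl _].
    move: hk hl => [hk _]; rewrite /= !hside_shift in hk *.
    move=> hl; have /(congr1 (fun t => t * n%:R)) : k%:R / n%:R = l%:R / n%:R :> R by lra.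
    rewrite !divfK ?gt_eqF// => /eqP; rewrite eqr_nat => /eqP kl.
    by move: lk; rewrite -val_eqE/= kl eqxx.
  have c0 : leb (cube (r%:R + 1)) = ((2 * (r%:R + 1)) ^+ N)%:E by rewrite leb_cube// addr_ge0.
  have leoo : leb (Z r%:R) \is a fin_num.
    rewrite ge0_fin_numE//; apply: le_lt_trans (leb_box_lty (const_mx (- r%:R)) (const_mx r%:R)).
    by apply: le_measure; rewrite ?inE; [exact: mZ|exact: measurable_box|exact: subIsetr].
  have : 0 <= fine (leb (Z r%:R)) by rewrite fine_ge0.
  rewrite le_eqVlt => /predU1P[h0|m0]; first by rewrite -(fineK leoo) -h0.
  have := bd (Num.bound ((2 * (r%:R + 1)) ^+ N / fine (leb (Z r%:R)))).
  rewrite c0 -(fineK leoo) -EFinM lee_fin leNgt -ltr_pdivrMr// archi_boundP//.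
  by rewrite divr_ge0// ?exprn_ge0// ?mulr_ge0 ?addr_ge0// ltW.
have : {ae leb, forall x, forall r : nat, ~ Z r%:R x}.
  apply: ae_foralln => r; exists (Z r%:R); split; [exact: mZ|exact: Z0|].
  by move=> x /= /contrapT.
apply: filterS => x Hx; apply/eqP => hx.
have : [set: X] x by []; rewrite -bigcup_cube => -[n _ xn].
by apply: (Hx n).
Qed.

Definition jcut U : jet := fun o x => U o x * \1_H x.

Lemma smooth_step n : smooth (fun x => step_down n (hs x)).
Proof. by apply: smooth_comp; [exact: Dk_step_down|exact: smooth_hside]. Qed.

Lemma partial_step n i x :
  partial i (fun x => step_down n (hs x)) x = step_down' n (hs x) * nu ord0 i.
Proof.
rewrite (partial_comp i x (is_derive_step_down n)) ?partial_hside//.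
exact: smooth_hside.
Qed.

Lemma test_refl phi : test_function phi -> test_function (fun x => phi (S x)).
Proof. by move=> tphi; apply: (test_affine _ (hrefl_sqr nu1)). Qed.

(* Multiplying by a steep symmetric step creates no boundary term because an odd
   function has vanishing trace on the hyperplane. *)
Lemma H1j_cut U : H1j U -> (forall x, U None (S x) = - U None x) -> H1j (jcut U).
Proof.
move=> [LU WU] odd.
have mH : measurable H by exact: measurable_hneg.
split; first by move=> o; apply: L2_mul_indic.
move=> i phi tphi; have Lphi := test_L2 tphi.
have tdp := test_partial i tphi; have Ldp := test_L2 tdp.
have hS := leb_hrefl c nu1.
pose chi n x := step_down n (hs x).
have mchi n : measurable_fun setT (chi n).
  by apply: continuous_measurable_rV; have [] := smooth_step n [::].
have chi1 n x : `|chi n x| <= 1 by exact: step_down_bound.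
have chicvg : {ae leb, forall x, (fun n => chi n x) @ \oo --> (\1_H x : R)}.
  apply: filterS hyperplane_null => x /step_down_cvg; rewrite indicE.
  suff -> : (x \in H) = (hs x < 0) by [].
  by apply/idP/idP; rewrite inE.
have Lchi f n : L2 f -> L2 (fun x => chi n x * f x).
  move=> Lf; apply: (L2_dom _ _ Lf) => [|x]; first by apply: measurable_funM => //; case: Lf.
  by rewrite normrM ler_piMl.
have lim f g : L2 f -> L2 g ->
    (fun n => dot f (fun x => chi n x * g x)) @ \oo --> dot (fun x => f x * \1_H x) g.
  move=> Lf Lg.
  have [|||||_ cF] := @Rint_dct _ _ _ leb (fun n x => f x * (chi n x * g x))
    (fun x => f x * \1_H x * g x) (fun x => `|f x| * `|g x|).
  - by move=> n; apply: measurable_funM; [case: Lf|apply: measurable_funM => //; case: Lg].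
  - apply: measurable_funM; last by case: Lg.
    by apply: measurable_funM; [case: Lf|exact: measurable_indic].
  - apply: filterS chicvg => x hx.
    under eq_fun do rewrite mulrA.
    apply: cvgM; last exact: cvg_cst.
    by apply: cvgM; [exact: cvg_cst|].
  - by apply: (L2_intgM (f := fun x => `|f x|) (g := fun x => `|g x|)); exact: L2_norm.
  - apply: aeW => x n; rewrite !normrM ler_wpM2l// ler_piMl//.
  exact: cF.
have c1 := lim _ _ (LU None) Ldp; have c2 := lim _ _ (LU (Some i)) Lphi.
pose rho n x := step_down' n (hs x) * nu ord0 i.
(* Twice the odd part of [phi]. The step derivative [rho n] is even under [S] and [U None] is odd,
   so only this part contributes to the boundary term. *)
pose psi x := phi x + -1 * phi (S x).
have tpsi : test_function psi by apply: testD => //; apply: testZ; exact: test_refl.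
have trho n : test_function (fun x => rho n x * phi x).
  have -> : rho n = partial i (fun x => chi n x) by apply/funext => x; rewrite partial_step.
  by apply: testM => //; apply: smooth_partial; exact: smooth_step.
have c3 : (fun n => dot (U None) (fun x => rho n x * phi x)) @ \oo --> (0 : R).
  have E n : dot (U None) (fun x => rho n x * phi x) =
      2^-1 * \int[leb]_x (U None x * (rho n x * psi x)).
    have e1 := scaling_dot ler01 hS (LU None) (test_L2 (trho n)).
    have rS x : rho n (S x) = rho n x.
      by rewrite /rho /step_down' hside_refl// mulrN sqrrN.
    have e2 : dot (fun x => U None (S x)) (fun x => rho n (S x) * phi (S x)) =
        - dot (U None) (fun x => rho n x * phi (S x)).
      rewrite -dotNl//.
        by apply: eq_Rintegral => x _; rewrite odd rS.
      have := test_L2 (test_refl (trho n)).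
      by under eq_fun do rewrite rS.
    have LrS : L2 (fun x => rho n x * phi (S x)).
      by have := test_L2 (test_refl (trho n)); under eq_fun do rewrite rS.
    have e3 : \int[leb]_x (U None x * (rho n x * psi x)) =
       dot (U None) (fun x => rho n x * phi x) - dot (U None) (fun x => rho n x * phi (S x)).
      rewrite -dotBr//; last exact: test_L2.
      by apply: eq_Rintegral => x _; rewrite /psi; ring.
    rewrite e3; move: e1; rewrite e2 mul1r => e1; lra.
  rewrite (_ : (fun n => _) = (fun n => 2^-1 * \int[leb]_x (U None x * (rho n x * psi x)))); last exact/funext.
  rewrite -(mulr0 (2^-1)); apply: cvgMr.
  have [L L0 HL] := test_lipschitz tphi.
  have /testP[_ [r Hr]] := tpsi.
  (* [S x - x] is [- 2 (hs x) nu], so [psi] vanishes linearly on the hyperplane, which compensates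
     the steepness of [rho n]. *)
  have psib x : `|psi x| <= L * (2 * `|nu|) * `|hs x|.
    have := HL x (- (2 * hs x) *: nu); rewrite normrZ normrN normrM -[x + _]/(x + _).
    have -> : x + - (2 * hs x) *: nu = S x by rewrite hreflE scaleNr.
    rewrite distrC /psi mulN1r (ger0_norm (ler0n _ _)) => h; apply: le_trans h _.
    by rewrite le_eqVlt; apply/orP; left; apply/eqP; ring.
  pose K := pi^-1 * `|nu ord0 i| * (L * (2 * `|nu|)).
  have K0 : 0 <= K.
    by rewrite /K !mulr_ge0// ?invr_ge0// ltW// pi_gt0.
  have rb n x : `|rho n x * psi x| <= K * \1_(cube r) x.
    have [cx|nx] := pselect (cube r x); last by rewrite Hr// mulr0 normr0 mulr_ge0.
    rewrite indicE mem_set// mulr1 normrM /rho normrM.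
    have h1 := step_down'_bound n (hs x); have h2 := psib x.
    apply: le_trans (ler_wpM2l _ h2) _; first by rewrite mulr_ge0.
    have -> : `|step_down' n (hs x)| * `|nu ord0 i| * (L * (2 * `|nu|) * `|hs x|) =
      (`|step_down' n (hs x)| * `|hs x|) * (`|nu ord0 i| * (L * (2 * `|nu|))) by ring.
    rewrite /K -[X in _ <= X]mulrA; apply: ler_wpM2r => //.
    by rewrite !mulr_ge0.
  have mrho n : measurable_fun setT (rho n).
    have -> : rho n = partial i (fun x => chi n x) by apply/funext => x; rewrite partial_step.
    by apply: continuous_measurable_rV; have [] := smooth_partial i (smooth_step n) [::].
  have [|||||_ cF] := @Rint_dct _ _ _ leb (fun n x => U None x * (rho n x * psi x))
    (fun x => 0) (fun x => `|U None x| * (K * \1_(cube r) x)).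
  - move=> n; apply: measurable_funM; first by case: (LU None).
    by apply: measurable_funM => //; exact: test_meas.
  - exact: measurable_cst.
  - apply: aeW => x; rewrite -(mulr0 (U None x)); apply: cvgMr.
    have cz := step_down'_cvg (hs x).
    have [hx0|hx0] := eqVneq (hs x) 0.
      have p0 : psi x = 0.
        by apply/eqP; rewrite -normr_le0; apply: le_trans (psib x) _; rewrite hx0 normr0 mulr0.
      by under eq_fun do rewrite p0 mulr0; exact: cvg_cst.
    rewrite (_ : (fun n => rho n x * psi x) =
      (fun n => (nu ord0 i * psi x / hs x) * (step_down' n (hs x) * hs x))).
      by rewrite -(mulr0 (nu ord0 i * psi x / hs x)); apply: cvgMr.
    by apply/funext => n; rewrite /rho; field.
  - apply: (L2_intgM (f := fun x => `|U None x|)); first exact: L2_norm.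
    by apply: L2Z; apply: L2_indic; [exact: measurable_box|exact: leb_box_lty].
  - by apply: aeW => x n; rewrite normrM ler_wpM2l.
  by rewrite Rint0 in cF.
have key n : dot (U None) (fun x => chi n x * partial i phi x) +
   dot (U None) (fun x => rho n x * phi x) = - dot (U (Some i)) (fun x => chi n x * phi x).
  rewrite -WU; last by apply: testM => //; exact: smooth_step.
  rewrite -dotDr//; [|exact: Lchi|exact: test_L2].
  apply: eq_Rintegral => x _; rewrite partialM; [|exact: smooth_step|exact: test_smooth].
  by rewrite /rho -partial_step addrC.
have c4 := cvgD c1 c3; rewrite addr0 in c4.
have c5 : (fun n => dot (U None) (fun x => chi n x * partial i phi x) +
    dot (U None) (fun x => rho n x * phi x)) @ \oo --> - dot (jcut U (Some i)) phi.
  rewrite (_ : (fun n => _) = (fun n => - dot (U (Some i)) (fun x => chi n x * phi x))).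
    exact: cvgN.
  by apply/funext => n; exact: key.
have c6 : (fun n => dot (U None) (fun x => chi n x * partial i phi x) +
    dot (U None) (fun x => rho n x * phi x)) @ \oo --> dot (jcut U None) (partial i phi).
  exact: c4.
exact: cvg_unique c6 c5.
Qed.

(** Multiply by [bump (hs x)], smooth and positive exactly where [hs x > 0]: the integration by
    parts then pairs [U None] only with functions living where it vanishes. *)
Lemma jet_local U i : H1j U -> (forall x, 0 < hs x -> U None x = 0) ->
  {ae leb, forall x, 0 < hs x -> U (Some i) x = 0}.
Proof.
move=> [LU WU] U0.
have dbump t : is_derive t (1 : R) bump (bumpP ('X^2 * (1 - 1^`())) t).
  by rewrite bumpE; exact: is_derive_bumpP.
have sb : smooth (fun x => bump (hs x)).
  by apply: smooth_comp; [exact: Dk_bump|exact: smooth_hside].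
have mb : measurable_fun setT (fun x => bump (hs x)).
  by apply: continuous_measurable_rV; have [] := sb [::].
have : {ae leb, forall x, U (Some i) x * bump (hs x) = 0}.
  apply: fundamental_lemma => [|phi tphi].
    apply: (L2_dom _ _ (LU (Some i))) => [|x].
      by apply: measurable_funM => //; case: (LU (Some i)).
    by rewrite normrM ler_piMr// ger0_norm ?bump_ge0 ?bump_le1.
  have tb := testM tphi sb.
  have : dot (U None) (partial i (fun x => bump (hs x) * phi x)) = 0.
    rewrite -(@Rint0 _ _ _ leb); apply: eq_Rintegral => x _.
    have [hx|hx] := ltP 0 (hs x); first by rewrite U0// mul0r.
    rewrite partialM; [|exact: sb|exact: test_smooth].
    rewrite (partial_comp i x dbump); last exact: smooth_hside.
    by rewrite {1}/bumpP ltNge hx/= mul0r mul0r (bump_eq0 hx) mul0r addr0 mulr0.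
  rewrite WU// => /eqP; rewrite oppr_eq0 => /eqP <-.
  by apply: eq_Rintegral => x _; rewrite mulrA.
apply: filterS => x /eqP; rewrite mulf_eq0 => /orP[/eqP//|/eqP h hx].
by have := bump_gt0 hx; rewrite h ltxx.
Qed.

Definition polarize f x : R :=
  if hs x < 0 then Num.max (f x) (f (S x)) else
  if 0 < hs x then Num.min (f x) (f (S x)) else f x.

(** Let [tau] be composition with the reflection and let [G] be the odd function [F = U - tau U] cut
    to the negative side. The polarization is [(U + tau U + A - tau A) / 2] with [A = |G|]. Here
    [U + tau U] is orthogonal to [A - tau A], [A] is orthogonal to [tau A], and
    [2 |A|^2 <= 2 |G|^2 <= |F|^2], which gives the norm bound. *)
Lemma polarize_H1 U : H1j U ->
  exists W, [/\ H1j W, W None = polarize (U None) & fdot leb W W <= fdot leb U U].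
Proof.
move=> HU; have hP := @H1j_hilbert R N; have [LU WU] := HU.
have hS := leb_hrefl c nu1.
have TT : (hrefl_mx nu)^T *m hrefl_mx nu = 1%:M by rewrite hrefl_tr hrefl_sqr.
pose tau U := jcomp (hrefl_mx nu) ((2 * c) *: nu) U.
have Htau V : H1j V -> H1j (tau V).
  by move=> HV; apply: (H1j_jcomp (B := hrefl_mx nu) ler01 _ hS HV); exact: hrefl_sqr.
have tauE V1 V2 : H1j V1 -> H1j V2 -> fdot leb (tau V1) (tau V2) = fdot leb V1 V2.
  move=> [L1 _] [L2' _]; rewrite !fdotE (dot_jcomp0 ler01 hS L1 L2').
  by rewrite (gdot_jcomp ler01 TT hS L1 L2') !mul1r.
have tauK V : tau (tau V) = V.
  apply/funext => -[i|]; apply/funext => x; last by rewrite /tau /= -/(S _) -/(S _) hreflK.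
  rewrite /tau /=.
  under eq_bigr do rewrite mulr_sumr.
  rewrite exchange_big/= -/(S _) -/(S _) hreflK//.
  rewrite (bigD1 i)//= [X in _ + X]big1 ?addr0.
    under eq_bigr do rewrite mulrA.
    rewrite -mulr_suml; have := congr1 (fun M : 'M[R]_N => M i i) (hrefl_sqr nu1).
    by rewrite !mxE eqxx => ->; rewrite mul1r.
  move=> j ji; under eq_bigr do rewrite mulrA.
  rewrite -mulr_suml; have := congr1 (fun M : 'M[R]_N => M i j) (hrefl_sqr nu1).
  by rewrite !mxE eq_sym (negPf ji) => ->; rewrite mul0r.
have tau2 V1 V2 : H1j V1 -> H1j V2 -> fdot leb (tau V1) V2 = fdot leb V1 (tau V2).
  by move=> H1 H2; rewrite -(tauE (tau V1) V2 (Htau _ H1) H2) tauK.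
pose F := fadd U (fscale (-1) (tau U)).
have HtU := Htau _ HU.
have HF : H1j F by apply: (hilbertD hP) => //; exact: (hilbertZ hP).
have FE x : F None x = U None x - U None (S x) by rewrite /F /fadd /fscale /tau /= mulN1r.
have oddF x : F None (S x) = - F None x by rewrite !FE hreflK// opprB.
have HG := H1j_cut HF oddF; set G := jcut F in HG.
pose O : jet := fun=> fun=> 0.
have HO : H1j O.
  split => [k|i phi tphi]; first exact: L2_0.
  by rewrite /O !(dotC _ (fun=> 0)) !dot0r oppr0.
have [LG _] := HG.
have [||| A [HA A0 Ai]] := @H1j_of_lipschitz R N G O (fun x => `|G None x|) HG HO.
- by apply: measurableT_comp => //; case: (LG None).
- by move=> x; rewrite real_normK ?num_real// lerDl sqr_ge0.
- move=> x y; rewrite /O subrr expr0n addr0 -[leLHS]real_normK ?num_real//.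
  by rewrite -[leRHS]real_normK ?num_real// ler_sqr ?nnegrE//; exact: ler_dist_dist.
have [LA _] := HA; have HtA := Htau _ HA.
have O0 : dot (fun=> 0) (fun=> 0) = 0 by exact: dot0r.
have AG : fdot leb A A <= fdot leb G G.
  rewrite !fdotE; apply: lerD.
    rewrite A0 !dotE le_eqVlt; apply/orP; left; apply/eqP; apply: eq_Rintegral => x _.
    by rewrite real_normK ?num_real.
  by apply: ler_sum => i _; apply: le_trans (Ai i) _; rewrite /O O0 addr0.
have tauF k x : tau F k x = - F k x.
  have tauD : tau F k x = tau U k x - tau (tau U) k x.
    rewrite /F; case: k => [i|]; rewrite /tau /= /fadd /fscale /=; last by rewrite mulN1r.
    by rewrite -sumrB; apply: eq_bigr => j _; ring.
  by rewrite tauD tauK /F /fadd /fscale; ring.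
have tauG k x : tau G k x = - F k x * \1_H (S x).
  rewrite -tauF /G /jcut; case: k => [i|]; rewrite /tau /= -?/(S _)//.
  by rewrite mulr_suml; apply: eq_bigr => j _; rewrite mulrA.
have Hdisj x : \1_H x + \1_H (S x) <= 1 :> R.
  rewrite !indicE; case: (boolP (x \in H)) => [|_]; last first.
    by rewrite add0r; case: (_ \in _).
  rewrite inE => hx; rewrite memNset ?addr0// /hneg /= hside_refl// oppr_lt0.
  by apply/negP; rewrite -leNgt ltW.
have indic_sq (x : X) (B : set X) : (\1_B x : R) * \1_B x = \1_B x.
  by rewrite indicE; case: (_ \in _); rewrite ?mulr1 ?mulr0.
have HtG := Htau _ HG; have [LtG _] := HtG; have [LF _] := HF.
have mH : measurable H by exact: measurable_hneg.
have GF : 2 * fdot leb G G <= fdot leb F F.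
  have -> : 2 * fdot leb G G = fdot leb G G + fdot leb (tau G) (tau G) by rewrite tauE//; ring.
  rewrite /fdot -big_split; apply: ler_sum => k _ /=.
  rewrite /L2dot -RintD; [|exact: L2_intgM..].
  apply: Rint_le => [||x]; [by apply: intgD; exact: L2_intgM|exact: L2_intgM|].
  rewrite tauG /G /jcut.
  have -> : F k x * \1_H x * (F k x * \1_H x) + - F k x * \1_H (S x) * (- F k x * \1_H (S x)) =
     F k x ^+ 2 * ((\1_H x * \1_H x) + (\1_H (S x) * \1_H (S x))) by ring.
  by rewrite !indic_sq -expr2 ler_piMr ?sqr_ge0.
have A00 x : 0 < hs x -> A None x = 0.
  move=> hx; rewrite A0 /G /jcut indicE memNset ?mulr0 ?normr0//.
  by rewrite /hneg /=; apply/negP; rewrite -leNgt ltW.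
(* [A] and [tau A] live on opposite sides of the hyperplane, derivatives included by [jet_local],
   and the hyperplane itself is null. *)
have AtA : fdot leb A (tau A) = 0.
  have z0 k : {ae leb, forall x, A k x * tau A k x = 0}.
    have loc k' : {ae leb, forall x, 0 < hs x -> A k' x = 0}.
      by case: k' => [i|]; [exact: jet_local|exact: aeW].
    have loc' : {ae leb, forall x, forall k', 0 < hs x -> A k' x = 0}.
      by apply: filter_forall => k'; exact: loc.
    have locS : {ae leb, forall x, forall k', 0 < hs (S x) -> A k' (S x) = 0}.
      exact: (scaling_ae hS loc').
    near=> x.
    have l1 : forall k', 0 < hs x -> A k' x = 0 by near: x; exact: loc'.
    have l2 : forall k', 0 < hs (S x) -> A k' (S x) = 0 by near: x; exact: locS.
    have l3 : hs x != 0 by near: x; exact: hyperplane_null.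
    have [hx|hx] := ltP 0 (hs x); first by rewrite l1// mul0r.
    have hSx : 0 < hs (S x) by rewrite hside_refl// oppr_gt0 lt_neqAle l3.
    rewrite [tau A k x](_ : _ = 0) ?mulr0//.
    rewrite /tau; case: k => [i|] /=; last by rewrite -/(S x) l2.
    by rewrite big1// => j _; rewrite -/(S x) l2// mulr0.
  rewrite /fdot big1// => k _; rewrite -(@Rint0 _ _ _ leb); apply: Rint_ae => //.
    by apply: measurable_funM; apply: L2_meas; [exact: LA|case: HtA].
pose W := fscale (2^-1) (fadd (fadd U (tau U)) (fadd A (fscale (-1) (tau A)))).
exists W; split.
- apply: (hilbertZ hP); apply: (hilbertD hP); first exact: (hilbertD hP).
  by apply: (hilbertD hP) => //; exact: (hilbertZ hP).
- apply/funext => x; rewrite /W /fscale /fadd mulN1r -[tau A None x]/(A None (S x)).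
  rewrite -[tau U None x]/(U None (S x)) A0 /G /jcut oddF FE /polarize !indicE.
  have inH y : (y \in H) = (hs y < 0) by apply/idP/idP; rewrite inE.
  rewrite !inH hside_refl// oppr_lt0.
  have [hx|hx|hx] := ltgtP (hs x) 0.
  + rewrite mulr1 mulr0 normr0 subr0.
    have [h|h] := leP (U None x) (U None (S x)).
      by rewrite ler0_norm ?subr_le0//; field.
    by rewrite gtr0_norm ?subr_gt0//; field.
  + rewrite mulr1 mulr0 normr0 add0r normrN.
    have [h|h] := leP (U None x) (U None (S x)).
      by rewrite ler0_norm ?subr_le0//; field.
    by rewrite gtr0_norm ?subr_gt0//; field.
  + have -> : S x = x by rewrite hreflE hx mulr0 scale0r subr0.
    by rewrite !mulr0 normr0 subr0 addr0; field.
have LtU : H1j (tau U) by [].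
have mA : H1j (fscale (-1) (tau A)) by exact: (hilbertZ hP).
have d1 : H1j (fadd U (tau U)) by exact: (hilbertD hP).
have d2 : H1j (fadd A (fscale (-1) (tau A))) by exact: (hilbertD hP).
have d3 : H1j (fadd (fadd U (tau U)) (fadd A (fscale (-1) (tau A)))) by exact: (hilbertD hP).
have m3 : H1j (fscale (-1) (tau U)) by exact: (hilbertZ hP).
have FFE : fdot leb F F = 2 * fdot leb U U - 2 * fdot leb U (tau U).
  rewrite /F !(ipDl hP, ipDr hP, ipZl hP, ipZr hP)//.
  by rewrite tauE// tau2//; ring.
have WWE : fdot leb W W = 4^-1 * (2 * fdot leb U U + 2 * fdot leb U (tau U) + 2 * fdot leb A A).
  rewrite /W (ipZl hP)//; last exact: (hilbertZ hP).
  rewrite (ipZr hP)//.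
  rewrite !(ipDl hP, ipDr hP)// !(ipZl hP, ipZr hP)//.
  rewrite (tauE U U)// (tauE U A)// (tauE A U)// (tauE A A)// (tau2 U U)// (tau2 U A)// (tau2 A U)// (tau2 A A)// AtA.
  by field.
rewrite WWE; move: AG GF; rewrite FFE; lra.
Unshelve. all: by end_near. Qed.

End polarization.
(** * The weight |x|^-b and the compact weighted embedding *)

Section weight.
Context {R : realType} {N : nat}.
Variable b : R.
Hypotheses (b0 : 0 < b) (bN : b < N%:R).
Local Notation X := 'rV[R]_N.
Local Notation leb := (lebesgue_rV R N).
Local Notation intg := (intg leb).

Definition wt (x : X) : R := euclid_norm x `^ (- b).

Lemma wt_ge0 x : 0 <= wt x. Proof. exact: powR_ge0. Qed.

Lemma measurable_wt : measurable_fun setT wt.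
Proof. by apply: (measurableT_comp (measurable_powR (- b))); exact: measurable_euclid. Qed.

Lemma wt_far r x : 0 < r -> ~ cube r x -> wt x <= r `^ (- b).
Proof.
move=> r0 nx; have [i xi] : exists i, r < `|x ord0 i|.
  apply/not_existsP => h; apply: nx; apply/cubeP => i.
  by rewrite leNgt; apply/negP; exact: h.
have rx : r <= euclid_norm x by apply: ltW; apply: lt_le_trans xi (coord_le_euclid x i).
rewrite /wt !powRN lef_pV2 ?posrE ?powR_gt0//; last exact: lt_le_trans rx.
by apply: ge0_ler_powR; rewrite ?nnegrE ?(ltW r0) ?(ltW b0) ?euclid_norm_ge0.
Qed.

Lemma euclid_norm0 : euclid_norm (0 : X) = 0.
Proof. by rewrite /euclid_norm big1 ?sqrtr0// => i _; rewrite mxE expr0n. Qed.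

(** [powR] sends base [0] and a nonzero exponent to [0], so the weight is finite at its singularity
    and the shell decomposition below is exact at the origin too. *)
Lemma wt0 : wt 0 = 0.
Proof. by rewrite /wt euclid_norm0 powR0// oppr_eq0 gt_eqF. Qed.

Let h (k : nat) : R := 2^-1 ^+ k.
Let h0 k : 0 < h k. Proof. by rewrite exprn_gt0// invr_gt0. Qed.
Let hS k : h k.+1 <= h k. Proof. by rewrite /h exprS ler_piMl ?exprn_ge0 ?invr_ge0// invf_le1// ler1n. Qed.
Let hle j k : (j <= k)%N -> h k <= h j.
Proof. by move=> /subnK <-; elim: (k - j)%N => // n IH; apply: le_trans (hS _) IH. Qed.
Let s := N%:R - b.
Let s0 : 0 < s. Proof. by rewrite subr_gt0. Qed.
Let q : R := 2^-1 `^ s.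

Lemma powR_exprC (a t : R) k : 0 <= a -> (a ^+ k) `^ t = (a `^ t) ^+ k.
Proof. by move=> a0; rewrite -powR_mulrn// powRAC powR_mulrn// powR_ge0. Qed.

Lemma powR_lt1 (a t : R) : 0 <= a -> a < 1 -> 0 < t -> a `^ t < 1.
Proof.
by move=> a0 a1 t0; have := @gt0_ltr_powR R t t0 a 1; rewrite powR1 !nnegrE; apply.
Qed.

Let q1 : q < 1. Proof. by apply: powR_lt1; rewrite ?invf_lt1 ?ltr1n. Qed.

Lemma cube_mono r1 r2 : r1 <= r2 -> cube r1 `<=` (cube r2 : set X).
Proof. by move=> r12 x /cubeP xr; apply/cubeP => i; exact: le_trans (xr i) r12. Qed.

Lemma intg_cube r : intg (\1_(cube r) : X -> R).
Proof. by apply: intg_indic; [exact: measurable_box|exact: leb_box_lty]. Qed.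

Lemma Rint_cube r : 0 <= r -> \int[leb]_x (\1_(cube r) x : R) = (2 * r) ^+ N.
Proof.
move=> r0; have := leb_cube (N := N) r0; rewrite leb_indic; last exact: measurable_box.
by rewrite -EFin_Rint; [move=> [->]|exact: intg_cube].
Qed.

(** On the shell between the cubes of radius [h] and [h / 2] the weight is at most [2 ^ b h ^ (- b)]
    and the volume at most [(2 h) ^ N]; summing over dyadic [h] gives a geometric series of ratio
    [q = 2 ^ (b - N)]. *)
Definition wt_const : R := 2 `^ b * 2 ^+ N * (1 - q)^-1.

Let shell j n x : R := wt x * (\1_(cube (h j)) x - \1_(cube (h (j + n))) x).

Let indic_le k l (x : X) : (k <= l)%N -> \1_(cube (h l)) x <= \1_(cube (h k)) x :> R.
Proof.
move=> kl; rewrite !indicE ler_nat; case: (boolP (x \in cube (h l))) => //.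
by rewrite inE => /(cube_mono (hle kl)) xk; rewrite mem_set.
Qed.

Let shell_ge0 j n x : 0 <= shell j n x.
Proof. by rewrite mulr_ge0 ?wt_ge0// subr_ge0 indic_le// leq_addr. Qed.

Let m1 r : measurable_fun setT (\1_(cube r) : X -> R).
Proof. by apply: measurable_indic; exact: measurable_box. Qed.

Let mshell j n : measurable_fun setT (shell j n).
Proof. by apply: measurable_funM; [exact: measurable_wt|apply: measurable_funB]. Qed.

Let shellS j n x : shell j n.+1 x <=
  shell j n x + (h (j + n).+1) `^ (- b) * \1_(cube (h (j + n))) x.
Proof.
rewrite /shell addnS.
have -> : wt x * (\1_(cube (h j)) x - \1_(cube (h (j + n).+1)) x) =
   wt x * (\1_(cube (h j)) x - \1_(cube (h (j + n))) x) +
   wt x * (\1_(cube (h (j + n))) x - \1_(cube (h (j + n).+1)) x) by ring.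
rewrite lerD2l !indicE; case: (boolP (x \in cube (h (j + n).+1))) => [xS|].
  have := @indic_le _ _ x (leqnSn (j + n)); rewrite !indicE xS.
  by case: (_ \in _) => /=; rewrite ?subrr ?mulr0 ?mulr1 ?powR_ge0// ler10.
rewrite notin_setE subr0 => nx; case: (_ \in _); rewrite ?mulr0// !mulr1.
by apply: wt_far.
Qed.

Let shell_bound j n : intg (shell j n) /\
  \int[leb]_x shell j n x <= 2 `^ b * 2 ^+ N * (h j) `^ s * \sum_(k < n) q ^+ k.
Proof.
elim: n => [|n [IH1 IH2]].
  have -> : shell j 0 = fun=> 0 by apply/funext => x; rewrite /shell addn0 subrr mulr0.
  by rewrite big_ord0 mulr0 Rint0; split => //; exact: intg0.
have i1 := intgZ ((h (j + n).+1) `^ (- b)) (intg_cube (h (j + n))).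
have i2 : intg (shell j n.+1).
  by apply: intg_le (intgD IH1 i1) => // x; rewrite ger0_norm.
split => //; apply: le_trans (Rint_le i2 (intgD IH1 i1) (shellS j n)) _.
rewrite RintD// RintZ; last exact: intg_cube.
rewrite Rint_cube; last exact: ltW.
rewrite big_ord_recr/= mulrDr lerD// le_eqVlt; apply/orP; left; apply/eqP.
rewrite {1}/h exprS powRM ?exprn_ge0 ?invr_ge0// -/(h (j + n)).
have -> : 2^-1 `^ (- b) = 2 `^ b :> R by rewrite -powR_inv1// -powRrM mulrNN mul1r.
rewrite exprMn.
rewrite -[h (j + n) ^+ N]powR_mulrn; last exact: ltW.
have -> : h (j + n) `^ N%:R = h (j + n) `^ s * h (j + n) `^ b.
  by rewrite -powRD ?subrK// (gt_eqF (h0 _)) implybT.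
rewrite powRN {2}/h exprD powRM ?exprn_ge0 ?invr_ge0// -/(h j) (powR_exprC _ n) ?invr_ge0// -/q.
have hb : h (j + n) `^ b != 0 by rewrite gt_eqF// powR_gt0.
by field.
Qed.

(** The shells exhaust the cube away from the origin, and the uniform bound on their integrals
    passes to the limit by Fatou. *)
Lemma wt_cube k : (\int[leb]_x (wt x * \1_(cube (2^-1 ^+ k)) x)%:E <=
  (wt_const * (2^-1 ^+ k) `^ (N%:R - b))%:E)%E.
Proof.
apply: (@fatou_bound _ _ _ leb (shell k) _ _ 0) => //.
- by apply: measurable_funM => //; exact: measurable_wt.
- by move=> x; rewrite mulr_ge0 ?wt_ge0// indicE.
- apply: aeW => x; have [->|x0] := eqVneq x 0.
    by rewrite /shell wt0 mul0r; under eq_fun do rewrite mul0r; exact: cvg_cst.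
  rewrite -[X in _ --> X](subr0 (wt x * _)).
  have [i xi] : exists i, x ord0 i != 0.
    apply/not_existsP => hx; move/eqP: x0; apply; apply/rowP => i; rewrite mxE.
    by apply/eqP; apply: contrapT => /negP; exact: hx.
  apply: cvg_near_cst; near=> n.
  rewrite /shell [X in _ - X]indicE memNset ?subr0//.
  move=> /cubeP /(_ i); apply/negP; rewrite -ltNge.
  apply: le_lt_trans (hle (leq_addl k n)) _.
  near: n.
  have : h @ \oo --> 0 by apply: cvg_expr; rewrite ger0_norm ?invr_ge0// invf_lt1// ltr1n.
  by move/cvgr_lt; apply; rewrite normr_gt0.
- move=> n _; have [i1 i2] := shell_bound k n.
  rewrite -EFin_Rint// lee_fin; apply: le_trans i2 _.
  rewrite /wt_const -/(h k) -/s -!mulrA ler_pM2l ?powR_gt0// ler_pM2l ?exprn_gt0//.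
  rewrite mulrC ler_pM2r ?powR_gt0//.
  have q1' : 0 < 1 - q by rewrite subr_gt0.
  rewrite -(ler_pM2r q1') mulVf ?gt_eqF//.
  have -> : (\sum_(i < n) q ^+ i) * (1 - q) = 1 - q ^+ n.
    by rewrite mulrC -opprB -(opprB (q ^+ n)) subrX1 mulNr.
  by rewrite gerBl exprn_ge0// powR_ge0.
Unshelve. all: by end_near. Qed.

Lemma wt_const_ge0 : 0 <= wt_const.
Proof. by rewrite !mulr_ge0 ?powR_ge0// invr_ge0 subr_ge0 ltW. Qed.

Lemma intg_wt_cube r : intg (fun x => wt x * \1_(cube r) x).
Proof.
have mw r' : measurable_fun setT (fun x => wt x * \1_(cube r') x).
  by apply: measurable_funM => //; exact: measurable_wt.
have i1 : intg (fun x => wt x * \1_(cube 1) x).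
  apply: intg_lty => // [x|]; first by rewrite mulr_ge0 ?wt_ge0// indicE.
  by have := wt_cube 0; rewrite expr0 => /le_lt_trans; apply; exact: ltry.
apply: intg_le (intgD i1 (intg_cube r)) => // x.
rewrite ger0_norm ?mulr_ge0 ?wt_ge0 ?indicE//.
case: (x \in cube r); rewrite ?mulr0 ?mulr1 ?addr0; last by rewrite mulr_ge0 ?wt_ge0.
case: (boolP (x \in cube 1)) => [_|]; first by rewrite mulr1 lerDl.
rewrite notin_setE mulr0 add0r => /wt_far /le_trans; apply => //.
by rewrite powR1.
Qed.

End weight.

(** * Averages over small sets *)

Section averages.
Context {R : realType} {N : nat}.
Local Notation X := 'rV[R]_N.
Local Notation leb := (lebesgue_rV R N).
Local Notation intg := (intg leb).
Local Notation L2 := (L2 leb).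
Local Notation dot := (L2dot leb).
Local Notation jet := (option 'I_N -> X -> R).
Local Open Scope ring_scope.

Definition vol (E : set X) : R := \int[leb]_x (\1_E x : R).

(** [E] is a set near the origin, translated to [x]. It is kept general because cubes serve for the
    embedding and Euclidean balls, stable under reflections, for radial monotonicity. *)
Definition avg (E : set X) (u : X -> R) (x : X) : R :=
  (vol E)^-1 * dot (\1_E) (fun z => u (z + x)).

Definition osc (E : set X) (u : X -> R) (x : X) : R :=
  \int[leb]_z (\1_E z * (u (z + x) - u x) ^+ 2).

Lemma shift_L2 u (x : X) : L2 u -> L2 (fun z => u (z + x)).
Proof. exact: (scaling_L2 ler01 (leb_shift x)). Qed.

Section one_set.
Variable E : set X.
Hypotheses (mE : measurable E) (fE : (leb E < +oo)%E).

Lemma vol_ge0 : 0 <= vol E.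
Proof. by apply: Rint_ge0 => x; rewrite indicE. Qed.

Lemma L2_vol : L2 (\1_E). Proof. exact: L2_indic. Qed.

Lemma dot_vol : dot (\1_E) (\1_E) = vol E.
Proof. by apply: eq_Rintegral => x _; rewrite indicE -natrM mulnb andbb. Qed.

Lemma L2_osc u (x : X) (c : R) : L2 u -> L2 (fun z => (u (z + x) - c) * \1_E z).
Proof.
move=> Lu; have := L2B (L2_mul_indic mE (shift_L2 x Lu)) (L2Z c L2_vol).
by congr (L2 _); apply/funext => z; ring.
Qed.

Lemma intg_osc u (x : X) (c : R) : L2 u -> intg (fun z => \1_E z * (u (z + x) - c) ^+ 2).
Proof.
move=> /(@L2_osc u x c) [_]; congr (intg _); apply/funext => z.
by rewrite exprMn mulrC indicE; case: (_ \in _); rewrite ?expr0n ?expr1n.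
Qed.

Hypothesis V0 : 0 < vol E.

Lemma avg_jensen u (x : X) (c : R) : L2 u ->
  (avg E u x - c) ^+ 2 <= (vol E)^-1 * \int[leb]_z (\1_E z * (u (z + x) - c) ^+ 2).
Proof.
move=> Lu; have LU := L2_osc x c Lu; have Ls := shift_L2 x Lu.
have ac : avg E u x - c = (vol E)^-1 * dot (\1_E) (fun z => (u (z + x) - c) * \1_E z).
  have -> : (fun z => (u (z + x) - c) * \1_E z) =
      (fun z => u (z + x) * \1_E z - c * \1_E z) by apply/funext => z; rewrite mulrBl.
  rewrite dotBr; [|exact: L2_mul_indic|exact/L2Z/L2_vol|exact: L2_vol].
  rewrite dotZr; [|exact: L2_vol..].
  rewrite dot_vol mulrBr [_ * (c * _)]mulrCA mulVf ?gt_eqF// mulr1 /avg.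
  congr (_ * _ - _); apply: eq_Rintegral => z _.
  by rewrite indicE; case: (_ \in _); rewrite ?mul0r ?mulr0// mul1r mulr1 mul1r.
rewrite ac exprMn expr2 -mulrA ler_pM2l ?invr_gt0// mulrC ler_pdivrMr//.
apply: le_trans (dot_cauchy_schwarz L2_vol LU) _.
rewrite dot_vol mulrC ler_pM2r// dotE le_eqVlt; apply/orP; left; apply/eqP.
apply: eq_Rintegral => z _; rewrite exprMn mulrC indicE.
by case: (_ \in _); rewrite ?expr0n ?expr1n.
Qed.

(** Moving the base point translates [u], so [shift_bound_cube] applies. This gives continuity of
    averages, hence measurability, and later the perturbation of a point in the case of equal
    norms. *)
Lemma avg_lipschitz U (x y : X) (r : R) : H1j U -> (forall i, `|(x - y) ord0 i| <= r) ->
  (avg E (U None) x - avg E (U None) y) ^+ 2 <= (vol E)^-1 * (N%:R * r ^+ 2 * gdot U U).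
Proof.
move=> HU xyr; have [LU _] := HU; set u := U None; have Lu := LU None : L2 u.
have Lx := shift_L2 x Lu; have Ly := shift_L2 y Lu.
rewrite /avg -mulrBr -dotBr//; last exact: L2_vol.
rewrite exprMn expr2 -mulrA ler_pM2l ?invr_gt0// mulrC ler_pdivrMr//.
apply: le_trans (dot_cauchy_schwarz L2_vol (L2B Lx Ly)) _.
rewrite dot_vol mulrC ler_pM2r//; apply: le_trans (shift_bound_cube HU xyr).
have Ls : L2 (shift_diff u (x - y)).
  by apply: L2B => //; exact: (scaling_L2 ler01 (leb_shift (x - y))).
rewrite -[leRHS]mul1r -(scaling_dot ler01 (leb_shift y) Ls Ls) le_eqVlt.
apply/orP; left; apply/eqP; apply: eq_Rintegral => z _.
by rewrite /shift_diff -addrA [y + _]addrC subrK.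
Qed.

Lemma avg_continuous U : H1j U -> continuous (avg E (U None) : X -> R).
Proof.
move=> HU x A /nbhs_ballP[e0 /= e00 HA].
pose K := (vol E)^-1 * (N%:R * gdot U U).
have K0 : 0 <= K by rewrite !mulr_ge0 ?invr_ge0 ?vol_ge0 ?gdot_ge0.
have K1 : 0 < K + 1 by rewrite ltr_wpDl.
suff : nbhs x (avg E (U None) @^-1` A) by [].
apply/nbhs_ballP; exists (e0 / (K + 1)); first by rewrite /= divr_gt0.
move=> y; rewrite -ball_normE /= ltr_pdivlMr// => rs; apply: HA; rewrite -ball_normE /=.
rewrite -ltr_sqr ?nnegrE ?(ltW e00)// real_normK ?num_real//.
have hr i : `|(x - y) ord0 i| <= `|x - y|.
  rewrite [leRHS]mx_normrE.
  by apply: (le_bigmax _ (fun i : 'I_1 * 'I_N => `|(x - y) i.1 i.2|) (ord0, i)).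
apply: le_lt_trans (avg_lipschitz HU hr) _.
rewrite [X in _ * X]mulrAC mulrA -/K.
move: (K) (`|x - y|) (normr_ge0 (x - y)) rs K0 K1 => k r r0 rs k0 k1.
have : r ^+ 2 * k <= (r * (k + 1)) ^+ 2 by rewrite exprMn ler_wpM2l ?sqr_ge0//; nra.
move=> h; rewrite mulrC; apply: le_lt_trans h _.
by rewrite ltr_sqr// nnegrE ?(ltW e00)// mulr_ge0// ltW.
Qed.

End one_set.

Lemma measurable_addX : measurable_fun setT (fun p : X * X => p.1 + p.2).
Proof.
apply: measurable_fun_coordP => i; under eq_fun do rewrite mxE.
apply: measurable_funD.
  exact: (measurableT_comp (measurable_coord i) measurable_fst).
exact: (measurableT_comp (measurable_coord i) measurable_snd).
Qed.

Section oscillation.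
Variables (E : set X) (r : R) (U : option 'I_N -> X -> R).
Hypotheses (mE : measurable E) (Er : E `<=` cube r) (HU : H1j U).
Let u := U None.
Let Lu : L2 u. Proof. by case: HU => h _; exact: h. Qed.

Let fE : (leb E < +oo)%E.
Proof.
by apply: le_lt_trans (leb_box_lty (const_mx (- r)) (const_mx r)); apply: le_measure; rewrite ?inE//; exact: measurable_box.
Qed.

Let F (p : X * X) : \bar R := (\1_E p.2 * (u (p.2 + p.1) - u p.1) ^+ 2)%:E.

Let F0 p : (0 <= F p)%E.
Proof. by rewrite lee_fin mulr_ge0 ?sqr_ge0// indicE. Qed.

Let mF : measurable_fun setT F.
Proof.
have mu_ := L2_meas Lu.
apply/measurable_EFinP; apply: measurable_funM.
  by apply: (measurableT_comp _ measurable_snd); exact: measurable_indic.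
apply: measurable_funX; apply: measurable_funB; last exact: (measurableT_comp mu_ measurable_fst).
have -> : (fun p : X * X => u (p.2 + p.1)) = u \o (fun p => p.1 + p.2).
  by apply/funext => p /=; rewrite addrC.
by apply: (measurableT_comp mu_); exact: measurable_addX.
Qed.

Let oscE x : (osc E u x)%:E = (\int[leb]_y F (x, y))%E.
Proof. by rewrite /osc EFin_Rint//; exact: intg_osc. Qed.

Lemma osc_ge0 (x : X) : 0 <= osc E u x.
Proof. by apply: Rint_ge0 => z; rewrite mulr_ge0 ?sqr_ge0// indicE. Qed.

(** By Tonelli the integral in [x] is taken first: for each [z] in [E] it is the squared $L^2$ norm
    of a translation difference, at most [N r^2 gdot U U]. *)
Lemma osc_bound : intg (osc E u) /\
  \int[leb]_x osc E u x <= vol E * (N%:R * r ^+ 2 * gdot U U).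
Proof.
have mo : measurable_fun setT (osc E u).
  apply/measurable_EFinP; rewrite (_ : EFin \o _ = fun x => \int[leb]_y F (x, y))%E.
    exact: (measurable_fun_fubini_tonelli_F _ mF).
  by apply/funext => x; exact: oscE.
have i1 := intgZ (N%:R * r ^+ 2 * gdot U U) (intg_indic mE fE).
have le1 : (\int[leb]_x (osc E u x)%:E <= (vol E * (N%:R * r ^+ 2 * gdot U U))%:E)%E.
  rewrite mulrC -RintZ; last exact: intg_indic.
  under eq_integral do rewrite oscE.
  rewrite (fubini_tonelli _ mF)// EFin_Rint//; apply: ge0_le_integral => //.
  - by move=> y _; exact: integral_ge0.
  - exact: (measurable_fun_fubini_tonelli_G _ mF).
  - by apply/measurable_EFinP; apply: intg_meas i1.
  move=> y _; rewrite /F /= indicE; case: (boolP (y \in E)) => [|_]; last first.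
    by under eq_integral do rewrite mul0r; rewrite integral0 mulr0.
  rewrite inE => /Er /cubeP yr; rewrite mulr1.
  under eq_integral do rewrite mul1r.
  have Ls : L2 (shift_diff u y).
    by apply: L2B => //; exact: (scaling_L2 ler01 (leb_shift y)).
  apply: le_trans (_ : (dot (shift_diff u y) (shift_diff u y))%:E <= _)%E.
    rewrite EFin_dot//; apply: ge0_le_integral => //.
    - by move=> x _; rewrite lee_fin sqr_ge0.
    - apply/measurable_EFinP/measurable_funX; apply: measurable_funB; last exact: (L2_meas Lu).
      rewrite (_ : (fun x => _) = (fun x => u (x + y))); last by apply/funext => x; rewrite addrC.
      by apply: (L2_meas (shift_L2 y Lu)).
    - by apply/measurable_EFinP; case: Ls => m1 _; exact: measurable_funX.
    by move=> x _; rewrite /shift_diff /= (addrC x).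
  by rewrite lee_fin; exact: shift_bound_cube.
have io : intg (osc E u) by apply: intg_lty => //; [exact: osc_ge0|apply: le_lt_trans le1 _; exact: ltry].
by split => //; rewrite -lee_fin EFin_Rint.
Qed.

Hypothesis V0 : 0 < vol E.

Lemma avg_L2 : L2 (avg E u).
Proof.
have ma : measurable_fun setT (avg E u).
  by apply: continuous_measurable_rV; exact: avg_continuous.
have [io _] := osc_bound.
have : L2 (fun x => avg E u x - u x).
  split; first by apply: measurable_funB => //; exact: (L2_meas Lu).
  apply: intg_le (intgZ (vol E)^-1 io) => [|x].
    by apply: measurable_funX; apply: measurable_funB => //; exact: (L2_meas Lu).
  by rewrite ger0_norm ?sqr_ge0//; exact: avg_jensen.
by move=> /(L2D Lu); congr (L2 _); apply/funext => x; rewrite addrC subrK.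
Qed.

Lemma avg_approx :
  dot (fun x => avg E u x - u x) (fun x => avg E u x - u x) <= N%:R * r ^+ 2 * gdot U U.
Proof.
have [io ob] := osc_bound.
rewrite -(ler_pM2l V0); apply: le_trans ob.
rewrite dotE -RintZ; last by case: (L2B avg_L2 Lu).
apply: Rint_le => // [|x]; first by apply: intgZ; case: (L2B avg_L2 Lu).
by rewrite -ler_pdivlMl//; exact: avg_jensen.
Qed.

End oscillation.


Lemma vol_cube r : 0 <= r -> vol (cube r) = (2 * r) ^+ N.
Proof. exact: Rint_cube. Qed.

(* Poincare's inequality on a cube, with the gradient taken over the whole space. *)
Lemma avg_diff (E E' : set X) (r : R) U x : measurable E -> measurable E' ->
  0 <= r -> E `<=` cube r -> E' `<=` cube r -> 0 < vol E -> 0 < vol E' -> H1j U ->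
  (avg E (U None) x - avg E' (U None) x) ^+ 2 <=
  (vol E)^-1 * (vol E')^-1 * ((4 * r) ^+ N * (N%:R * (2 * r) ^+ 2 * gdot U U)).
Proof.
move=> mE mE' r0 Er Er' V0 V0' HU; have [LU _] := HU; set u := U None.
have Lu : L2 u := LU None.
have fin (A : set X) : A `<=` cube r -> measurable A -> (leb A < +oo)%E.
  move=> Ar mA; apply: le_lt_trans (leb_box_lty (const_mx (- r)) (const_mx r)).
  by apply: le_measure; rewrite ?inE//; exact: measurable_box.
have fE := fin _ Er mE; have fE' := fin _ Er' mE'.
have mc : measurable (cube (2 * r) : set X) by exact: measurable_box.
have fc : (leb (cube (2 * r)) < +oo)%E by exact: leb_box_lty.
have [io] := osc_bound mc (@subset_refl _ _) HU.
rewrite vol_cube ?mulr_ge0// (_ : 2 * (2 * r) = 4 * r); last by ring.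
rewrite -/u => ob.
have ios := scaling_intg ler01 (leb_shift x) io.
(* Seen from [z + x], the set [x + E'] lies in a cube of radius [2 r], since [E] and [E'] both lie
   in the cube of radius [r]. *)
have step z : E z -> (u (z + x) - avg E' u x) ^+ 2 <=
    (vol E')^-1 * osc (cube (2 * r)) u (z + x).
  move=> Ez; rewrite -opprB sqrrN; apply: le_trans (avg_jensen mE' fE' V0' x _ Lu) _.
  rewrite ler_pM2l ?invr_gt0//.
  have ii := intg_osc mE' fE' x (u (z + x)) Lu.
  rewrite -[leLHS]mul1r -(scaling_Rint ler01 (leb_shift z) ii).
  apply: Rint_le => [||y]; [exact: (scaling_intg ler01 (leb_shift z) ii)|exact: intg_osc|].
  rewrite addrA ler_wpM2r ?sqr_ge0// !indicE ler_nat.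
  case: (boolP (y + z \in E')) => //; rewrite inE => yz; rewrite mem_set//.
  apply/cubeP => i; have /cubeP/(_ i) h1 := Er' _ yz; have /cubeP/(_ i) h2 := Er _ Ez.
  have -> : y ord0 i = (y + z) ord0 i - z ord0 i by rewrite mxE addrK.
  by apply: le_trans (ler_normB _ _) _; lra.
apply: le_trans (avg_jensen mE fE V0 x _ Lu) _.
rewrite -mulrA ler_pM2l ?invr_gt0//.
apply: (@le_trans _ _ (\int[leb]_z ((vol E')^-1 * osc (cube (2 * r)) u (z + x)))).
  apply: Rint_le => [||z]; [exact: intg_osc|exact: intgZ|].
  rewrite indicE; case: (boolP (z \in E)) => [|_]; last first.
    by rewrite mul0r mulr_ge0 ?invr_ge0 ?vol_ge0 ?osc_ge0.
  by rewrite inE mul1r; exact: step.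
rewrite RintZ// ler_pM2l ?invr_gt0// (scaling_Rint ler01 (leb_shift x) io) mul1r.
exact: ob.
Qed.

Lemma avg_sqr_le (E : set X) u x : measurable E -> (leb E < +oo)%E -> 0 < vol E ->
  L2 u -> avg E u x ^+ 2 <= (vol E)^-1 * dot u u.
Proof.
move=> mE fE V0 Lu; have := avg_jensen mE fE V0 x 0 Lu; rewrite subr0 => /le_trans; apply.
rewrite ler_pM2l ?invr_gt0// -[dot u u]mul1r -(scaling_dot ler01 (leb_shift x) Lu Lu).
apply: Rint_le => [||z]; [exact: intg_osc|by apply: L2_intgM; exact: shift_L2|].
by rewrite subr0 -expr2 ler_piMl ?sqr_ge0// indicE; case: (_ \in _).
Qed.

End averages.

(** * Real powers, and almost everywhere convergence from summability *)

Section powR_facts.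
Context {R : realType}.

Lemma powR_le_mono (p a c : R) : 0 <= p -> 0 <= a -> a <= c -> a `^ p <= c `^ p.
Proof. by move=> p0 a0 ac; apply: ge0_ler_powR => //; rewrite nnegrE// (le_trans a0). Qed.

Lemma powR_lt_mono (p a c : R) : 0 < p -> 0 <= a -> a < c -> a `^ p < c `^ p.
Proof. by move=> p0 a0 ac; apply: gt0_ltr_powR => //; rewrite nnegrE// ltW// (le_lt_trans a0). Qed.

Lemma powRK (p a : R) : p != 0 -> 0 <= a -> (a `^ p) `^ p^-1 = a.
Proof. by move=> p0 a0; rewrite -powRrM mulfV// powRr1. Qed.

Lemma powRKV (p a : R) : p != 0 -> 0 <= a -> (a `^ p^-1) `^ p = a.
Proof. by move=> p0 a0; rewrite -powRrM mulVf// powRr1. Qed.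

Lemma cvg_powR (p : R) (u : nat -> R) (a : R) : 0 < p -> (forall n, 0 <= u n) ->
  u @ \oo --> a -> (fun n => u n `^ p) @ \oo --> a `^ p.
Proof.
move=> p0 u0 ua; have a0 : 0 <= a by apply: (cvgr_to_ge ua); exact: nearW.
have pn : p != 0 by rewrite gt_eqF.
have lbd c : c < a `^ p -> \forall n \near \oo, c < u n `^ p.
  move=> ca; have [c0|c0] := ltP c 0; first by apply: nearW => n; apply: lt_le_trans c0 _; exact: powR_ge0.
  have : c `^ p^-1 < a by rewrite -[ltRHS](powRK pn a0); apply: powR_lt_mono; rewrite ?invr_gt0.
  move=> /(cvgr_gt _ ua); apply: filterS => n h.
  by rewrite -[ltLHS](powRKV pn c0); apply: powR_lt_mono; rewrite ?powR_ge0.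
have ubd c : a `^ p < c -> \forall n \near \oo, u n `^ p < c.
  move=> ca; have c0 : 0 <= c by apply: le_trans (ltW ca); exact: powR_ge0.
  have : a < c `^ p^-1.
    by rewrite -[ltLHS](powRK pn a0); apply: powR_lt_mono; rewrite ?invr_gt0 ?powR_ge0.
  move=> /(cvgr_lt _ ua); apply: filterS => n h.
  by rewrite -[ltRHS](powRKV pn c0); apply: powR_lt_mono.
apply/cvgrPdist_lt => e e0; near=> n.
rewrite distrC ltr_distl; apply/andP; split; near: n.
  by apply: lbd; rewrite gtrBl.
by apply: ubd; rewrite ltrDl.
Unshelve. all: by end_near. Qed.

End powR_facts.

Section summable_ae.
Context {d} {T : measurableType d} {R : realType}.
Variable mu : {measure set T -> \bar R}.

(** The series of [2 ^ n f n] is integrable, hence its sum [H] is finite almost everywhere, and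
    [f n <= H / 2 ^ n] there. *)
Lemma ae_cvg0_of_summable (f : nat -> T -> R) (K : R) :
  (forall n, measurable_fun setT (f n)) -> (forall n x, 0 <= f n x) ->
  (forall n, (\int[mu]_x (f n x)%:E <= (K * 4^-1 ^+ n)%:E)%E) ->
  {ae mu, forall x, f ^~ x @ \oo --> (0 : R)}.
Proof.
move=> mf f0 fK.
pose h j x : \bar R := (2 ^+ j * f j x)%:E.
have h0 j x : (0 <= h j x)%E by rewrite lee_fin mulr_ge0// exprn_ge0.
have mh j : measurable_fun setT (h j) by apply/measurable_EFinP; exact: measurable_funM.
pose H x := (\sum_(j <oo) h j x)%E.
have H0 x : (0 <= H x)%E by apply: nneseries_ge0.
have K0 : 0 <= K.
  have := fK 0; rewrite expr0 mulr1 -lee_fin; apply: le_trans.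
  by apply: integral_ge0 => x _; rewrite lee_fin.
have iH : mu.-integrable setT H.
  apply/integrableP; split; first exact: ge0_emeasurable_sum.
  under eq_integral do rewrite gee0_abs//.
  rewrite /H integral_nneseries//.
  apply: (@le_lt_trans _ _ (K * 2)%:E); last exact: ltry.
  apply: lime_le; first by apply: is_cvg_nneseries => *; exact: integral_ge0.
  apply: nearW => n.
  apply: (@le_trans _ _ (\sum_(0 <= j < n) (K * (2^-1) ^+ j)%:E)%E).
    apply: lee_sum => j _; rewrite /h.
    under eq_integral do rewrite EFinM.
    rewrite ge0_integralZl//=; last 2 first.
      - exact/measurable_EFinP.
      - by move=> *; rewrite ?lee_fin ?exprn_ge0.
    have tj : (0 <= (2 ^+ j)%:E :> \bar R)%E by rewrite lee_fin exprn_ge0.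
    apply: le_trans (lee_wpmul2l tj (fK j)) _.
    by rewrite -EFinM lee_fin mulrCA -exprMn (_ : 2 * 4^-1 = 2^-1)//; field.
  rewrite sumEFin lee_fin big_mkord -mulr_sumr ler_wpM2l//.
  have -> : \sum_(i < n) (2^-1 : R) ^+ i = 2 - 2 * 2^-1 ^+ n.
    elim: n => [|n IH]; first by rewrite big_ord0 expr0; ring.
    by rewrite big_ord_recr/= IH exprS; field.
  by rewrite gerBl mulr_ge0// exprn_ge0.
apply: filterS (integrable_ae measurableT iH) => x /(_ I) Hx.
have fb n : f n x <= fine (H x) * 2^-1 ^+ n.
  rewrite exprVn ler_pdivlMr ?exprn_gt0// mulrC -lee_fin fineK//.
  have := @nneseries_lim_ge R (h^~ x) predT 0 n.+1 (fun n _ _ => h0 n x).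
  apply: le_trans; rewrite big_mkord big_ord_recr /=.
  by rewrite leeDr// sume_ge0.
apply: (squeeze_cvgr (f := fun=> 0) (h := fun n => fine (H x) * 2^-1 ^+ n)).
- by apply: nearW => n; rewrite f0 fb.
- exact: cvg_cst.
- rewrite -(mulr0 (fine (H x))); apply: cvgMl_tmp.
  by apply: cvg_expr; rewrite ger0_norm ?invr_ge0// invf_lt1// ltr1n.
Qed.

End summable_ae.

(** * The weighted norm *)

Section weighted_norm.
Context {R : realType} {N : nat}.
Variables b s : R.
Hypotheses (b0 : 0 < b) (bN : b < N%:R) (s0 : 0 < s) (sN : s * N%:R = 2 - b).
Local Notation X := 'rV[R]_N.
Local Notation leb := (lebesgue_rV R N).
Local Notation intg := (intg leb).
Local Notation L2 := (L2 leb).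
Local Notation dot := (L2dot leb).
Local Notation wt := (@wt R N b).
Local Notation p := (2 * s + 2).

Let p0 : 0 < p. Proof. by rewrite addr_gt0// mulr_gt0. Qed.
Let p1 : 1 <= p. Proof. by have := s0; lra. Qed.

(** This is [|t| ^ (2 s + 2)]; passing through [t ^ 2] leaves a single real power, of a square, and
    no absolute value. *)
Definition pw (t : R) : R := (t ^+ 2) `^ s * t ^+ 2.

Lemma pwE t : pw t = `|t| `^ p.
Proof.
have [->|t0] := eqVneq t 0; first by rewrite /pw expr0n /= mulr0 normr0 powR0// gt_eqF.
rewrite powRD ?normr_eq0 ?t0 ?implybT// powR_mulrn// -[RHS]mulrC powRrM powR_mulrn//.
by rewrite real_normK ?num_real// /pw mulrC.
Qed.

Lemma pw_ge0 t : 0 <= pw t. Proof. by rewrite mulr_ge0 ?powR_ge0 ?sqr_ge0. Qed.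

Lemma measurable_pw (f : X -> R) : measurable_fun setT f -> measurable_fun setT (fun x => pw (f x)).
Proof.
move=> mf; apply: measurable_funM; last exact: measurable_funX.
by apply: (measurableT_comp (measurable_powR s)); exact: measurable_funX.
Qed.

Definition wint (f : X -> R) : \bar R := (\int[leb]_x (wt x * pw (f x))%:E)%E.

(** The weight is placed inside the function, as in [weighted_norm], so that Minkowski's inequality
    applies; [wint] carries it as a density, which suits pointwise estimates and Fatou. *)
Definition wnm (f : X -> R) : \bar R :=
  Lnorm leb p%:E (fun x => (euclid_norm x `^ (- b / p) * f x)%:E).

Lemma wnmE f : wnm f = (wint f `^ p^-1)%E.
Proof.
rewrite /wnm unlock /wint; congr (_ `^ _)%E; apply: eq_integral => x _.
rewrite /=; congr (_%:E).
rewrite normrM powRM// ger0_norm ?powR_ge0// -powRrM divfK ?gt_eqF//.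
by rewrite pwE.
Qed.

Lemma wint_ge0 f : (0 <= wint f)%E.
Proof. by apply: integral_ge0 => x _; rewrite lee_fin mulr_ge0 ?wt_ge0 ?pw_ge0. Qed.

Lemma wnm_ge0 f : (0 <= wnm f)%E. Proof. exact: Lnorm_ge0. Qed.

Lemma measurable_wpw (f : X -> R) : measurable_fun setT f -> measurable_fun setT (fun x => wt x * pw (f x)).
Proof. by move=> mf; apply: measurable_funM; [exact: measurable_wt|exact: measurable_pw]. Qed.

Lemma wnm_add (f g : X -> R) : measurable_fun setT f -> measurable_fun setT g ->
  (wnm (fun x => (f x + g x)%R) <= wnm f + wnm g)%E.
Proof.
move=> mf mg; have me : measurable_fun setT (fun x : X => euclid_norm x `^ (- b / p)).
  by apply: (measurableT_comp (measurable_powR _)); exact: measurable_euclid.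
have := minkowski_EFin leb (measurable_funM me mf) (measurable_funM me mg) p1.
congr (_ <= _)%E; congr Lnorm; apply/funext => x /=; by rewrite mulrDr.
Qed.

Lemma poweR_le_mono (q : R) (x y : \bar R) : 0 <= q -> (0 <= x)%E -> (x <= y)%E ->
  (x `^ q <= y `^ q)%E.
Proof.
move=> q0 x0 xy; apply: gt0_ler_poweR => //; rewrite in_itv/= leey andbT//.
exact: le_trans xy.
Qed.

Lemma wnm_le f (c : R) : 0 <= c -> (wint f <= (c `^ p)%:E)%E -> (wnm f <= c%:E)%E.
Proof.
move=> c0 h; rewrite wnmE -[leRHS](_ : ((c `^ p)%:E `^ p^-1)%E = _); last first.
  by rewrite poweR_EFin powRK// gt_eqF.
by apply: poweR_le_mono => //; [rewrite invr_ge0 ltW|exact: wint_ge0].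
Qed.

Lemma wint_le f (c : R) : 0 <= c -> (wnm f <= c%:E)%E -> (wint f <= (c `^ p)%:E)%E.
Proof.
move=> c0 h; have -> : wint f = (wnm f `^ p)%E.
  by rewrite wnmE -poweRrM mulVf ?gt_eqF// poweRe1// wint_ge0.
by rewrite -poweR_EFin; apply: poweR_le_mono => //; [exact: ltW|exact: wnm_ge0].
Qed.

Lemma wnm_fatou (F : nat -> X -> R) (f : X -> R) (c : R) : 0 <= c ->
  (forall n, measurable_fun setT (F n)) -> measurable_fun setT f ->
  {ae leb, forall x, F ^~ x @ \oo --> f x} ->
  (forall n, (wnm (F n) <= c%:E)%E) -> (wnm f <= c%:E)%E.
Proof.
move=> c0 mF mf Ff Fc; apply: wnm_le => //.
apply: (@fatou_bound _ _ _ leb (fun n x => wt x * pw (F n x)) _ _ 0) => //.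
- by move=> n; exact: measurable_wpw.
- exact: measurable_wpw.
- by move=> n x; rewrite mulr_ge0 ?wt_ge0 ?pw_ge0.
- by move=> x; rewrite mulr_ge0 ?wt_ge0 ?pw_ge0.
- apply: filterS Ff => x Fx; apply: cvgMl_tmp; under eq_fun do rewrite pwE; rewrite pwE.
  by apply: cvg_powR => //; exact: cvg_norm.
- by move=> n _; exact: wint_le.
Qed.

Lemma wint_quad (f : X -> R) (A : R) : (forall x, f x ^+ 2 <= A) -> measurable_fun setT f ->
  intg (fun x => wt x * f x ^+ 2) ->
  (wint f <= (A `^ s * \int[leb]_x (wt x * f x ^+ 2))%:E)%E.
Proof.
move=> fA mf If; rewrite -RintZ// EFin_Rint; last exact: intgZ.
apply: ge0_le_integral => //.
- by move=> x _; rewrite lee_fin mulr_ge0 ?wt_ge0 ?pw_ge0.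
- by apply/measurable_EFinP; exact: measurable_wpw.
- by apply/measurable_EFinP; apply: intg_meas (intgZ _ If).
move=> x _; have q0 : 0 <= wt x * f x ^+ 2 by rewrite mulr_ge0 ?wt_ge0 ?sqr_ge0.
rewrite lee_fin /pw mulrCA ler_wpM2r//.
by apply: powR_le_mono; rewrite ?(ltW s0) ?sqr_ge0.
Qed.

(** Inside the cube the weight is integrable and [f] bounded; outside, the weight is at most
    [r ^ (- b)] and [f] is square integrable. *)
Lemma quad_split (f : X -> R) (A r : R) : 0 < r -> (forall x, f x ^+ 2 <= A) -> L2 f ->
  [/\ intg (fun x => wt x * f x ^+ 2), intg (fun x => wt x * \1_(cube r) x * f x ^+ 2) &
  \int[leb]_x (wt x * f x ^+ 2) <=
    \int[leb]_x (wt x * \1_(cube r) x * f x ^+ 2) + r `^ (- b) * dot f f].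
Proof.
move=> r0 fA [mf If].
have mw := @measurable_wt R N b.
have i1 : intg (fun x => wt x * \1_(cube r) x * f x ^+ 2).
  apply: intg_le (intgZ A (intg_wt_cube b0 bN r)) => [|x].
    apply: measurable_funM; last exact: measurable_funX.
    exact: (intg_meas (intg_wt_cube b0 bN r)).
  have h : 0 <= wt x * \1_(cube r) x by rewrite mulr_ge0 ?wt_ge0 ?indicE.
  have q0 := mulr_ge0 h (sqr_ge0 (f x)).
  by rewrite ger0_norm// mulrC ler_wpM2r.
have i2 := intgZ (r `^ (- b)) If.
have le x : wt x * f x ^+ 2 <= wt x * \1_(cube r) x * f x ^+ 2 + r `^ (- b) * f x ^+ 2.
  rewrite indicE; case: (boolP (x \in cube r)) => [_|].
    by rewrite mulr1 lerDl mulr_ge0 ?powR_ge0 ?sqr_ge0.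
  by rewrite notin_setE => /(wt_far b0 r0) h; rewrite mulr0 mul0r add0r ler_wpM2r ?sqr_ge0.
have i3 : intg (fun x => wt x * f x ^+ 2).
  apply: intg_le (intgD i1 i2) => [|x]; last first.
    have q0 : 0 <= wt x * f x ^+ 2 by rewrite mulr_ge0 ?wt_ge0 ?sqr_ge0.
    by rewrite ger0_norm.
  by apply: measurable_funM => //; exact: measurable_funX.
split => //; rewrite dotE -RintZ// -RintD//; exact: Rint_le (intgD i1 i2) le.
Qed.

Lemma quad_cube (f : X -> R) (A : R) (k : nat) : (forall x, f x ^+ 2 <= A) -> L2 f ->
  \int[leb]_x (wt x * f x ^+ 2) <= A * (@wt_const R N b * (2^-1 ^+ k) `^ (N%:R - b)) +
    (2^-1 ^+ k) `^ (- b) * dot f f.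
Proof.
move=> fA Lf; have r0 : 0 < (2^-1 ^+ k : R) by rewrite exprn_gt0 ?invr_gt0.
have [_ i1 h] := quad_split r0 fA Lf; apply: le_trans h _; rewrite lerD2r.
have A0 : 0 <= A by apply: le_trans (fA 0); exact: sqr_ge0.
have iw := intg_wt_cube b0 bN (2^-1 ^+ k).
apply: (@le_trans _ _ (\int[leb]_x (A * (wt x * \1_(cube (2^-1 ^+ k)) x)))).
  apply: Rint_le => //; first exact: intgZ.
  by move=> x; rewrite mulrC ler_wpM2r ?mulr_ge0 ?wt_ge0 ?indicE.
by rewrite RintZ// ler_wpM2l// -lee_fin EFin_Rint//; exact: wt_cube.
Qed.

End weighted_norm.

(** * The weighted embedding by telescoping dyadic averages *)

Section weighted_embedding.
Context {R : realType} {N : nat}.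
Variables b s : R.
Hypotheses (b0 : 0 < b) (bN : b < N%:R) (s0 : 0 < s) (sN : s * N%:R = 2 - b).
Local Notation X := 'rV[R]_N.
Local Notation leb := (lebesgue_rV R N).
Local Notation intg := (intg leb).
Local Notation L2 := (L2 leb).
Local Notation dot := (L2dot leb).
Local Notation wt := (@wt R N b).
Local Notation p := (2 * s + 2).
Local Notation wnm := (wnm b s).
Local Notation wint := (wint b s).

Let p0 : 0 < p. Proof. by rewrite addr_gt0// mulr_gt0. Qed.
Let h (k : nat) : R := 2^-1 ^+ k.
Let h0 k : 0 < h k. Proof. by rewrite exprn_gt0// invr_gt0. Qed.

(** The weighted integral of an increment at scale [2 ^ -k] carries a factor [2 ^ (- 2 s k)]; this
    is the ratio left after the [p]-th root. *)
Definition wratio : R := 2^-1 `^ (2 * s / p).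

Lemma wratio_ge0 : 0 <= wratio. Proof. exact: powR_ge0. Qed.
Lemma wratio_lt1 : wratio < 1.
Proof. by apply: powR_lt1; rewrite ?invf_lt1 ?ltr1n// divr_gt0// mulr_gt0. Qed.

Definition dyavg (k : nat) (u : X -> R) : X -> R := avg (cube (h k)) u.

Lemma dot_sub_le f g : L2 f -> L2 g ->
  dot (fun x => f x - g x) (fun x => f x - g x) <= 2 * dot f f + 2 * dot g g.
Proof.
move=> Lf Lg; have Lfg := L2B Lf Lg.
rewrite !dotE -!RintZ; [|by case: Lg|by case: Lf].
rewrite -RintD; [|by apply: intgZ; case: Lf|by apply: intgZ; case: Lg].
apply: Rint_le => [||x]; [by case: Lfg|by apply: intgD; apply: intgZ; [case: Lf|case: Lg]|].
by have := sqr_ge0 (f x + g x); move: (f x) (g x) => a c; rewrite !expr2; lra.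
Qed.

(** From [avg_diff] with [r = h]: the cubes of radius [h / 2] and [h] have volumes [h ^ N] and
    [(2 h) ^ N], and [(4 h) ^ N N (2 h) ^ 2] divided by their product is [c1 h ^ (2 - N)]. *)
Let c1 : R := 2 ^+ N * (4 * N%:R).
Let mc r : measurable (cube r : set X). Proof. exact: measurable_box. Qed.
Let fc r : (leb (cube r) < +oo)%E. Proof. exact: leb_box_lty. Qed.
Let vc k : vol (cube (h k) : set X) = (2 * h k) ^+ N. Proof. by rewrite vol_cube// ltW. Qed.
Let vp k : 0 < vol (cube (h k) : set X). Proof. by rewrite vc exprn_gt0// mulr_gt0. Qed.

Lemma dyavg_L2 k U : H1j U -> L2 (dyavg k (U None)).
Proof. by move=> HU; exact: (avg_L2 (mc _) (@subset_refl _ _) HU (vp k)). Qed.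

Lemma dyavg_approx k U : H1j U ->
  dot (fun x => dyavg k (U None) x - U None x) (fun x => dyavg k (U None) x - U None x) <=
  N%:R * h k ^+ 2 * gdot U U.
Proof. by move=> HU; exact: (avg_approx (mc _) (@subset_refl _ _) HU (vp k)). Qed.

Let hS k : h k.+1 <= h k. Proof. by rewrite /h exprS ler_piMl ?exprn_ge0 ?invr_ge0// invf_le1// ler1n. Qed.

Definition wstep_const : R :=
  (c1 `^ s * (c1 * @wt_const R N b + 4 * N%:R)) `^ p^-1.

Let c10 : 0 <= c1. Proof. by rewrite !mulr_ge0 ?exprn_ge0. Qed.
Let K0 : 0 <= c1 `^ s * (c1 * @wt_const R N b + 4 * N%:R).
Proof.
apply: mulr_ge0; [exact: powR_ge0|apply: addr_ge0; last exact: mulr_ge0].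
by apply: mulr_ge0 => //; exact: wt_const_ge0.
Qed.

Lemma wstep_const_ge0 : 0 <= wstep_const. Proof. exact: powR_ge0. Qed.

(* At scale [h = 2^-k] the increment is [O(h^(1 - N/2))] in sup norm and [O(h)] in
   [L^2]; splitting the weighted integral along the cube of radius [h] shows that
   the critical exponent [s = (2 - b) / N] leaves a factor [h^(2 s)]. *)
Lemma wstep k U : H1j U ->
  (wnm (fun x => (dyavg k.+1 (U None) x - dyavg k (U None) x)%R) <=
    (wstep_const * wratio ^+ k * Num.sqrt (gdot U U))%:E)%E.
Proof.
have lin (a c m n : R) : a <= m -> m <= n -> c <= n -> 2 * a + 2 * c <= 4 * n by lra.
move=> HU; set u := U None; set G := gdot U U; have G0 : 0 <= G by exact: gdot_ge0.
have [LU _] := HU; have Lu : L2 u := LU None.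
pose g x := dyavg k.+1 u x - dyavg k u x.
have L1 := dyavg_L2 k.+1 HU; have L0 := dyavg_L2 k HU.
have Lg : L2 g := L2B L1 L0.
pose A := c1 * G * h k `^ (2 - N%:R).
have hk0 := h0 k.
have hn : h k != 0 by rewrite gt_eqF.
have hp r r' : h k `^ (r + r') = h k `^ r * h k `^ r' by rewrite powRD// hn implybT.
have gA x : g x ^+ 2 <= A.
  have h2S : 2 * h k.+1 = h k by rewrite /h exprS mulrA divff// mul1r.
  apply: le_trans (avg_diff x (mc _) (mc _) (ltW (h0 k)) (cube_mono (hS k)) (@subset_refl _ _) (vp _) (vp _) HU) _.
  rewrite !vc h2S -/G /A hp powRN !powR_mulrn ?(ltW hk0)// !exprMn.
  rewrite (_ : 4 ^+ N = 2 ^+ N * 2 ^+ N :> R); last by rewrite -exprMn -natrM.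
  have t0 : (2 ^+ N : R) != 0 by rewrite expf_neq0.
  have t1 : h k ^+ N != 0 by rewrite expf_neq0.
  by rewrite /c1 le_eqVlt; apply/orP; left; apply/eqP; field; rewrite t0 t1.
have gB : dot g g <= 4 * N%:R * h k ^+ 2 * G.
  have e1 := dyavg_approx k.+1 HU; have e0 := dyavg_approx k HU.
  have -> : g = fun x => (dyavg k.+1 u x - u x) - (dyavg k u x - u x).
    by apply/funext => x; rewrite opprB addrA subrK.
  apply: le_trans (dot_sub_le (L2B L1 Lu) (L2B L0 Lu)) _.
  have e2 : N%:R * h k.+1 ^+ 2 * G <= N%:R * h k ^+ 2 * G.
    by rewrite ler_wpM2r// ler_wpM2l//; apply: lerXn2r; rewrite ?nnegrE ?(ltW (h0 _)).
  by apply: le_trans (lin _ _ _ _ e1 e2 e0) _; rewrite !mulrA.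
have mg : measurable_fun setT g by case: Lg.
have A0 : 0 <= A by rewrite !mulr_ge0 ?powR_ge0.
have [iq _ _] := quad_split b0 bN (ltr01 : (0 : R) < 1) gA Lg.
apply: wnm_le => //; first by rewrite !mulr_ge0 ?wstep_const_ge0 ?exprn_ge0 ?wratio_ge0 ?sqrtr_ge0.
apply: le_trans (wint_quad s0 gA mg iq) _; rewrite lee_fin.
apply: (@le_trans _ _ (A `^ s * (A * (@wt_const R N b * h k `^ (N%:R - b)) +
    h k `^ (- b) * (4 * N%:R * h k ^+ 2 * G)))).
  rewrite ler_wpM2l ?powR_ge0//; apply: le_trans (quad_cube b0 bN k gA Lg) _.
  by rewrite lerD2l ler_wpM2l ?powR_ge0.
rewrite le_eqVlt; apply/orP; left; apply/eqP.
rewrite powRM ?mulr_ge0 ?sqrtr_ge0 ?wstep_const_ge0 ?exprn_ge0 ?wratio_ge0//.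
rewrite powRM ?wstep_const_ge0 ?exprn_ge0 ?wratio_ge0// /wstep_const.
rewrite powRKV ?gt_eqF//.
have -> : (wratio ^+ k) `^ p = h k `^ (2 * s).
  by rewrite /wratio -powR_exprC ?invr_ge0// -/(h k) -powRrM divfK// gt_eqF.
have -> : Num.sqrt G `^ p = G `^ s * G.
  rewrite powRD; last by apply/implyP; rewrite gt_eqF.
  by rewrite powRrM !powR_mulrn ?sqrtr_ge0// sqr_sqrtr.
have -> : A `^ s = c1 `^ s * G `^ s * h k `^ ((2 - N%:R) * s).
  by rewrite powRM ?mulr_ge0 ?powR_ge0// powRM// -powRrM.
have e1 : h k `^ (2 - N%:R) * h k `^ (N%:R - b) = h k `^ (2 - b).
  by rewrite -hp; congr (_ `^ _); ring.
have e2 : h k `^ (- b) * h k ^+ 2 = h k `^ (2 - b).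
  by rewrite -powR_mulrn ?(ltW hk0)// -hp; congr (_ `^ _); ring.
(* Criticality enters here: [s N = 2 - b] makes the total exponent [(2 - N) s + 2 - b] equal to
   [2 s], which is positive. *)
have e3 : h k `^ ((2 - N%:R) * s) * h k `^ (2 - b) = h k `^ (2 * s).
  by rewrite -hp -sN; congr (_ `^ _); ring.
rewrite -e3 /A.
transitivity (c1 `^ s * G `^ s * h k `^ ((2 - N%:R) * s) *
  (c1 * @wt_const R N b * G * (h k `^ (2 - N%:R) * h k `^ (N%:R - b)) + 4 * N%:R * G * (h k `^ (- b) * h k ^+ 2))).
  by ring.
by rewrite e1 e2; ring.
Qed.

Definition wemb_const : R := wstep_const * (1 - wratio)^-1.

Lemma wemb_const_ge0 : 0 <= wemb_const.
Proof. by rewrite mulr_ge0 ?wstep_const_ge0// invr_ge0 subr_ge0 ltW// wratio_lt1. Qed.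

(** [avg_approx] bounds the squared $L^2$ error by a multiple of [4 ^ -k], which is summable; this
    is a differentiation theorem for $H^1$ functions along any sets shrinking inside the dyadic
    cubes. *)
Lemma avg_cvg (E : nat -> set X) U : (forall k, measurable (E k)) ->
  (forall k, E k `<=` cube (h k)) -> (forall k, 0 < vol (E k)) -> H1j U ->
  {ae leb, forall x, (fun k => avg (E k) (U None) x) @ \oo --> U None x}.
Proof.
move=> mE Eh VE HU; have [LU _] := HU; have Lu : L2 (U None) := LU None.
pose d k x := avg (E k) (U None) x - U None x.
have Ld k : L2 (d k) by apply: L2B => //; exact: avg_L2 (mE k) (Eh k) HU (VE k).
have hae : {ae leb, forall x, (fun k => d k x ^+ 2) @ \oo --> (0 : R)}.
  apply: (@ae_cvg0_of_summable _ _ _ leb (fun k x => d k x ^+ 2) (N%:R * gdot U U)).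
  - by move=> k; apply: measurable_funX; case: (Ld k).
  - by move=> k x; exact: sqr_ge0.
  - move=> k; rewrite -EFin_dot// lee_fin.
    apply: le_trans (avg_approx (mE k) (Eh k) HU (VE k)) _.
    rewrite /h -exprM mulnC exprM (_ : 2^-1 ^+ 2 = 4^-1); last by field.
    by rewrite mulrAC.
apply: filterS hae => x hx.
suff : (fun k => d k x) @ \oo --> 0.
  move=> h1; rewrite -[X in _ --> X]add0r.
  rewrite (_ : (fun k => _) = (fun k => d k x + U None x)).
    by apply: cvgD h1 _; exact: cvg_cst.
  by apply/funext => k; rewrite subrK.
apply/norm_cvg0P.
have i2 : 0 < 2^-1 :> R by rewrite invr_gt0.
have := cvg_powR i2 (fun k => sqr_ge0 (d k x)) hx.
rewrite powR0 ?invr_eq0//; apply: cvg_trans; apply: near_eq_cvg; apply: nearW => k.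
by rewrite powR12_sqrt ?sqr_ge0// sqrtr_sqr.
Qed.

Lemma dyavg_cvg U : H1j U ->
  {ae leb, forall x, (fun k => dyavg k (U None) x) @ \oo --> U None x}.
Proof. by move=> HU; exact: (avg_cvg (fun k => mc _) (fun k => @subset_refl _ _) vp HU). Qed.

(** The increments from scale [k] on form a geometric series of ratio [wratio], and Fatou lets the
    fine scale tend to zero. The factor [wratio ^ k] makes the approximation uniform on bounded sets
    of $H^1$, the source of compactness. *)
Lemma wnm_sub_dyavg k U : H1j U ->
  (wnm (fun x => (U None x - dyavg k (U None) x)%R) <=
    (wemb_const * wratio ^+ k * Num.sqrt (gdot U U))%:E)%E.
Proof.
move=> HU; set u := U None; set G := Num.sqrt _.
have G0 : 0 <= G by exact: sqrtr_ge0.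
have q0 := wratio_ge0; have q1 := wratio_lt1.
have q1' : 0 < 1 - wratio by rewrite subr_gt0.
have [LU _] := HU; have Lu : L2 u := LU None.
have md j : measurable_fun setT (dyavg j u) by case: (dyavg_L2 j HU).
have bd n : (wnm (fun x => (dyavg (k + n) u x - dyavg k u x)%R) <=
   (wemb_const * (wratio ^+ k - wratio ^+ (k + n)) * G)%:E)%E.
  elim: n => [|n IH].
    rewrite addn0 subrr mulr0 mul0r; apply: wnm_le => //.
    rewrite powR0 ?gt_eqF// /wint; under eq_integral do rewrite subrr /pw expr0n/= mulr0 mulr0.
    by rewrite integral0.
  rewrite addnS (_ : (fun x => _) = (fun x => (dyavg (k + n).+1 u x - dyavg (k + n) u x) + (dyavg (k + n) u x - dyavg k u x))).
    apply: le_trans (wnm_add _ _ _ _) _ => //; [exact: measurable_funB..|].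
    apply: le_trans (leeD (wstep (k + n) HU) IH) _.
    rewrite -EFinD lee_fin -/G exprS /wemb_const le_eqVlt; apply/orP; left; apply/eqP.
    move: (wstep_const) (wratio ^+ k) (wratio ^+ (k + n)) => a c e.
    by field; rewrite gt_eqF.
  by apply/funext => x; rewrite addrA subrK.
apply: (wnm_fatou s0 (F := fun n x => dyavg (k + n) u x - dyavg k u x)) => //.
- exact: (mulr_ge0 (mulr_ge0 wemb_const_ge0 (exprn_ge0 k q0)) G0).
- by move=> n; exact: measurable_funB.
- by apply: measurable_funB => //; case: Lu.
- apply: filterS (dyavg_cvg HU) => x hx; apply: cvgB; last exact: cvg_cst.
  by under eq_fun do rewrite addnC; move: hx; rewrite -(cvg_shiftn k).
- move=> n; apply: le_trans (bd n) _; rewrite lee_fin ler_wpM2r// ler_wpM2l ?wemb_const_ge0//.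
  by rewrite gerBl exprn_ge0.
Qed.

End weighted_embedding.

(** * Compactness of the weighted embedding *)

Section weighted_compactness.
Context {R : realType} {N : nat}.
Variables b s : R.
Hypotheses (b0 : 0 < b) (bN : b < N%:R) (s0 : 0 < s) (sN : s * N%:R = 2 - b).
Local Notation X := 'rV[R]_N.
Local Notation leb := (lebesgue_rV R N).
Local Notation intg := (intg leb).
Local Notation L2 := (L2 leb).
Local Notation dot := (L2dot leb).
Local Notation wt := (@wt R N b).
Local Notation p := (2 * s + 2).
Local Notation wnm := (@wnm R N b s).
Local Notation wint := (@wint R N b s).
Local Notation pw := (pw s).

Let p0 : 0 < p. Proof. by rewrite addr_gt0// mulr_gt0. Qed.

Lemma dyavg_sqr_le k : exists2 A, 0 <= A & forall g, L2 g -> forall x : X,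
  dyavg k g x ^+ 2 <= A * dot g g.
Proof.
pose V := vol (cube (2^-1 ^+ k) : set X).
have h0 : 0 < (2^-1 ^+ k : R) by rewrite exprn_gt0 ?invr_gt0.
have V0 : 0 < V by rewrite /V vol_cube ?(ltW h0)// exprn_gt0// mulr_gt0.
exists V^-1; first by rewrite invr_ge0 ltW.
by move=> g Lg x; apply: avg_sqr_le => //; [exact: measurable_box|exact: leb_box_lty].
Qed.

Lemma wnm_lty U : H1j U -> (wnm (U None) < +oo)%E.
Proof.
move=> HU; have [LU _] := HU; have Lu : L2 (U None) := LU None.
have L0 := dyavg_L2 0 HU.
have [A A0 HA] := dyavg_sqr_le 0.
have gA x := HA _ Lu x.
have mg : measurable_fun setT (dyavg 0 (U None)) by case: L0.
have mu_ : measurable_fun setT (U None) by case: Lu.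
have [iq _ _] := quad_split b0 bN (ltr01 : (0 : R) < 1) gA L0.
have := wint_quad s0 gA mg iq; set D := _ * _ => hD.
have D0 : 0 <= D by rewrite -lee_fin; apply: le_trans hD; exact: wint_ge0.
have h1 : (wnm (dyavg 0 (U None)) <= (D `^ p^-1)%:E)%E.
  by apply: wnm_le => //; rewrite ?powR_ge0// powRKV// gt_eqF.
have h2 := wnm_sub_dyavg b0 bN s0 sN 0 HU.
have -> : U None = fun x => (U None x - dyavg 0 (U None) x) + dyavg 0 (U None) x.
  by apply/funext => x; rewrite subrK.
apply: le_lt_trans (wnm_add _ s0 _ _) _ => //; first exact: measurable_funB.
by apply: le_lt_trans (leeD h2 h1) _; rewrite -EFinD ltry.
Qed.

(** One scale [k] is fixed at which every [W n] is within [e / 2] of its average. The averages are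
    bounded and tend to zero pointwise, so dominated convergence handles a large cube and the
    smallness of the weight its complement. *)
Lemma wnm_compact (W : nat -> option 'I_N -> X -> R) (G : R) :
  (forall n, H1j (W n)) -> (forall n, gdot (W n) (W n) <= G) ->
  (forall n, dot (W n None) (W n None) <= G) ->
  (forall k x, (fun n => dyavg k (W n None) x) @ \oo --> (0 : R)) ->
  forall e, 0 < e -> exists K, forall n, (K <= n)%N -> (wnm (W n None) <= e%:E)%E.
Proof.
move=> HW gW dW cW e e0.
have LW n : L2 (W n None) by case: (HW n) => h _; exact: h.
have G0 : 0 <= G by apply: le_trans (dW 0); exact: dot_ge0.
have e20 : 0 < e / 2 by rewrite divr_gt0.
have C0 := @wemb_const_ge0 R N b s s0.
have [k hk] : exists k, @wemb_const R N b s * wratio s ^+ k * Num.sqrt G <= e / 2 :> R.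
  pose D := @wemb_const R N b s * Num.sqrt G + 1.
  have D0 : 0 < D by rewrite ltr_wpDl// mulr_ge0 ?sqrtr_ge0.
  have : (fun k => wratio s ^+ k) @ \oo --> (0 : R).
    by apply: cvg_expr; rewrite ger0_norm ?wratio_ge0// wratio_lt1.
  have eD : 0 < e / 2 / D by rewrite divr_gt0.
  move=> /cvgr_lt/(_ _ eD)[k _ Hk]; exists k.
  have := Hk k (leqnn k); rewrite ltr_pdivlMr// => h; apply: le_trans (ltW h).
  rewrite /D mulrDr mulr1 mulrAC [leLHS]mulrC; rewrite lerDl; exact: exprn_ge0 (wratio_ge0 _).
pose f n := dyavg k (W n None).
have Lf n : L2 (f n) by exact: dyavg_L2.
have mf n : measurable_fun setT (f n) by case: (Lf n).
have [A1 A10 HA] := dyavg_sqr_le k.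
pose A := A1 * G.
have fA n x : f n x ^+ 2 <= A.
  by apply: le_trans (HA _ (LW n) x) _; rewrite ler_wpM2l.
have A0 : 0 <= A by exact: mulr_ge0.
pose B := 2 * (N%:R * (2^-1 ^+ k) ^+ 2 * G) + 2 * G.
have fB n : dot (f n) (f n) <= B.
  have LN : L2 (fun x => - W n None x) := L2N (LW n).
  have -> : f n = fun x => (f n x - W n None x) - (- W n None x).
    by apply/funext => x; rewrite opprK subrK.
  apply: le_trans (dot_sub_le (L2B (Lf n) (LW n)) LN) _.
  rewrite dotNl// dotNr// opprK; apply: lerD; last by rewrite ler_pM2l.
  rewrite ler_pM2l//; apply: le_trans (dyavg_approx k (HW n)) _.
  by rewrite ler_wpM2l// mulr_ge0// sqr_ge0.
have B0 : 0 <= B by apply: le_trans (fB 0); exact: dot_ge0.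
pose c := (e / 2) `^ p; have cp : 0 < c by exact: powR_gt0.
pose As := A `^ s; have As0 : 0 <= As by exact: powR_ge0.
(* Solves [r ^ (- b) = (c / 2) / (As B + 1)], the [+ 1] covering a vanishing [As B]. *)
have [r r0 hr] : exists2 r, 0 < r & As * (r `^ (- b) * B) <= c / 2.
  have D0 : 0 < As * B + 1 by rewrite ltr_wpDl// mulr_ge0.
  have c20 : 0 < c / 2 by rewrite divr_gt0.
  exists (((As * B + 1) / (c / 2)) `^ b^-1); first by rewrite powR_gt0// divr_gt0.
  rewrite powRN powRKV ?gt_eqF//; last by rewrite divr_ge0 ?ltW.
  rewrite invf_div; move: (As * B + 1) (lerDl (As * B) 1) D0 => D hD D0.
  have -> : As * (c / 2 / D * B) = c / 2 * (As * B) / D by ring.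
  by rewrite ler_pdivrMr// ler_wpM2l ?(ltW c20)// hD.
pose I n := \int[leb]_x (wt x * \1_(cube r) x * f n x ^+ 2).
have cI : I @ \oo --> (0 : R).
  rewrite -(@Rint0 _ _ _ leb).
  apply: (proj2 (@Rint_dct _ _ _ leb (fun n x => wt x * \1_(cube r) x * f n x ^+ 2) (fun=> 0) (fun x => A * (wt x * \1_(cube r) x)) _ _ _ _ _)).
  - move=> n; apply: measurable_funM; last exact: measurable_funX.
    exact: (intg_meas (intg_wt_cube b0 bN r)).
  - by [].
  - apply: aeW => x; rewrite -[X in _ --> X](mulr0 (wt x * \1_(cube r) x)).
    apply: cvgMl_tmp; rewrite -(mulr0 0); under eq_fun do rewrite expr2.
    by apply: cvgM; exact: cW.
  - by apply: intgZ; exact: intg_wt_cube.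
  - apply: aeW => x n; have h : 0 <= wt x * \1_(cube r) x by rewrite mulr_ge0 ?wt_ge0 ?indicE.
    have q0 := mulr_ge0 h (sqr_ge0 (f n x)).
    by rewrite ger0_norm// mulrC ler_wpM2r.
have c3 : 0 < c / 2 / (As + 1) by rewrite !divr_gt0// ltr_wpDl.
have [K _ HK] := cvgr_lt _ cI _ c3.
exists K => n Kn; have := HK n Kn; rewrite ltr_pdivlMr ?ltr_wpDl// => hI.
have [iq i1 hq] := quad_split b0 bN r0 (fA n) (Lf n).
have wf : (wnm (f n) <= (e / 2)%:E)%E.
  apply: wnm_le => //; first exact: ltW.
  apply: le_trans (wint_quad s0 (fA n) (mf n) iq) _; rewrite lee_fin -/As -/c.
  apply: (@le_trans _ _ (As * I n + As * (r `^ (- b) * B))).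
    rewrite -mulrDr ler_wpM2l//; apply: le_trans hq _.
    by rewrite lerD2l ler_wpM2l ?powR_ge0.
  have I0 : 0 <= I n.
    by apply: Rint_ge0 => x; rewrite mulr_ge0 ?sqr_ge0// mulr_ge0 ?wt_ge0 ?indicE.
  rewrite [leRHS](splitr c); apply: lerD => //; apply: le_trans (ltW hI).
  by rewrite mulrC ler_wpM2l// lerDl.
have h2 := wnm_sub_dyavg b0 bN s0 sN k (HW n).
have -> : W n None = fun x => (W n None x - f n x) + f n x.
  by apply/funext => x; rewrite subrK.
apply: le_trans (wnm_add _ s0 _ _) _ => //.
  by apply: measurable_funB => //; case: (LW n).
rewrite (splitr e) EFinD; apply: leeD => //; apply: le_trans h2 _; rewrite lee_fin.
apply: le_trans hk; apply: ler_wpM2l; last exact: ler_wsqrtr.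
by apply: (mulr_ge0 C0); exact: exprn_ge0 (wratio_ge0 _).
Qed.

Lemma intg_wpw U : H1j U -> intg (fun x => wt x * pw (U None x)).
Proof.
move=> HU; have [LU _] := HU; have Lu : L2 (U None) := LU None.
apply: intg_lty => [|x|]; [|by rewrite mulr_ge0 ?wt_ge0 ?pw_ge0|].
  by apply: measurable_wpw => //; case: Lu.
have := wnm_lty HU; rewrite (wnmE _ s0) => /lty_poweRy; apply.
by rewrite invr_eq0 gt_eqF.
Qed.

Definition wfun (u : X -> R) : R := \int[leb]_x (wt x * pw (u x)).

Lemma wfun_ge0 u : 0 <= wfun u.
Proof. by apply: Rint_ge0 => x; rewrite mulr_ge0 ?wt_ge0 ?pw_ge0. Qed.

Lemma wnm_wfun U : H1j U -> wnm (U None) = (wfun (U None) `^ p^-1)%:E.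
Proof. by move=> /intg_wpw/EFin_Rint h; rewrite (wnmE _ s0) -poweR_EFin; congr (_ `^ _)%E; rewrite h. Qed.

End weighted_compactness.
(** * Minimizers of the Weinstein quotient *)

Section test_jets.
Context {R : realType} {N : nat}.
Local Notation X := 'rV[R]_N.
Local Notation leb := (lebesgue_rV R N).
Local Notation L2 := (L2 leb).
Local Notation dot := (L2dot leb).
Local Notation e i := (delta_mx ord0 i : X).

Lemma dpartial_delta i (phi : X -> R) : dpartial (e i) phi = partial i phi :> (X -> R).
Proof.
apply/funext => x; rewrite /dpartial (bigD1 i)//= big1 ?addr0.
  by rewrite mxE !eqxx mul1r.
by move=> j ji; rewrite mxE eqxx (negPf ji) mul0r.
Qed.

Lemma dpartial_opp (z : X) (phi : X -> R) : dpartial (- z) phi = (fun x => - dpartial z phi x) :> (X -> R).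
Proof. by apply/funext => x; rewrite /dpartial -sumrN; apply: eq_bigr => i _; rewrite mxE mulNr. Qed.

(** Integration by parts as one derivative computed twice: pairing [phi] with [psi] translated by
    [t e_i] is the same as pairing [psi] with [phi] translated by [- t e_i]. *)
Lemma test_wpd i (phi : X -> R) : test_function phi -> wpd i phi (partial i phi).
Proof.
move=> tp psi tq; have Lp := test_L2 tp; have Lq := test_L2 tq.
have h1 := @is_derive_dot_shift _ _ phi psi (e i) 0 Lp tq.
have h2 := @is_derive_dot_shift _ _ psi phi (- e i) 0 Lq tp.
have eqf : (fun t : R => dot phi (fun x => psi (x + t *: e i))) =
           (fun t : R => dot psi (fun x => phi (x + t *: - e i))).
  apply/funext => t; rewrite scalerN.
  have Ls : L2 (fun x : X => phi (x + - (t *: e i))) := shift_L2 _ Lp.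
  rewrite -[RHS]mul1r -(scaling_dot ler01 (leb_shift (t *: e i)) Lq Ls) dotC.
  by congr (dot _ _); apply/funext => x; rewrite addrK.
have E1 : dot phi (fun x => dpartial (e i) psi (x + 0 *: e i)) = dot phi (partial i psi).
  by congr (L2dot leb); apply/funext => x; rewrite scale0r addr0 dpartial_delta.
have E2 : dot psi (fun x => dpartial (- e i) phi (x + 0 *: - e i)) = - dot (partial i phi) psi.
  rewrite -dotNl//; last exact/test_L2/test_partial.
  rewrite dotC; congr (L2dot leb); apply/funext => x.
  by rewrite scale0r addr0 dpartial_opp dpartial_delta.
rewrite eqf E1 in h1; rewrite E2 in h2; exact: is_derive_unique h1 h2.
Qed.

Definition test_jet (phi : X -> R) : option 'I_N -> X -> R :=
  fun o => if o is Some i then partial i phi else phi.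

Lemma H1j_test (phi : X -> R) : test_function phi -> H1j (test_jet phi).
Proof.
move=> tp; split => [[i|]|i]; [exact/test_L2/test_partial|exact: test_L2|exact: test_wpd].
Qed.

Lemma gdot_test U (phi : X -> R) : H1j U -> test_function phi ->
  gdot U (test_jet phi) = - dot (U None) (laplacian phi).
Proof.
move=> [LU WU] tp; rewrite /gdot.
have Lpp i : L2 (iter_partial [:: i; i] phi).
  by apply: test_L2; apply: test_partial; exact: test_partial.
rewrite (eq_bigr (fun i => - dot (U None) (iter_partial [:: i; i] phi))); last first.
  by move=> i _; rewrite /= WU ?opprK//; exact: test_partial.
rewrite sumrN -dot_sumr//; exact: LU None.
Qed.

End test_jets.

(** * Weak convergence and the weighted norm *)

Section weak_convergence.
Context {R : realType} {N : nat}.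
Variables b s : R.
Hypotheses (b0 : 0 < b) (bN : b < N%:R) (s0 : 0 < s) (sN : s * N%:R = 2 - b).
Local Notation X := 'rV[R]_N.
Local Notation leb := (lebesgue_rV R N).
Local Notation L2 := (L2 leb).
Local Notation dot := (L2dot leb).
Local Notation p := (2 * s + 2).
Local Notation wnm := (@wnm R N b s).
Local Notation jet := (option 'I_N -> X -> R).
Local Notation hfun := (functional (@fadd _ X R (option 'I_N)) (@fscale _ X R (option 'I_N)) (fdot leb (I := option 'I_N)) H1j).

Definition jsub (U V : jet) : jet := fadd U (fscale (-1) V).

Lemma H1j_sub U V : H1j U -> H1j V -> H1j (jsub U V).
Proof.
by move=> HU HV; apply: (hilbertD H1j_hilbert) => //; exact: (hilbertZ H1j_hilbert).
Qed.

Lemma functional_dyavg k (x : X) : hfun (fun U => dyavg k (U None) x).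
Proof.
have [A A0 HA] := @dyavg_sqr_le R N k.
have mc : measurable (cube (2^-1 ^+ k) : set X) by exact: measurable_box.
have L1 : L2 (\1_(cube (2^-1 ^+ k)) : X -> R) by apply: L2_indic => //; exact: leb_box_lty.
split=> [U V [LU _] [LV _]|a U [LU _]|].
- have Lu := shift_L2 x (LU None); have Lv := shift_L2 x (LV None).
  by rewrite /dyavg /avg /fadd dotDr// mulrDr.
- have Lu := shift_L2 x (LU None).
  by rewrite /dyavg /avg /fscale dotZr// mulrCA.
- exists A => // U [LU _]; apply: le_trans (HA _ (LU None) x) _.
  by rewrite ler_wpM2l// fdotE lerDl gdot_ge0.
Qed.

(** [dyavg k] at a point is a bounded functional, so weak convergence makes the averages of the
    differences tend to zero pointwise, as [wnm_compact] requires. *)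
Lemma wnm_weak_cvg (U : nat -> jet) V (G : R) : (forall n, H1j (U n)) -> H1j V ->
  (forall n, fdot leb (U n) (U n) <= G) ->
  (forall l, hfun l -> (fun n => l (U n)) @ \oo --> l V) ->
  forall e, 0 < e -> exists K, forall n, (K <= n)%N -> (wnm (jsub (U n) V None) <= e%:E)%E.
Proof.
move=> HU HV UG cU.
have HW n := H1j_sub (HU n) HV.
pose G' := 2 * G + 2 * fdot leb V V.
have WG n : fdot leb (jsub (U n) V) (jsub (U n) V) <= G'.
  have h : fdot leb (jsub (U n) V) (jsub (U n) V) + fdot leb (fadd (U n) V) (fadd (U n) V) =
      2 * fdot leb (U n) (U n) + 2 * fdot leb V V.
    have hP := @H1j_hilbert R N; have HZ : H1j (fscale (-1) V) by exact: (hilbertZ hP).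
    have HA : H1j (fadd (U n) V) by exact: (hilbertD hP).
    rewrite (ipDl hP)// (ipDr hP)// (ipDr hP)// (ipDl hP)// (ipDr hP)// (ipDr hP)//.
    by rewrite !(ipZl hP)// !(ipZr hP)//; ring.
  have h2 : 0 <= fdot leb (fadd (U n) V) (fadd (U n) V).
    by apply: (ip_ge0 H1j_hilbert); exact: (hilbertD H1j_hilbert).
  rewrite -(lerD2r (fdot leb (fadd (U n) V) (fadd (U n) V))) h.
  apply: le_trans (_ : 2 * G + 2 * fdot leb V V <= _); last by rewrite lerDl.
  by rewrite lerD2r ler_pM2l.
apply: (wnm_compact b0 bN s0 sN (W := fun n => jsub (U n) V) (G := G')) => //.
- by move=> n; apply: le_trans (WG n); rewrite fdotE lerDr dot_ge0.
- by move=> n; apply: le_trans (WG n); rewrite fdotE lerDl gdot_ge0.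
- move=> k x; have [hD hZ _] := functional_dyavg k x.
  have HZ : H1j (fscale (-1) V) by exact: (hilbertZ H1j_hilbert).
  rewrite (_ : (fun n => _) = (fun n => dyavg k (U n None) x - dyavg k (V None) x)).
    rewrite -(subrr (dyavg k (V None) x)); apply: cvgB; last exact: cvg_cst.
    exact: (cU _ (functional_dyavg k x)).
  by apply/funext => n; rewrite /jsub hD// hZ// mulN1r.
Qed.

Lemma wnm_sub_le (f g : X -> R) : measurable_fun setT f -> measurable_fun setT g ->
  (wnm f <= wnm (fun x => (f x - g x)%R) + wnm g)%E.
Proof.
move=> mf mg; have := @wnm_add R N b s s0 (fun x => f x - g x) g.
have -> : (fun x => (f x - g x + g x)%R) = f by apply/funext => x; rewrite subrK.
by apply => //; exact: measurable_funB.
Qed.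

Lemma wnm_opp (f : X -> R) : wnm (fun x => (- f x)%R) = wnm f.
Proof. by rewrite !(wnmE _ s0); congr (_ `^ _)%E; apply: eq_integral => x _; rewrite /pw sqrrN. Qed.

Lemma wnm_weak_le (U : nat -> jet) V (G c : R) : (forall n, H1j (U n)) -> H1j V ->
  (forall n, fdot leb (U n) (U n) <= G) ->
  (forall l, hfun l -> (fun n => l (U n)) @ \oo --> l V) ->
  (forall n, (c%:E <= wnm (U n None))%E) -> (c%:E <= wnm (V None))%E.
Proof.
move=> HU HV UG cU cn; apply/lee_addgt0Pr => e e0.
have [K HK] := wnm_weak_cvg HU HV UG cU e0.
have mU : measurable_fun setT (U K None) by case: (HU K) => h _; case: (h None).
have mV : measurable_fun setT (V None) by case: HV => h _; case: (h None).
apply: le_trans (cn K) _; apply: le_trans (wnm_sub_le mU mV) _; rewrite addeC leeD2l//.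
have := HK K (leqnn K); congr (wnm _ <= _)%E.
by apply/funext => x; rewrite /jsub /fadd /fscale mulN1r.
Qed.

(** Cauchy-Schwarz between the limit and the sequence, then division by the squared norm of the
    limit. *)
Lemma weak_ip_le (U : nat -> jet) V (c : R) : (forall n, H1j (U n)) -> H1j V ->
  (forall l, hfun l -> (fun n => l (U n)) @ \oo --> l V) ->
  (fun n => fdot leb (U n) (U n)) @ \oo --> c -> fdot leb V V <= c.
Proof.
move=> HU HV cU cc; have hP := @H1j_hilbert R N.
have V0 := ip_ge0 hP HV.
have c0 : 0 <= c by apply: (cvgr_to_ge cc); apply: nearW => n; exact: (ip_ge0 hP).
have h1 := cU _ (functional_ip hP HV).
have : fdot leb V V ^+ 2 <= fdot leb V V * c.
  have l1 : (fun n => fdot leb V (U n) ^+ 2) @ \oo --> fdot leb V V ^+ 2.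
    by rewrite expr2; under eq_fun do rewrite expr2; exact: cvgM.
  have l2 : (fun n => fdot leb V V * fdot leb (U n) (U n)) @ \oo --> fdot leb V V * c.
    exact: cvgMl_tmp.
  by apply: (ler_cvg_to l1 l2); apply: nearW => n; exact: (cauchy_schwarz hP).
rewrite expr2; move: V0; rewrite le_eqVlt => /predU1P[<-//|V0].
by rewrite ler_pM2l.
Qed.

End weak_convergence.

(** * Convexity of the nonlinearity *)

Section power_facts.
Context {R : realType}.
Variable s : R.
Hypothesis s0 : 0 < s.
Local Notation p := (2 * s + 2).
Local Notation pw := (@pw R s).

(** The derivative of [pw] is [p dpw]. *)
Definition dpw (t : R) : R := (t ^+ 2) `^ s * t.

Lemma pwM (c t : R) : pw (c * t) = pw c * pw t.
Proof. by rewrite /pw exprMn powRM ?sqr_ge0//; ring. Qed.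

Lemma pw_norm t : pw `|t| = pw t.
Proof. by rewrite /pw real_normK ?num_real. Qed.

Lemma pw_nneg t : 0 <= t -> pw t = t `^ p.
Proof. by move=> t0; rewrite pwE// ger0_norm. Qed.

Lemma pw_mono t u : 0 <= t -> t <= u -> pw t <= pw u.
Proof.
move=> t0 tu; rewrite !pw_nneg ?(le_trans t0)//; apply: powR_le_mono => //.
by rewrite addr_ge0// mulr_ge0// ltW.
Qed.

Lemma pw_inj t u : 0 <= t -> 0 <= u -> pw t = pw u -> t = u.
Proof.
move=> t0 u0; rewrite !pw_nneg// => h; apply: powR_injective h; rewrite ?nnegrE//.
by rewrite addr_gt0// mulr_gt0.
Qed.

(* Bernoulli's inequality for [x `^ (s + 1)], obtained from Young's. *)
Lemma powR_tangent (a x : R) : 0 <= a -> 0 <= x ->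
  a `^ s * a + (s + 1) * a `^ s * (x - a) <= x `^ s * x.
Proof.
move=> a0 x0; have q0 : 0 < s + 1 by rewrite addr_gt0.
have E y : 0 <= y -> y `^ (s + 1) = y `^ s * y.
  rewrite le_eqVlt => /predU1P[<-|y0]; first by rewrite powR0 ?gt_eqF// mulr0.
  by rewrite powRD ?(gt_eqF y0) ?implybT// powRr1// ltW.
have hc : (s + 1)^-1 + ((s + 1) / s)^-1 = 1.
  by rewrite invf_div -[X in X + _]mul1r -mulrDl addrC divff// gt_eqF.
have es : s * ((s + 1) / s) = s + 1 by rewrite mulrC divfK// gt_eqF.
have := conjugate_powR x0 (powR_ge0 a s) q0 (divr_gt0 q0 s0) hc.
rewrite -powRrM es !E// invf_div => h.
rewrite -(ler_pM2r (x := (s + 1)^-1)) ?invr_gt0//.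
move: h; move: (x `^ s) (a `^ s) => X A h.
have -> : (A * a + (s + 1) * A * (x - a)) / (s + 1) = A * x - A * a * (s / (s + 1)).
  by field; rewrite gt_eqF.
by rewrite lerBlDr (mulrC A x).
Qed.

Lemma pw_tangent u h : pw u + p * dpw u * h <= pw (u + h).
Proof.
have := powR_tangent (sqr_ge0 u) (sqr_ge0 (u + h)); rewrite /pw /dpw; apply: le_trans.
rewrite lerD2l; have := powR_ge0 (u ^+ 2) s; move: (_ `^ _) => A A0.
have -> : (u + h) ^+ 2 - u ^+ 2 = 2 * u * h + h ^+ 2 by ring.
have -> : (2 * s + 2) * (A * u) * h = (s + 1) * A * (2 * u * h) by ring.
apply: ler_wpM2l; last by rewrite lerDl sqr_ge0.
by rewrite mulr_ge0// addr_ge0// ltW.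
Qed.

(** Bounded by the power of whichever of [|u|] and [|h|] is larger; this makes the first variation
    integrable. *)
Lemma dpw_bound u h : `|dpw u * h| <= pw u + pw h.
Proof.
rewrite /dpw !normrM (ger0_norm (powR_ge0 _ _)) -mulrA.
have e v : pw v = (v ^+ 2) `^ s * (`|v| * `|v|) by rewrite /pw -(real_normK (num_real v)).
have [hu|/ltW uh] := leP `|h| `|u|.
  apply: le_trans (_ : pw u <= _); last by rewrite lerDl pw_ge0.
  by rewrite e; apply: ler_wpM2l; [exact: powR_ge0|exact: ler_wpM2l].
apply: le_trans (_ : pw h <= _); last by rewrite lerDr pw_ge0.
rewrite e; apply: ler_pM; rewrite ?powR_ge0 ?mulr_ge0//.
  apply: powR_le_mono; rewrite ?sqr_ge0 ?(ltW s0)//.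
  by rewrite -(real_normK (num_real u)) -(real_normK (num_real h)); apply: lerXn2r; rewrite ?nnegrE.
exact: ler_wpM2r.
Qed.

(** From [ln (1 + y) >= y / (1 + y)]. The usual minorant [1 + q y] fails for exponents below [1],
    and the exponent of interest is [2 / p = 1 / (s + 1)]; to first order at [y = 0] the two
    agree. *)
Lemma powR_bernoulli (q y : R) : 0 <= q -> - 1 < y -> 1 + q * (y / (1 + y)) <= (1 + y) `^ q.
Proof.
move=> q0 y1; have t0 : 0 < 1 + y by lra.
rewrite /powR gt_eqF//; apply: le_trans (expR_ge1Dx _); rewrite lerD2l ler_wpM2l//.
have t1 : 0 < (1 + y)^-1 by rewrite invr_gt0.
have : 1 - ln (1 + y) <= (1 + y)^-1.
  by have := expR_ge1Dx (- ln (1 + y)); rewrite expRN lnK.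
have -> : y / (1 + y) = 1 - (1 + y)^-1 by field; rewrite gt_eqF.
lra.
Qed.

End power_facts.

(** * Existence of minimizers and the Euler-Lagrange equation *)

Section minimizer.
Context {R : realType} {N : nat}.
Variables b s : R.
Hypotheses (b0 : 0 < b) (bN : b < N%:R) (s0 : 0 < s) (sN : s * N%:R = 2 - b).
Local Notation X := 'rV[R]_N.
Local Notation leb := (lebesgue_rV R N).
Local Notation intg := (intg leb).
Local Notation L2 := (L2 leb).
Local Notation dot := (L2dot leb).
Local Notation wt := (@wt R N b).
Local Notation p := (2 * s + 2).
Local Notation pw := (@pw R s).
Local Notation dpw := (@dpw R s).
Local Notation wfun := (@wfun R N b s).
Local Notation wnm := (@wnm R N b s).
Local Notation jet := (option 'I_N -> X -> R).
Local Notation fdot := (fdot leb (I := option 'I_N)).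

Let p0 : 0 < p. Proof. by rewrite addr_gt0// mulr_gt0. Qed.
Let pn : p != 0. Proof. by rewrite gt_eqF. Qed.
Let hP := @H1j_hilbert R N.

Lemma wfunZ (c : R) U : H1j U -> wfun (fun x => c * U None x) = pw c * wfun (U None).
Proof.
move=> HU; rewrite /wfun -RintZ; last exact: (intg_wpw b0 bN s0 sN).
by apply: eq_Rintegral => x _; rewrite pwM; ring.
Qed.

(** The last clause is homogeneous of degree two in [V], so dilations and polarizations can be
    inserted without renormalization. *)
Definition minimizer (S : R) (U : jet) := [/\ H1j U, wfun (U None) = 1, fdot U U = S &
  forall V, H1j V -> S * wfun (V None) `^ (2 / p) <= fdot V V].

Lemma wnm_eq1 U : H1j U -> (wnm (U None) = 1%:E) <-> wfun (U None) = 1.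
Proof.
move=> HU; rewrite (wnm_wfun b0 bN s0 sN HU); split => [[h]|->]; last by rewrite powR1.
by rewrite -[LHS](powRKV pn) ?wfun_ge0// h powR1.
Qed.

Lemma wfun_weak_cvg (U : nat -> jet) V (G : R) : (forall n, H1j (U n)) -> H1j V ->
  (forall n, fdot (U n) (U n) <= G) ->
  (forall l, functional (@fadd _ X R (option 'I_N)) (@fscale _ X R (option 'I_N)) fdot H1j l ->
    (fun n => l (U n)) @ \oo --> l V) ->
  (forall n, wfun (U n None) = 1) -> wfun (V None) = 1.
Proof.
move=> HU HV UG cU U1; apply/(wnm_eq1 HV)/eqP; rewrite eq_le; apply/andP; split.
  apply/lee_addgt0Pr => e e0.
  have [K HK] := wnm_weak_cvg b0 bN s0 sN HU HV UG cU e0.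
  have mU : measurable_fun setT (U K None) by case: (HU K) => h _; case: (h None).
  have mV : measurable_fun setT (V None) by case: HV => h _; case: (h None).
  apply: le_trans (wnm_sub_le b s0 mV mU) _.
  rewrite ((wnm_eq1 (HU K)).2 (U1 K)) addeC leeD2l//.
  have := HK K (leqnn K); rewrite -(wnm_opp b s0); congr (wnm _ <= _)%E.
  by apply/funext => x; rewrite /jsub /fadd /fscale mulN1r opprD opprK addrC.
apply: (wnm_weak_le b0 bN s0 sN HU HV UG cU) => n.
by rewrite (wnm_eq1 (HU n)).2.
Qed.

(** [U0] makes the constraint set nonempty. The constraint survives weak limits by [wfun_weak_cvg];
    passing to the modulus of the limit keeps it and does not increase the norm. *)
Lemma minimizer_exists (U0 : jet) : H1j U0 -> 0 < wfun (U0 None) ->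
  exists S U, [/\ 0 < S, minimizer S U & forall x, 0 <= U None x].
Proof.
move=> HU0 w0.
pose adm V := H1j V /\ wfun (V None) = 1.
have norm V : H1j V -> 0 < wfun (V None) ->
    adm (fscale (wfun (V None) `^ (- p^-1)) V) /\
    fdot (fscale (wfun (V None) `^ (- p^-1)) V) (fscale (wfun (V None) `^ (- p^-1)) V) =
      (wfun (V None) `^ (2 / p))^-1 * fdot V V.
  move=> HV d0; set d := wfun (V None) in d0 *; set c := d `^ _.
  have HcV : H1j (fscale c V) by exact: (hilbertZ hP).
  split; last first.
    rewrite (ipZl hP)// (ipZr hP)// mulrA; congr (_ * _).
    rewrite /c -powRD; last by rewrite (gt_eqF d0) implybT.
    by rewrite -powRN; congr (_ `^ _); field.
  split => //; rewrite [LHS](wfunZ _ HV) pw_nneg ?powR_ge0// /c -powRrM mulNr mulVf//.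
  by rewrite powRN powRr1 ?(ltW d0)// mulVf// gt_eqF.
pose E := [set r : R | exists2 V, adm V & r = fdot V V].
pose S := inf E.
have lbE : lbound E 0 by move=> r [V [HV _] ->]; exact: (ip_ge0 hP).
have hE : has_inf E.
  split; last by exists 0.
  by have [a _] := norm _ HU0 w0; eexists; eexists; [exact: a|reflexivity].
have Sle V : H1j V -> S * wfun (V None) `^ (2 / p) <= fdot V V.
  move=> HV; have := wfun_ge0 b s (V None); rewrite le_eqVlt => /predU1P[<-|d0].
    rewrite powR0 ?mulr0; first exact: (ip_ge0 hP).
    by rewrite mulf_neq0 ?invr_eq0.
  have [a e] := norm V HV d0.
  rewrite -ler_pdivlMr ?powR_gt0// mulrC -e.
  by apply: ge_inf; [by exists 0|eexists; [exact: a|]].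
have ex n : exists V, adm V /\ fdot V V < S + n.+1%:R^-1.
  have [r [V aV ->] h] := @inf_adherent R E n.+1%:R^-1 (ltac:(by rewrite invr_gt0)) hE.
  by exists V.
have [u Hu] := choice ex.
have HU n : H1j (u n) by case: (Hu n) => -[].
have uG n : fdot (u n) (u n) <= S + 1.
  apply: le_trans (ltW (Hu n).2) _; rewrite lerD2l invf_le1//; exact: ler1n.
have [k ki [V HV cV]] := hilbert_weak_compact hP HU uG.
have wV : wfun (V None) = 1.
  apply: (wfun_weak_cvg (U := fun n => u (k n)) (G := S + 1)) => // n.
  by case: (Hu (k n)) => -[].
have kge n : (n <= k n)%N by elim: n => // n IH; apply: leq_ltn_trans IH _; exact: ki.
have SE V' : adm V' -> S <= fdot V' V'.
  by move=> aV'; apply: ge_inf; [exists 0|exists V'].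
have VS : fdot V V <= S.
  apply: (weak_ip_le (U := fun n => u (k n))) => //.
  apply: (squeeze_cvgr (f := fun=> S) (h := fun n => S + n.+1%:R^-1)).
  - apply: nearW => n; apply/andP; split; first exact: SE (Hu _).1.
    apply: le_trans (ltW (Hu (k n)).2) _.
    by rewrite lerD2l lef_pV2 ?posrE// ler_nat ltnS.
  - exact: cvg_cst.
  - rewrite -[X in _ --> X]addr0; apply: cvgD; [exact: cvg_cst|exact: cvg_harmonic].
(* A zero infimum would force the limit to vanish almost everywhere, against [wfun = 1]. *)
have S0 : 0 < S.
  apply: lt_le_trans VS; rewrite lt_neqAle (ip_ge0 hP HV) andbT.
  apply/eqP => V0; have LV : L2 (V None) by case: HV => h _; exact: h.
  have d0 : dot (V None) (V None) = 0.
    apply/eqP; rewrite eq_le dot_ge0 andbT V0 fdotE lerDl; exact: gdot_ge0.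
  have : wfun (V None) = 0.
    rewrite /wfun -(@Rint0 _ _ _ leb); apply: Rint_ae => //.
      exact: (intg_meas (intg_wpw b0 bN s0 sN HV)).
    by apply: filterS (dot_eq0 LV d0) => x ->; rewrite /pw expr0n/= !mulr0.
  by rewrite wV => /eqP; rewrite oner_eq0.
pose O : jet := fun=> fun=> 0.
have HO : H1j O.
  split => [j|i phi tphi]; first exact: L2_0.
  by rewrite /O !(dotC _ (fun=> 0)) !dot0r oppr0.
have [LV _] := HV.
have [||| A [HA A0 Ai]] := @H1j_of_lipschitz R N V O (fun x => `|V None x|) HV HO.
- by apply: measurableT_comp => //; case: (LV None).
- by move=> x; rewrite real_normK ?num_real// lerDl sqr_ge0.
- move=> x y; rewrite /O subrr expr0n addr0 -[leLHS]real_normK ?num_real//.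
  by rewrite -[leRHS]real_normK ?num_real// ler_sqr ?nnegrE//; exact: ler_dist_dist.
have wA : wfun (A None) = 1.
  by rewrite -wV A0; apply: eq_Rintegral => x _; rewrite pw_norm.
exists S, A; split => //; last by move=> x; rewrite A0.
split => //; apply/eqP; rewrite eq_le SE// andbT; apply: le_trans VS.
have O0 : dot (fun=> 0) (fun=> 0) = 0 by exact: dot0r.
rewrite !fdotE; apply: lerD.
  rewrite A0 !dotE le_eqVlt; apply/orP; left; apply/eqP; apply: eq_Rintegral => x _.
  by rewrite real_normK ?num_real.
by apply: ler_sum => i _; apply: le_trans (Ai i) _; rewrite /O O0 addr0.
Qed.

Section euler_lagrange.
Variables (S : R) (U : jet).
Hypotheses (S0 : 0 < S) (mU : minimizer S U).
Local Notation u := (U None).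

Let HU : H1j U. Proof. by case: mU. Qed.

Lemma intg_dpw Phi : H1j Phi -> intg (fun x => wt x * (dpw (u x) * Phi None x)).
Proof.
move=> HP; have i1 := intg_wpw b0 bN s0 sN HU; have i2 := intg_wpw b0 bN s0 sN HP.
have m1 : measurable_fun setT u by case: HU => h _; case: (h None).
have m2 : measurable_fun setT (Phi None) by case: HP => h _; case: (h None).
apply: intg_le (intgD i1 i2) => [|x].
  apply: measurable_funM; first exact: measurable_wt.
  apply: measurable_funM => //; apply: measurable_funM => //.
  by apply: (measurableT_comp (measurable_powR s)); exact: measurable_funX.
rewrite normrM (ger0_norm (wt_ge0 _ _)) -mulrDr; apply: ler_wpM2l; first exact: wt_ge0.
exact: dpw_bound.
Qed.

(* Comparison of first-order terms at [t = 0], from both sides. *)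
Lemma slope_eq (a c k m : R) :
  (forall t, -1 < t * k -> 2 * t * m * (1 + t * k)^-1 <= 2 * t * a + t ^+ 2 * c) -> a = m.
Proof.
move=> H; pose K := `|c + 2 * a * k| + `|c * k| + `|k| + 1.
have c1 := normr_ge0 (c + 2 * a * k); have c2 := normr_ge0 (c * k); have c3 := normr_ge0 k.
have K0 : 0 < K by rewrite /K; lra.
have main t : `|t| <= 1 -> `|t| * K < 1 -> 0 <= 2 * t * (a - m) + t ^+ 2 * K.
  move=> t1 tK; have tk : `|t * k| < 1.
    rewrite normrM; apply: le_lt_trans tK; rewrite ler_wpM2l// /K; lra.
  have := tk; rewrite ltr_norml => /andP[tk1 tk2].
  have h := H t tk1; have d0 : 0 < 1 + t * k by rewrite -ltrBlDl sub0r.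
  move: h; rewrite ler_pdivrMr// => h.
  have e1 : (2 * t * a + t ^+ 2 * c) * (1 + t * k) =
     2 * t * a + t ^+ 2 * (c + 2 * a * k + t * (c * k)) by ring.
  have l1 : c + 2 * a * k + t * (c * k) <= K.
    have := ler_norm (c + 2 * a * k); have := ler_norm (t * (c * k)); rewrite normrM.
    have : `|t| * `|c * k| <= `|c * k| by rewrite ler_piMl.
    by rewrite /K; lra.
  have l2 : t ^+ 2 * (c + 2 * a * k + t * (c * k)) <= t ^+ 2 * K by rewrite ler_wpM2l ?sqr_ge0.
  by move: h; rewrite e1; lra.
apply/eqP; rewrite -subr_eq0; apply/negP => /negP am.
pose n := `|a - m|; have n0 : 0 < n by rewrite normr_gt0.
pose r := Num.min 1 n / (2 * K + 2).
have D0 : 0 < 2 * K + 2 by lra.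
(* The test value will be [t = - r sg (a - m)]: the linear term is then [- 2 r n], and [r K < n]
   keeps the quadratic term below it. *)
have r0 : 0 < r by rewrite divr_gt0// lt_min ltr01.
have rD : r * (2 * K + 2) = Num.min 1 n by rewrite divfK// gt_eqF.
have r1 : r * (2 * K + 2) <= 1 by rewrite rD ge_min lexx.
have r2 : r * (2 * K + 2) <= n by rewrite rD ge_min lexx orbT.
have rK : 0 < r * K by rewrite mulr_gt0.
have := main (- (r * Num.sg (a - m))).
have sg1 : `|Num.sg (a - m)| = 1 by rewrite normr_sg am.
rewrite normrN normrM sg1 mulr1 (gtr0_norm r0) => /(_ _ _)h.
have : 0 <= 2 * - (r * Num.sg (a - m)) * (a - m) + (- (r * Num.sg (a - m))) ^+ 2 * K by apply: h; lra.
have -> : 2 * - (r * Num.sg (a - m)) * (a - m) + (- (r * Num.sg (a - m))) ^+ 2 * K =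
  - (2 * r * (Num.sg (a - m) * (a - m))) + r ^+ 2 * (Num.sg (a - m) ^+ 2) * K by ring.
rewrite -normrEsg sqr_sg am mulr1 -/n.
have : r * (r * K) < r * n by rewrite ltr_pM2l//; lra.
have : 0 < r * n by rewrite mulr_gt0.
rewrite /= expr2 -(mulrA r r K) -(mulrA 2 r n); lra.
Qed.

(** The constraint is minorized rather than differentiated: convexity bounds [wfun] of [U + t Phi]
    below by [1 + t p E], Bernoulli minorizes its power [2 / p], and both hold for either sign of
    [t] near [0], so the slopes at [t = 0] agree. *)
Lemma euler_lagrange Phi : H1j Phi ->
  fdot U Phi = S * \int[leb]_x (wt x * (dpw (u x) * Phi None x)).
Proof.
move=> HP; have [_ w1 fS Sle] := mU; have iE := intg_dpw HP; set E := \int[leb]_x _.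
apply: (@slope_eq _ (fdot Phi Phi) (p * E)) => t tk.
have HtP : H1j (fscale t Phi) by exact: (hilbertZ hP).
have HV : H1j (fadd U (fscale t Phi)) by exact: (hilbertD hP).
have := Sle _ HV; rewrite (ip_addt hP t HU HP) fS => h.
have wge : 1 + t * (p * E) <= wfun (fadd U (fscale t Phi) None).
  have iu := intg_wpw b0 bN s0 sN HU.
  have -> : t * (p * E) = \int[leb]_x (p * t * (wt x * (dpw (u x) * Phi None x))).
    by rewrite RintZ// -/E; ring.
  rewrite -[X in X + _ <= _]w1 /wfun -RintD//; last exact: intgZ.
  apply: Rint_le => [||x]; [by apply: intgD => //; exact: intgZ|exact: (intg_wpw b0 bN s0 sN HV)|].
  rewrite /fadd /fscale; have := pw_tangent s0 (u x) (t * Phi None x).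
  move=> /(ler_wpM2l (wt_ge0 b x)); apply: le_trans; rewrite le_eqVlt; apply/orP; left; apply/eqP.
  by ring.
have q0 : 0 <= 2 / p by rewrite divr_ge0// ltW.
have d0 : 0 < 1 + t * (p * E) by rewrite -ltrBlDl sub0r.
have h2 : S * (1 + 2 / p * (t * (p * E) / (1 + t * (p * E)))) <=
    fdot Phi Phi * t ^+ 2 + 2 * fdot U Phi * t + S.
  apply: le_trans h; rewrite ler_pM2l//; apply: le_trans (powR_bernoulli q0 tk) _.
  by apply: powR_le_mono => //; exact: ltW.
move: h2; rewrite mulrDr mulr1 addrC lerD2r => h2.
have -> : 2 * t * (S * E) * (1 + t * (p * E))^-1 = S * (2 / p * (t * (p * E) / (1 + t * (p * E)))).
  move: (1 + t * (p * E))^-1 => z.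
  have -> : S * (2 / p * (t * (p * E) * z)) = 2 * t * (S * E) * z * (p / p) by ring.
  by rewrite divff// mulr1.
by apply: le_trans h2 _; rewrite le_eqVlt; apply/orP; left; apply/eqP; ring.
Qed.

End euler_lagrange.

End minimizer.

(** * Pohozaev identity and polarization of minimizers *)

Section minimizer_symmetry.
Context {R : realType} {N : nat}.
Variables b s : R.
Hypotheses (b0 : 0 < b) (bN : b < N%:R) (s0 : 0 < s) (sN : s * N%:R = 2 - b).
Local Notation X := 'rV[R]_N.
Local Notation leb := (lebesgue_rV R N).
Local Notation intg := (intg leb).
Local Notation L2 := (L2 leb).
Local Notation dot := (L2dot leb).
Local Notation wt := (@wt R N b).
Local Notation p := (2 * s + 2).
Local Notation pw := (@pw R s).
Local Notation wfun := (@wfun R N b s).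
Local Notation jet := (option 'I_N -> X -> R).
Local Notation fdot := (fdot leb (I := option 'I_N)).
Variables (S : R) (U : jet).
Hypotheses (S0 : 0 < S) (mU : minimizer b s S U) (U0 : forall x, 0 <= U None x).
Local Notation u := (U None).

Let p0 : 0 < p. Proof. by rewrite addr_gt0// mulr_gt0. Qed.
Let pn : p != 0. Proof. by rewrite gt_eqF. Qed.
Let HU : H1j U. Proof. by case: mU. Qed.
Let LU : fL2 leb U. Proof. by case: HU. Qed.

Lemma euclid_normZ (l : R) (x : X) : 0 <= l -> euclid_norm (l *: x) = l * euclid_norm x.
Proof. by move=> l0; rewrite !euclid_normE sqnZ sqrtrM ?sqr_ge0// sqrtr_sqr ger0_norm. Qed.

Lemma wfun_dilate (V : jet) (l : R) : H1j V -> 0 < l ->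
  wfun (fun x => V None (l *: x)) = l `^ b * (l ^+ N)^-1 * wfun (V None).
Proof.
move=> HV l0; have iu := intg_wpw b0 bN s0 sN HV.
have lN : 0 <= (l ^+ N)^-1 by rewrite invr_ge0 exprn_ge0 ?ltW.
rewrite -mulrA -(scaling_Rint lN (leb_dilation l0) iu) -RintZ; last first.
  exact: (scaling_intg lN (leb_dilation l0) iu).
apply: eq_Rintegral => x _; rewrite /wt euclid_normZ ?(ltW l0)//.
rewrite powRM ?euclid_norm_ge0 ?(ltW l0)// !mulrA (powRN l) divff ?mul1r//.
by rewrite gt_eqF// powR_gt0.
Qed.

Lemma dilation_le (V : jet) (l : R) : H1j V -> 0 < l ->
  S * (l `^ (- N%:R + b) * wfun (V None)) `^ (2 / p) <=
  l `^ (- N%:R) * (dot (V None) (V None) + l ^+ 2 * gdot V V).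
Proof.
move=> HV l0; have [_ _ _ Sle] := mU; have [LV _] := HV.
have lN : 0 <= (l ^+ N)^-1 by rewrite invr_ge0 exprn_ge0 ?ltW.
have lNE : (l ^+ N)^-1 = l `^ (- N%:R) by rewrite powRN powR_mulrn// ltW.
have sc : leb_scaling (l ^+ N)^-1 (fun x : X => x *m l%:M + 0).
  by have := leb_dilation (N := N) l0; congr leb_scaling; apply/funext => x; rewrite mul_mx_scalar addr0.
have inv : l%:M *m (l^-1)%:M = 1%:M :> 'M[R]_N.
  by rewrite -scalar_mxM divff// gt_eqF.
have TT : (l%:M)^T *m l%:M = (l ^+ 2)%:M :> 'M[R]_N by rewrite tr_scalar_mx -scalar_mxM.
have := Sle _ (H1j_jcomp lN inv sc HV).
rewrite fdotE (dot_jcomp0 lN sc LV LV) (gdot_jcomp lN TT sc LV LV).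
have -> : jcomp l%:M 0 V None = (fun x => V None (l *: x)).
  by apply/funext => x; rewrite /= mul_mx_scalar addr0.
rewrite (wfun_dilate HV l0) lNE -powRD; last by rewrite (gt_eqF l0) implybT.
rewrite [b + _]addrC; move/le_trans; apply; rewrite le_eqVlt; apply/orP; left; apply/eqP.
by ring.
Qed.

Lemma is_derive_expRc (c t : R) : is_derive t (1 : R) (fun t => expR (c * t)) (c * expR (c * t)).
Proof.
have h1 := is_derive_cmulf c (is_derive_id t (1 : R)).
have h := is_derive_compf h1 (is_derive_expR (c * t)).
by apply: (is_derive_eq h); rewrite mulr1 mulrC.
Qed.

(* The derivative at [l = 1] of the Weinstein quotient along the dilations [U (l x)]. *)
Lemma pohozaev : dot u u = s * gdot U U.
Proof.
have [_ w1 fS Sle] := mU; set B := dot u u; set A := gdot U U.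
have AB : B + A = S by rewrite -fS fdotE.
(* With [l = e ^ t], [f t] is the gap in the minimality inequality for the dilate: gradient, mass
   and constraint scale with exponents [2 - N], [- N] and [(b - N) 2 / p]. It is nonnegative and
   vanishes at [0], hence its derivative vanishes there. *)
pose e1 : R := 2 - N%:R; pose e2 : R := - N%:R; pose e3 := (- N%:R + b) * (2 / p).
pose f t := A * expR (e1 * t) + (B * expR (e2 * t) + - S * expR (e3 * t)).
have fge t : 0 <= f t.
  pose l := expR t; have l0 : 0 < l by exact: expR_gt0.
  have lp r : l `^ r = expR (r * t) by rewrite /powR gt_eqF// /l expRK.
  have := dilation_le HU l0; rewrite w1 mulr1 -powRrM -/A -/B.
  rewrite -[l ^+ 2]powR_mulrn ?(ltW l0)// mulrDr mulrA -powRD; last by rewrite (gt_eqF l0) implybT.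
  rewrite !lp -/e3 => h.
  have -> : f t = A * expR (e1 * t) + B * expR (e2 * t) - S * expR (e3 * t) by rewrite /f; ring.
  rewrite subr_ge0; apply: le_trans h _; rewrite le_eqVlt; apply/orP; left; apply/eqP.
  by rewrite /e1 /e2 [- N%:R + 2]addrC; ring.
have df t : is_derive t (1 : R) f (A * (e1 * expR (e1 * t)) +
    (B * (e2 * expR (e2 * t)) + - S * (e3 * expR (e3 * t)))).
  by apply: is_derive_addf; [|apply: is_derive_addf]; apply: is_derive_cmulf; exact: is_derive_expRc.
have f0 : f 0 = 0 by rewrite /f !mulr0 expR0 !mulr1 -AB; ring.
have i0 : (0 : R) \in `](-1), 1[%R by rewrite in_itv/= ltrN10 ltr01.
have l11 : -1 <= 1 :> R by rewrite (le_trans (lerN10 _) ler01).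
have dv t : derivable f t 1 by case: (df t).
have := @derive1_at_min R f (-1) 1 0 l11 (fun t _ => dv t) i0.
rewrite f0 => /(_ (fun t _ => fge t)) h.
have := is_derive_unique h (df 0); rewrite !mulr0 expR0 !mulr1 -AB => e.
have : p * (A * e1 + (B * e2 + - (B + A) * e3)) = 0 by rewrite -e mulr0.
have -> : p * (A * e1 + (B * e2 + - (B + A) * e3)) =
    A * (e1 * p) + (B * (e2 * p) - (B + A) * ((- N%:R + b) * 2 * (p / p))) by rewrite /e3; ring.
rewrite divff// mulr1 /e1 /e2 => e'.
have k1 : (2 - N%:R) * p = 4 * s + 4 - 2 * (s * N%:R) - 2 * N%:R by ring.
have k2 : - N%:R * p = - 2 * (s * N%:R) - 2 * N%:R by ring.
move: e'; rewrite k1 k2 sN => e'.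
have : 4 * (s * A - B) = 0 by rewrite -e'; ring.
by move/eqP; rewrite mulf_eq0 pnatr_eq0 /= subr_eq0 => /eqP.
Qed.

Lemma wt_lt (x y : X) : x != 0 -> sqn x < sqn y -> wt y < wt x.
Proof.
move=> x0 xy; have sx : 0 < sqn x.
  rewrite lt_neqAle sqn_ge0 andbT eq_sym; apply/eqP => h; move/eqP: x0; apply.
  apply/rowP => i; rewrite mxE; apply/eqP; rewrite -sqrf_eq0.
  by have /eqP := h; rewrite psumr_eq0 => [/allP/(_ i (mem_index_enum _))|j _]; rewrite ?sqr_ge0.
have ex : 0 < euclid_norm x by rewrite euclid_normE sqrtr_gt0.
have exy : euclid_norm x < euclid_norm y by rewrite !euclid_normE ltr_sqrt// (lt_trans sx).
rewrite /wt !powRN ltf_pV2 ?posrE ?powR_gt0//; last exact: lt_trans exy.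
by apply: powR_lt_mono => //; exact: ltW.
Qed.

(** For [c > 0] a point on the negative side is sent farther from the origin, where the weight is
    smaller. *)
Lemma sqn_hrefl (nu : X) (c : R) x : sqn nu = 1 ->
  sqn (hrefl nu c x) = sqn x - 4 * c * hside nu c x.
Proof.
move=> nu1; rewrite hreflE// -scaleNr sqnD sqnZ nu1 innerC innerZl innerC.
have -> : inner x nu = hside nu c x + c by rewrite /hside subrK.
ring.
Qed.

(* Polarization does not increase the H^1 norm and moves larger values of [u]
   to the side of the origin, where the weight is strictly larger; equality
   forces [u] to be its own polarization. *)
Lemma polarization_le (nu : X) (c : R) : sqn nu = 1 -> 0 < c ->
  {ae leb, forall x, hside nu c x < 0 -> u (hrefl nu c x) <= u x}.
Proof.
move=> nu1 c0; have [_ w1 fS Sle] := mU.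
set T := hrefl nu c; set hs := hside nu c.
have [W [HW WE WS]] := polarize_H1 c nu1 HU.
set w := W None in WE.
have wle : wfun w <= 1.
  rewrite leNgt; apply/negP => w1'.
  have := Sle _ HW; rewrite -/w => h; have {}h := le_trans h WS; rewrite fS in h.
  have : S * 1 < S * wfun w `^ (2 / p).
    have q0 : 0 < 2 / p by rewrite divr_gt0.
    by have := powR_lt_mono q0 ler01 w1'; rewrite powR1 ltr_pM2l.
  by rewrite mulr1 ltNge h.
have hsT x : hs (T x) = - hs x by exact: hside_refl.
have TK : involutive T by exact: hreflK.
(* Polarization at most exchanges the two values of [u] at [x] and [T x], so [k] is odd under
   [T]. *)
pose k x := pw (w x) - pw (u x).
have kneg x : hs x < 0 -> k x = pw (Num.max (u x) (u (T x))) - pw (u x).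
  by move=> hx; rewrite /k WE /polarize -/hs hx.
have kT x : k (T x) = - k x.
  wlog hx : x / hs x < 0 => [H|].
    have [hx|hx|hx] := ltgtP (hs x) 0; first exact: H.
      by rewrite -[in RHS](TK x) (H (T x)) ?opprK// hsT oppr_lt0.
    have -> : T x = x by rewrite /T hreflE// -/(hside nu c x) -/(hs x) hx mulr0 scale0r subr0.
    by rewrite /k WE /polarize -/hs hx ltxx subrr oppr0.
  rewrite (kneg _ hx) /k WE /polarize -/hs -/T !hsT oppr_lt0 oppr_gt0 hx ltNge (ltW hx) /= TK.
  by rewrite opprB; case: leP => h; [ring|ring].
have iw := intg_wpw b0 bN s0 sN HW; have iu := intg_wpw b0 bN s0 sN HU.
have ik : intg (fun x => wt x * k x).
  by have := intgB iw iu; congr (intg _); apply/funext => x; rewrite /k mulrBr.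
have kle : \int[leb]_x (wt x * k x) <= 0.
  have -> : (fun x => wt x * k x) = (fun x => wt x * pw (w x) - wt x * pw (u x)).
    by apply/funext => x; rewrite /k mulrBr.
  by rewrite RintB// subr_le0 -[leRHS]/(wfun u) w1.
have sc : leb_scaling 1 T by exact: leb_hrefl.
have iT := scaling_intg ler01 sc ik.
have IT := scaling_Rint ler01 sc ik.
(* Pairs [x] with [T x]. Almost everywhere both factors have the same sign, so [g >= 0], while its
   integral is twice that of [wt k], which is nonpositive. *)
pose g x := (wt x - wt (T x)) * k x.
have gE : g = fun x => wt x * k x + wt (T x) * k (T x).
  by apply/funext => x; rewrite /g kT; ring.
have ig : intg g by rewrite gE; exact: intgD.
have gle : \int[leb]_x g x <= 0.
  rewrite gE RintD// IT mul1r; move: kle; set J := Rintegral _ _ _ => kle.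
  by rewrite -[leRHS](addr0 0) lerD.
have x0 : {ae leb, forall x : X, x != 0}.
  apply: filterS (hyperplane_null 0 nu1) => x; apply: contra => /eqP ->.
  by rewrite /hside subr0 -[0](scale0r (0 : X)) innerZl mul0r.
have Tx0 : {ae leb, forall x, T x != 0} by exact: (scaling_ae sc x0).
have wtT x : hs x < 0 -> x != 0 -> wt (T x) < wt x.
  move=> hx xn; apply: wt_lt => //; rewrite sqn_hrefl// -/(hs x) ltrBrDl gtrDr.
  by rewrite -mulrA pmulr_rlt0// pmulr_rlt0.
have k0 x : hs x < 0 -> 0 <= k x.
  by move=> hx; rewrite kneg// subr_ge0; apply: pw_mono => //; rewrite le_max lexx.
have gabs : {ae leb, forall x, g x = `|g x|}.
  apply: filterS2 x0 Tx0 => x xn Tn; rewrite ger0_norm//.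
  have [hx|hx|hx] := ltgtP (hs x) 0.
  - by rewrite mulr_ge0 ?k0// subr_ge0 ltW// wtT.
  - have hT : hs (T x) < 0 by rewrite hsT oppr_lt0.
    have h1 := wtT _ hT Tn; have h2 := k0 _ hT; rewrite TK in h1; rewrite kT in h2.
    by rewrite /g -mulrNN mulr_ge0// opprB subr_ge0 ltW.
  - by rewrite /g -[X in wt X](_ : T x = x) ?subrr ?mul0r// /T hreflE// -/(hside nu c x) -/(hs x) hx mulr0 scale0r subr0.
have mg := intg_meas ig.
have g0 : {ae leb, forall x, `|g x| = 0}.
  apply: Rint_eq0_ae (intg_norm ig) _ _ => //; apply/eqP; rewrite eq_le Rint_ge0// andbT.
  by apply: le_trans gle; rewrite (Rint_ae mg _ gabs)//; exact: (intg_meas (intg_norm ig)).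
apply: filterS2 x0 g0 => x xn /normr0_eq0 gx hx.
have wx := wtT _ hx xn.
move: gx => /eqP; rewrite mulf_eq0 subr_eq0 (gt_eqF wx) /= kneg// subr_eq0 => /eqP/pw_inj h.
have m0 : 0 <= Num.max (u x) (u (T x)) by rewrite le_max U0.
by rewrite -[leRHS](h s0)// le_max lexx orbT.
Qed.

End minimizer_symmetry.
(** * Radial monotonicity *)

Section radial.
Context {R : realType} {N : nat}.
Local Notation X := 'rV[R]_N.
Local Notation leb := (lebesgue_rV R N).
Local Notation intg := (intg leb).
Local Notation L2 := (L2 leb).
Local Notation dot := (L2dot leb).
Local Notation jet := (option 'I_N -> X -> R).
Variable U : jet.
Hypothesis HU : H1j U.
Local Notation u := (U None).
Let Lu : L2 u. Proof. by case: HU => h _; exact: h. Qed.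

Hypothesis polar : forall (nu : X) (c : R), sqn nu = 1 -> 0 < c ->
  {ae leb, forall x, hside nu c x < 0 -> u (hrefl nu c x) <= u x}.

Lemma Rint_le_ae f g : intg f -> intg g -> {ae leb, forall x, f x <= g x} ->
  \int[leb]_x f x <= \int[leb]_x g x.
Proof.
move=> hf hg fg.
have hm : intg (fun x => Num.min (f x) (g x)).
  have mf := intg_meas hf; have mg := intg_meas hg.
  apply: intg_le (intgD (intg_norm hf) (intg_norm hg)) => [|x]; first exact: measurable_minr.
  by case: (leP (f x) (g x)) => _; rewrite ?lerDl ?lerDr.
rewrite (_ : \int[leb]_x f x = \int[leb]_x Num.min (f x) (g x)).
  by apply: Rint_le => // x; rewrite ge_min lexx orbT.
apply: Rint_ae; [exact: intg_meas hf|exact: intg_meas hm|].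
by apply: filterS fg => x /min_idPl ->.
Qed.

Lemma inner_le (nu z : X) : sqn nu = 1 -> inner z nu ^+ 2 <= sqn z.
Proof.
move=> nu1; have := sqn_ge0 (z + (- inner z nu) *: nu).
rewrite sqnD sqnZ nu1 innerC innerZl (innerC nu) => h.
rewrite -subr_ge0; apply: le_trans h _; rewrite le_eqVlt; apply/orP; left; apply/eqP; ring.
Qed.

Lemma vol_eball_gt0 (r : R) : 0 < r -> 0 < vol (eball r : set X).
Proof.
move=> r0; rewrite -lte_fin /vol EFin_Rint.
  by rewrite -leb_indic ?leb_eball_gt0//; exact: measurable_eball.
by apply: intg_indic; [exact: measurable_eball|apply: leb_eball_lty; exact: ltW].
Qed.

(* The reflection exchanging [x] and [y] exchanges the balls around them. *)
Lemma avg_reflect (x y : X) (r : R) : 0 < r -> sqn x < sqn y -> 4 * r ^+ 2 < sqn (y - x) ->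
  avg (eball r) u y <= avg (eball r) u x.
Proof.
move=> r0 xy rxy; pose n := Num.sqrt (sqn (y - x)).
have n2 : n ^+ 2 = sqn (y - x) by rewrite sqr_sqrtr// sqn_ge0.
have n0 : 0 < n by rewrite sqrtr_gt0; apply: le_lt_trans rxy; rewrite mulr_ge0// sqr_ge0.
have nn : n != 0 by rewrite gt_eqF.
(* The perpendicular bisector of [x] and [y]; [c > 0] says that the origin is strictly on the side
   of [x]. *)
pose nu := n^-1 *: (y - x); pose c := (sqn y - sqn x) / (2 * n).
have c0 : 0 < c by rewrite divr_gt0 ?subr_gt0// mulr_gt0.
have nu1 : sqn nu = 1 by rewrite sqnZ -n2 -exprMn mulVf// expr1n.
have syx : sqn (y - x) = sqn y - 2 * inner x y + sqn x.
  rewrite sqnD -[- x]scaleN1r sqnZ innerC innerZl; ring.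
have ixn : inner x nu = n^-1 * (inner x y - sqn x).
  by rewrite innerC innerZl innerDl -[- x]scaleN1r innerZl inner_sqn (innerC y); ring.
have hx : hside nu c x = - (n / 2).
  rewrite /hside ixn /c; have -> : n / 2 = n ^+ 2 / (2 * n) by field.
  by rewrite n2 syx; field.
have Tx : hrefl nu c x = y.
  rewrite hreflE// hx -scaleNr scalerA.
  have -> : - (2 * - (n / 2)) / n = 1 by field.
  by rewrite scale1r addrC subrK.
pose M := hrefl_mx nu.
have Tzx z : hrefl nu c (z + x) = z *m M + y by rewrite /hrefl mulmxDl -addrA -/(hrefl nu c x) Tx.
have sc : leb_scaling 1 (fun z : X => z *m M).
  by have := leb_hrefl 0 nu1; congr (leb_scaling _ _); apply/funext => z; rewrite /hrefl mulr0 scale0r addr0.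
have sqM z : sqn (z *m M) = sqn z.
  have := sqn_hrefl 0 z nu1; rewrite mulr0 mul0r subr0 => <-.
  by rewrite /hrefl mulr0 scale0r addr0.
have mB : measurable (eball r : set X) by exact: measurable_eball.
have fB : (leb (eball r) < +oo)%E by apply: leb_eball_lty; exact: ltW.
have L1 : L2 (\1_(eball r) : X -> R) by exact: L2_indic.
have iF v : intg (fun z => \1_(eball r) z * u (z + v)).
  by apply: L2_intgM => //; exact: shift_L2.
rewrite /avg ler_pM2l ?invr_gt0 ?vol_eball_gt0//.
rewrite /L2dot -[leLHS]mul1r -(scaling_Rint ler01 sc (iF y)).
apply: Rint_le_ae; [exact: scaling_intg ler01 sc (iF y)|exact: iF|].
have := scaling_ae (leb_shift x) (polar nu1 c0).
apply: filterS => z hz; rewrite [X in X * _ <= _](_ : _ = \1_(eball r) z); last first.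
  by rewrite !indicE; congr ((nat_of_bool _)%:R); apply/idP/idP; rewrite !inE /eball /= sqM.
rewrite -Tzx indicE; case: (boolP (z \in eball r)); rewrite ?mul0r// !mul1r.
rewrite inE /eball /= => zr; apply: hz.
have -> : hside nu c (z + x) = inner z nu - n / 2.
  by rewrite /hside innerDl -addrA -/(hside nu c x) hx.
(* The ball of radius [r < n / 2] around [x] does not reach the bisector. *)
rewrite subr_lt0 ltNge; apply/negP => h.
have n20 : 0 <= n / 2 by rewrite divr_ge0// ltW.
have := le_trans (inner_le z nu1) zr.
have : (n / 2) ^+ 2 <= inner z nu ^+ 2 by apply: lerXn2r => //; rewrite nnegrE// (le_trans n20).
move: rxy; rewrite -n2 expr_div_n; move: (n ^+ 2) (r ^+ 2) (inner z nu ^+ 2) => a1 a2 a3.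
rewrite -[2 ^+ 2](natrX _ 2 2); lra.
Qed.

(** For points at equal distance from the origin, [y] is pushed outward to [(1 + t) y], and the
    Lipschitz bound on averages absorbs the displacement. *)
Lemma avg_decr (x y : X) (r : R) : 0 < r -> sqn x <= sqn y -> 4 * r ^+ 2 < sqn (y - x) ->
  avg (eball r) u y <= avg (eball r) u x.
Proof.
move=> r0; rewrite le_eqVlt => /predU1P[xy|]; last exact: avg_reflect.
move=> rxy; have mB : measurable (eball r : set X) by exact: measurable_eball.
have fB : (leb (eball r) < +oo)%E by apply: leb_eball_lty; exact: ltW.
have V0 := vol_eball_gt0 r0.
pose K := (vol (eball r : set X))^-1 * (N%:R * gdot U U * sqn y).
have K0 : 0 <= K by rewrite !mulr_ge0 ?invr_ge0 ?(ltW V0) ?gdot_ge0 ?sqn_ge0.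
have sxy : 0 < sqn (y - x) by apply: le_lt_trans rxy; rewrite mulr_ge0// sqr_ge0.
have syx : sqn (y - x) = sqn y - 2 * inner y x + sqn x.
  rewrite sqnD -[- x]scaleN1r sqnZ (innerC y) innerZl (innerC x); ring.
have y0 : 0 < sqn y.
  rewrite lt_neqAle sqn_ge0 andbT eq_sym; apply/eqP => h.
  have hx := inner_le; move: sxy; rewrite syx xy h.
  have : inner y x = 0.
    rewrite /inner big1// => i _; have /eqP := h; rewrite psumr_eq0 => [/allP/(_ i (mem_index_enum _))|j _]; rewrite ?sqr_ge0//.
    by rewrite sqrf_eq0 => /eqP ->; rewrite mul0r.
  by move=> ->; rewrite mulr0 subr0 addr0 ltxx.
apply/ler_addgt0Pr => e e0.
(* Displacing [y] to [(1 + t) y] changes the average by at most [t sqrt K], hence by at most [e]. *)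
pose t := e / (Num.sqrt K + 1).
have K1 : 0 < Num.sqrt K + 1 by rewrite ltr_wpDl ?sqrtr_ge0.
have t0 : 0 < t by rewrite divr_gt0.
pose yt := y + t *: y.
have syt : sqn yt = (1 + t) ^+ 2 * sqn y by rewrite /yt -[X in X + _]scale1r -scalerDl sqnZ.
have t1 : sqn x < sqn yt.
  rewrite syt xy -[ltLHS]mul1r ltr_pM2r//; nra.
have t2 : 4 * r ^+ 2 < sqn (yt - x).
  have -> : sqn (yt - x) = sqn (y - x) + (2 * (t * (sqn y - inner y x)) + t ^+ 2 * sqn y).
    have -> : yt - x = (y - x) + t *: y by rewrite /yt addrAC.
    rewrite (sqnD (y - x)) sqnZ -addrA; congr (_ + (2 * _ + _)).
    by rewrite innerC innerZl innerC innerDl -[- x]scaleN1r innerZl inner_sqn mulN1r (innerC x).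
  apply: lt_le_trans rxy _; rewrite lerDl.
  have h1 : 0 <= t ^+ 2 * sqn y by rewrite mulr_ge0 ?sqr_ge0 ?sqn_ge0.
  have h2 : 0 <= 2 * (t * (sqn y - inner y x)).
    rewrite mulr_ge0// mulr_ge0// ?(ltW t0)//; move: sxy; rewrite syx xy.
    by move: (sqn y) (inner y x) => a1 a2; lra.
  exact: addr_ge0.
have hr i : `|(y - yt) ord0 i| <= t * euclid_norm y.
  rewrite /yt opprD addrA subrr sub0r !mxE normrN normrM (gtr0_norm t0) ler_pM2l//.
  exact: coord_le_euclid.
have := avg_lipschitz mB fB V0 HU hr; rewrite exprMn sqr_euclid.
have -> : (vol (eball r : set X))^-1 * (N%:R * (t ^+ 2 * sqn y) * gdot U U) = t ^+ 2 * K.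
  by rewrite /K; ring.
move=> h; apply: le_trans (_ : avg (eball r) u yt + e <= _); last first.
  by rewrite lerD2r; exact: avg_reflect.
rewrite -lerBlDl; apply: le_trans (ler_norm _) _.
rewrite -ler_sqr ?nnegrE ?(ltW e0)// real_normK ?num_real//; apply: le_trans h _.
rewrite -[K](sqr_sqrtr K0) -exprMn; apply: lerXn2r; rewrite ?nnegrE ?(ltW e0)//.
  by rewrite mulr_ge0 ?sqrtr_ge0// ltW.
by rewrite /t mulrAC ler_pdivrMr// ler_pM2l// lerDl.
Qed.

(** The null set in [polar] depends on the hyperplane, and there are uncountably many of these. Ball
    averages obey the comparison at every point, so it holds wherever they converge to [u], a single
    set of full measure. *)
Lemma radially_decreasing : exists2 F : set X, {ae leb, forall x, F x} &
  forall x y, F x -> F y -> sqn x <= sqn y -> u y <= u x.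
Proof.
pose h (k : nat) : R := 2^-1 ^+ k.
have h0 k : 0 < h k by rewrite exprn_gt0// invr_gt0.
exists [set x | (fun k => avg (eball (h k)) u x) @ \oo --> u x].
  apply: (avg_cvg (E := fun k => eball (h k))) => // k.
  - exact: measurable_eball.
  - by apply: eball_sub_cube; exact: ltW.
  - exact: vol_eball_gt0.
move=> x y /= cx cy xy; have [->//|nxy] := eqVneq x y.
have d0 : 0 < sqn (y - x).
  rewrite lt_neqAle sqn_ge0 andbT eq_sym; apply: contra nxy => /eqP.
  rewrite /sqn => /eqP; rewrite psumr_eq0 => [/allP H|i _]; last exact: sqr_ge0.
  rewrite eq_sym -subr_eq0; apply/eqP/rowP => i; rewrite [RHS]mxE.
  by apply/eqP; rewrite -sqrf_eq0; exact: H i (mem_index_enum _).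
apply: (ler_cvg_to cy cx).
have : (fun k => 4 * h k ^+ 2) @ \oo --> (4 * (0 * 0) : R).
  apply: cvgMl_tmp; under eq_fun do rewrite expr2.
  by apply: cvgM; apply: cvg_expr; rewrite ger0_norm ?invr_ge0// invf_lt1// ltr1n.
rewrite !mulr0 => /cvgr_lt/(_ _ d0); apply: filterS => k hk.
exact: avg_decr.
Qed.

End radial.
(** * Positivity *)

Section barrier.
Context {R : realType} {N : nat}.
Local Notation X := 'rV[R]_N.
Local Notation leb := (lebesgue_rV R N).
Variables (a r : R).

Lemma is_derive_sqn i (x : X) :
  is_derive x (delta_mx ord0 i : X) (@sqn R N) (2 * x ord0 i).
Proof.
have h1 := is_derive_cmulf (2 * x ord0 i) (is_derive_id (0 : R) (1 : R)).
have h2 := is_derive_mulf (is_derive_id (0 : R) (1 : R)) (is_derive_id (0 : R) (1 : R)).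
have h3 : is_derive (0 : R) (1 : R) (fun t => 2 * x ord0 i * t + t * t) (2 * x ord0 i).
  by apply: (is_derive_eq (is_derive_addf h1 h2)); ring.
apply: is_derive_quot h3 => h.
rewrite sqnD sqnZ innerZl addr0 !mulr0 addr0 subr0.
have -> : inner (delta_mx ord0 i) x = x ord0 i.
  rewrite /inner (bigD1 i)//= big1 ?addr0; first by rewrite mxE !eqxx mul1r.
  by move=> j ji; rewrite mxE (negPf ji) andbF mul0r.
have -> : sqn (delta_mx ord0 i : X) = 1.
  rewrite /sqn (bigD1 i)//= big1 ?addr0; first by rewrite mxE !eqxx expr1n.
  by move=> j ji; rewrite mxE (negPf ji) andbF expr0n.
by rewrite -[h *: 1]/(h * 1) mulr1; ring.
Qed.

(** [a] and [r] are squared radii: for [a < r] this is positive exactly in the annulus between them.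
    As a function of [|x|^2] it is a parabola, whose slope is [D] below. *)
Definition barrier_arg (x : X) : R := (sqn x + - a) * (r + - 1 * sqn x).
Local Notation g := barrier_arg.
Definition barrier (x : X) : R := bump (g x).

Lemma smooth_barrier_arg : smooth g.
Proof.
exact: (smoothM (smoothD (@smooth_sqn R N) (smooth_cst (- a)))
  (smoothD (smooth_cst r) (smoothM (smooth_cst (- 1)) (@smooth_sqn R N)))).
Qed.

Let D (x : X) : R := r + a - 2 * sqn x.

Lemma partial_barrier_arg i : partial i g = (fun x : X => D x * (2 * x ord0 i)).
Proof.
apply: partial_is_derive => x; have d := is_derive_sqn i x.
have h := is_derive_mulf (is_derive_addf d (is_derive_cstf (- a) x _))
  (is_derive_addf (is_derive_cstf r x _) (is_derive_cmulf (- 1) d)).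
by apply: (is_derive_eq h); rewrite /D; ring.
Qed.

Lemma partial2_barrier_arg i (x : X) :
  partial i (partial i g) x = 2 * D x - 8 * x ord0 i ^+ 2.
Proof.
have dc y : is_derive y (delta_mx ord0 i : X) (fun x : X => x ord0 i) (1 : R).
  by have := smooth_is_derive i y (@smooth_coord R N i); rewrite partial_coord eqxx.
rewrite partial_barrier_arg.
suff -> : partial i (fun x => D x * (2 * x ord0 i)) = (fun x : X => 2 * D x - 8 * x ord0 i ^+ 2) by [].
apply: partial_is_derive => y.
have h := is_derive_mulf (is_derive_addf (is_derive_cstf (r + a) y _)
  (is_derive_cmulf (- 2) (is_derive_sqn i y))) (is_derive_cmulf 2 (dc y)).
have e : (fun x : X => D x * (2 * x ord0 i)) =
    (fun x => ((r + a) + (- 2) * sqn x) * (2 * x ord0 i)).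
  by apply/funext => z; rewrite /D; ring.
by rewrite e; apply: (is_derive_eq h); rewrite /D; ring.
Qed.

Let P1 : {poly R} := 'X^2 * (1 - 1^`()).
Let P2 : {poly R} := 'X^2 * (P1 - P1^`()).

(** Chain rule for [bump (g x)]: [P1] and [P2] encode the first two derivatives of [bump], the
    squared gradient of [g] is [4 |x|^2 D^2] and its Laplacian [2 N D - 8 |x|^2]. *)
Lemma laplacian_barrier (x : X) : laplacian barrier x =
  bumpP P2 (g x) * (4 * sqn x * D x ^+ 2) + bumpP P1 (g x) * (2 * N%:R * D x - 8 * sqn x).
Proof.
have sg := smooth_barrier_arg.
have p1 i : partial i barrier = (fun x => bumpP P1 (g x) * partial i g x).
  apply/funext => y; rewrite /barrier (_ : (fun x => _) = (fun x => bumpP 1 (g x))).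
    exact: (partial_comp i y (is_derive_bumpP 1) sg).
  by apply/funext => z; rewrite bumpE.
have p2 i : partial i (partial i barrier) x =
    bumpP P2 (g x) * (partial i g x) ^+ 2 + bumpP P1 (g x) * partial i (partial i g) x.
  rewrite p1 (partialM i x (smooth_comp (fun n => Dk_bumpP n P1) sg) (smooth_partial i sg)).
  rewrite (partial_comp i x (is_derive_bumpP P1) sg) -/P2.
  by ring.
rewrite /laplacian (eq_bigr (fun i => bumpP P2 (g x) * (4 * D x ^+ 2 * x ord0 i ^+ 2) +
    bumpP P1 (g x) * (2 * D x - 8 * x ord0 i ^+ 2))); last first.
  by move=> i _; rewrite /= p2 partial2_barrier_arg partial_barrier_arg; ring.
rewrite big_split /= -!mulr_sumr sumrB -!mulr_sumr -/(sqn x).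
by rewrite sumr_const card_ord -mulr_natl; ring.
Qed.

Lemma test_barrier : test_function barrier.
Proof.
apply/testP; split; first by apply: smooth_comp smooth_barrier_arg => n; exact: Dk_bump.
exists (`|r| + `|a| + 1) => x nx; apply: bump_eq0.
have [i xi] : exists i, `|r| + `|a| + 1 < `|x ord0 i|.
  apply/not_existsP => h; apply: nx; apply/cubeP => i.
  by rewrite leNgt; apply/negP; exact: h.
have := lt_le_trans xi (coord_le_euclid x i).
have := euclid_norm_ge0 x; have := sqr_euclid x; rewrite /barrier_arg.
move: (euclid_norm x) (sqn x) => e q eq e0 he.
have := ler_norm r; have := ler_norm a; have := normr_ge0 r; have := normr_ge0 a.
move: `|r| `|a| he => c d he *; rewrite -eq.
have eq1 : e <= e ^+ 2 by nra.
have : 0 <= (e ^+ 2 - a) * (e ^+ 2 - r) by rewrite mulr_ge0//; lra.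
nra.
Qed.

(* Near the inner sphere of its support, [barrier] is a strict subsolution of
   [- laplacian phi + phi = 0]. *)
Lemma barrier_strict (x : X) : let q := sqn x in
  0 < g x -> g x <= 8^-1 -> g x <= q -> 2^-1 <= D x -> barrier x < laplacian barrier x.
Proof.
rewrite laplacian_barrier /barrier bumpE => s0; set t := g x in s0 *; set q := sqn x => t8 tq D2.
rewrite /bumpP s0; set E := expR _; have E0 : 0 < E by exact: expR_gt0.
have e1 : P1.[t^-1] = t^-1 ^+ 2 by rewrite /P1 -polyC1 derivC subr0 !hornerE.
have e2 : P2.[t^-1] = t^-1 ^+ 2 * (t^-1 ^+ 2 - 2 * t^-1).
  rewrite /P2 /P1 -polyC1 derivC subr0 mulr1 derivXn !hornerE /=.
  by rewrite -mulr_natl; ring.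
rewrite (_ : 1.[t^-1] = 1) ?hornerC// mul1r.
have t0 : t != 0 by rewrite gt_eqF.
(* Dividing by [E] and multiplying by [t ^ 4], the claim compares [t ^ 4] with the second factor.
   Its main term comes from the second derivative of [bump], and [D >= 1/2] gives
   [4 q D^2 >= q >= t]. *)
rewrite [ltRHS](_ : _ =
    E * (t^-1 ^+ 4 * ((1 - 2 * t) * (4 * q * D x ^+ 2) + t ^+ 2 * (2 * N%:R * D x - 8 * q)))); last first.
  by rewrite e1 e2; field.
rewrite -[ltLHS]mulr1 ltr_pM2l// exprVn ltr_pdivlMl ?exprn_gt0// mulr1.
have q0 : 0 < q by exact: lt_le_trans tq.
have D0 : 0 <= D x by apply: le_trans D2; rewrite invr_ge0.
have ND : 0 <= t ^+ 2 * (2 * N%:R * D x).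
  by apply: mulr_ge0; [exact: sqr_ge0|apply: mulr_ge0 => //; exact: mulr_ge0].
have h1 : q <= 4 * q * D x ^+ 2.
  have : (2^-1) ^+ 2 <= D x ^+ 2 by apply: lerXn2r; rewrite ?nnegrE ?invr_ge0.
  rewrite (_ : 2^-1 ^+ 2 = 4^-1); last by field.
  move: (D x ^+ 2) => d h; rewrite mulrAC ler_peMl ?(ltW q0)//; lra.
have h2 : (1 - 2 * t) * q <= (1 - 2 * t) * (4 * q * D x ^+ 2) by apply: ler_wpM2l => //; lra.
have t2 : t ^+ 2 <= 8^-1 * t by rewrite expr2 ler_wpM2r// ltW.
have h3 : t ^+ 2 * (8 * q) <= t * q.
  have := ler_wpM2r (ltW q0) t2; lra.
have h4 : t * q <= 8^-1 * q by rewrite ler_wpM2r// ltW.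
have h5 : t ^+ 4 <= 64^-1 * t.
  have : t ^+ 2 * t ^+ 2 <= (8^-1 * t) * (8^-1 * t) by apply: ler_pM; rewrite ?sqr_ge0.
  have -> : t ^+ 4 = t ^+ 2 * t ^+ 2 by ring.
  have : 8^-1 * t * (8^-1 * t) <= 8^-1 * t * (8^-1 * 1).
    by apply: ler_wpM2l; [rewrite mulr_ge0// ltW|apply: ler_wpM2l => //; lra].
  move: (t ^+ 2 * t ^+ 2) => w; lra.
rewrite mulrBr; move: (t ^+ 2 * (2 * N%:R * D x)) ND (4 * q * D x ^+ 2) h1 h2 (t ^+ 2 * (8 * q)) h3 => A A0 B hB h2' C hC.
move: (t ^+ 4) h5 => T4 h5.
have : (1 - 2 * t) * q = q - 2 * (t * q) by ring.
move: ((1 - 2 * t) * q) ((1 - 2 * t) * B) (t * q) h2' hC h4 => *; lra.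
Qed.

End barrier.

Section positivity.
Context {R : realType} {N : nat}.
Variables b s : R.
Hypotheses (N0 : (0 < N)%N) (b0 : 0 < b) (bN : b < N%:R) (s0 : 0 < s) (sN : s * N%:R = 2 - b).
Local Notation X := 'rV[R]_N.
Local Notation leb := (lebesgue_rV R N).
Local Notation intg := (intg leb).
Local Notation L2 := (L2 leb).
Local Notation dot := (L2dot leb).
Local Notation wt := (@wt R N b).
Local Notation dpw := (@dpw R s).
Local Notation jet := (option 'I_N -> X -> R).
Variables (S : R) (U : jet).
Hypotheses (S0 : 0 < S) (mU : minimizer b s S U) (U0 : forall x, 0 <= U None x).
Local Notation u := (U None).

Let HU : H1j U. Proof. by case: mU. Qed.
Let Lu : L2 u. Proof. by case: HU => h _; exact: h. Qed.

Lemma test_laplacian (phi : X -> R) : test_function phi -> L2 (laplacian phi).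
Proof.
by move=> tp; apply: L2_sum => i; apply: test_L2; apply: test_partial; exact: test_partial.
Qed.

Lemma euler_lagrange_test (phi : X -> R) : test_function phi ->
  dot u phi - dot u (laplacian phi) = S * \int[leb]_x (wt x * (dpw (u x) * phi x)).
Proof.
move=> tp; rewrite -(euler_lagrange b0 bN s0 sN S0 mU (H1j_test tp)).
by rewrite fdotE gdot_test.
Qed.

(** The annulus contains a ball, centred on a coordinate axis at squared radius [(c + d) / 2]. *)
Lemma annulus_not_null (c d : R) : 0 <= c -> c < d ->
  ~ {ae leb, forall x : X, ~ (c < sqn x < d)}.
Proof.
move=> c0 cd ae0; pose i0 := Ordinal N0.
pose m := (c + d) / 2; have m0 : 0 < m by rewrite divr_gt0//; lra.
pose t := Num.sqrt m; have t2 : t ^+ 2 = m by rewrite sqr_sqrtr// ltW.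
have t0 : 0 <= t by exact: sqrtr_ge0.
pose e : X := delta_mx ord0 i0; pose y := t *: e.
have se : sqn e = 1.
  rewrite /sqn (bigD1 i0)//= big1 ?addr0; first by rewrite mxE !eqxx expr1n.
  by move=> j ji; rewrite mxE (negPf ji) andbF expr0n.
have ie z : inner z e = z ord0 i0.
  rewrite /inner (bigD1 i0)//= big1 ?addr0; first by rewrite mxE !eqxx mulr1.
  by move=> j ji; rewrite mxE (negPf ji) andbF mulr0.
pose dl := (d - c) / 2; have dl0 : 0 < dl by rewrite divr_gt0// subr_gt0.
have D0 : 0 < dl + 1 + 2 * t by lra.
(* Small enough that [r ^ 2 + 2 t r < dl], which bounds the change of the squared norm over the
   ball. *)
pose r := dl / (dl + 1 + 2 * t) / 2.
have r0 : 0 < r by apply: divr_gt0 => //; exact: divr_gt0.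
have rD : r * (dl + 1 + 2 * t) = dl / 2 by rewrite /r mulrAC divfK// gt_eqF.
have aey := scaling_ae (leb_shift y) ae0.
have : vol (eball r : set X) = 0.
  rewrite /vol -(@Rint0 _ _ _ leb); apply: Rint_ae => //.
    by apply: measurable_indic; exact: measurable_eball.
  apply: filterS aey => z hz; rewrite indicE memNset//= => zr; apply: hz.
  have zr' : sqn z <= r ^+ 2 by exact: zr.
  have sz := sqn_ge0 z.
  have z0r : `|z ord0 i0| <= r.
    apply: le_trans (coord_le_euclid z i0) _.
    by rewrite -ler_sqr ?nnegrE ?(ltW r0) ?euclid_norm_ge0// sqr_euclid.
  have := z0r; rewrite ler_norml => /andP[z1 z2].
  rewrite sqnD /y sqnZ se mulr1 t2 innerC innerZl innerC ie.
  have h1 : t * z ord0 i0 <= t * r by rewrite ler_wpM2l.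
  have h2 : t * - r <= t * z ord0 i0 by rewrite ler_wpM2l.
  have dlE : 2 * dl = d - c by rewrite mulrC divfK.
  have mE : 2 * m = c + d by rewrite mulrC divfK.
  have r1 : r <= 1.
    rewrite leNgt; apply/negP => r1; have : dl < r * dl by rewrite ltr_pMl.
    have : 0 <= r * t by rewrite mulr_ge0// ltW.
    by move: rD; rewrite !mulrDr mulr1 (mulrCA r 2 t); move: (r * t) (r * dl) (dl) dl0 => *; lra.
  have h3 : r ^+ 2 <= r by rewrite expr2 ler_piMl// ltW.
  have h4 : 0 < r * dl by rewrite mulr_gt0.
  move: rD h1 h2 h4; rewrite !mulrDr mulr1 mulrN (mulrC t r) (mulrCA r 2 t).
  move: (dl) (m) (t * z ord0 i0) (r * t) (r * dl) dlE mE dl0 => l k w w1 w2 dlE mE dl0 rD h1 h2 h4.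
  apply/andP; split; move: sz h3 zr'; move: (sqn z) (r ^+ 2) => *; lra.
by move=> v0; have := vol_eball_gt0 (N := N) r0; rewrite v0 ltxx.
Qed.

(* If [u] vanished first on the sphere of square radius [Q], testing the
   Euler-Lagrange equation with a barrier supported just outside a slightly smaller
   sphere would give a negative left-hand side and a nonnegative right-hand side. *)
Lemma minimizer_gt0 (F : set X) : {ae leb, forall x, F x} ->
  (forall x y, F x -> F y -> sqn x <= sqn y -> u y <= u x) -> {ae leb, forall x, 0 < u x}.
Proof.
move=> aeF decr.
have [[z0 Fz0 uz0]|nz] := pselect (exists2 z, F z & u z = 0); last first.
  apply: filterS aeF => x Fx; rewrite lt_neqAle U0 andbT; apply/eqP => h; apply: nz.
  by exists x.
(* On [F], where [u] is radially nonincreasing, [u] is positive inside the sphere of squared radius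
   [Q = inf Z] and zero outside it. *)
exfalso; pose Z := [set q | exists2 z, F z /\ u z = 0 & q = sqn z].
have hZ : has_inf Z.
  by split; [exists (sqn z0), z0|exists 0 => q [z _ ->]; exact: sqn_ge0].
pose Q := inf Z.
have Qle z : F z -> u z = 0 -> Q <= sqn z.
  by move=> Fz uz; apply: ge_inf; [case: hZ|exists z].
have uin x : F x -> sqn x < Q -> 0 < u x.
  move=> Fx xQ; rewrite lt_neqAle U0 andbT; apply/eqP => h.
  by have := Qle x Fx (esym h); rewrite leNgt xQ.
have uout x : F x -> Q < sqn x -> u x = 0.
  move=> Fx Qx; have e0 : 0 < sqn x - Q by rewrite subr_gt0.
  have [q [z [Fz uz] ->]] := inf_adherent e0 hZ.
  rewrite -/Q addrC subrK => zx; apply/eqP; rewrite eq_le U0 andbT.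
  by rewrite -uz; apply: decr => //; exact: ltW.
have Q0 : 0 < Q.
  rewrite ltNge; apply/negP => Qle0.
  have uae : {ae leb, forall x, u x = 0}.
    have nn : {ae leb, forall x : X, x != 0}.
      pose e : X := delta_mx ord0 (Ordinal N0).
      have se : sqn e = 1.
        rewrite /sqn (bigD1 (Ordinal N0))//= big1 ?addr0; first by rewrite mxE !eqxx expr1n.
        by move=> j ji; rewrite mxE (negPf ji) andbF expr0n.
      apply: filterS (hyperplane_null 0 se) => x; apply: contra => /eqP ->.
      by rewrite /hside subr0 -[0](scale0r (0 : X)) innerZl mul0r.
    apply: filterS2 aeF nn => x Fx xn; apply: uout => //; apply: le_lt_trans Qle0 _.
    rewrite lt_neqAle sqn_ge0 andbT eq_sym; apply: contra xn; rewrite /sqn.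
    rewrite psumr_eq0 => [/allP H|i _]; last exact: sqr_ge0.
    apply/eqP/rowP => i; rewrite mxE; apply/eqP; rewrite -sqrf_eq0.
    exact: H i (mem_index_enum _).
  have [_ w1 _ _] := mU; have : wfun b s u = 0.
    rewrite /wfun -(@Rint0 _ _ _ leb); apply: Rint_ae => //.
      exact: (intg_meas (intg_wpw b0 bN s0 sN HU)).
    by apply: filterS uae => x ->; rewrite /pw expr0n/= !mulr0.
  by rewrite w1 => /eqP; rewrite oner_eq0.
(* With [a = Q - ep] and [r = Q + 1], on [a < |x|^2 <= Q] the argument of [bump] is at most [2 ep],
   hence at most [1/8] and at most [|x|^2], and [D >= 1 - ep >= 1/2]: the conditions of
   [barrier_strict]. *)
pose ep := Num.min 16^-1 (Q / 4).
have ep0 : 0 < ep by rewrite lt_min invr_gt0 ltr0n /= divr_gt0.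
have ep1 : ep <= 16^-1 by rewrite ge_min lexx.
have ep2 : ep <= Q / 4 by rewrite ge_min lexx orbT.
pose a := Q - ep; pose r := Q + 1.
pose phi : X -> R := barrier a r.
have tp : test_function phi by exact: test_barrier.
have Lp := test_L2 tp; have Ll := test_laplacian tp.
pose h x := u x * phi x - u x * laplacian phi x.
have ih : intg h by apply: intgB; exact: L2_intgM.
have strict x : a < sqn x <= Q -> phi x < laplacian phi x.
  move=> /andP[ax xQ]; have qa : 0 < sqn x - a by rewrite subr_gt0.
  have qr : 0 < r - sqn x by rewrite subr_gt0 /r; lra.
  have gE : barrier_arg a r x = (sqn x - a) * (r - sqn x) by rewrite /barrier_arg mulN1r.
  have g0 : 0 < barrier_arg a r x by rewrite gE mulr_gt0.
  have g1 : barrier_arg a r x <= ep * 2.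
    rewrite gE; apply: ler_pM; rewrite ?(ltW qa) ?(ltW qr)// /a /r; last by move: ax; rewrite /a; lra.
    by rewrite opprB addrA lerBlDr addrC lerD2l.
  apply: barrier_strict => //.
  - by apply: le_trans g1 _; lra.
  - by apply: le_trans g1 _; move: ax; rewrite /a; lra.
  - by move: xQ; rewrite /r /a; lra.
have zero x : sqn x <= a -> phi x = 0 /\ laplacian phi x = 0.
  move=> xa; have g0 : barrier_arg a r x <= 0.
    rewrite /barrier_arg mulN1r mulr_le0_ge0 ?subr_le0// subr_ge0 (le_trans xa)// /a /r; lra.
  split; first exact: bump_eq0.
  by rewrite /phi laplacian_barrier /bumpP ltNge g0 /= !mul0r addr0.
have phi0 x : 0 <= phi x by exact: bump_ge0.
(* Below [a] the barrier vanishes, beyond [Q] the function [u] does, and in between the strict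
   inequality applies. The Euler-Lagrange equation gives [h] a nonnegative integral, so [h = 0]
   almost everywhere, although [h < 0] on [F] where [a < |x|^2 < Q]. *)
have hle x : F x -> h x <= 0.
  move=> Fx; rewrite /h -mulrBr; have [xa|ax] := leP (sqn x) a.
    by have [-> ->] := zero x xa; rewrite subrr mulr0.
  have [xQ|Qx] := leP (sqn x) Q; last by rewrite uout// mul0r.
  by rewrite mulr_ge0_le0// subr_le0 ltW// strict// ax.
have hI : 0 <= \int[leb]_x h x.
  rewrite RintB; [|exact: L2_intgM|exact: L2_intgM].
  rewrite (euler_lagrange_test tp) mulr_ge0 ?(ltW S0)//; apply: Rint_ge0 => x.
  by rewrite mulr_ge0 ?wt_ge0// mulr_ge0// mulr_ge0 ?powR_ge0.
have habs : {ae leb, forall x, - h x = `|h x|}.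
  by apply: filterS aeF => x Fx; rewrite ler0_norm// hle.
have h0 : {ae leb, forall x, `|h x| = 0}.
  apply: Rint_eq0_ae (intg_norm ih) _ _ => //; apply/eqP; rewrite eq_le Rint_ge0// andbT.
  rewrite -(Rint_ae (intg_meas (intgN ih)) (intg_meas (intg_norm ih)) habs) RintN//.
  by rewrite oppr_le0.
apply: (@annulus_not_null a Q).
- by rewrite /a; lra.
- by rewrite /a; lra.
apply: filterS2 aeF h0 => x Fx /normr0_eq0 hx /andP[ax xQ].
have ux := uin x Fx xQ; have := strict x; rewrite ax (ltW xQ) => /(_ isT) px.
by move/eqP: hx; rewrite /h -mulrBr mulf_eq0 (gt_eqF ux) subr_eq0 (lt_eqF px).
Qed.

End positivity.
(** * Complex-valued functions *)

Section complex_sobolev.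
Context {R : realType} {N : nat}.
Local Notation X := 'rV[R]_N.
Local Notation leb := (lebesgue_rV R N).
Local Notation L2 := (L2 leb).
Local Notation dot := (L2dot leb).
Local Notation jet := (option 'I_N -> X -> R).
Local Notation fdot := (fdot leb (I := option 'I_N)).
Implicit Types (u w g : X -> R[i]) (A B : jet).

Definition rept u : X -> R := fun x => complex.Re (u x).
Definition impt u : X -> R := fun x => complex.Im (u x).
Definition cpx (f g : X -> R) : X -> R[i] := fun x => Complex (f x) (g x).

Lemma normc_sqr (z : R[i]) : Normc.normc z ^+ 2 = complex.Re z ^+ 2 + complex.Im z ^+ 2.
Proof. by case: z => a c /=; rewrite sqr_sqrtr// addr_ge0 ?sqr_ge0. Qed.

Lemma normc_ge0 (z : R[i]) : 0 <= Normc.normc z.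
Proof. by case: z => a c; exact: sqrtr_ge0. Qed.

Lemma normc_le (z : R[i]) : Normc.normc z <= `|complex.Re z| + `|complex.Im z|.
Proof.
rewrite -ler_sqr ?nnegrE ?normc_ge0 ?addr_ge0// normc_sqr.
rewrite -[complex.Re z ^+ 2]real_normK ?num_real// -[complex.Im z ^+ 2]real_normK ?num_real//.
have : 0 <= `|complex.Re z| * `|complex.Im z| by rewrite mulr_ge0.
by move: `|_| `|_| => a c; nra.
Qed.

Lemma Re_le_normc (z : R[i]) : `|complex.Re z| <= Normc.normc z.
Proof.
by rewrite -ler_sqr ?nnegrE ?normc_ge0// normc_sqr real_normK ?num_real// lerDl sqr_ge0.
Qed.

Lemma Im_le_normc (z : R[i]) : `|complex.Im z| <= Normc.normc z.
Proof.
by rewrite -ler_sqr ?nnegrE ?normc_ge0// normc_sqr real_normK ?num_real// lerDr sqr_ge0.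
Qed.

Lemma measurable_normc u : cmeasurable u -> measurable_fun setT (fun x => Normc.normc (u x) : R).
Proof.
move=> [m1 m2]; rewrite (_ : (fun x => _) = (fun x => (rept u x ^+ 2 + impt u x ^+ 2) `^ 2^-1)).
  apply: (measurableT_comp (measurable_powR _)).
  by apply: measurable_funD; exact: measurable_funX.
apply/funext => x; rewrite powR12_sqrt ?addr_ge0 ?sqr_ge0// -normc_sqr sqrtr_sqr.
by rewrite ger0_norm// normc_ge0.
Qed.

Lemma Lnorm2E (f : X -> R) : L2 f ->
  Lnorm leb 2%:E (fun x => (f x)%:E) = (Num.sqrt (dot f f))%:E.
Proof.
move=> Lf; rewrite unlock (_ : (\int[leb]_x _ = (dot f f)%:E)%E).
  by rewrite poweR_EFin powR12_sqrt ?dot_ge0.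
rewrite EFin_dot//; apply: eq_integral => x _.
by rewrite /= powR_mulrn// real_normK ?num_real.
Qed.

Lemma Lnorm2_lty (f : X -> R) : measurable_fun setT f ->
  (Lnorm leb 2%:E (fun x => (f x)%:E) < +oo)%E -> L2 f.
Proof.
move=> mf; rewrite unlock => /lty_poweRy; rewrite invr_eq0 pnatr_eq0 => /(_ isT) h.
split => //; apply: intg_lty; [exact: measurable_funX|by move=> x; exact: sqr_ge0|].
move: h; congr (_ < _)%E; apply: eq_integral => x _.
by rewrite /= powR_mulrn// real_normK ?num_real.
Qed.

Lemma in_L2P u : in_L2 u <-> L2 (rept u) /\ L2 (impt u).
Proof.
split=> [[mu_ h]|[L1 L2']].
  have mn := measurable_normc mu_; have Ln := Lnorm2_lty mn h; have [m1 m2] := mu_.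
  split; apply: (L2_dom _ _ Ln) => // x; rewrite [leRHS]ger0_norm ?normc_ge0//.
    exact: Re_le_normc.
  exact: Im_le_normc.
have mu_ : cmeasurable u by split; [case: L1|case: L2'].
split => //; rewrite /cLnorm Lnorm2E ?ltry//; split; first exact: measurable_normc.
under eq_fun do rewrite normc_sqr.
by apply: intgD; [case: L1|case: L2'].
Qed.

Lemma dot_normc u : in_L2 u ->
  dot (fun x => Normc.normc (u x)) (fun x => Normc.normc (u x)) =
  dot (rept u) (rept u) + dot (impt u) (impt u).
Proof.
move=> /in_L2P[L1 L2']; rewrite !dotE -RintD; [|by case: L1|by case: L2'].
by apply: eq_Rintegral => x _; rewrite normc_sqr.
Qed.

Lemma normc_L2 u : in_L2 u -> L2 (fun x => Normc.normc (u x) : R).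
Proof. by move=> [mu_ h]; apply: Lnorm2_lty h; exact: measurable_normc. Qed.

Lemma cLnorm2E u : in_L2 u ->
  cLnorm 2 u = (Num.sqrt (dot (rept u) (rept u) + dot (impt u) (impt u)))%:E.
Proof. by move=> Lu; rewrite /cLnorm Lnorm2E ?dot_normc//; exact: normc_L2. Qed.

Lemma cintegral_mul u (f : X -> R) :
  cintegral (fun x => u x * (f x)%:C%C) = Complex (dot (rept u) f) (dot (impt u) f).
Proof.
rewrite /cintegral; congr Complex; apply: eq_Rintegral => x _.
  by rewrite /rept; case: (u x) => a c /=; rewrite mulr0 subr0.
by rewrite /impt; case: (u x) => a c /=; rewrite mulr0 add0r.
Qed.

Lemma is_weak_partialP i u g : is_weak_partial i u g <->
  wpd i (rept u) (rept g) /\ wpd i (impt u) (impt g).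
Proof.
split=> [h|[h1 h2] phi tp].
  by split=> phi tp; have := h phi tp; rewrite !cintegral_mul => -[].
by rewrite !cintegral_mul h1// h2.
Qed.

Definition jre u : jet := fun o => if o is Some i then rept (weak_partial i u) else rept u.
Definition jim u : jet := fun o => if o is Some i then impt (weak_partial i u) else impt u.

Lemma in_H1_jet u : in_H1 u -> H1j (jre u) /\ H1j (jim u).
Proof.
move=> [/in_L2P[L1 L2'] hp].
have P i : in_L2 (weak_partial i u) /\ is_weak_partial i u (weak_partial i u).
  by rewrite /weak_partial; case: xgetP => [g _ //|/= H]; have [g h1 h2] := hp i; case: (H g).
have Q i := (in_L2P (weak_partial i u)).1 (P i).1.
have S i := (is_weak_partialP i u (weak_partial i u)).1 (P i).2.
split; split=> [[i|]|i] //=; by [case: (Q i)|case: (S i)].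
Qed.

Lemma in_H1_cpx A B : H1j A -> H1j B -> in_H1 (cpx (A None) (B None)).
Proof.
move=> [LA WA] [LB WB]; split; first by apply/in_L2P; split; [exact: (LA None)|exact: (LB None)].
move=> i; exists (cpx (A (Some i)) (B (Some i))).
  by apply/in_L2P; split; [exact: (LA (Some i))|exact: (LB (Some i))].
by apply/is_weak_partialP; split; [exact: (WA i)|exact: (WB i)].
Qed.

Lemma cpxK u : cpx (rept u) (impt u) = u.
Proof. by apply/funext => x; rewrite /cpx /rept /impt; case: (u x). Qed.

(** [weak_partial] picks some weak derivative, so its jet may differ from a given one on a null set;
    norms are unaffected. *)
Lemma jet_unique A B : H1j A -> H1j B -> A None = B None -> gdot A A = gdot B B.
Proof.
move=> [LA WA] [LB WB] AB; apply: eq_bigr => i _.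
have h : {ae leb, forall x, A (Some i) x = B (Some i) x}.
  by apply: (wpd_unique (i := i) (f := A None)); [exact: LA|exact: LB|exact: WA|rewrite AB; exact: WB].
exact: (dot_ae (LA (Some i)) (LA (Some i)) (LB (Some i)) (LB (Some i)) h h).
Qed.

Lemma grad_normE u : in_H1 u ->
  grad_norm u = (Num.sqrt (gdot (jre u) (jre u) + gdot (jim u) (jim u)))%:E.
Proof.
move=> /in_H1_jet[[L1 _] [L2' _]].
pose f x := Num.sqrt (\sum_(i < N) Normc.normc (weak_partial i u x) ^+ 2) : R.
have Lw i : in_L2 (weak_partial i u).
  by apply/in_L2P; split; [exact: (L1 (Some i))|exact: (L2' (Some i))].
have f2 x : f x ^+ 2 = \sum_(i < N) Normc.normc (weak_partial i u x) ^+ 2.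
  by rewrite sqr_sqrtr// sumr_ge0// => i _; exact: sqr_ge0.
have i2 : intg leb (fun x => \sum_(i < N) Normc.normc (weak_partial i u x) ^+ 2).
  by apply: intg_sum => i; case: (normc_L2 (Lw i)).
have Lf : L2 f.
  split; last by under eq_fun do rewrite f2.
  rewrite (_ : f = (fun x => (\sum_(i < N) Normc.normc (weak_partial i u x) ^+ 2) `^ 2^-1)).
    by apply: (measurableT_comp (measurable_powR _)); exact: intg_meas i2.
  by apply/funext => x; rewrite powR12_sqrt// sumr_ge0// => i _; exact: sqr_ge0.
rewrite /grad_norm -/f Lnorm2E//; congr (Num.sqrt _)%:E.
rewrite dotE; under eq_Rintegral do rewrite f2.
rewrite Rint_sum; last by move=> i; case: (normc_L2 (Lw i)).
rewrite /gdot -big_split; apply: eq_bigr => i _ /=.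
by rewrite -dotE dot_normc.
Qed.

Lemma H1_normE u : in_H1 u ->
  H1_norm u = (Num.sqrt (fdot (jre u) (jre u) + fdot (jim u) (jim u)))%:E.
Proof.
move=> Hu; have [Lu _] := Hu; rewrite /H1_norm cLnorm2E// grad_normE//.
have d0 : 0 <= dot (rept u) (rept u) + dot (impt u) (impt u) by rewrite addr_ge0 ?dot_ge0.
have g0 : 0 <= gdot (jre u) (jre u) + gdot (jim u) (jim u) by rewrite addr_ge0 ?gdot_ge0.
rewrite -[LHS]/(((Num.sqrt _ `^ 2 + Num.sqrt _ `^ 2) `^ 2^-1)%:E).
rewrite !powR_mulrn ?sqrtr_ge0// !sqr_sqrtr//.
rewrite powR12_sqrt; last exact: addr_ge0.
by rewrite !fdotE; congr (Num.sqrt _)%:E; rewrite /=; ring.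
Qed.

Definition cpx0 (f : X -> R) : X -> R[i] := cpx f (fun=> 0).

Let hP := @H1j_hilbert R N.
Let O : jet := fun=> fun=> 0.
Let HO : H1j O.
Proof.
split => [k|i phi tphi]; first exact: L2_0.
by rewrite /O !(dotC _ (fun=> 0)) !dot0r oppr0.
Qed.

Lemma in_H1_cpx0 A : H1j A -> in_H1 (cpx0 (A None)).
Proof. by move=> HA; exact: in_H1_cpx HA HO. Qed.

Lemma H1_norm_cpx0 A : H1j A -> H1_norm (cpx0 (A None)) = (Num.sqrt (fdot A A))%:E.
Proof.
move=> HA; have Hu := in_H1_cpx0 HA; have [H1 H2] := in_H1_jet Hu.
rewrite H1_normE// !fdotE (jet_unique H1 HA)// (jet_unique H2 HO)//.
have -> : jim (cpx0 (A None)) None = (fun=> 0) by [].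
have -> : jre (cpx0 (A None)) None = A None by [].
by rewrite dot0r /gdot [X in _ + (_ + X)]big1 ?addr0// => i _; exact: dot0r.
Qed.

(** Meant for [part] the real or imaginary part: a complex functional, restricted to real-valued
    functions, splits into two real functionals to which weak convergence of jets applies. *)
Lemma functional_part (l : (X -> R[i]) -> R[i]) (part : R[i] -> R) : H1_functional l ->
  (forall z z' : R[i], part (z + z') = part z + part z') ->
  (forall (a : R) z, part (a%:C%C * z) = a * part z) ->
  (forall z, `|part z| <= Normc.normc z) ->
  functional (@fadd _ X R (option 'I_N)) (@fscale _ X R (option 'I_N)) fdot H1j
    (fun A => part (l (cpx0 (A None)))).
Proof.
move=> [lin [K HK]] pD pZ pn.
(* Linearity is given only for combinations [a u + w]; homogeneity follows once [l 0 = 0] is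
   known. *)
have l0 : l (cpx0 (fun=> 0)) = 0.
  have H0 := in_H1_cpx0 HO; have := lin 1 _ _ H0 H0.
  have -> : (fun x => 1 * cpx0 (O None) x + cpx0 (O None) x) = cpx0 (O None).
    by apply/funext => x; rewrite mul1r /cpx0 /cpx /O; apply/eqP; rewrite eq_complex /= addr0 eqxx.
  by rewrite mul1r => /eqP; rewrite -subr_eq0 opprD addrA subrr sub0r oppr_eq0 => /eqP.
split=> [A B HA HB|a A HA|].
- rewrite -pD -[l (cpx0 (A None))]mul1r -lin; [|exact: in_H1_cpx0..].
  congr (part (l _)); apply/funext => x; rewrite mul1r; apply/eqP.
  by rewrite eq_complex /= /fadd addr0 !eqxx.
- rewrite -pZ -[_ * l _]addr0 -l0 -(lin _ _ _ (in_H1_cpx0 HA) (in_H1_cpx0 HO)).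
  congr (part (l _)); apply/funext => x; apply/eqP.
  by rewrite eq_complex /= /fscale /O !mul0r !mulr0 subr0 !addr0 !eqxx.
- exists (K ^+ 2) => [|A HA]; first exact: sqr_ge0.
  have := HK _ (in_H1_cpx0 HA); rewrite H1_norm_cpx0// -EFinM lee_fin => h.
  rewrite -[part _ ^+ 2]real_normK ?num_real//.
  have p0 : 0 <= K * Num.sqrt (fdot A A) by apply: le_trans h; exact: normc_ge0.
  rewrite -[fdot A A]sqr_sqrtr; last exact: (ip_ge0 hP).
  rewrite -exprMn; apply: lerXn2r; rewrite ?nnegrE//.
  by apply: le_trans h; exact: pn.
Qed.

(* [Complex 0 1] is the imaginary unit. *)
Lemma functional_split (l : (X -> R[i]) -> R[i]) A B : H1_functional l -> H1j A -> H1j B ->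
  l (cpx (A None) (B None)) = Complex 0 1 * l (cpx0 (B None)) + l (cpx0 (A None)).
Proof.
move=> [lin _] HA HB; rewrite -lin; [|exact: in_H1_cpx0..].
congr l; apply/funext => x; apply/eqP.
by rewrite eq_complex /= !mul0r !mulr0 mul1r subrr !add0r !addr0 !eqxx.
Qed.

(** By [l (f + i g) = l f + i l g], the real and imaginary parts of [l] reduce to real functionals
    of the two jets. *)
Lemma H1_weak_cvg_jets (A B : nat -> jet) A0 B0 :
  (forall n, H1j (A n)) -> (forall n, H1j (B n)) -> H1j A0 -> H1j B0 ->
  (forall l, functional (@fadd _ X R (option 'I_N)) (@fscale _ X R (option 'I_N)) fdot H1j l ->
     (fun n => l (A n)) @ \oo --> l A0) ->
  (forall l, functional (@fadd _ X R (option 'I_N)) (@fscale _ X R (option 'I_N)) fdot H1j l ->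
     (fun n => l (B n)) @ \oo --> l B0) ->
  H1_weak_cvg (fun n => cpx (A n None) (B n None)) (cpx (A0 None) (B0 None)).
Proof.
move=> HA HB HA0 HB0 cA cB l Hl.
have fRe := functional_part Hl (part := @complex.Re R) (fun z z' => ltac:(by case: z z' => [? ?] [? ?])) _ Re_le_normc.
have fIm := functional_part Hl (part := @complex.Im R) (fun z z' => ltac:(by case: z z' => [? ?] [? ?])) _ Im_le_normc.
have {}fRe := fRe (fun a z => ltac:(by case: z => c d /=; rewrite mul0r subr0)).
have {}fIm := fIm (fun a z => ltac:(by case: z => c d /=; rewrite mul0r addr0)).
have ReE (C D : jet) : H1j C -> H1j D -> complex.Re (l (cpx (C None) (D None))) =
    complex.Re (l (cpx0 (C None))) - complex.Im (l (cpx0 (D None))).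
  move=> HC HD; rewrite (functional_split Hl HC HD).
  by case: (l (cpx0 (C None))) (l (cpx0 (D None))) => [c1 c2] [d1 d2] /=; ring.
have ImE (C D : jet) : H1j C -> H1j D -> complex.Im (l (cpx (C None) (D None))) =
    complex.Im (l (cpx0 (C None))) + complex.Re (l (cpx0 (D None))).
  move=> HC HD; rewrite (functional_split Hl HC HD).
  by case: (l (cpx0 (C None))) (l (cpx0 (D None))) => [c1 c2] [d1 d2] /=; ring.
pose z n := l (cpx (A n None) (B n None)) - l (cpx (A0 None) (B0 None)).
have cRe : (fun n => complex.Re (z n)) @ \oo --> (0 : R).
  rewrite (_ : (fun n => _) = (fun n =>
     (complex.Re (l (cpx0 (A n None))) - complex.Im (l (cpx0 (B n None)))) -
     (complex.Re (l (cpx0 (A0 None))) - complex.Im (l (cpx0 (B0 None)))))).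
    rewrite -(subrr (complex.Re (l (cpx0 (A0 None))) - complex.Im (l (cpx0 (B0 None))))).
    by apply: cvgB; [apply: cvgB; [exact: cA _ fRe|exact: cB _ fIm]|exact: cvg_cst].
  by apply/funext => n; rewrite -!ReE// /z; case: (l _) (l _) => [? ?] [? ?].
have cIm : (fun n => complex.Im (z n)) @ \oo --> (0 : R).
  rewrite (_ : (fun n => _) = (fun n =>
     (complex.Im (l (cpx0 (A n None))) + complex.Re (l (cpx0 (B n None)))) -
     (complex.Im (l (cpx0 (A0 None))) + complex.Re (l (cpx0 (B0 None)))))).
    rewrite -(subrr (complex.Im (l (cpx0 (A0 None))) + complex.Re (l (cpx0 (B0 None))))).
    by apply: cvgB; [apply: cvgD; [exact: cA _ fIm|exact: cB _ fRe]|exact: cvg_cst].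
  by apply/funext => n; rewrite -!ImE// /z; case: (l _) (l _) => [? ?] [? ?].
apply: (squeeze_cvgr (f := fun=> 0) (h := fun n => `|complex.Re (z n)| + `|complex.Im (z n)|)).
- by apply: nearW => n; rewrite normc_ge0 normc_le.
- exact: cvg_cst.
- rewrite -[X in _ --> X](addr0 0); apply: cvgD; rewrite -(normr0 R); exact: cvg_norm.
Qed.

End complex_sobolev.
(** * The ground state and the concentration bound *)

Section ground_state_profile.
Context {R : realType} {N : nat}.
Variables b s : R.
Hypotheses (N0 : (0 < N)%N) (b0 : 0 < b) (bN : b < N%:R) (s0 : 0 < s) (sN : s * N%:R = 2 - b).
Local Notation X := 'rV[R]_N.
Local Notation leb := (lebesgue_rV R N).
Local Notation L2 := (L2 leb).
Local Notation dot := (L2dot leb).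
Local Notation wt := (@wt R N b).
Local Notation p := (2 * s + 2).
Local Notation dpw := (@dpw R s).
Local Notation wfun := (@wfun R N b s).
Local Notation jet := (option 'I_N -> X -> R).
Variables (S : R) (U : jet).
Hypotheses (S0 : 0 < S) (mU : minimizer b s S U) (U0 : forall x, 0 <= U None x).
Local Notation u := (U None).

Let HU : H1j U. Proof. by case: mU. Qed.
Let Lu : L2 u. Proof. by case: HU => h _; exact: h. Qed.

(** [c ^ (2 s) = S], so multiplying [u] by [c] absorbs the factor [S] in front of the
    nonlinearity. *)
Let c : R := S `^ (2 * s)^-1.
Let c0 : 0 < c. Proof. exact: powR_gt0. Qed.
Let s2 : 2 * s != 0. Proof. by rewrite mulf_neq0 ?gt_eqF. Qed.

Definition profile : X -> R[i] := cpx0 (fun x => c * u x).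

Lemma minimizer_solution : positive_radial_solution b s profile.
Proof.
have [F aeF decr] := radially_decreasing HU
  (fun nu d h1 h2 => polarization_le b0 bN s0 sN S0 mU U0 h1 h2).
have upos := minimizer_gt0 N0 b0 bN s0 sN S0 mU U0 aeF decr.
have HcU : H1j (fscale c U) by exact: (hilbertZ H1j_hilbert).
split.
- exact: (in_H1_cpx0 HcU).
- apply: filterS upos => x ux.
  by rewrite /profile -[_ x]/((c * u x)%:C%C) -[ltLHS]/(0%:C%C) ltcR mulr_gt0.
(* The radial profile reads off the value at any point of [F] of the given norm; monotonicity in
   both directions makes the choice irrelevant. *)
- exists (fun t => profile (xget 0 [set x | F x /\ euclid_norm x = t])).
  apply: filterS aeF => x Fx; congr Complex; congr (c * _).
  set z := xget _ _; have [Fz zx] : F z /\ euclid_norm z = euclid_norm x.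
    by apply: (@xgetPex _ 0 [set y | F y /\ euclid_norm y = euclid_norm x]); exists x.
  have qe : sqn z = sqn x by rewrite -!sqr_euclid zx.
  by apply/eqP; rewrite eq_le !decr// qe.
move=> phi tp; have Lp := test_L2 tp; have Ll := test_laplacian tp.
pose h x := c * (u x * laplacian phi x) - c * (u x * phi x) + c * S * (wt x * (dpw (u x) * phi x)).
have iE := intg_dpw b0 bN s0 sN mU (H1j_test tp).
have i1 := intgZ c (L2_intgM Lu Ll); have i2 := intgZ c (L2_intgM Lu Lp).
rewrite (_ : (fun x => _) = cpx0 h); last first.
  apply/funext => x; have nE : Normc.normc (profile x) = c * u x.
    by rewrite /= expr0n addr0 sqrtr_sqr ger0_norm// mulr_ge0// ltW.
  have pE : (c * u x) `^ (2 * s) = S * (u x ^+ 2) `^ s.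
    by rewrite powRM ?(ltW c0)// /c powRKV ?(ltW S0)// powRrM powR_mulrn.
  rewrite nE pE; apply/eqP; rewrite eq_complex /= /h /dpw; apply/andP; split; apply/eqP.
    by rewrite /wt; ring.
  by ring.
rewrite /cintegral; apply/eqP; rewrite eq_complex /= Rint0 eqxx andbT; apply/eqP.
rewrite /h RintD; [|exact: intgB|exact: (intgZ (c * S) iE)].
rewrite RintB// !RintZ; [|exact: iE|exact: L2_intgM|exact: L2_intgM].
have := euler_lagrange_test b0 bN s0 sN S0 mU tp; rewrite /L2dot => e.
by rewrite -(mulrA c S) -e; ring.
Qed.

Lemma cLnorm_profile : cLnorm 2 profile = (c * Num.sqrt (dot u u))%:E.
Proof.
have HcU : H1j (fscale c U) by exact: (hilbertZ H1j_hilbert).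
have [Lc _] := in_H1_cpx0 HcU; rewrite cLnorm2E//; congr (_%:E).
have -> : impt profile = (fun=> 0) by [].
have -> : rept profile = (fun x => c * u x) by [].
rewrite dot0r addr0 dotZl ?dotZr//; last exact: L2Z.
by rewrite mulrA -expr2 sqrtrM ?sqr_ge0// sqrtr_sqr ger0_norm// ltW.
Qed.

(** The core is [key], the same inequality raised to the power [2 s]; taking the root is
    monotone. *)
Lemma profile_bound (W : jet) (M m : R) : 0 < m -> 0 < M -> H1j W ->
  gdot W W <= M ^+ 2 -> m `^ p <= wfun (W None) ->
  profile_const N b M m * (c * Num.sqrt (dot u u)) <= Num.sqrt (dot (W None) (W None)).
Proof.
move=> m0 M0 HW gM dm; set d := wfun _ in dm; set be := dot (W None) _; set B := dot u u.
have mp0 : 0 < m `^ p by exact: powR_gt0.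
have d0 : 0 < d by exact: lt_le_trans dm.
have LW : L2 (W None) by case: HW => h _; exact: h.
have be0 : 0 < be.
  rewrite lt_neqAle dot_ge0 andbT; apply/eqP => /esym h.
  have : d = 0.
    rewrite /d /wfun -(@Rint0 _ _ _ leb); apply: Rint_ae => //.
      exact: (intg_meas (intg_wpw b0 bN s0 sN HW)).
    by apply: filterS (dot_eq0 LW h) => x ->; rewrite /pw expr0n/= !mulr0.
  by move=> e; rewrite e ltxx in d0.
have M2 : 0 < M ^+ 2 by rewrite exprn_gt0.
have s1 : 0 < s + 1 by rewrite addr_gt0.
have sn : s != 0 by rewrite gt_eqF.
have s1n : s + 1 != 0 by rewrite gt_eqF.
have Mn : M != 0 by rewrite gt_eqF.
have pn : p != 0 by rewrite gt_eqF// addr_gt0// mulr_gt0.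
have E y : 0 < y -> y `^ (s + 1) = y `^ s * y.
  by move=> y0; rewrite powRD ?(gt_eqF y0) ?implybT// powRr1// ltW.
(* The square of the optimal dilation factor: it puts mass and gradient bound in the Pohozaev ratio
   [be = s mu M^2], and [T] is then their sum. *)
pose mu := be / (s * M ^+ 2); have mu0 : 0 < mu by rewrite divr_gt0// mulr_gt0.
pose l := Num.sqrt mu; have l0 : 0 < l by rewrite sqrtr_gt0.
have l2 : l ^+ 2 = mu by rewrite sqr_sqrtr// ltW.
have lD r t : l `^ (r + t) = l `^ r * l `^ t by rewrite powRD// (gt_eqF l0) implybT.
pose T := be * ((s + 1) / s); have T0 : 0 < T by rewrite mulr_gt0// divr_gt0.
have h1 : S * (l `^ (- N%:R + b) * d) `^ (2 / p) <= l `^ (- N%:R) * T.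
  apply: le_trans (dilation_le b0 bN s0 sN mU HW l0) _; rewrite ler_pM2l ?powR_gt0// l2.
  have : mu * gdot W W <= mu * M ^+ 2 by rewrite ler_pM2l.
  have -> : mu * M ^+ 2 = T - be by rewrite /mu /T; field; rewrite ?sn ?Mn.
  by rewrite -/be lerBrDl.
have Y0 : 0 <= l `^ (- N%:R + b) * d by rewrite mulr_ge0 ?powR_ge0// ltW.
(* After raising to the power [s + 1 = p / 2], criticality gives
   [l ^ (- N (s + 1)) = l ^ (b - N) l ^ -2] on the right, and [l ^ (b - N)] cancels. *)
have h2 : S `^ (s + 1) * (mu * d) <= T `^ (s + 1).
  have := powR_le_mono (ltW s1) (mulr_ge0 (ltW S0) (powR_ge0 _ _)) h1.
  rewrite (powRM _ (ltW S0) (powR_ge0 _ _)) (powRM _ (powR_ge0 _ _) (ltW T0)) -!powRrM.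
  have -> : 2 / p * (s + 1) = 1 by field; rewrite ?pn ?s1n.
  rewrite powRr1// => h.
  have e1 : - N%:R * (s + 1) = (- N%:R + b) + - 2%:R.
    by rewrite mulrDr mulr1 mulNr mulrC sN; ring.
  rewrite e1 (lD (- N%:R + b) (- 2%:R)) in h.
  have lb : 0 < l `^ (- N%:R + b) by rewrite powR_gt0.
  move: h; rewrite mulrCA -mulrA ler_pM2l// powRN powR_mulrn ?(ltW l0)// l2 => h.
  by rewrite mulrCA -ler_pdivlMl.
(* The Pohozaev identity, with mass and gradient summing to [S], expresses the best constant through
   the mass of the minimizer. *)
have Bs : B * (s + 1) = s * S.
  have [_ _ fS _] := mU; have := pohozaev b0 bN s0 sN mU; rewrite -/B => BA.
  by rewrite -fS fdotE -/B [RHS]mulrDr -BA; ring.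
have BE : B = S * (s / (s + 1)) by rewrite mulrA -[S * s]mulrC -Bs mulfK.
have key : m `^ p / (M ^+ 2 * (s + 1)) * (S * B `^ s) <= be `^ s.
  pose r := s / (s + 1); have r0 : 0 < r by rewrite divr_gt0.
  have TE : T = be / r by rewrite /T /r invf_div.
  have Tp : T `^ (s + 1) * (r `^ s * r) = be `^ s * be.
    by rewrite -!E// -powRM ?(ltW r0) ?(ltW T0)// TE divfK// gt_eqF.
  have h3 : S `^ (s + 1) * (mu * d) * (r `^ s * r) <= be `^ s * be.
    by rewrite -Tp ler_wpM2r// mulr_ge0 ?powR_ge0// ltW.
  have -> : B `^ s = S `^ s * r `^ s by rewrite BE powRM ?(ltW S0)// ltW.
  rewrite -(ler_pM2r be0); apply: le_trans h3; rewrite E// /mu.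
  have -> : S `^ s * S * (be / (s * M ^+ 2) * d) * (r `^ s * r) =
     d / (M ^+ 2 * (s + 1)) * (S * (S `^ s * r `^ s)) * be.
    by rewrite /r; move: (S `^ s) ((s / (s + 1)) `^ s) => x y; field; rewrite ?sn ?s1n ?Mn.
  rewrite ler_pM2r// ler_wpM2r//; first by rewrite !mulr_ge0 ?powR_ge0// ltW.
  by rewrite ler_wpM2r// invr_ge0 mulr_ge0// ltW.
have Nn : N%:R != 0 :> R by rewrite pnatr_eq0 -lt0n.
(* With [s = (2 - b) / N]: [(4 - 2 b) / N + 2 = p], [2 - b + N = N (s + 1)], and the outer exponent
   is [1 / (2 s)]. *)
have pcE : profile_const N b M m = (m `^ p / (M ^+ 2 * (s + 1))) `^ (2 * s)^-1.
  rewrite /profile_const; congr (_ `^ _); last by rewrite -sN; field; rewrite ?sn ?Nn.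
  have -> : (4 - 2 * b) / N%:R + 2 = p.
    have -> : 4 - 2 * b = 2 * (2 - b) by ring.
    by rewrite -sN; field.
  have -> : 2 - b + N%:R = N%:R * (s + 1) by rewrite -sN; ring.
  by field; rewrite ?Mn ?s1n ?Nn.
have half y : 0 <= y -> Num.sqrt y = (y `^ s) `^ (2 * s)^-1.
  by move=> y0; rewrite -powRrM invfM mulrCA divff// mulr1 powR12_sqrt.
have i0 : 0 <= (2 * s)^-1 by rewrite invr_ge0 mulr_ge0// ltW.
have B0 : 0 <= B by exact: dot_ge0.
have X0 : 0 <= m `^ p / (M ^+ 2 * (s + 1)).
  by apply: divr_ge0; [exact: powR_ge0|by apply: mulr_ge0; [exact: sqr_ge0|exact: ltW]].
have SB0 : 0 <= S * B `^ s by rewrite mulr_ge0 ?powR_ge0// ltW.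
rewrite pcE (half _ B0) (half _ (ltW be0)) /c.
rewrite -(powRM _ (ltW S0) (powR_ge0 _ _)) -powRM//.
by apply: powR_le_mono key => //; exact: mulr_ge0.
Qed.

End ground_state_profile.

(** * Upper limits, weak lower semicontinuity of the gradient, and moduli *)

Section limits.
Context {R : realType} {N : nat}.
Local Notation X := 'rV[R]_N.
Local Notation leb := (lebesgue_rV R N).
Local Notation L2 := (L2 leb).
Local Notation dot := (L2dot leb).
Local Notation jet := (option 'I_N -> X -> R).

Lemma homo_geid (k : nat -> nat) n : {homo k : i j / (i < j)%N} -> (n <= k n)%N.
Proof. by move=> ki; elim: n => // n IH; apply: leq_ltn_trans IH _; exact: ki. Qed.

Lemma cvg_subseq (u : nat -> R) (l : R) (k : nat -> nat) :
  {homo k : i j / (i < j)%N} -> u @ \oo --> l -> (fun n => u (k n)) @ \oo --> l.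
Proof.
move=> ki /cvgnP cu; apply/cvgnP => e e0; have [K HK] := cu e e0.
by exists K => n Kn; apply: HK; apply: leq_trans Kn (homo_geid n ki).
Qed.

Lemma limn_esup_lt (u : (\bar R)^nat) (M e : R) : 0 < e -> (limn_esup u <= M%:E)%E ->
  exists K, forall n, (K <= n)%N -> (u n <= (M + e)%:E)%E.
Proof.
move=> e0 uM; have : (limn_esup u < (M + e)%:E)%E.
  by apply: le_lt_trans uM _; rewrite lte_fin ltrDl.
move=> /ereal_inf_lt[_ [A [K _ KA] <-] h]; exists K => n Kn.
apply: le_trans (ltW h); apply: ereal_sup_ubound; exists n => //; exact: KA.
Qed.

(** The recursion asks each index to exceed its predecessor and its value to beat [m - 1 / (n + 1)],
    which the upper limit allows beyond every rank. *)
Lemma limn_esup_subseq (u : (\bar R)^nat) (m : R) : (m%:E <= limn_esup u)%E ->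
  exists2 k : nat -> nat, {homo k : i j / (i < j)%N} &
    forall n, ((m - n.+1%:R^-1)%:E < u (k n))%E.
Proof.
move=> mu; have ex n j : exists i, (j <= i)%N /\ ((m - n.+1%:R^-1)%:E < u i)%E.
  have : ((m - n.+1%:R^-1)%:E < ereal_sup [set u i | i in [set i | (j <= i)%N]])%E.
    apply: (@lt_le_trans _ _ m%:E); first by rewrite lte_fin gtrBl invr_gt0.
    apply: le_trans mu _; apply: ereal_inf_lbound.
    by exists [set i | (j <= i)%N] => //; exists j.
  by move=> /ereal_sup_gt[_ [i ji <-] h]; exists i.
have [f Hf] := choice (fun nj : nat * nat => ex nj.1 nj.2).
pose k := fix k n := if n is n'.+1 then f (n, (k n').+1) else f (0, 0)%N.
exists k.
  by apply: homo_ltn => [a b c|n]; [exact: ltn_trans|exact: (Hf (n.+1, (k n).+1)).1].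
by case=> [|n]; [exact: (Hf (0, 0)%N).2|exact: (Hf (n.+1, (k n).+1)).2].
Qed.

Lemma gdot_hilbert : hilbert (@fadd _ X R 'I_N) (@fscale _ X R 'I_N) (fdot leb (I := 'I_N)) (fL2 leb (I := 'I_N)).
Proof. exact: fL2_hilbert. Qed.

Let grad (U : jet) : 'I_N -> X -> R := fun i => U (Some i).

Lemma functional_gdot U : H1j U ->
  functional (@fadd _ X R (option 'I_N)) (@fscale _ X R (option 'I_N)) (fdot leb (I := option 'I_N)) H1j
    (gdot U).
Proof.
move=> [LU _]; have hG := gdot_hilbert.
have LG : fL2 leb (grad U) by move=> i; exact: (LU (Some i)).
split=> [V W [LV _] [LW _]|a V [LV _]|].
- exact: (ipDr hG (fun i => LV (Some i)) (fun i => LW (Some i)) LG).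
- exact: (ipZr hG a (fun i => LV (Some i)) LG).
- exists (gdot U U) => [|V [LV _]]; first exact: gdot_ge0.
  apply: le_trans (cauchy_schwarz hG LG (fun i => LV (Some i))) _.
  by apply: ler_wpM2l; [exact: gdot_ge0|rewrite fdotE lerDr dot_ge0].
Qed.

Lemma gdot_young (U V : jet) : H1j U -> H1j V -> 2 * gdot U V <= gdot U U + gdot V V.
Proof.
move=> [LU _] [LV _]; have hG := gdot_hilbert.
have LGU : fL2 leb (grad U) by move=> i; exact: (LU (Some i)).
have LGV : fL2 leb (grad V) by move=> i; exact: (LV (Some i)).
have := ip_ge0 hG (hilbertD hG LGU (hilbertZ hG (-1) LGV)).
rewrite (ip_addt hG (-1) LGU LGV).
have E (V1 V2 : jet) : fdot leb (grad V1) (grad V2) = gdot V1 V2 by [].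
rewrite !E.
by move: (gdot U V) (gdot U U) (gdot V V) => a c e; rewrite sqrrN expr1n; lra.
Qed.

(** Pairing gradients with that of the limit is a bounded functional, so one passes to the limit in
    [2 gdot A0 (A n) <= gdot A0 A0 + gdot (A n) (A n)] and its analogue for [B]. The margin [e]
    reflects that an upper limit bounds terms only eventually. *)
Lemma gdot_weak_le (A B : nat -> jet) A0 B0 (M : R) : 0 < M ->
  (forall n, H1j (A n)) -> (forall n, H1j (B n)) -> H1j A0 -> H1j B0 ->
  (forall l, functional (@fadd _ X R (option 'I_N)) (@fscale _ X R (option 'I_N)) (fdot leb (I := option 'I_N)) H1j l ->
     (fun n => l (A n)) @ \oo --> l A0) ->
  (forall l, functional (@fadd _ X R (option 'I_N)) (@fscale _ X R (option 'I_N)) (fdot leb (I := option 'I_N)) H1j l ->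
     (fun n => l (B n)) @ \oo --> l B0) ->
  (forall e, 0 < e -> exists K, forall n, (K <= n)%N ->
     gdot (A n) (A n) + gdot (B n) (B n) <= (M + e) ^+ 2) ->
  gdot A0 A0 + gdot B0 B0 <= M ^+ 2.
Proof.
move=> M0 HA HB HA0 HB0 cA cB gM; set Z := _ + _.
have Z0 : 0 <= Z by rewrite addr_ge0 ?gdot_ge0.
suff : Num.sqrt Z <= M.
  move=> h; rewrite -[Z]sqr_sqrtr//; apply: lerXn2r; rewrite ?nnegrE ?sqrtr_ge0//.
  exact: ltW.
apply/ler_addgt0Pr => e e0; have [K HK] := gM e e0.
have Me : 0 <= M + e by rewrite addr_ge0// ltW.
rewrite -ler_sqr ?nnegrE ?sqrtr_ge0// sqr_sqrtr//.
have c1 : (fun n => 2 * (gdot A0 (A n) + gdot B0 (B n))) @ \oo --> 2 * Z.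
  by apply: cvgMl_tmp; apply: cvgD; [exact: cA _ (functional_gdot HA0)|exact: cB _ (functional_gdot HB0)].
have : 2 * Z <= Z + (M + e) ^+ 2.
  apply: (cvgr_to_le c1); exists K => // n Kn /=.
  rewrite mulrDr; apply: le_trans (lerD (gdot_young HA0 (HA n)) (gdot_young HB0 (HB n))) _.
  by rewrite addrACA lerD2l; exact: HK.
by rewrite mulr_natl mulr2n lerD2l.
Qed.

Variables b s : R.
Hypotheses (s0 : 0 < s).

Lemma wnm_mono (f g : X -> R) : measurable_fun setT f -> measurable_fun setT g ->
  (forall x, `|f x| <= g x) -> (wnm b s f <= wnm b s g)%E.
Proof.
move=> mf mg fg; rewrite !(wnmE _ s0).
apply: poweR_le_mono; [|exact: wint_ge0|].
  by rewrite invr_ge0 addr_ge0// mulr_ge0// ltW.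
apply: ge0_le_integral => //.
- by move=> x _; rewrite lee_fin mulr_ge0 ?wt_ge0 ?pw_ge0.
- by apply/measurable_EFinP; exact: measurable_wpw.
- by apply/measurable_EFinP; exact: measurable_wpw.
move=> x _; rewrite lee_fin; apply: ler_wpM2l; first exact: wt_ge0.
by rewrite -(pw_norm s (f x)); apply: pw_mono.
Qed.

Lemma weighted_normE (u : X -> R[i]) :
  weighted_norm b s u = wnm b s (fun x => Normc.normc (u x)).
Proof.
rewrite /weighted_norm /cLnorm /wnm; apply: eq_Lnorm => x; congr (_%:E).
by rewrite Normc.normcM /= expr0n addr0 sqrtr_sqr ger0_norm// powR_ge0.
Qed.

End limits.

Lemma normc_lipschitz (R : realType) (z w : R[i]) :
  (Normc.normc z - Normc.normc w) ^+ 2 <=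
  (complex.Re z - complex.Re w) ^+ 2 + (complex.Im z - complex.Im w) ^+ 2.
Proof.
have hz := normc_sqr z; have hw := normc_sqr w.
have z0 := normc_ge0 z; have w0 := normc_ge0 w.
move: (Normc.normc z) (Normc.normc w) hz hw z0 w0 => p q hz hw p0 q0.
move: (complex.Re z) (complex.Im z) (complex.Re w) (complex.Im w) hz hw => a c a' c' hz hw.
have h : a * a' + c * c' <= p * q.
  have [h|h] := leP 0 (a * a' + c * c'); last by apply: le_trans (ltW h) _; exact: mulr_ge0.
  rewrite -ler_sqr ?nnegrE ?mulr_ge0// exprMn hz hw -subr_ge0.
  rewrite (_ : _ - _ = (a * c' - c * a') ^+ 2); first exact: sqr_ge0.
  by ring.
have -> : (p - q) ^+ 2 = p ^+ 2 + q ^+ 2 - 2 * (p * q) by ring.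
have -> : (a - a') ^+ 2 + (c - c') ^+ 2 = (a ^+ 2 + c ^+ 2) + (a' ^+ 2 + c' ^+ 2) - 2 * (a * a' + c * c') by ring.
by rewrite hz hw lerD2l lerN2 ler_pM2l.
Qed.

(** For [N <= 3], [N / 3] is below both [2] and [N]; for [N >= 4], [2] is itself below [N]. *)
Lemma two_tilde_lt (R : realType) (N : nat) (b : R) : (1 <= N)%N -> b < two_tilde R N ->
  b < 2 /\ b < N%:R.
Proof.
rewrite /two_tilde => N0; case: ifPn => [N3 bN|]; last first.
  rewrite -ltnNge => N3 b2; split => //; apply: lt_trans b2 _.
  by rewrite (ltr_nat _ 2); exact: ltn_trans N3.
have n1 : 1 <= N%:R :> R by rewrite ler1n.
have n3 : N%:R <= 3 :> R by rewrite (ler_nat _ N 3).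
by split; lra.
Qed.
Unset Implicit Arguments.

Theorem theorem1p3 (R : realType) (N : nat) (b sigma M m : R)
    (v : nat -> 'rV[R]_N -> R[i]) :
  (1 <= N)%N ->
  0 < b -> b < two_tilde R N ->
  (2 - b) / N%:R <= sigma -> (sigma%:E < sigma_star N b)%E ->
  0 < m -> 0 < M ->
  H1_bounded v ->
  (limn_esup (fun n => grad_norm (v n)) <= M%:E)%E ->
  (m%:E <= limn_esup (fun n => weighted_norm b sigma (v n)))%E ->
  exists (x : nat -> 'rV[R]_N) (V : 'rV[R]_N -> R[i]),
    [/\ in_H1 V,
        exists2 k : nat -> nat, {homo k : i j / (i < j)%N} &
          H1_weak_cvg (fun n y => v (k n) (y + x (k n))) V &
        sigma = (2 - b) / N%:R ->
        forall Q : 'rV[R]_N -> R[i], ground_state b sigma Q ->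
          ((profile_const N b M m)%:E * cLnorm 2 Q <= cLnorm 2 V)%E].
Proof.
move=> N0 b0 bT sig1 sigstar m0 M0 [Kb Hb] gradM mw.
have [b2 bN] := two_tilde_lt N0 bT.
have Nn : 0 < N%:R :> R by rewrite ltr0n.
have s0 : 0 < sigma by apply: lt_le_trans sig1; rewrite divr_gt0// subr_gt0.
have Hv n : in_H1 (v n) := (Hb n).1.
(* This extraction comes first: [m] bounds an upper limit, so the lower bound must be secured on the
   terms from which the weak limit is taken. *)
have [k0 k0i Hk0] := limn_esup_subseq mw.
pose A n := jre (v (k0 n)); pose B n := jim (v (k0 n)).
have HA n : H1j (A n) := (in_H1_jet (Hv _)).1.
have HB n : H1j (B n) := (in_H1_jet (Hv _)).2.
have hP := @H1j_hilbert R N.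
have bAB n : fdot (lebesgue_rV R N) (A n) (A n) + fdot (lebesgue_rV R N) (B n) (B n) <= Kb ^+ 2.
  have := (Hb (k0 n)).2; rewrite H1_normE// lee_fin -/(A n) -/(B n) => h.
  have d0 : 0 <= fdot (lebesgue_rV R N) (A n) (A n) + fdot (lebesgue_rV R N) (B n) (B n).
    by rewrite addr_ge0// (ip_ge0 hP).
  rewrite -(sqr_sqrtr d0); apply: lerXn2r; rewrite ?nnegrE ?sqrtr_ge0//.
  exact: le_trans (sqrtr_ge0 _) h.
have bA n : fdot (lebesgue_rV R N) (A n) (A n) <= Kb ^+ 2.
  by apply: le_trans (bAB n); rewrite lerDl (ip_ge0 hP).
have bB n : fdot (lebesgue_rV R N) (B n) (B n) <= Kb ^+ 2.
  by apply: le_trans (bAB n); rewrite lerDr (ip_ge0 hP).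
(* Real parts converge along [k1], imaginary parts along a further extraction [k2]. *)
have [k1 k1i [A0 HA0 cA]] := hilbert_weak_compact hP HA bA.
have [k2 k2i [B0 HB0 cB]] :=
  hilbert_weak_compact hP (fun n => HB (k1 n)) (fun n => bB (k1 n)).
pose k n := k1 (k2 n).
have ki : {homo k : i j / (i < j)%N} by move=> i j ij; apply: k1i; exact: k2i.
have cA' l (fl : functional (@fadd _ _ R (option 'I_N)) (@fscale _ _ R (option 'I_N))
    (fdot (lebesgue_rV R N) (I := option 'I_N)) H1j l) :
    (fun n => l (A (k n))) @ \oo --> l A0 := cvg_subseq k2i (cA l fl).
have HV := in_H1_cpx HA0 HB0.
exists (fun=> 0), (cpx (A0 None) (B0 None)); split => //.
  exists (fun n => k0 (k n)); first by move=> i j ij; apply: k0i; exact: ki.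
  have := H1_weak_cvg_jets (fun n => HA (k n)) (fun n => HB (k n)) HA0 HB0 cA' cB.
  congr H1_weak_cvg; apply/funext => n; rewrite cpxK; apply/funext => y.
  by rewrite addr0.
move=> sE Q [[HQ _ _ _] Quniq].
have sN : sigma * N%:R = 2 - b by rewrite sE divfK// gt_eqF.
(* The minimization problem is real, so [V] enters through its modulus, which has the same mass and
   weighted norm, and a gradient that is no larger. *)
pose f y : R := Normc.normc (cpx (A0 None) (B0 None) y).
have [LV _] := HV; have [mV _] := LV.
have mf : measurable_fun setT f by exact: measurable_normc mV.
have f2 y : f y ^+ 2 <= A0 None y ^+ 2 + B0 None y ^+ 2 by rewrite /f normc_sqr.
have fl y z : (f y - f z) ^+ 2 <= (A0 None y - A0 None z) ^+ 2 + (B0 None y - B0 None z) ^+ 2.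
  exact: normc_lipschitz.
have [W [HW W0 Wi]] := H1j_of_lipschitz HA0 HB0 mf f2 fl.
have gW : gdot W W <= M ^+ 2.
  apply: (@le_trans _ _ (gdot A0 A0 + gdot B0 B0)).
    by rewrite /gdot -big_split; apply: ler_sum => i _; exact: Wi.
  apply: (gdot_weak_le M0 (fun n => HA (k n)) (fun n => HB (k n)) HA0 HB0 cA' cB) => e e0.
  have [K HK] := limn_esup_lt e0 gradM; exists K => n Kn.
  have kn : (K <= k0 (k n))%N.
    apply: leq_trans Kn _; apply: leq_trans (homo_geid n ki) _; exact: homo_geid.
  have := HK _ kn; rewrite grad_normE// lee_fin => h.
  have g0 : 0 <= gdot (A (k n)) (A (k n)) + gdot (B (k n)) (B (k n)).
    by rewrite addr_ge0 ?gdot_ge0.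
  rewrite -(sqr_sqrtr g0); apply: lerXn2r; rewrite ?nnegrE ?sqrtr_ge0//.
  exact: le_trans (sqrtr_ge0 _) h.
(* Along the subsequence, [|v| <= |V| + |Re (v - V)| + |Im (v - V)|] pointwise. A third of [e] pays
   for each of the two weighted differences, and a third for the defect [1 / (k n + 1)] in the lower
   bound. *)
have wW : (m%:E <= wnm b sigma (W None))%E.
  apply/lee_addgt0Pr => e e0; have e3 : 0 < e / 3 by rewrite divr_gt0.
  have [K1 HK1] := wnm_weak_cvg b0 bN s0 sN (fun n => HA (k n)) HA0 (fun n => bA (k n)) cA' e3.
  have [K2 HK2] := wnm_weak_cvg b0 bN s0 sN (fun n => HB (k n)) HB0 (fun n => bB (k n)) cB e3.
  have [K3 _ HK3] := cvgr_lt _ (@cvg_harmonic R) _ e3.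
  pose n := (K1 + K2 + K3)%N.
  have l1 : (K1 <= n)%N by rewrite /n -addnA leq_addr.
  have l2 : (K2 <= n)%N by rewrite /n (addnC K1) -addnA leq_addr.
  have l3 : (K3 <= k n)%N by apply: leq_trans (leq_addl _ _) (homo_geid n ki).
  pose d1 := jsub (A (k n)) A0 None; pose d2 := jsub (B (k n)) B0 None.
  have md1 : measurable_fun setT d1.
    by have [h _] := H1j_sub (HA (k n)) HA0; case: (h None).
  have md2 : measurable_fun setT d2.
    by have [h _] := H1j_sub (HB (k n)) HB0; case: (h None).
  have wabs (g : 'rV[R]_N -> R) : wnm b sigma (fun y => `|g y|) = wnm b sigma g.
    rewrite !(wnmE _ s0); congr (_ `^ _)%E; apply: eq_integral => y _.
    by rewrite pw_norm.
  have mabs (g : 'rV[R]_N -> R) : measurable_fun setT g -> measurable_fun setT (fun y => `|g y|).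
    by move=> mg; exact: measurableT_comp.
  have mvn : measurable_fun setT (fun y => Normc.normc (v (k0 (k n)) y) : R).
    by apply: measurable_normc; case: (Hv (k0 (k n))) => -[].
  have hw : (weighted_norm b sigma (v (k0 (k n))) <=
      wnm b sigma (W None) + ((e / 3)%:E + (e / 3)%:E))%E.
    rewrite weighted_normE.
    apply: (@le_trans _ _ (wnm b sigma (fun y => (f y + (`|d1 y| + `|d2 y|))%R))).
      apply: wnm_mono => //; first by apply: measurable_funD => //; apply: measurable_funD; exact: mabs.
      move=> y; rewrite ger0_norm ?normc_ge0// -lerBlDl.
      apply: le_trans (ler_norm _) _.
      rewrite -ler_sqr ?nnegrE ?addr_ge0// real_normK ?num_real//.
      apply: le_trans (normc_lipschitz _ _) _.
      have -> : complex.Re (v (k0 (k n)) y) - complex.Re (cpx (A0 None) (B0 None) y) = d1 y.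
        by rewrite /d1 /jsub /fadd /fscale mulN1r.
      have -> : complex.Im (v (k0 (k n)) y) - complex.Im (cpx (A0 None) (B0 None) y) = d2 y.
        by rewrite /d2 /jsub /fadd /fscale mulN1r.
      rewrite -(real_normK (num_real (d1 y))) -(real_normK (num_real (d2 y))).
      have := mulr_ge0 (normr_ge0 (d1 y)) (normr_ge0 (d2 y)).
      by move: `|d1 y| `|d2 y| => a c ac; rewrite !expr2; lra.
    apply: le_trans (wnm_add b s0 mf _) _.
      by apply: measurable_funD; exact: mabs.
    rewrite W0 leeD2l//; apply: le_trans (wnm_add b s0 (mabs _ md1) (mabs _ md2)) _.
    by rewrite !wabs; apply: leeD; [exact: HK1|exact: HK2].
  have := le_trans (ltW (Hk0 (k n))) hw.
  have h3 := HK3 _ l3; rewrite EFinB leeBlDr//.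
  move/le_trans; apply; rewrite -addeA leeD2l// -!EFinD lee_fin.
  by move: h3 => /=; move: (k n).+1%:R^-1 => a ha; lra.
have dW : m `^ (2 * sigma + 2) <= wfun b sigma (W None).
  have p0 : 0 < 2 * sigma + 2 by rewrite addr_gt0// mulr_gt0.
  move: wW; rewrite (wnm_wfun b0 bN s0 sN HW) lee_fin => h.
  rewrite -[leRHS](powRKV (p := 2 * sigma + 2)) ?gt_eqF ?wfun_ge0//.
  by apply: powR_le_mono => //; exact: ltW.
have wpos : 0 < wfun b sigma (W None) by apply: lt_le_trans dW; exact: powR_gt0.
(* [W] itself witnesses that the constraint set is nonempty. *)
have [S [U [S0 mU U0]]] := minimizer_exists b0 bN s0 sN HW wpos.
(* The uniqueness half of [ground_state] identifies the rescaled minimizer with [Q] almost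
   everywhere. *)
have PQ := Quniq _ (minimizer_solution N0 b0 bN s0 sN S0 mU U0).
have [LP _] : in_H1 (profile sigma S U).
  by have [] := minimizer_solution N0 b0 bN s0 sN S0 mU U0.
have [LQ _] := HQ.
have -> : cLnorm 2 Q = cLnorm 2 (profile sigma S U).
  have [P1 P2] := (in_L2P _).1 LP; have [Q1 Q2] := (in_L2P _).1 LQ.
  have a1 : {ae lebesgue_rV R N, forall y, rept Q y = rept (profile sigma S U) y}.
    by apply: filterS PQ => y yE; rewrite /rept yE.
  have a2 : {ae lebesgue_rV R N, forall y, impt Q y = impt (profile sigma S U) y}.
    by apply: filterS PQ => y yE; rewrite /impt yE.
  by rewrite !cLnorm2E// (dot_ae Q1 Q1 P1 P1 a1 a1) (dot_ae Q2 Q2 P2 P2 a2 a2).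
rewrite (cLnorm_profile S0 mU) (cLnorm2E LV) -(dot_normc LV) -EFinM lee_fin -/f -W0.
exact: (profile_bound N0 b0 bN s0 sN S0 mU m0 M0 HW gW dW).
Qed.
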